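(* Let $\mathcal U\subset\mathcal A$ be a simply connected open set, let $\psi:\mathcal U\to\mathcal A$ be a conformal map, and let $\theta_1,\theta_2:\mathcal U\to\mathbb R$ be such that $\psi=\theta_1+\sigma\theta_2$. Suppose that $\lambda,\mu:\mathcal U\to\mathbb R$ are solutions of $$\partial_x\mu=\lambda\,\partial_x\theta_2,\qquad \partial_y\lambda=-\mu\,\partial_y\theta_2,$$ such that $\lambda\mu>0$, and define $$\underline{e_2}=\sin\theta_1\frac1\lambda+\sigma\cos\theta_1\frac1\mu,\qquad \underline{e_3}=-\cos\theta_1\frac1\lambda+\sigma\sin\theta_1\frac1\mu .$$ Then, if $g:\mathcal U\to S^3_{\mathcal A}=Spin(4)\subset\mathbb H^{\mathcal A}$ is a conformal map solving $$g'g^{-1}=\cos\psi\ J+\sin\psi\ K,$$ and if we set $$\xi:=g^{-1}(\omega_2J+\omega_3K)\,\hat g,$$ where $\omega_2,\omega_3:T\mathcal U\to\mathbb R$ are the dual forms of $\underline{e_2},\underline{e_3}\in\Gamma(T\mathcal U)$, the function $F=\int\xi$ defines an immersion $\mathcal U\to\mathbb R^4$ with $K=K_N=0$. Reciprocally, the immersions in $\mathbb R^4$ of a surface $M$ such that $K=K_N=0$ and with regular Gauss map are locally of this form (in suitable local charts $\mathcal U\to M$).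
   Context: $\mathcal A=\{x+\sigma y:\ x,y\in\mathbb R\}$ is the algebra of Lorentz numbers, $\sigma^2=1$, with conjugation $\overline{x+\sigma y}=x-\sigma y$; $\cos,\sin$ on $\mathcal A$ are defined by the usual power series. $\mathbb H^{\mathcal A}=\{\xi=a_01+a_1I+a_2J+a_3K:\ a_i\in\mathcal A\}$ are the quaternions with coefficients in $\mathcal A$ ($I^2=J^2=K^2=-1$, $IJ=-JI=K$), $\hat\xi=\overline{a_0}1+\overline{a_1}I+\overline{a_2}J+\overline{a_3}K$ (conjugation of the coefficients in $\mathcal A$), $H(\xi,\xi)=\sum_ia_i^2\in\mathcal A$, $S^3_{\mathcal A}=\{\xi\in\mathbb H^{\mathcal A}:H(\xi,\xi)=1\}$. $\mathbb R^4$ is identified with $\{\sigma x_01+x_1I+x_2J+x_3K:\ x_i\in\mathbb R\}\subset\mathbb H^{\mathcal A}$ with its Euclidean metric. A smooth map $f$ from an open subset of $\mathcal A$ (coordinates $x+\sigma y$) to $\mathcal A$ or $\mathbb H^{\mathcal A}\simeq\mathcal A^4$ is conformal if $\partial_yf=\sigma\,\partial_xf$; then $df=f'(dx+\sigma dy)$ with $f'=\partial_xf$. Functions $\mathcal U\to\mathcal A\simeq\mathbb R^2$ are viewed as vector fields on $\mathcal U$ ($1\leftrightarrow\partial_x$, $\sigma\leftrightarrow\partial_y$). $F=\int\xi$ denotes a primitive of $\xi$ (defined up to a constant). $K$ and $K_N$ are the Gauss curvature and the normal curvature of the immersed surface, and the Gauss map is regular if it is an immersion into the Grassmannian of oriented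 2-planes of $\mathbb R^4$. *)

(* Defs.v *)
From HB Require Import structures.
From mathcomp Require Import all_boot all_order all_algebra.
From mathcomp Require Import all_classical all_reals all_analysis.
From mathcomp Require Import ring.

Set Implicit Arguments.
Unset Strict Implicit.
Unset Printing Implicit Defensive.

Import Order.TTheory GRing.Theory Num.Theory.
Import numFieldNormedType.Exports.

Local Open Scope classical_set_scope.
Local Open Scope ring_scope.

(* The pair [(x, y)] encodes x + sigma y.  As a real normed space this is the
   product R * R, but its ring structure is the one with sigma ^+ 2 = 1, not
   the componentwise one of a product of rings. *)
Definition lorentz (R : realType) : Type := (R * R)%type.

HB.instance Definition _ (R : realType) := NormedModule.on (lorentz R).

Section LorentzRing.
Context {R : realType}.
Implicit Types z w : lorentz R.

Definition lone : lorentz R := (1, 0).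
Definition lmul z w : lorentz R :=
  (z.1 * w.1 + z.2 * w.2, z.1 * w.2 + z.2 * w.1).

Lemma lorentzP z w : z.1 = w.1 -> z.2 = w.2 -> z = w.
Proof. by case: z w => [? ?] [? ?] /= -> ->. Qed.

Fact lmulA : associative lmul.
Proof. by move=> a b c; apply: lorentzP => /=; ring. Qed.
Fact lmulC : commutative lmul.
Proof. by move=> a b; apply: lorentzP => /=; ring. Qed.
Fact lmul1 : left_id lone lmul.
Proof. by move=> a; apply: lorentzP => /=; ring. Qed.
Fact lmulDl : left_distributive lmul +%R.
Proof. by move=> a b c; apply: lorentzP => /=; ring. Qed.
Fact lone_neq0 : lone != 0.
Proof. by rewrite xpair_eqE /= oner_eq0. Qed.

HB.instance Definition _ := GRing.Zmodule_isComNzRing.Build (lorentz R)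
  lmulA lmulC lmul1 lmulDl lone_neq0.

Definition lnorm z : R := z.1 ^+ 2 - z.2 ^+ 2.
Definition lunit : pred (lorentz R) := [pred z | lnorm z != 0].
Definition linv z : lorentz R :=
  if lunit z then (z.1 / lnorm z, - z.2 / lnorm z) else z.

Fact lmulVr : {in lunit, left_inverse 1 linv *%R}.
Proof.
move=> z zu; rewrite /linv ifT//; have {}zu : lnorm z != 0 by [].
by apply: lorentzP => /=; move: zu; rewrite /lnorm => zu; field.
Qed.
Fact lunitP z w : w * z = 1 -> lunit z.
Proof.
move=> wz; apply/eqP => z0.
have [wz1 wz2] : (w.1 * z.1 + w.2 * z.2 = 1) /\ (w.1 * z.2 + w.2 * z.1 = 0).
  by move: wz => [? ?].
have : lnorm w * lnorm z = 1.
  rewrite -[RHS](expr1n _ 2) -[in RHS]wz1.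
  transitivity ((w.1 * z.1 + w.2 * z.2) ^+ 2 - (w.1 * z.2 + w.2 * z.1) ^+ 2).
    by rewrite /lnorm; ring.
  by rewrite wz2; ring.
by rewrite z0 mulr0 => /esym/eqP; rewrite oner_eq0.
Qed.
Fact linv_out : {in [predC lunit], linv =1 id}.
Proof. by move=> z zu; rewrite /linv ifN. Qed.

HB.instance Definition _ := GRing.ComNzRing_hasMulInverse.Build (lorentz R)
  lmulVr lunitP linv_out.

Definition lsigma : lorentz R := (0, 1).
Definition lofR (x : R) : lorentz R := (x, 0).
Definition lconj z : lorentz R := (z.1, - z.2).

Lemma lsigma_sqr : lsigma ^+ 2 = 1.
Proof. by rewrite expr2; apply: lorentzP => /=; ring. Qed.

Lemma lorentzE z : z = lofR z.1 + lsigma * lofR z.2.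
Proof. by apply: lorentzP => /=; ring. Qed.

(* Limits are taken in the normed space [lorentz R]. *)
Definition lcos z : lorentz R :=
  limn (series (fun k => ((-1) ^+ k / (2 * k)`!%:R : R) *: z ^+ (2 * k))).
Definition lsin z : lorentz R :=
  limn (series (fun k => ((-1) ^+ k / (2 * k).+1`!%:R : R) *: z ^+ (2 * k).+1)).

End LorentzRing.

(* [(a0, a1, a2, a3)] encodes a0 1 + a1 I + a2 J + a3 K; as a real normed space
   this is the fourth power of [lorentz R]. *)
Definition lquat (R : realType) : Type :=
  (lorentz R * lorentz R * lorentz R * lorentz R)%type.

HB.instance Definition _ (R : realType) := NormedModule.on (lquat R).

Section LorentzQuaternions.
Context {R : realType}.
Implicit Types (a : lorentz R) (p q : lquat R).

Definition Quat (a0 a1 a2 a3 : lorentz R) : lquat R := (a0, a1, a2, a3).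
Definition qc0 q : lorentz R := q.1.1.1.
Definition qc1 q : lorentz R := q.1.1.2.
Definition qc2 q : lorentz R := q.1.2.
Definition qc3 q : lorentz R := q.2.

Definition qone : lquat R := Quat 1 0 0 0.
Definition qmul p q : lquat R := Quat
  (qc0 p * qc0 q - qc1 p * qc1 q - qc2 p * qc2 q - qc3 p * qc3 q)
  (qc0 p * qc1 q + qc1 p * qc0 q + qc2 p * qc3 q - qc3 p * qc2 q)
  (qc0 p * qc2 q - qc1 p * qc3 q + qc2 p * qc0 q + qc3 p * qc1 q)
  (qc0 p * qc3 q + qc1 p * qc2 q - qc2 p * qc1 q + qc3 p * qc0 q).

Lemma lquatP p q : qc0 p = qc0 q -> qc1 p = qc1 q -> qc2 p = qc2 q ->
  qc3 p = qc3 q -> p = q.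
Proof.
case: p q => [[[? ?] ?] ?] [[[? ?] ?] ?].
by rewrite /qc0 /qc1 /qc2 /qc3 /= => -> -> -> ->.
Qed.

Lemma qc0_mul p q : qc0 (qmul p q) =
  qc0 p * qc0 q - qc1 p * qc1 q - qc2 p * qc2 q - qc3 p * qc3 q.
Proof. by []. Qed.
Lemma qc1_mul p q : qc1 (qmul p q) =
  qc0 p * qc1 q + qc1 p * qc0 q + qc2 p * qc3 q - qc3 p * qc2 q.
Proof. by []. Qed.
Lemma qc2_mul p q : qc2 (qmul p q) =
  qc0 p * qc2 q - qc1 p * qc3 q + qc2 p * qc0 q + qc3 p * qc1 q.
Proof. by []. Qed.
Lemma qc3_mul p q : qc3 (qmul p q) =
  qc0 p * qc3 q + qc1 p * qc2 q - qc2 p * qc1 q + qc3 p * qc0 q.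
Proof. by []. Qed.
Definition qc_mul := (qc0_mul, qc1_mul, qc2_mul, qc3_mul).

Lemma qc0_add p q : qc0 (p + q) = qc0 p + qc0 q. Proof. by []. Qed.
Lemma qc1_add p q : qc1 (p + q) = qc1 p + qc1 q. Proof. by []. Qed.
Lemma qc2_add p q : qc2 (p + q) = qc2 p + qc2 q. Proof. by []. Qed.
Lemma qc3_add p q : qc3 (p + q) = qc3 p + qc3 q. Proof. by []. Qed.
Definition qc_add := (qc0_add, qc1_add, qc2_add, qc3_add).

Lemma qc0_opp q : qc0 (- q) = - qc0 q. Proof. by []. Qed.
Lemma qc1_opp q : qc1 (- q) = - qc1 q. Proof. by []. Qed.
Lemma qc2_opp q : qc2 (- q) = - qc2 q. Proof. by []. Qed.
Lemma qc3_opp q : qc3 (- q) = - qc3 q. Proof. by []. Qed.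
Definition qc_opp := (qc0_opp, qc1_opp, qc2_opp, qc3_opp).

Lemma qc0_Quat (a0 a1 a2 a3 : lorentz R) : qc0 (Quat a0 a1 a2 a3) = a0.
Proof. by []. Qed.
Lemma qc1_Quat (a0 a1 a2 a3 : lorentz R) : qc1 (Quat a0 a1 a2 a3) = a1.
Proof. by []. Qed.
Lemma qc2_Quat (a0 a1 a2 a3 : lorentz R) : qc2 (Quat a0 a1 a2 a3) = a2.
Proof. by []. Qed.
Lemma qc3_Quat (a0 a1 a2 a3 : lorentz R) : qc3 (Quat a0 a1 a2 a3) = a3.
Proof. by []. Qed.
Definition qc_Quat := (qc0_Quat, qc1_Quat, qc2_Quat, qc3_Quat).

Fact qmulA : associative qmul.
Proof. by move=> p q r; apply: lquatP; rewrite !qc_mul; ring. Qed.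
Fact qmul1l : left_id qone qmul.
Proof. by move=> p; apply: lquatP; rewrite !qc_mul !qc_Quat; ring. Qed.
Fact qmul1r : right_id qone qmul.
Proof. by move=> p; apply: lquatP; rewrite !qc_mul !qc_Quat; ring. Qed.
Fact qmulDl : left_distributive qmul +%R.
Proof. by move=> p q r; apply: lquatP; rewrite !(qc_mul, qc_add); ring. Qed.
Fact qmulDr : right_distributive qmul +%R.
Proof. by move=> p q r; apply: lquatP; rewrite !(qc_mul, qc_add); ring. Qed.
Fact qone_neq0 : qone != 0.
Proof. by apply/eqP => /(congr1 qc0) /eqP; rewrite qc0_Quat oner_eq0. Qed.

HB.instance Definition _ := GRing.Zmodule_isNzRing.Build (lquat R)
  qmulA qmul1l qmul1r qmulDl qmulDr qone_neq0.

Lemma qmulE p q : p * q = qmul p q. Proof. by []. Qed.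
Lemma qoneE : 1 = qone. Proof. by []. Qed.

Definition qofL a : lquat R := Quat a 0 0 0.
Definition qI : lquat R := Quat 0 1 0 0.
Definition qJ : lquat R := Quat 0 0 1 0.
Definition qK : lquat R := Quat 0 0 0 1.

(* Quaternionic conjugation, which fixes the coefficients; to be distinguished
   from [qhat], which conjugates the coefficients. *)
Definition qconj q : lquat R := Quat (qc0 q) (- qc1 q) (- qc2 q) (- qc3 q).
Definition qhat q : lquat R :=
  Quat (lconj (qc0 q)) (lconj (qc1 q)) (lconj (qc2 q)) (lconj (qc3 q)).

Definition qH q : lorentz R := qc0 q ^+ 2 + qc1 q ^+ 2 + qc2 q ^+ 2 + qc3 q ^+ 2.
Definition S3 : set (lquat R) := [set q | qH q = 1].

Lemma mulq_conj q : q * qconj q = qofL (qH q).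
Proof.
by rewrite qmulE /qH; apply: lquatP; rewrite !qc_mul !qc_Quat; ring.
Qed.
Lemma mul_conjq q : qconj q * q = qofL (qH q).
Proof.
by rewrite qmulE /qH; apply: lquatP; rewrite !qc_mul !qc_Quat; ring.
Qed.
Lemma qHM p q : qH (p * q) = qH p * qH q.
Proof. by rewrite qmulE /qH !qc_mul; ring. Qed.
Lemma qofLM a (b : lorentz R) : qofL (a * b) = qofL a * qofL b.
Proof.
by rewrite qmulE /qofL; apply: lquatP; rewrite !qc_mul !qc_Quat; ring.
Qed.
Lemma qofLC a q : qofL a * q = q * qofL a.
Proof.
by rewrite !qmulE /qofL; apply: lquatP; rewrite !qc_mul !qc_Quat; ring.
Qed.
Lemma qH1 : qH 1 = 1.
Proof. by rewrite qoneE /qH !qc_Quat; ring. Qed.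

Definition qunit : pred (lquat R) := [pred q | qH q \is a GRing.unit].
Definition qinv q : lquat R :=
  if qunit q then qofL (qH q)^-1 * qconj q else q.

Fact qmulVr : {in qunit, left_inverse 1 qinv *%R}.
Proof.
by move=> q qu; rewrite /qinv ifT// -mulrA mul_conjq -qofLM mulVr.
Qed.
Fact qmulrV : {in qunit, right_inverse 1 qinv *%R}.
Proof.
move=> q qu; rewrite /qinv ifT// mulrA -qofLC -mulrA mulq_conj -qofLM.
by rewrite mulVr.
Qed.
Fact qunitP p q : q * p = 1 /\ p * q = 1 -> qunit p.
Proof.
move=> [/(congr1 qH) qp _]; apply/unitrP; exists (qH q).
by rewrite -qHM qp qH1 mulrC -qHM qp qH1.
Qed.
Fact qinv_out : {in [predC qunit], qinv =1 id}.
Proof. by move=> q qu; rewrite /qinv ifN. Qed.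

HB.instance Definition _ := GRing.NzRing_hasMulInverse.Build (lquat R)
  qmulVr qmulrV qunitP qinv_out.

Lemma S3_invr q : S3 q -> q \is a GRing.unit /\ q^-1 = qconj q.
Proof.
move=> q1; have qu : qunit q by rewrite /qunit /= q1 unitr1.
split=> //; change (qinv q = qconj q).
by rewrite /qinv qu q1 invr1 [qofL 1]/(1 : lquat R) mul1r.
Qed.

Lemma lquat_relations : [/\ qI * qI = -1, qJ * qJ = -1, qK * qK = -1,
  qI * qJ = qK & qJ * qI = - qK].
Proof.
by split; rewrite qmulE ?qoneE; apply: lquatP;
  rewrite !(qc_mul, qc_opp) /qI /qJ /qK /qone !qc_Quat; ring.
Qed.

(* R^4 as the set of the sigma x0 + x1 I + x2 J + x3 K; [qH] restricts to the
   Euclidean quadratic form because sigma ^+ 2 = 1. *)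
Definition r4 (x : 'rV[R]_4) : lquat R :=
  Quat (lsigma * lofR (x 0 0)) (lofR (x 0 1)) (lofR (x 0 2%R)) (lofR (x 0 3%R)).

Lemma qH_r4 (x : 'rV[R]_4) : qH (r4 x) = lofR (\sum_i x 0 i ^+ 2).
Proof.
rewrite /qH /r4 !qc_Quat exprMn lsigma_sqr mul1r !big_ord_recr big_ord0 /=.
rewrite !expr2 add0r; apply: lorentzP => /=; last by ring.
rewrite !mulr0 !addr0; do !congr (_ + _); congr (_ * _); congr (x 0 _);
  exact: val_inj.
Qed.

End LorentzQuaternions.

Section Calculus.
Context {R : realType}.
Local Notation A := (lorentz R).

Section Smooth.
Context {W : normedModType R}.
Implicit Types (U : set A) (f : A -> W).

Definition partial_x f : A -> W := 'D_(1 : A) f.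
Definition partial_y f : A -> W := 'D_(lsigma : A) f.

Fixpoint Ck_on (k : nat) U f : Prop :=
  {in U, continuous f} /\
  if k is k'.+1 then
    [/\ forall z, U z -> derivable f z (1 : A) /\ derivable f z (lsigma : A),
        Ck_on k' U (partial_x f) & Ck_on k' U (partial_y f)]
  else True.

(* Meaningful for an open set U, as are the predicates built on it. *)
Definition smooth_on U f : Prop := forall k, Ck_on k U f.

Definition immersion_on U f : Prop :=
  smooth_on U f /\ forall z, U z -> injective ('d f z).

End Smooth.

Definition conformal_on (U : set A) (f : A -> A) : Prop :=
  smooth_on U f /\
  forall z, U z -> partial_y f z = lsigma * partial_x f z.

Definition qconformal_on (U : set A) (f : A -> lquat R) : Prop :=
  smooth_on U f /\
  forall z, U z -> partial_y f z = qofL lsigma * partial_x f z.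

Definition path_in (U : set A) (c : R -> A) : Prop :=
  {within `[0, 1], continuous c} /\ forall t, 0 <= t <= 1 -> U (c t).

Definition simply_connected (U : set A) : Prop :=
  (forall z w, U z -> U w ->
     exists c : R -> A, [/\ path_in U c, c 0 = z & c 1 = w]) /\
  (forall c : R -> A, path_in U c -> c 0 = c 1 ->
     exists h : R * R -> A,
       [/\ {within `[0, 1] `*` `[0, 1], continuous h},
           forall s t, 0 <= s <= 1 -> 0 <= t <= 1 -> U (h (s, t)),
           forall t, 0 <= t <= 1 -> h (0, t) = c t /\ h (1, t) = c 0 &
           forall s, 0 <= s <= 1 -> h (s, 0) = c 0 /\ h (s, 1) = c 0]).

End Calculus.

Section Parametrized.
Context {R : realType}.
Local Notation A := (lorentz R).
Local Notation E4 := 'rV[R]_4.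
Implicit Types (U : set A) (F Y : A -> E4) (u v : E4) (z : A).

Definition dotp u v : R := \sum_i u 0 i * v 0 i.

(* The rows of the Jacobian matrix are the coordinate tangent vectors, hence
   J *m J^T is the Gram matrix of the induced metric. *)
Definition jac F z : 'M[R]_(2, 4) := col_mx (partial_x F z) (partial_y F z).
Definition gram F z : 'M[R]_2 := jac F z *m (jac F z)^T.

Definition tan_proj F z v : E4 :=
  v *m (jac F z)^T *m invmx (gram F z) *m jac F z.
Definition nor_proj F z v : E4 := v - tan_proj F z v.

(* Covariant derivatives of a vector field Y along F, in the direction w: the
   Levi-Civita connection of the induced metric when Y is tangent, the normal
   connection when Y is normal. *)
Definition tan_nabla F (w : A) Y : A -> E4 := fun z => tan_proj F z ('D_w Y z).
Definition nor_nabla F (w : A) Y : A -> E4 := fun z => nor_proj F z ('D_w Y z).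

(* R(d/dx, d/dy) Y; there is no bracket term since [d/dx, d/dy] = 0. *)
Definition curv (nabla : A -> (A -> E4) -> A -> E4) Y : A -> E4 := fun z =>
  nabla 1 (nabla lsigma Y) z - nabla lsigma (nabla 1 Y) z.

Definition gauss_curvature F z : R :=
  dotp (curv (tan_nabla F) (partial_y F) z) (partial_x F z) / \det (gram F z).

(* [n1], [n2] is a smooth orthonormal frame of the normal bundle over [W],
   oriented so that (F_x, F_y, n1, n2) is a positive basis of R^4. *)
Definition oriented_normal_frame (W : set A) F (n1 n2 : A -> E4) : Prop :=
  [/\ smooth_on W n1, smooth_on W n2 & forall z, W z ->
    [/\ dotp (n1 z) (n1 z) = 1, dotp (n2 z) (n2 z) = 1, dotp (n1 z) (n2 z) = 0,
        jac F z *m (n1 z)^T = 0 /\ jac F z *m (n2 z)^T = 0 &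
        0 < \det (col_mx (jac F z) (col_mx (n1 z) (n2 z)) : 'M[R]_4)]].

(* K_N = <R^N(e1, e2) n2, n1>, where (e1, e2) is an oriented orthonormal frame
   of the tangent plane, so that R^N(d/dx, d/dy) = sqrt (det gram) R^N(e1, e2).
   The value depends on the chosen normal frame only through its orientation. *)
Definition is_normal_curvature F z (k : R) : Prop :=
  exists W n1 n2, [/\ open W, W z, oriented_normal_frame W F n1 n2 &
    k = dotp (curv (nor_nabla F) n2 z) (n1 z) / Num.sqrt (\det (gram F z))].

(* The Gauss map z |-> (F_x /\ F_y) / |F_x /\ F_y|.  The bivector u /\ v is
   encoded as the antisymmetric matrix u^T v - v^T u, and the Grassmannian of
   oriented 2-planes as the submanifold of unit decomposable bivectors. *)
Definition gauss_map F z : 'M[R]_4 :=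
  (Num.sqrt (\det (gram F z)))^-1 *:
    ((partial_x F z)^T *m partial_y F z - (partial_y F z)^T *m partial_x F z).

End Parametrized.

Section Surfaces.
Context {R : realType}.
Local Notation A := (lorentz R).

(* Charts are given by their inverses, the local parametrizations [phi], with
   domain an open subset [U] of the plane [A]. *)
Definition param_homeo (M : topologicalType) (U : set A) (phi : A -> M) :=
  [/\ open U, {in U, continuous phi}, {in U &, injective phi} &
      forall V : set A, open V -> V `<=` U -> open (phi @` V)].

Definition smooth_transition (M : topologicalType)
    (U : set A) (phi : A -> M) (V : set A) (chi : A -> M) : Prop :=
  let D := U `&` phi @^-1` (chi @` V) in
  exists tau : A -> A,
    smooth_on D tau /\ forall z, D z -> V (tau z) /\ chi (tau z) = phi z.

End Surfaces.

Record surface (R : realType) := Surface {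
  carrier :> topologicalType;
  atlas : set (set (lorentz R) * (lorentz R -> carrier));
  surface_hausdorff : hausdorff_space carrier;
  surface_second_countable : @second_countable carrier;
  atlas_homeo : forall c, atlas c -> param_homeo c.1 c.2;
  atlas_cover : forall p, exists2 c, atlas c & (c.2 @` c.1) p;
  atlas_smooth : forall c d, atlas c -> atlas d ->
    smooth_transition c.1 c.2 d.1 d.2
}.

Section SurfaceImmersions.
Context {R : realType} (M : surface R).
Implicit Type f : M -> 'rV[R]_4.

(* Local parametrizations belonging to the maximal atlas. *)
Definition local_chart (U : set (lorentz R)) (phi : lorentz R -> M) : Prop :=
  param_homeo U phi /\ forall c, atlas c ->
    smooth_transition U phi c.1 c.2 /\ smooth_transition c.1 c.2 U phi.

Definition immersion f : Prop :=
  forall c, @atlas R M c -> immersion_on c.1 (f \o c.2).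

Definition zero_gauss_curvature f : Prop :=
  forall c, @atlas R M c -> forall z, c.1 z -> gauss_curvature (f \o c.2) z = 0.

Definition zero_normal_curvature f : Prop :=
  forall c, @atlas R M c -> forall z, c.1 z -> is_normal_curvature (f \o c.2) z 0.

(* Each chart carries its own orientation; reversing it replaces the Gauss map
   by its opposite, so that regularity makes sense without orienting [M]. *)
Definition regular_gauss_map f : Prop :=
  forall c, @atlas R M c -> immersion_on c.1 (gauss_map (f \o c.2)).

End SurfaceImmersions.

Section Representation.
Context {R : realType}.
Local Notation A := (lorentz R).
Implicit Types (U : set A) (psi : A -> A) (th lam mu : A -> R)
  (g : A -> lquat R) (w : A -> {linear A -> R}).

Definition frame_e2 (th1 : A -> R) lam mu : A -> A := fun z =>
  lofR (sin (th1 z) * (lam z)^-1) + lsigma * lofR (cos (th1 z) * (mu z)^-1).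
Definition frame_e3 (th1 : A -> R) lam mu : A -> A := fun z =>
  lofR (- cos (th1 z) * (lam z)^-1) + lsigma * lofR (sin (th1 z) * (mu z)^-1).

Definition dual_forms U (e2 e3 : A -> A) (w2 w3 : A -> {linear A -> R}) : Prop := forall z, U z ->
  [/\ w2 z (e2 z) = 1, w2 z (e3 z) = 0, w3 z (e2 z) = 0 & w3 z (e3 z) = 1].

Definition rep_data U psi (th1 th2 : A -> R) lam mu g
    (w2 w3 : A -> {linear A -> R}) : Prop :=
  [/\ open U /\ simply_connected U,
      conformal_on U psi /\
        (forall z, U z -> psi z = lofR (th1 z) + lsigma * lofR (th2 z)),
      [/\ smooth_on U lam, smooth_on U mu & forall z, U z ->
        [/\ partial_x mu z = lam z * partial_x th2 z,
            partial_y lam z = - mu z * partial_y th2 z & 0 < lam z * mu z]],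
      [/\ qconformal_on U g, (forall z, U z -> S3 (g z)) & forall z, U z ->
        partial_x g z * (g z)^-1 =
          qofL (lcos (psi z)) * qJ + qofL (lsin (psi z)) * qK] &
      dual_forms U (frame_e2 th1 lam mu) (frame_e3 th1 lam mu) w2 w3].

(* [z] is the base point and [v] the tangent vector. *)
Definition xi_form g (w2 w3 : A -> {linear A -> R}) (z v : A) : lquat R :=
  (g z)^-1 * (qofL (lofR (w2 z v)) * qJ + qofL (lofR (w3 z v)) * qK)
  * qhat (g z).

(* F = \int xi, as a map into R^4. *)
Definition primitive_on U (F : A -> 'rV[R]_4) (xi : A -> A -> lquat R) : Prop :=
  forall z, U z -> differentiable F z /\ forall v, r4 ('d F z v) = xi z v.

End Representation.

(* Main.v *)
(* In the null coordinates [z.1 + z.2] and [z.1 - z.2] the ring of Lorentz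
   numbers splits as R x R, so that a conformal [g] with values in the unit
   sphere is a pair [(a, b)] of unit real quaternions, [a] depending on [x + y]
   and [b] on [x - y], and [xi] becomes the R^4-valued form
   [a^-1 (w2 J + w3 K) b].  The normal frame [a^-1 b], [a^-1 I b] then makes
   both curvatures vanish by the Gauss and Ricci equations, and the PDE for
   [lam] and [mu] says that the form is closed.

   Conversely the tangent planes of an immersion are encoded by two maps [X],
   [Y] to the sphere of imaginary unit quaternions (the self-dual and the
   anti-self-dual part of the Gauss map).  The pullbacks of the area form by [X]
   and [Y] are combinations of [K] and [K_N], hence vanish: [X] and [Y] have
   rank at most one, and exactly one because the Gauss map is regular.  Lifting
   [X = a^-1 I a] and removing the I-part of [da a^-1] by a gauge rotation gives
   [da = (cos al J + sin al K) a ds], with [al] a function of [s]; likewise for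
   [Y] with [b], [be] and [t].  In the coordinates [x = (s + t) / 2],
   [y = (s - t) / 2], the symmetry of the second derivatives of [F] yields the
   shape of [xi] and the PDE. *)

Require Import Defs.
From HB Require Import structures.
From mathcomp Require Import all_boot all_order all_algebra.
From mathcomp Require Import all_classical all_reals all_analysis.
From mathcomp Require Import ring lra.
Import Order.TTheory GRing.Theory Num.Theory.
Import numFieldNormedType.Exports.
Local Open Scope classical_set_scope.
Local Open Scope ring_scope.
Set Implicit Arguments.
Unset Strict Implicit.
Unset Printing Implicit Defensive.

(** * Smooth functions on the Lorentz plane *)

(** Three points remain. The homotopies in [simply_connected] are only continuous, so a form cannot
    be pulled back along them: a global primitive is built from increments of local primitives,
    summed along fine subdivisions and shown invariant over a fine grid of the homotopy square. The
    normal curvature is only given through a frame chosen near each point. The twistor [n2] times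
    conjugate [n1] of that frame is plus or minus the canonical one of the tangent plane; the sign
    has zero derivative, and this carries the Gauss and Ricci equations over to [X] and [Y]. In the
    converse, [ds] and [dt] must be independent and correctly oriented. A vector killed by both
    would be killed by the differential of the Gauss map, so regularity gives independence. Since
    [lam * mu] is the oriented area of the coordinate tangent vectors, the change of coordinates
    must keep the orientation; if it does not, [s] becomes [- s] and [al] becomes [al + pi], which
    leaves [a] and its equation unchanged. *)

Section PlaneCalculus.
Context {R : realType}.
Local Notation A := (lorentz R).
Implicit Types (U V : set A) (f g : A -> R) (z w v : A).

Lemma open_box U z : open U -> U z ->
  exists2 r : R, 0 < r &
    forall w, `|w.1 - z.1| < r -> `|w.2 - z.2| < r -> U w.
Proof.
move=> oU Uz; have /nbhs_ballP[r r0 rU] : nbhs z U by apply: open_nbhs_nbhs.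
exists r => // w w1 w2; apply: rU; split; rewrite -ball_normE /= distrC //.
Qed.

Definition box z (r : R) : set A :=
  [set w | `|w.1 - z.1| < r /\ `|w.2 - z.2| < r].

Lemma box_center z (r : R) : 0 < r -> box z r z.
Proof. by move=> r0; rewrite /box /= !subrr normr0. Qed.

Lemma box_ball z (r : R) : 0 < r -> box z r = ball z r.
Proof.
move=> r0; apply/seteqP; split=> w [] w1 w2; split; move: w1 w2;
  rewrite -?ball_normE /= => w1 w2; by rewrite distrC.
Qed.

Lemma open_boxE z (r : R) : 0 < r -> open (box z r).
Proof. by move=> r0; rewrite box_ball//; exact: ball_open. Qed.

Lemma nbhs_box z (P : set A) :
  nbhs z P <-> exists2 r : R, 0 < r & box z r `<=` P.
Proof.
split=> [/nbhs_ballP[r r0 rP]|[r r0 rP]].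
  by exists r => //; rewrite box_ball.
by apply/nbhs_ballP; exists r => //; rewrite -box_ball.
Qed.

(* Restriction to a line, which brings one-variable results to bear. *)
Lemma is_derive_line f z v (t d : R) :
  is_derive (z + t *: v) v f d ->
  is_derive t (1 : R) (fun s : R => f (z + s *: v)) d.
Proof.
have E : (fun h : R => h^-1 *:
      (((fun s : R => f (z + s *: v)) \o shift t) (h *: (1 : R)) - f (z + t *: v))) =
    (fun h : R => h^-1 *: ((f \o shift (z + t *: v)) (h *: v) - f (z + t *: v))).
  apply/funext => h /=; congr (_ *: (f _ - _)).
  by rewrite [h *: 1]mulr1 scalerDl addrCA.
by move=> [df dE]; split; rewrite /derivable /derive E.
Qed.

(** One-variable mean value theorem on [s |-> f (z + s *: v)]. The intermediate point is a fraction
    [t] of [h] in the closed unit interval, which treats both signs of [h] and the case [h = 0]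
    alike. *)
Lemma mvt_dir f z v (h : R) :
  (forall t, 0 <= t <= 1 -> derivable f (z + (t * h) *: v) v) ->
  exists2 t, 0 <= t <= 1 &
    f (z + h *: v) - f z = h * 'D_v f (z + (t * h) *: v).
Proof.
move=> df.
pose g (s : R) := f (z + s *: v); pose dg (s : R) := 'D_v f (z + s *: v).
have dgt t : 0 <= t <= 1 -> is_derive (t * h) (1 : R) g (dg (t * h)).
  by move=> t01; apply: is_derive_line; apply: derivableP; exact: df.
have [h0|h0|h0] := ltgtP h 0; last first.
- by exists 0; rewrite ?lexx ?ler01 // h0 scale0r addr0 subrr mul0r.
- have in01 x : 0 <= x <= h -> 0 <= x / h <= 1.
    by move=> /andP[x0 xh]; rewrite divr_ge0 ?(ltW h0)//= ler_pdivrMr// mul1r.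
  have dgx x : 0 <= x <= h -> is_derive x (1 : R) g (dg x).
    by move=> /in01 /dgt; rewrite divfK ?gt_eqF.
  have [x|x|c /[!in_itv]/= cI E] := @MVT _ g dg _ _ h0.
  + by rewrite in_itv /= => /andP[/ltW x0 /ltW xh]; apply: dgx; rewrite x0.
  + apply: derivable_within_continuous => y /[!in_itv] /= /dgx yy; exact: ex_derive.
  + exists (c / h); first by apply: in01; case/andP: cI => /ltW-> /ltW->.
    move: E; rewrite /g /dg subr0 divfK ?gt_eqF// scale0r addr0 => ->.
    by rewrite mulrC.
- have in01 x : h <= x <= 0 -> 0 <= x / h <= 1.
    by move=> /andP[xh x0]; rewrite ler_ndivlMr ?ler_ndivrMr// mul0r x0 mul1r.
  have dgx x : h <= x <= 0 -> is_derive x (1 : R) g (dg x).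
    by move=> /in01 /dgt; rewrite divfK ?lt_eqF.
  have [x|x|c /[!in_itv]/= cI E] := @MVT _ g dg _ _ h0.
  + by rewrite in_itv /= => /andP[/ltW xh /ltW x0]; apply: dgx; rewrite xh.
  + apply: derivable_within_continuous => y /[!in_itv] /= /dgx yy; exact: ex_derive.
  + exists (c / h); first by apply: in01; case/andP: cI => /ltW-> /ltW->.
    move: E; rewrite /g /dg sub0r divfK ?lt_eqF// scale0r addr0.
    by rewrite mulrN => /eqP; rewrite -opprB eqr_opp => /eqP->; rewrite mulrC.
Qed.

Lemma lorentz_line1 z (h : R) : z + h *: (1 : A) = (z.1 + h, z.2).
Proof.
by rewrite [in LHS](surjective_pairing z); congr (_, _) => /=;
  rewrite /GRing.scale /= ?mulr1 ?mulr0 ?addr0.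
Qed.

Lemma lorentz_lines z (h : R) : z + h *: (lsigma : A) = (z.1, z.2 + h).
Proof.
by rewrite [in LHS](surjective_pairing z); congr (_, _) => /=;
  rewrite /GRing.scale /= ?mulr1 ?mulr0 ?addr0.
Qed.

(** Bundled as a linear map because it serves twice: as the differential of a C^1 function, and as
    the forms [w2], [w3] produced in the converse. *)
Definition lin2 (a b : R) : A -> R := fun v => v.1 * a + v.2 * b.

Lemma lin2_is_linear (a b : R) : linear (lin2 a b).
Proof.
move=> k [u1 u2] [v1 v2]; rewrite /lin2 /= /GRing.scale /=; ring.
Qed.
HB.instance Definition _ (a b : R) :=
  GRing.isLinear.Build R A R *:%R (lin2 a b) (lin2_is_linear a b).

Lemma continuous_fst' : continuous (fun z : A => z.1).
Proof. by move=> z; exact: (@cvg_fst R R). Qed.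

Lemma continuous_snd' : continuous (fun z : A => z.2).
Proof. by move=> z; exact: (@cvg_snd R R). Qed.

Lemma lin2_continuous (a b : R) : continuous (lin2 a b).
Proof.
move=> z; apply: cvgD; apply: cvgMr_tmp; [exact: continuous_fst'|exact: continuous_snd'].
Qed.

Lemma lorentz_normE z : `|z| = Num.max `|z.1| `|z.2|.
Proof. by []. Qed.

(** The increment is split into a horizontal and a vertical move. Each is a partial derivative at an
    intermediate point, within [e / 2] of its value at [z] by continuity, and the two errors add up
    to [e]. *)
Lemma is_diff_C1 f z :
  (\forall w \near z, derivable f w (1 : A) /\ derivable f w (lsigma : A)) ->
  {for z, continuous (partial_x f)} -> {for z, continuous (partial_y f)} ->
  is_diff z f (lin2 (partial_x f z) (partial_y f z)).
Proof.
move=> df cx cy.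
have dE : f \o shift z =
    cst (f z) + lin2 (partial_x f z) (partial_y f z) +o_ 0 id.
  apply/eqaddoP => e e0.
  have e20 : 0 < e / 2 by rewrite divr_gt0.
  have [r0 r0P H0] := (nbhs_box _ _).1 df.
  have [r1 r1P H1] := (nbhs_box _ _).1 (((cvgrPdist_lt _ _).1 cx) _ e20).
  have [r2 r2P H2] := (nbhs_box _ _).1 (((cvgrPdist_lt _ _).1 cy) _ e20).
  have {}H0 : forall w, box z r0 w ->
    derivable f w (1 : A) /\ derivable f w (lsigma : A) := H0.
  pose r := Num.min r0 (Num.min r1 r2).
  have rP : 0 < r by rewrite !lt_min r0P r1P.
  have /filterS : nbhs (0 : A) (box 0 r) by apply/nbhs_box; exists r.
  apply=> v [].
  rewrite /= !subr0 !lt_min => /and3P[v10 v11 v12] /and3P[v20 v21 v22].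
  have tb (t x b : R) : 0 <= t <= 1 -> `|x| < b -> `|t * x| < b.
    move=> /andP[t0 t1]; apply: le_lt_trans; rewrite normrM ger0_norm//.
    by rewrite ler_piMl.
  have [t t01 E1] : exists2 t, 0 <= t <= 1 & f (z + v.1 *: (1 : A)) - f z
      = v.1 * 'D_(1 : A) f (z + (t * v.1) *: (1 : A)).
    apply: (@mvt_dir f z (1 : A) v.1) => t t01; apply: (proj1 (H0 _ _)); rewrite lorentz_line1; split => /=.
      by rewrite addrAC subrr add0r tb.
    by rewrite subrr normr0.
  have [s s01 E2] : exists2 s, 0 <= s <= 1 &
      f ((z + v.1 *: (1 : A)) + v.2 *: lsigma) - f (z + v.1 *: (1 : A))
      = v.2 * 'D_lsigma f ((z + v.1 *: (1 : A)) + (s * v.2) *: lsigma).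
    apply: (@mvt_dir f (z + v.1 *: (1 : A)) lsigma v.2) => t' t01'; apply: (proj2 (H0 _ _)).
    rewrite lorentz_line1 lorentz_lines; split => /=.
      by rewrite addrAC subrr add0r.
    by rewrite addrAC subrr add0r tb.
  have vE : v + z = (z + v.1 *: (1 : A)) + v.2 *: lsigma.
    rewrite lorentz_line1 lorentz_lines [in LHS]addrC.
    by rewrite [in LHS](surjective_pairing z) [in LHS](surjective_pairing v).
  have -> : (f \o shift z - (cst (f z) + lin2 (partial_x f z) (partial_y f z))) v
    = f (v + z) - (f z + lin2 (partial_x f z) (partial_y f z) v) by [].
  rewrite vE.
  have -> : f (z + v.1 *: (1 : A) + v.2 *: lsigma) -
      (f z + lin2 (partial_x f z) (partial_y f z) v) =
      - (v.1 * (partial_x f z - 'D_(1 : A) f (z + (t * v.1) *: (1 : A)))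
      + v.2 * (partial_y f z - 'D_lsigma f ((z + v.1 *: (1 : A)) + (s * v.2) *: lsigma))).
    rewrite /lin2 opprD mulrBr mulrBr -E1 -E2; ring.
  rewrite normrN; apply: le_trans (ler_normD _ _) _; rewrite !normrM.
  have [n1 n2] : `|v.1| <= `|v| /\ `|v.2| <= `|v|.
    by rewrite lorentz_normE !le_max !lexx orbT.
  rewrite [e]splitr mulrDl; apply: lerD.
    rewrite mulrC; apply: ler_pM => //; apply/ltW/H1.
    rewrite lorentz_line1; split => /=; last by rewrite subrr normr0.
    by rewrite addrAC subrr add0r tb.
  rewrite mulrC; apply: ler_pM => //; apply/ltW/H2.
  rewrite lorentz_line1 lorentz_lines; split => /=.
    by rewrite addrAC subrr add0r.
  by rewrite addrAC subrr add0r tb.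
have dv : 'd f z = lin2 (partial_x f z) (partial_y f z) :> (A -> R).
  apply: (@diff_unique _ _ _ _ (lin2 (partial_x f z) (partial_y f z))) => //.
  exact: lin2_continuous.
split=> //; apply/diff_locallyP; rewrite dv; split=> //; exact: lin2_continuous.
Qed.

End PlaneCalculus.

(** * C^k maps into normed spaces *)

Section VectorCalculus.
Context {R : realType}.
Local Notation A := (lorentz R).
Implicit Types (U V : set A) (z v : A).

Section OneSpace.
Context {W : normedModType R}.
Implicit Types f g : A -> W.

Lemma Ck_on_continuous k U f z : Ck_on k U f -> U z -> {for z, continuous f}.
Proof. by case: k => [|k] [cf _] Uz; apply: cf; rewrite inE. Qed.

Lemma Ck_onW k U f : Ck_on k.+1 U f -> Ck_on k U f.
Proof.
elim: k f => [|k IH] f [cf [df fx fy]]; split=> //.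
by split=> //; apply: IH.
Qed.

Lemma Ck_on_subset k U V f : V `<=` U -> Ck_on k U f -> Ck_on k V f.
Proof.
move=> VU; elim: k f => [|k IH] f [cf H].
  by split=> // z /[1!inE] /VU Uz; apply: cf; rewrite inE.
split; first by move=> z /[1!inE] /VU Uz; apply: cf; rewrite inE.
by case: H => df fx fy; split; [move=> z /VU /df|exact: IH|exact: IH].
Qed.

Lemma near_open U z (P : A -> Prop) :
  open U -> U z -> (forall w, U w -> P w) -> \forall w \near z, P w.
Proof. by move=> oU Uz UP; apply: (@filterS _ _ _ U) => //; exact: open_nbhs_nbhs. Qed.

Lemma is_derive_ext U f g z v d : open U -> U z -> (forall w, U w -> f w = g w) ->
  is_derive z v f d -> is_derive z v g d.
Proof.
by move=> oU Uz fg; apply: near_eq_is_derive; exact: (near_open oU Uz fg).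
Qed.

Lemma derive_ext U f g z v : open U -> U z -> (forall w, U w -> f w = g w) ->
  'D_v f z = 'D_v g z.
Proof. by move=> oU Uz fg; apply: near_eq_derive; exact: (near_open oU Uz fg). Qed.

Lemma continuous_ext U f g z : open U -> U z -> (forall w, U w -> f w = g w) ->
  {for z, continuous f} -> {for z, continuous g}.
Proof.
move=> oU Uz fg cf; rewrite /prop_for /continuous_at -(fg z Uz).
apply: cvg_trans cf; apply: near_eq_cvg.
by apply: (near_open oU Uz) => w Uw; rewrite fg.
Qed.

Lemma Ck_on_ext k U f g : open U -> (forall w, U w -> f w = g w) ->
  Ck_on k U f -> Ck_on k U g.
Proof.
move=> oU; elim: k f g => [|k IH] f g fg [cf H].
  split=> // z /[1!inE] Uz; apply: (continuous_ext oU Uz fg).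
  by apply: cf; rewrite inE.
split.
  move=> z /[1!inE] Uz; apply: (continuous_ext oU Uz fg).
  by apply: cf; rewrite inE.
case: H => df fx fy; split.
- move=> z Uz; have [d1 d2] := df z Uz.
  have E : {near z, f =1 g} by exact: (near_open oU Uz fg).
  by split; [exact: near_eq_derivable d1|exact: near_eq_derivable d2].
- by apply: IH fx => w Uw; exact: (@derive_ext U f g w (1 : A) oU Uw fg).
- by apply: IH fy => w Uw; exact: (@derive_ext U f g w (lsigma : A) oU Uw fg).
Qed.

(** Introduction rule with named candidates for the derivatives: regularity is proved on explicit
    formulas, and openness of [U] transfers it to [partial_x f] and [partial_y f], which agree with
    them only on [U]. *)
Lemma Ck_onS k U f fx fy : open U ->
  (forall z, U z -> {for z, continuous f}) ->
  (forall z, U z -> is_derive z (1 : A) f (fx z)) ->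
  (forall z, U z -> is_derive z (lsigma : A) f (fy z)) ->
  Ck_on k U fx -> Ck_on k U fy -> Ck_on k.+1 U f.
Proof.
move=> oU cf dx dy Cx Cy; split; first by move=> z /[1!inE] /cf.
split.
- by move=> z Uz; split; [case: (dx z Uz)|case: (dy z Uz)].
- by apply: Ck_on_ext Cx => // w Uw; have [_ <-] := dx w Uw.
- by apply: Ck_on_ext Cy => // w Uw; have [_ <-] := dy w Uw.
Qed.

Lemma Ck_on_derive k U f z : Ck_on k.+1 U f -> U z ->
  is_derive z (1 : A) f (partial_x f z) /\ is_derive z (lsigma : A) f (partial_y f z).
Proof.
move=> [_ [df _ _]] /df[d1 d2]; split; exact: derivableP.
Qed.

Lemma Ck_on_x k U f : Ck_on k.+1 U f -> Ck_on k U (partial_x f).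
Proof. by move=> [_ []]. Qed.
Lemma Ck_on_y k U f : Ck_on k.+1 U f -> Ck_on k U (partial_y f).
Proof. by move=> [_ []]. Qed.

Lemma Ck_on_cst k U (c : W) : Ck_on k U (fun=> c).
Proof.
elim: k c => [|k IH] c; first by split=> // z _; exact: cst_continuous.
split; first by move=> z _; exact: cst_continuous.
split; first by move=> z _; split; exact: derivable_cst.
- by rewrite (_ : partial_x _ = fun=> 0) //; apply/funext => z; exact: derive_cst.
- by rewrite (_ : partial_y _ = fun=> 0) //; apply/funext => z; exact: derive_cst.
Qed.

Lemma is_deriveD' f g z v df dg : is_derive z v f df -> is_derive z v g dg ->
  is_derive z v (fun w => f w + g w) (df + dg).
Proof. by move=> *; exact: is_deriveD. Qed.

Lemma Ck_onD k U f g : open U -> Ck_on k U f -> Ck_on k U g ->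
  Ck_on k U (fun z => f z + g z).
Proof.
move=> oU; elim: k f g => [|k IH] f g Cf Cg.
  split=> // z /[1!inE] Uz.
  exact: continuousD (Ck_on_continuous Cf Uz) (Ck_on_continuous Cg Uz).
apply: (@Ck_onS _ _ _ (fun z => partial_x f z + partial_x g z)
  (fun z => partial_y f z + partial_y g z)) => //.
- move=> z Uz; exact: continuousD (Ck_on_continuous Cf Uz) (Ck_on_continuous Cg Uz).
- by move=> z Uz; apply: is_deriveD'; [case: (Ck_on_derive Cf Uz)|case: (Ck_on_derive Cg Uz)].
- by move=> z Uz; apply: is_deriveD'; [case: (Ck_on_derive Cf Uz)|case: (Ck_on_derive Cg Uz)].
- by apply: IH; exact: Ck_on_x.
- by apply: IH; exact: Ck_on_y.
Qed.

Lemma smooth_subset U V f : V `<=` U -> smooth_on U f -> smooth_on V f.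
Proof. by move=> VU sf k; exact: Ck_on_subset (sf k). Qed.

Lemma smooth_ext U f g : open U -> (forall w, U w -> f w = g w) ->
  smooth_on U f -> smooth_on U g.
Proof. by move=> oU fg sf k; exact: Ck_on_ext (sf k). Qed.

Lemma smooth_cst U (c : W) : smooth_on U (fun=> c).
Proof. by move=> k; exact: Ck_on_cst. Qed.

Lemma smoothD U f g : open U -> smooth_on U f -> smooth_on U g ->
  smooth_on U (fun z => f z + g z).
Proof. by move=> oU sf sg k; exact: Ck_onD. Qed.

Lemma smooth_x U f : smooth_on U f -> smooth_on U (partial_x f).
Proof. by move=> sf k; exact: Ck_on_x. Qed.

Lemma smooth_y U f : smooth_on U f -> smooth_on U (partial_y f).
Proof. by move=> sf k; exact: Ck_on_y. Qed.

Lemma smooth_cont U f z : smooth_on U f -> U z -> {for z, continuous f}.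
Proof. by move=> sf; exact: Ck_on_continuous (sf 0%N). Qed.

Lemma smooth_dx U f z : smooth_on U f -> U z -> is_derive z (1 : A) f (partial_x f z).
Proof. by move=> sf Uz; have [] := Ck_on_derive (sf 1%N) Uz. Qed.

Lemma smooth_dy U f z : smooth_on U f -> U z ->
  is_derive z (lsigma : A) f (partial_y f z).
Proof. by move=> sf Uz; have [] := Ck_on_derive (sf 1%N) Uz. Qed.

Lemma smooth_sum U (I : Type) (r : seq I) (F : I -> A -> W) : open U ->
  (forall i, smooth_on U (F i)) -> smooth_on U (fun z => \sum_(i <- r) F i z).
Proof.
move=> oU sF; elim: r => [|i r IH].
  by apply: smooth_ext (@smooth_cst U 0) => // w _; rewrite big_nil.
by apply: smooth_ext (smoothD oU (sF i) IH) => // w _; rewrite big_cons.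
Qed.

End OneSpace.

Section LinearImage.
Context {W W' : normedModType R} (L : W -> W').
Hypotheses (linL : linear L) (cL : continuous L).
Implicit Types f : A -> W.

Lemma is_derive_lin f z v d : is_derive z v f d ->
  is_derive z v (fun w => L (f w)) (L d).
Proof.
(* [linear] is taken as a predicate so that bare functions such as coordinates, [qplus] or the
   injections into a pair qualify; the bundle is local and only gives access to the linearity
   lemmas. *)
pose LL : {linear W -> W'} := HB.pack L (GRing.isLinear.Build _ _ _ _ _ linL).
have LZ k a : L (k *: a) = k *: L a by exact: (linearZZ LL).
have LB a b : L (a - b) = L a - L b by exact: (linearB LL).
have E : (fun h : R => h^-1 *: (((fun w => L (f w)) \o shift z) (h *: v) - L (f z))) =
    L \o (fun h : R => h^-1 *: ((f \o shift z) (h *: v) - f z)).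
  by apply/funext => h /=; rewrite LZ LB.
move=> [df <-].
have cv : h^-1 *: (((fun w => L (f w)) \o shift z) (h *: v) - L (f z)) @[h --> 0^']
    --> L ('D_v f z).
  rewrite E; apply: cvg_comp; last exact: cL.
  exact: df.
split; first by apply/cvg_ex; exists (L ('D_v f z)).
exact: cvg_lim.
Qed.

Lemma Ck_on_lin k U f : open U -> Ck_on k U f -> Ck_on k U (fun z => L (f z)).
Proof.
move=> oU; elim: k f => [|k IH] f Cf.
  split=> // z /[1!inE] Uz.
  by apply: continuous_comp; [exact: Ck_on_continuous Cf Uz|exact: cL].
apply: (@Ck_onS _ _ _ _ (fun z => L (partial_x f z)) (fun z => L (partial_y f z))) => //.
- move=> z Uz.
  by apply: continuous_comp; [exact: Ck_on_continuous Cf Uz|exact: cL].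
- by move=> z Uz; apply: is_derive_lin; case: (Ck_on_derive Cf Uz).
- by move=> z Uz; apply: is_derive_lin; case: (Ck_on_derive Cf Uz).
- by apply: IH; exact: Ck_on_x.
- by apply: IH; exact: Ck_on_y.
Qed.

Lemma smooth_lin U f : open U -> smooth_on U f -> smooth_on U (fun z => L (f z)).
Proof. by move=> oU sf k; exact: Ck_on_lin. Qed.

End LinearImage.
End VectorCalculus.

Section RealCalculus.
Context {R : realType}.
Local Notation A := (lorentz R).
Implicit Types (U V : set A) (f g : A -> R) (h : R -> R) (z v : A).

(** Converse of [is_derive_line] at the origin of the line. Together they reduce chain rules for
    directional derivatives to those of one variable. *)
Lemma is_derive_line0 f z v (d : R) :
  is_derive (0 : R) (1 : R) (fun s : R => f (z + s *: v)) d -> is_derive z v f d.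
Proof.
have E : (fun k : R => k^-1 *:
      (((fun s : R => f (z + s *: v)) \o shift 0) (k *: (1 : R)) - f (z + 0 *: v))) =
    (fun k : R => k^-1 *: ((f \o shift z) (k *: v) - f z)).
  apply/funext => k /=; congr (_ *: (f _ - f _)).
    by rewrite [k *: 1]mulr1 addr0 addrC.
  by rewrite scale0r addr0.
by move=> [df dE]; split; [move: df|move: dE]; rewrite /derivable /derive E.
Qed.

Lemma is_derive_chain h f z v (df dh : R) : is_derive z v f df ->
  is_derive (f z) (1 : R) h dh -> is_derive z v (fun w => h (f w)) (df * dh).
Proof.
move=> Df Dh; apply: is_derive_line0.
have D1 : is_derive (0 : R) (1 : R) (fun s : R => f (z + s *: v)) df.
  by apply: is_derive_line; rewrite scale0r addr0.
have D2 : is_derive (f (z + 0 *: v)) (1 : R) h dh by rewrite scale0r addr0.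
have [e1 v1] := D1; have [e2 v2] := D2.
split.
  apply/derivable1_diffP.
  by apply: (@differentiable_comp _ _ _ _ (fun s : R => f (z + s *: v)) h);
    exact/derivable1_diffP.
rewrite -derive1E (_ : (fun s : R => _) = h \o (fun s : R => f (z + s *: v)))//.
by rewrite derive1_comp // !derive1E v1 v2 mulrC.
Qed.

Lemma is_deriveM' f g z v df dg : is_derive z v f df -> is_derive z v g dg ->
  is_derive z v (fun w => f w * g w) (df * g z + f z * dg).
Proof.
move=> Df Dg; apply: (is_derive_eq (is_deriveM Df Dg)).
by rewrite /GRing.scale /= addrC [g z * df]mulrC.
Qed.

Lemma is_deriveV' f z v df : f z != 0 -> is_derive z v f df ->
  is_derive z v (fun w => (f w)^-1) (- df * ((f z)^-1 * (f z)^-1)).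
Proof.
move=> fz [Df <-]; split; first exact: derivableV.
rewrite [LHS]deriveV // /GRing.scale /= expr2 invfM; ring.
Qed.

Lemma Ck_onM k U f g : open U -> Ck_on k U f -> Ck_on k U g ->
  Ck_on k U (fun z => f z * g z).
Proof.
move=> oU; elim: k f g => [|k IH] f g Cf Cg.
  split=> // z /[1!inE] Uz.
  exact: continuousM (Ck_on_continuous Cf Uz) (Ck_on_continuous Cg Uz).
apply: (@Ck_onS _ _ _ _ _ (fun z => partial_x f z * g z + f z * partial_x g z)
  (fun z => partial_y f z * g z + f z * partial_y g z)) => //.
- move=> z Uz; exact: continuousM (Ck_on_continuous Cf Uz) (Ck_on_continuous Cg Uz).
- by move=> z Uz; apply: is_deriveM'; [case: (Ck_on_derive Cf Uz)|case: (Ck_on_derive Cg Uz)].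
- by move=> z Uz; apply: is_deriveM'; [case: (Ck_on_derive Cf Uz)|case: (Ck_on_derive Cg Uz)].
- by apply: Ck_onD => //; apply: IH => //; by [exact: Ck_onW|exact: Ck_on_x].
- by apply: Ck_onD => //; apply: IH => //; by [exact: Ck_onW|exact: Ck_on_y].
Qed.

Lemma Ck_onN k U f : open U -> Ck_on k U f -> Ck_on k U (fun z => - f z).
Proof.
move=> oU Cf; apply: (@Ck_on_ext _ _ _ _ (fun z => -1 * f z)) => //.
  by move=> w _; rewrite mulN1r.
by apply: Ck_onM => //; exact: Ck_on_cst.
Qed.

(* The inductive step for a post-composition: the derivative of [h] at [f]
   only has to be of class C^k once [h \o f] is. *)
Lemma Ck_on_chain k U h (dh : A -> R) f : open U ->
  (forall z, U z -> is_derive (f z) (1 : R) h (dh z)) ->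
  Ck_on k.+1 U f -> Ck_on k U dh -> Ck_on k.+1 U (fun z => h (f z)).
Proof.
move=> oU Dh Cf Cdh.
apply: (@Ck_onS _ _ _ _ _ (fun z => partial_x f z * dh z)
  (fun z => partial_y f z * dh z)) => //.
- move=> z Uz; apply: (@continuous_comp _ _ _ f h); first exact: Ck_on_continuous Cf Uz.
  apply/differentiable_continuous/derivable1_diffP.
  by case: (Dh z Uz).
- by move=> z Uz; apply: is_derive_chain (Dh z Uz); case: (Ck_on_derive Cf Uz).
- by move=> z Uz; apply: is_derive_chain (Dh z Uz); case: (Ck_on_derive Cf Uz).
- by apply: Ck_onM => //; exact: Ck_on_x.
- by apply: Ck_onM => //; exact: Ck_on_y.
Qed.

Lemma Ck_on0_comp U h f : (forall z, U z -> {for f z, continuous h}) ->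
  Ck_on 0 U f -> Ck_on 0 U (fun z => h (f z)).
Proof.
move=> ch Cf; split=> // z /[1!inE] Uz.
by apply: (@continuous_comp _ _ _ f h); [exact: Ck_on_continuous Cf Uz|exact: ch].
Qed.

Lemma Ck_onV k U f : open U -> (forall z, U z -> f z != 0) -> Ck_on k U f ->
  Ck_on k U (fun z => (f z)^-1).
Proof.
move=> oU f0; elim: k f f0 => [|k IH] f f0 Cf.
  by apply: (Ck_on0_comp _ Cf) => z Uz; apply: inv_continuous; exact: f0.
have CV := IH f f0 (Ck_onW Cf).
apply: (@Ck_onS _ _ _ _ _ (fun z => - partial_x f z * ((f z)^-1 * (f z)^-1))
  (fun z => - partial_y f z * ((f z)^-1 * (f z)^-1))) => //.
- by move=> z Uz; exact: Ck_on_continuous CV Uz.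
- by move=> z Uz; apply: is_deriveV'; [exact: f0|case: (Ck_on_derive Cf Uz)].
- by move=> z Uz; apply: is_deriveV'; [exact: f0|case: (Ck_on_derive Cf Uz)].
- by apply: Ck_onM => //; [apply: Ck_onN => //; exact: Ck_on_x|exact: Ck_onM].
- by apply: Ck_onM => //; [apply: Ck_onN => //; exact: Ck_on_y|exact: Ck_onM].
Qed.

Lemma Ck_on_sqrt k U f : open U -> (forall z, U z -> 0 < f z) -> Ck_on k U f ->
  Ck_on k U (fun z => Num.sqrt (f z)).
Proof.
move=> oU f0; elim: k f f0 => [|k IH] f f0 Cf.
  by apply: (Ck_on0_comp _ Cf) => z Uz; exact: sqrt_continuous.
apply: (@Ck_on_chain _ _ _ (fun z => (2 * Num.sqrt (f z))^-1)) => //.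
  by move=> z Uz; apply: is_derive1_sqrt; exact: f0.
apply: Ck_onV => //.
  by move=> z Uz; rewrite mulf_neq0// gt_eqF// sqrtr_gt0 f0.
by apply: Ck_onM => //; [exact: Ck_on_cst|apply: IH => //; exact: Ck_onW].
Qed.

(** Both statements are proved in one induction because each function is, up to sign, the derivative
    of the other. *)
Lemma Ck_on_cos_sin k U f : open U -> Ck_on k U f ->
  Ck_on k U (fun z => cos (f z)) /\ Ck_on k U (fun z => sin (f z)).
Proof.
move=> oU; elim: k f => [|k IH] f Cf.
  by split; apply: (Ck_on0_comp _ Cf) => z Uz; [exact: continuous_cos|exact: continuous_sin].
have [Cc Cs] := IH f (Ck_onW Cf).
by split; [exact: (Ck_on_chain oU _ Cf (Ck_onN oU Cs))|exact: (Ck_on_chain oU _ Cf Cc)].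
Qed.

(** A case analysis on [k] suffices: the derivative of [atan] is rational, so it is already known to
    be as regular as [f]. *)
Lemma Ck_on_atan k U f : open U -> Ck_on k U f -> Ck_on k U (fun z => atan (f z)).
Proof.
move=> oU; case: k f => [|k] f Cf.
  by apply: (Ck_on0_comp _ Cf) => z Uz; exact: continuous_atan.
apply: (@Ck_on_chain _ _ _ (fun z => (1 + f z * f z)^-1)) => //.
apply: Ck_onV => //.
  by move=> z Uz; rewrite gt_eqF// -expr2 ltr_pwDl// sqr_ge0.
by apply: Ck_onD => //; [exact: Ck_on_cst|apply: Ck_onM => //; exact: Ck_onW].
Qed.

Lemma smoothM U f g : open U -> smooth_on U f -> smooth_on U g ->
  smooth_on U (fun z => f z * g z).
Proof. by move=> oU sf sg k; exact: Ck_onM. Qed.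
Lemma smoothN U f : open U -> smooth_on U f -> smooth_on U (fun z => - f z).
Proof. by move=> oU sf k; exact: Ck_onN. Qed.
Lemma smoothB U f g : open U -> smooth_on U f -> smooth_on U g ->
  smooth_on U (fun z => f z - g z).
Proof. by move=> oU sf sg; apply: smoothD => //; exact: smoothN. Qed.
Lemma smoothV U f : open U -> (forall z, U z -> f z != 0) -> smooth_on U f ->
  smooth_on U (fun z => (f z)^-1).
Proof. by move=> oU f0 sf k; exact: Ck_onV. Qed.
Lemma smooth_sqrt U f : open U -> (forall z, U z -> 0 < f z) -> smooth_on U f ->
  smooth_on U (fun z => Num.sqrt (f z)).
Proof. by move=> oU f0 sf k; exact: Ck_on_sqrt. Qed.
Lemma smooth_cos U f : open U -> smooth_on U f -> smooth_on U (fun z => cos (f z)).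
Proof. by move=> oU sf k; have [] := Ck_on_cos_sin oU (sf k). Qed.
Lemma smooth_sin U f : open U -> smooth_on U f -> smooth_on U (fun z => sin (f z)).
Proof. by move=> oU sf k; have [] := Ck_on_cos_sin oU (sf k). Qed.
Lemma smooth_atan U f : open U -> smooth_on U f -> smooth_on U (fun z => atan (f z)).
Proof. by move=> oU sf k; exact: Ck_on_atan. Qed.

Lemma smooth_is_diff U f z : open U -> smooth_on U f -> U z ->
  is_diff z f (lin2 (partial_x f z) (partial_y f z)).
Proof.
move=> oU sf Uz; apply: is_diff_C1.
- apply: (near_open oU Uz) => w Uw.
  by split; [case: (smooth_dx sf Uw)|case: (smooth_dy sf Uw)].
- exact: smooth_cont (smooth_x sf) Uz.
- exact: smooth_cont (smooth_y sf) Uz.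
Qed.

Lemma Ck_on_is_diff k U f z : open U -> Ck_on k.+1 U f -> U z ->
  is_diff z f (lin2 (partial_x f z) (partial_y f z)).
Proof.
move=> oU Cf Uz; apply: is_diff_C1.
- apply: (near_open oU Uz) => w Uw.
  by have [[? _] [? _]] := Ck_on_derive Cf Uw.
- exact: Ck_on_continuous (Ck_on_x Cf) Uz.
- exact: Ck_on_continuous (Ck_on_y Cf) Uz.
Qed.

(** Total differentiability of [f] enters here: the curve traced by [(S1, S2)] does not follow a
    coordinate direction. *)
Lemma is_derive_subst f (S1 S2 : A -> R) z v (a b d1 d2 : R) :
  is_diff ((S1 z, S2 z) : A) f (lin2 a b) ->
  is_derive z v S1 d1 -> is_derive z v S2 d2 ->
  is_derive z v (fun w => f (S1 w, S2 w)) (d1 * a + d2 * b).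
Proof.
move=> Df D1 D2; apply: is_derive_line0.
pose S1' s := S1 (z + s *: v); pose S2' s := S2 (z + s *: v).
have D1' : is_derive (0 : R) (1 : R) S1' d1.
  by apply: is_derive_line; rewrite scale0r addr0.
have D2' : is_derive (0 : R) (1 : R) S2' d2.
  by apply: is_derive_line; rewrite scale0r addr0.
have [/derivable1_diffP e1 v1] := D1'; have [/derivable1_diffP e2 v2] := D2'.
have dS : differentiable (fun s => (S1' s, S2' s)) (0 : R) by exact: differentiable_pair.
have Df0 : is_diff ((S1' 0, S2' 0) : A) f (lin2 a b).
  by rewrite /S1' /S2' scale0r addr0.
have dfE : 'd f ((S1' 0, S2' 0) : A) = lin2 a b :> (A -> R) by case: Df0.
have df0 : differentiable f ((S1' 0, S2' 0) : A) by case: Df0.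
have dc : differentiable (f \o (fun s => (S1' s, S2' s) : A)) (0 : R).
  exact: (@differentiable_comp _ _ _ _ (fun s => (S1' s, S2' s) : A) f).
split; first by apply/derivable1_diffP.
rewrite [LHS](deriveE _ dc).
rewrite (@diff_comp _ _ _ _ (fun s => (S1' s, S2' s) : A) f)//=.
rewrite dfE.
rewrite (@diff_pair _ _ _ _ S1' S2')//= /lin2 /=.
by rewrite -!deriveE // v1 v2.
Qed.

Lemma continuous_pairA (S1 S2 : A -> R) z : {for z, continuous S1} ->
  {for z, continuous S2} -> {for z, continuous (fun w => (S1 w, S2 w) : A)}.
Proof. by move=> c1 c2; exact: (cvg_pair c1 c2). Qed.

Lemma Ck_on_subst k U V f (S1 S2 : A -> R) : open U -> open V ->
  (forall z, U z -> V (S1 z, S2 z)) -> Ck_on k U S1 -> Ck_on k U S2 ->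
  Ck_on k V f -> Ck_on k U (fun z => f (S1 z, S2 z)).
Proof.
move=> oU oV SUV; elim: k f => [|k IH] f C1 C2 Cf.
  split=> // z /[1!inE] Uz.
  apply: (@continuous_comp _ _ _ (fun z => (S1 z, S2 z) : A) f).
    by apply: continuous_pairA; [exact: Ck_on_continuous C1 Uz|exact: Ck_on_continuous C2 Uz].
  exact: Ck_on_continuous Cf (SUV z Uz).
apply: (@Ck_onS _ _ _ _ _
  (fun z => partial_x S1 z * partial_x f (S1 z, S2 z) + partial_x S2 z * partial_y f (S1 z, S2 z))
  (fun z => partial_y S1 z * partial_x f (S1 z, S2 z) + partial_y S2 z * partial_y f (S1 z, S2 z))) => //.
- move=> z Uz; apply: (@continuous_comp _ _ _ (fun z => (S1 z, S2 z) : A) f).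
    by apply: continuous_pairA; [exact: Ck_on_continuous C1 Uz|exact: Ck_on_continuous C2 Uz].
  exact: Ck_on_continuous Cf (SUV z Uz).
- move=> z Uz; apply: is_derive_subst; first exact: Ck_on_is_diff oV Cf (SUV z Uz).
    by case: (Ck_on_derive C1 Uz).
  by case: (Ck_on_derive C2 Uz).
- move=> z Uz; apply: is_derive_subst; first exact: Ck_on_is_diff oV Cf (SUV z Uz).
    by case: (Ck_on_derive C1 Uz).
  by case: (Ck_on_derive C2 Uz).
- have Fx := IH _ (Ck_onW C1) (Ck_onW C2) (Ck_on_x Cf).
  have Fy := IH _ (Ck_onW C1) (Ck_onW C2) (Ck_on_y Cf).
  exact: Ck_onD oU (Ck_onM oU (Ck_on_x C1) Fx) (Ck_onM oU (Ck_on_x C2) Fy).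
- have Fx := IH _ (Ck_onW C1) (Ck_onW C2) (Ck_on_x Cf).
  have Fy := IH _ (Ck_onW C1) (Ck_onW C2) (Ck_on_y Cf).
  exact: Ck_onD oU (Ck_onM oU (Ck_on_y C1) Fx) (Ck_onM oU (Ck_on_y C2) Fy).
Qed.

Lemma smooth_subst U V f (S1 S2 : A -> R) : open U -> open V ->
  (forall z, U z -> V (S1 z, S2 z)) -> smooth_on U S1 -> smooth_on U S2 ->
  smooth_on V f -> smooth_on U (fun z => f (S1 z, S2 z)).
Proof. by move=> oU oV SUV s1 s2 sf k; exact: Ck_on_subst (sf k). Qed.

End RealCalculus.

(** * Equality of mixed partial derivatives *)

Section MixedPartials.
Context {R : realType}.
Local Notation A := (lorentz R).
Implicit Types (U V : set A) (f g : A -> R) (z v w : A).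

Lemma is_derive_shiftA f z v c d : is_derive (z + c) v f d ->
  is_derive z v (fun p => f (p + c)) d.
Proof.
have E : (fun k : R => k^-1 *: (((fun p => f (p + c)) \o shift z) (k *: v) - f (z + c)))
    = (fun k : R => k^-1 *: ((f \o shift (z + c)) (k *: v) - f (z + c))).
  by apply/funext => k /=; rewrite addrA.
by move=> [df dE]; split; [move: df|move: dE]; rewrite /derivable /derive E.
Qed.

(** The mean value theorem is applied to the first difference [p] in the direction [v], then to
    ['D_v f] in the direction [w]. *)
Lemma second_difference f z v w (h k : R) :
  (forall s t, 0 <= s <= 1 -> 0 <= t <= 1 ->
     derivable f (z + (t * h) *: v + (s * k) *: w) v /\
     derivable ('D_v f) (z + (t * h) *: v + (s * k) *: w) w) ->
  exists s t, [/\ 0 <= s <= 1, 0 <= t <= 1 &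
    f (z + h *: v + k *: w) - f (z + h *: v) - (f (z + k *: w) - f z) =
    h * (k * 'D_w ('D_v f) (z + (t * h) *: v + (s * k) *: w))].
Proof.
move=> H; pose p y := f (y + k *: w) - f y.
have dp t : 0 <= t <= 1 -> is_derive (z + (t * h) *: v) v p
    ('D_v f (z + (t * h) *: v + k *: w) - 'D_v f (z + (t * h) *: v)).
  move=> t01; apply: is_deriveB.
    apply: is_derive_shiftA; apply: derivableP.
    have [] := H 1 t _ t01; first by rewrite ler01 lexx.
    by rewrite mul1r.
  apply: derivableP.
  have [] := H 0 t _ t01; first by rewrite ler01 lexx.
  by rewrite mul0r scale0r addr0.
have [t t01 E] := @mvt_dir R p z v h (fun t t01 => @ex_derive _ _ _ _ _ _ _ (dp t t01)).
have [s s01 E'] := @mvt_dir R ('D_v f) (z + (t * h) *: v) w k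
  (fun s s01 => (H s t s01 t01).2).
exists s, t; split=> //.
rewrite -E' -[RHS](_ : p (z + h *: v) - p z = _) //.
rewrite E; congr (_ * _); have [_ ->] := dp t t01; by [].
Qed.

(** The second difference over a small square is symmetric in the two directions, so the mixed
    derivatives take a common value at two points near [z]. If they differed at [z], continuity
    would keep each within half of the gap of its own value, a contradiction. *)
Lemma schwarz U f z : open U -> smooth_on U f -> U z ->
  partial_x (partial_y f) z = partial_y (partial_x f) z.
Proof.
move=> oU sf Uz; apply/eqP; rewrite -subr_eq0; apply/negPn/negP => n0.
set a := partial_x (partial_y f) z in n0 *; set b := partial_y (partial_x f) z in n0 *.
have e0 : 0 < `|a - b| / 2 by rewrite divr_gt0// normr_gt0.
have cxy := smooth_cont (smooth_x (smooth_y sf)) Uz.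
have cyx := smooth_cont (smooth_y (smooth_x sf)) Uz.
have [r0 r0P H0] := open_box oU Uz.
have [r1 r1P H1] := (nbhs_box _ _).1 (((cvgrPdist_lt _ _).1 cxy) _ e0).
have [r2 r2P H2] := (nbhs_box _ _).1 (((cvgrPdist_lt _ _).1 cyx) _ e0).
pose r := Num.min r0 (Num.min r1 r2) / 2.
have rP : 0 < r by rewrite divr_gt0// !lt_min r0P r1P.
have rlt : r < Num.min r0 (Num.min r1 r2).
  by rewrite ltr_pdivrMr// ltr_pMr ?ltr1n// !lt_min r0P r1P.
move: (rlt); rewrite !lt_min => /and3P[rr0 rr1 rr2].
have tb (t b' : R) : 0 <= t <= 1 -> r < b' -> `|t * r| < b'.
  move=> /andP[t0 t1]; apply: le_lt_trans; rewrite normrM !ger0_norm ?(ltW rP)//.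
  by rewrite ler_piMl// ltW.
have inb (s t b' : R) : 0 <= s <= 1 -> 0 <= t <= 1 -> r < b' ->
    box z b' (z + (t * r) *: (1 : A) + (s * r) *: lsigma).
  move=> s01 t01 rb; rewrite lorentz_line1 lorentz_lines; split => /=.
    by rewrite addrAC subrr add0r tb.
  by rewrite addrAC subrr add0r tb.
have inb' (s t b' : R) : 0 <= s <= 1 -> 0 <= t <= 1 -> r < b' ->
    box z b' (z + (t * r) *: lsigma + (s * r) *: (1 : A)).
  by move=> s01 t01 rb; rewrite addrAC; exact: inb.
have UH w : box z r0 w -> U w by case; exact: H0.
have [s [t [s01 t01 E1]]] : exists s t, [/\ 0 <= s <= 1, 0 <= t <= 1 &
    f (z + r *: (1 : A) + r *: lsigma) - f (z + r *: (1 : A)) - (f (z + r *: lsigma) - f z) =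
    r * (r * 'D_lsigma ('D_(1 : A) f) (z + (t * r) *: (1 : A) + (s * r) *: lsigma))].
  apply: second_difference => s t s01 t01; have Up := UH _ (inb s t _ s01 t01 rr0).
  by split; [case: (smooth_dx sf Up)|case: (smooth_dy (smooth_x sf) Up)].
have [s' [t' [s01' t01' E2]]] : exists s t, [/\ 0 <= s <= 1, 0 <= t <= 1 &
    f (z + r *: lsigma + r *: (1 : A)) - f (z + r *: lsigma) - (f (z + r *: (1 : A)) - f z) =
    r * (r * 'D_(1 : A) ('D_lsigma f) (z + (t * r) *: lsigma + (s * r) *: (1 : A)))].
  apply: second_difference => s' t' s01' t01'; have Up := UH _ (inb' s' t' _ s01' t01' rr0).
  by split; [case: (smooth_dy sf Up)|case: (smooth_dx (smooth_y sf) Up)].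
have {E1 E2} E : 'D_lsigma ('D_(1 : A) f) (z + (t * r) *: (1 : A) + (s * r) *: lsigma) =
    'D_(1 : A) ('D_lsigma f) (z + (t' * r) *: lsigma + (s' * r) *: (1 : A)).
  have rn : r != 0 by rewrite gt_eqF.
  apply: (mulfI rn); apply: (mulfI rn).
  apply: (eq_trans (esym E1)); apply: eq_trans E2.
  rewrite [z + r *: lsigma + r *: (1 : A)]addrAC; ring.
have : `|a - partial_x (partial_y f) (z + (t' * r) *: lsigma + (s' * r) *: (1 : A))|
    < `|a - b| / 2 by apply: H1; exact: inb'.
have : `|b - partial_y (partial_x f) (z + (t * r) *: (1 : A) + (s * r) *: lsigma)|
    < `|a - b| / 2 by apply: H2; exact: inb.
rewrite /partial_x /partial_y E => Hb Ha.
have := ltrD Ha Hb; rewrite -splitr => /(le_lt_trans (ler_normB _ _)).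
by rewrite opprB addrA subrK ltxx.
Qed.

End MixedPartials.

Section Slopes.
Context {R : realType}.
Local Notation A := (lorentz R).
Implicit Types (U V : set A) (f g : A -> R) (z v w : A).

(* Both slopes are values of the partial derivatives at intermediate points. *)
Lemma slopes (z0 : A) (r : R) f z : smooth_on (box z0 r) f -> box z0 r z ->
  exists p q : A -> A, forall w, box z0 r w ->
    [/\ box z0 r (p w), box z0 r (q w), `|p w - z| <= `|w - z|,
      `|q w - z| <= `|w - z| &
      f w - f z = (w.1 - z.1) * partial_x f (p w) + (w.2 - z.2) * partial_y f (q w)].
Proof.
move=> sf Bz.
suff H w : exists pq : A * A, box z0 r w ->
    [/\ box z0 r pq.1, box z0 r pq.2, `|pq.1 - z| <= `|w - z|,
      `|pq.2 - z| <= `|w - z| &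
      f w - f z = (w.1 - z.1) * partial_x f pq.1 + (w.2 - z.2) * partial_y f pq.2].
  have /choice[pq pqP] := H.
  by exists (fun w => (pq w).1), (fun w => (pq w).2).
have [[w1 w2]|nb] := pselect (box z0 r w); last by exists (z, z).
have [z1 z2] := Bz.
have conv (t a b c : R) : 0 <= t <= 1 -> `|a - c| < r -> `|b - c| < r ->
    `|a + t * (b - a) - c| < r.
  move=> /andP[t0 t1] ac bc.
  have -> : a + t * (b - a) - c = (1 - t) * (a - c) + t * (b - c) by ring.
  have r0 : 0 < r by apply: le_lt_trans ac.
  apply: le_lt_trans (ler_normD _ _) _; rewrite !normrM.
  rewrite (ger0_norm t0) (@ger0_norm _ (1 - t)) ?subr_ge0//.
  have [->|tn0] := eqVneq t 0; first by rewrite subr0 mul1r mul0r addr0.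
  have tp : 0 < t by rewrite lt_neqAle eq_sym tn0.
  have -> : r = (1 - t) * r + t * r by ring.
  apply: ler_ltD; first by rewrite ler_wpM2l ?subr_ge0// ltW.
  by rewrite ltr_pM2l.
have b1 t : 0 <= t <= 1 -> box z0 r (z + (t * (w.1 - z.1)) *: (1 : A)).
  by move=> t01; rewrite lorentz_line1; split => //=; exact: conv.
have b2 t : 0 <= t <= 1 -> box z0 r (z + (w.1 - z.1) *: (1 : A) + (t * (w.2 - z.2)) *: lsigma).
  move=> t01; rewrite lorentz_line1 lorentz_lines; split => /=.
    by have -> : z.1 + (w.1 - z.1) - z0.1 = w.1 - z0.1 by ring.
  exact: conv.
have [t t01 E1] : exists2 t, 0 <= t <= 1 &
    f (z + (w.1 - z.1) *: (1 : A)) - f z = (w.1 - z.1) * 'D_(1 : A) f (z + (t * (w.1 - z.1)) *: (1 : A)).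
  apply: (@mvt_dir _ f z (1 : A) (w.1 - z.1)) => t t01.
  by case: (smooth_dx sf (b1 t t01)).
have [s s01 E2] : exists2 s, 0 <= s <= 1 &
    f (z + (w.1 - z.1) *: (1 : A) + (w.2 - z.2) *: lsigma) - f (z + (w.1 - z.1) *: (1 : A))
    = (w.2 - z.2) * 'D_lsigma f (z + (w.1 - z.1) *: (1 : A) + (s * (w.2 - z.2)) *: lsigma).
  apply: (@mvt_dir _ f (z + (w.1 - z.1) *: (1 : A)) lsigma (w.2 - z.2)) => s s01.
  by case: (smooth_dy sf (b2 s s01)).
exists (z + (t * (w.1 - z.1)) *: (1 : A),
        z + (w.1 - z.1) *: (1 : A) + (s * (w.2 - z.2)) *: lsigma) => _ /=.
have tn (t' x : R) : 0 <= t' <= 1 -> `|t' * x| <= `|x|.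
  by move=> /andP[t0 t1]; rewrite normrM ger0_norm// ler_piMl.
split; [exact: b1|exact: b2| | |].
- rewrite lorentz_line1 lorentz_normE /= ge_max; apply/andP; split.
    by rewrite addrAC subrr add0r le_max tn.
  by rewrite subrr normr0.
- rewrite lorentz_line1 lorentz_lines lorentz_normE /= ge_max; apply/andP; split.
    by rewrite addrAC subrr add0r le_max lexx.
  by rewrite addrAC subrr add0r le_max tn ?orbT.
- rewrite -E1 -E2.
  have -> : z + (w.1 - z.1) *: (1 : A) + (w.2 - z.2) *: lsigma = w.
    rewrite lorentz_line1 lorentz_lines /= [RHS]surjective_pairing.
    by congr (_, _); ring.
  ring.
Qed.

End Slopes.

(** * Local primitives and the inverse function theorem *)

Section Poincare.
Context {R : realType}.
Local Notation A := (lorentz R).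
Local Notation mu := (@lebesgue_measure R).
Implicit Types (U V : set A) (f g : A -> R) (z v w : A).

Lemma is_derive_x_1D f (x y d : R) :
  is_derive x (1 : R) (fun s => f (s, y)) d <-> is_derive ((x, y) : A) (1 : A) f d.
Proof.
have E : (fun k : R => k^-1 *: (((fun s => f (s, y)) \o shift x) (k *: (1 : R)) - f (x, y)))
  = (fun k : R => k^-1 *: ((f \o shift ((x, y) : A)) (k *: (1 : A)) - f (x, y))).
  apply/funext => k; congr (_ *: (_ - _)).
  by rewrite /= [k *: (1 : A) + _]addrC lorentz_line1 /= [k *: 1]mulr1 addrC.
by split=> -[df dE]; split; [move: df|move: dE|move: df|move: dE];
  rewrite /derivable /derive E.
Qed.

Lemma is_derive_y_1D f (x y d : R) :
  is_derive y (1 : R) (fun s => f (x, s)) d <-> is_derive ((x, y) : A) (lsigma : A) f d.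
Proof.
have E : (fun k : R => k^-1 *: (((fun s => f (x, s)) \o shift y) (k *: (1 : R)) - f (x, y)))
  = (fun k : R => k^-1 *: ((f \o shift ((x, y) : A)) (k *: (lsigma : A)) - f (x, y))).
  apply/funext => k; congr (_ *: (_ - _)).
  by rewrite /= [k *: lsigma + _]addrC lorentz_lines /= [k *: 1]mulr1 addrC.
by split=> -[df dE]; split; [move: df|move: dE|move: df|move: dE];
  rewrite /derivable /derive E.
Qed.

Lemma slice_x_cont f (x y : R) : {for ((x, y) : A), continuous f} ->
  {for x, continuous (fun s => f (s, y))}.
Proof.
move=> cf; apply: (@continuous_comp _ _ _ (fun s : R => (s, y) : A) f) => //.
exact: (cvg_pair cvg_id (cvg_cst y)).
Qed.

Lemma slice_y_cont f (x y : R) : {for ((x, y) : A), continuous f} ->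
  {for y, continuous (fun s => f (x, s))}.
Proof.
move=> cf; apply: (@continuous_comp _ _ _ (fun s : R => (x, s) : A) f) => //.
exact: (cvg_pair (cvg_cst x) cvg_id).
Qed.

Lemma continuous_seg_integrable (h : R -> R) (a b : R) :
  (forall x, a <= x <= b -> {for x, continuous h}) ->
  mu.-integrable `[a, b] (EFin \o h).
Proof.
move=> ch; apply: continuous_compact_integrable; first exact: segment_compact.
by apply: continuous_in_subspaceT => x /[1!inE] /=; rewrite in_itv /=; exact: ch.
Qed.

Lemma is_derive_integral (h : R -> R) (a b x : R) : a < x < b ->
  (forall y, a <= y <= b -> {for y, continuous h}) ->
  is_derive x (1 : R) (fun x => \int[mu]_(t in `[a, x]) h t) (h x).
Proof.
move=> /andP[ax xb] ch.
have [d1 d2] := @continuous_FTC1_closed R h a x b xb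
  (continuous_seg_integrable ch) ax (ch x ltac:(by rewrite !ltW)).
by split; [exact: d1|rewrite -derive1E].
Qed.

Lemma FTC2_continuous (h k : R -> R) (a b : R) : a < b ->
  (forall x, a <= x <= b -> is_derive x (1 : R) k (h x)) ->
  (forall x, a <= x <= b -> {for x, continuous h}) ->
  \int[mu]_(t in `[a, b]) h t = k b - k a.
Proof.
move=> ab dk ch; rewrite /Rintegral (@continuous_FTC2 R h k)//=.
- apply: continuous_in_subspaceT => x /[1!inE] /=; rewrite in_itv /=; exact: ch.
- have ck x : a <= x <= b -> {for x, continuous k}.
    by move=> /dk[dx _]; apply/differentiable_continuous/derivable1_diffP.
  split.
  + by move=> x; rewrite in_itv /= => /andP[/ltW ax /ltW xb];
      have [] := dk x ltac:(by rewrite ax xb).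
  + by apply: cvg_at_right_filter; apply: ck; rewrite lexx ltW.
  + by apply: cvg_at_left_filter; apply: ck; rewrite lexx ltW.
- by move=> x; rewrite in_itv /= derive1E => /andP[/ltW ax /ltW xb];
    have [] := dk x ltac:(by rewrite ax xb).
Qed.

Lemma is_derive_under_integral (q : A -> R) (a b c d x : R) : a < x < b -> c <= d ->
  (forall s t, a <= s <= b -> c <= t <= d ->
     [/\ {for ((s, t) : A), continuous q}, derivable q ((s, t) : A) (1 : A) &
         {for ((s, t) : A), continuous (partial_x q)}]) ->
  is_derive x (1 : R) (fun s => \int[mu]_(t in `[c, d]) q (s, t))
    (\int[mu]_(t in `[c, d]) partial_x q (x, t)).
Proof.
move=> /andP[ax xb] cd H.
(* A constant serves as dominating function, by compactness of the rectangle. [compact_bounded]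
   bounds only by numbers strictly above its witness, whence the [M + 1] below. *)
have [M HM] : exists M, forall s t, a <= s <= b -> c <= t <= d ->
    `|partial_x q (s, t)| <= M.
  pose K := `[a, b]%classic `*` `[c, d]%classic : set (R * R).
  have cK : compact K by apply: compact_setX; exact: segment_compact.
  have : compact ((partial_x q : R * R -> R) @` K).
    apply: continuous_compact => //; apply: continuous_in_subspaceT => -[s t].
    by rewrite inE /K /= !in_itv /= => -[s1 t1]; have [] := H s t s1 t1.
  move=> /compact_bounded[M [_ HM]]; exists (M + 1) => s t s1 t1.
  by apply: (HM (M + 1) _); [rewrite ltrDl|exists (s, t) => //; rewrite /K /= !in_itv].
have D1 s t : a < s < b -> c <= t <= d ->
    is_derive s (1 : R) (fun s => q (s, t)) (partial_x q (s, t)).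
  move=> /andP[/ltW s1 /ltW s2] t1; apply/is_derive_x_1D; apply: derivableP.
  by have [] := H s t ltac:(by rewrite s1 s2) t1.
have p1E s t : a < s < b -> c <= t <= d ->
    partial1of2 (fun s t => q (s, t)) s t = partial_x q (s, t).
  by move=> s1 t1; rewrite partial1of2E; have [] := D1 s t s1 t1.
have HH := @cvg_differentiation_under_integral R _ _ mu (fun s t => q (s, t)) `[c, d]
  (measurable_itv _) x a b ltac:(by rewrite /= in_itv /= ax xb) _ _ (fun=> M) _ _ _.
have {}HH : (fun h : R => h^-1 *: (\int[mu]_(t in `[c, d]) q (h + x, t) -
     \int[mu]_(t in `[c, d]) q (x, t))) @ 0^' -->
    \int[mu]_(t in `[c, d]) partial_x q (x, t).
  rewrite (_ : \int[mu]_(t in `[c, d]) partial_x q (x, t) =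
    \int[mu]_(t in `[c, d]) partial1of2 (fun s t => q (s, t)) x t); last first.
    apply: eq_Rintegral => t; rewrite inE /= in_itv /= => t1.
    by rewrite p1E// ax xb.
  apply: HH.
  - move=> s /=; rewrite in_itv /= => /andP[/ltW s1 /ltW s2].
    apply: continuous_seg_integrable => t t1; apply: slice_y_cont.
    by have [] := H s t ltac:(by rewrite s1 s2) t1.
  - move=> s t /=; rewrite !in_itv /= => s1 t1.
    by have [] := D1 s t s1 t1.
  - move=> t; apply: le_trans (HM x c _ _); rewrite ?normr_ge0 ?lexx ?cd//.
    by rewrite !ltW.
  - apply: continuous_seg_integrable => t t1; exact: cst_continuous.
  - move=> s t /=; rewrite !in_itv /= => s1 t1; rewrite p1E//.
    by apply: HM => //; case/andP: s1 => /ltW -> /ltW ->.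
have E : (fun h : R => h^-1 *: (((fun s => \int[mu]_(t in `[c, d]) q (s, t)) \o shift x)
     (h *: (1 : R)) - \int[mu]_(t in `[c, d]) q (x, t))) =
   (fun h : R => h^-1 *: (\int[mu]_(t in `[c, d]) q (h + x, t) -
     \int[mu]_(t in `[c, d]) q (x, t))).
  by apply/funext => h /=; rewrite [h *: 1]mulr1.
split; first by rewrite /derivable E; apply/cvg_ex; eexists; exact: HH.
by rewrite /derive E; exact: cvg_lim HH.
Qed.

(** The primitive integrates [P] along the bottom edge of a rectangle and then [Q] vertically. The
    derivative along [y] is immediate; along [x], differentiation under the integral replaces [Q] by
    [partial_x Q = partial_y P], which integrates back to the missing part of [P]. *)
Lemma poincare (z0 : A) (r : R) (P Q : A -> R) : 0 < r ->
  smooth_on (box z0 r) P -> smooth_on (box z0 r) Q ->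
  (forall z, box z0 r z -> partial_y P z = partial_x Q z) ->
  exists f, forall z, box z0 (r / 2) z ->
    is_derive z (1 : A) f (P z) /\ is_derive z (lsigma : A) f (Q z).
Proof.
move=> r0 sP sQ PQ.
(* Any factor strictly between [1 / 2] and [1] would do: the rectangle must contain the half box in
   its interior and stay inside the box where [P] and [Q] are smooth. *)
pose a := z0.1 - 3 / 4 * r; pose b := z0.1 + 3 / 4 * r.
pose c := z0.2 - 3 / 4 * r; pose d := z0.2 + 3 / 4 * r.
have inB s t : a <= s <= b -> c <= t <= d -> box z0 r (s, t).
  rewrite /a /b /c /d => /andP[a1 a2] /andP[b1 b2]; split; rewrite /= ltr_norml;
  apply/andP; split; lra.
pose f1 x := \int[mu]_(s in `[a, x]) P (s, c).
pose f2 z := \int[mu]_(t in `[c, z.2]) Q (z.1, t).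
exists (fun z : A => f1 z.1 + f2 z) => -[x y] [] /=.
rewrite !ltr_norml => /andP[x1 x2] /andP[y1 y2].
have axb : a < x < b by rewrite /a /b; apply/andP; split; lra.
have cyd : c < y < d by rewrite /c /d; apply/andP; split; lra.
have cd : c <= d by rewrite /c /d; lra.
have cc : c <= c <= d by rewrite lexx cd.
have lab s : a < s < b -> a <= s <= b by move=> /andP[/ltW-> /ltW->].
split; last first.
  rewrite -[Q _]add0r; apply: is_deriveD'.
    by apply/is_derive_y_1D => /=; exact: is_derive_cst.
  apply/is_derive_y_1D; rewrite /f2 /=; apply: (is_derive_integral cyd) => t t1.
  by apply: slice_y_cont; apply: smooth_cont sQ _; apply: inB => //; exact: lab.
have -> : P (x, y) = P (x, c) + (P (x, y) - P (x, c)) by rewrite addrC subrK.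
apply: is_deriveD'.
  apply/is_derive_x_1D; rewrite /f1 /=; apply: (is_derive_integral axb) => s s1.
  by apply: slice_x_cont; apply: smooth_cont sP _; exact: inB.
have cy : c < y by case/andP: cyd.
have yd t : c <= t <= y -> c <= t <= d.
  by move=> /andP[-> /le_trans]; apply; case/andP: cyd => _ /ltW.
apply/is_derive_x_1D; rewrite /f2 /=.
have F : \int[mu]_(t in `[c, y]) partial_y P (x, t) = P (x, y) - P (x, c).
  apply: (@FTC2_continuous (fun t => partial_y P (x, t)) (fun t => P (x, t))) => //.
  - move=> t t1; apply/is_derive_y_1D; apply: smooth_dy sP _.
    by apply: inB; [exact: lab|exact: yd].
  - move=> t t1; apply: slice_y_cont; apply: smooth_cont (smooth_y sP) _.
    by apply: inB; [exact: lab|exact: yd].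
rewrite -F.
have -> : \int[mu]_(t in `[c, y]) partial_y P (x, t) =
    \int[mu]_(t in `[c, y]) partial_x Q (x, t).
  apply: eq_Rintegral => t; rewrite inE /= in_itv /= => t1.
  by rewrite PQ//; apply: inB; [exact: lab|exact: yd].
apply: is_derive_under_integral axb (ltW cy) _ => s t s1 /yd t1.
have B := inB s t s1 t1; split.
- exact: smooth_cont sQ B.
- by case: (smooth_dx sQ B).
- exact: smooth_cont (smooth_x sQ) B.
Qed.

(** Continuity of [f] itself has to come first, since [Ck_on] asks for it at every level; it follows
    from differentiability, the partial derivatives [P] and [Q] being continuous. *)
Lemma smooth_primitive U f (P Q : A -> R) : open U -> smooth_on U P -> smooth_on U Q ->
  (forall z, U z -> is_derive z (1 : A) f (P z) /\ is_derive z (lsigma : A) f (Q z)) ->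
  smooth_on U f.
Proof.
move=> oU sP sQ H.
have cf z : U z -> {for z, continuous f}.
  move=> Uz; apply: differentiable_continuous.
  have D : is_diff z f (lin2 (partial_x f z) (partial_y f z)).
    apply: is_diff_C1.
    - by apply: (near_open oU Uz) => w /H[[? _] [? _]].
    - apply: (continuous_ext oU Uz _ (smooth_cont sP Uz)) => w Uw.
      by have [[_ <-] _] := H w Uw.
    - apply: (continuous_ext oU Uz _ (smooth_cont sQ Uz)) => w Uw.
      by have [_ [_ <-]] := H w Uw.
  by case: D.
case=> [|k]; first by split=> // z /[1!inE] /cf.
by apply: (@Ck_onS _ _ _ _ _ P Q) => // z /H[].
Qed.

End Poincare.

(** * Inverse function theorem *)

Section Contractions.
Context {R : realType}.
Local Notation A := (lorentz R).
Implicit Types (U V : set A) (f g : A -> R) (z v w : A).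

(** Differentiability through a slope function. It suits inverse functions, where the slope is an
    explicit quotient of partial derivatives at intermediate points. *)
Lemma caratheodory f (G : R -> R) z v (d : R) :
  (\forall h \near (0 : R)^', f (z + h *: v) - f z = h * G h) ->
  G h @[h --> 0^'] --> d -> is_derive z v f d.
Proof.
move=> H cG.
have E : \forall h \near (0 : R)^', h^-1 *: ((f \o shift z) (h *: v) - f z) = G h.
  near=> h; rewrite /= [h *: v + z]addrC (near H h)// [_ *: _]mulKf //.
  by near: h; exact: nbhs_dnbhs_neq.
have cv : h^-1 *: ((f \o shift z) (h *: v) - f z) @[h --> 0^'] --> d.
  by apply: cvg_trans cG; apply: near_eq_cvg; near do apply/esym.
split; first by apply/cvg_ex; exists d.
exact: cvg_lim cv.
Unshelve. all: by end_near. Qed.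

Lemma continuous_near_box f z (e : R) : {for z, continuous f} -> 0 < e ->
  exists2 r : R, 0 < r & forall w, box z r w -> `|f w - f z| < e.
Proof.
move=> cf e0; have [r r0 H] := (nbhs_box _ _).1 (((cvgrPdist_lt _ _).1 cf) _ e0).
by exists r => // w /H; rewrite distrC.
Qed.

Lemma box_min z (r1 r2 : R) w : box z (Num.min r1 r2) w -> box z r1 w /\ box z r2 w.
Proof. by case; rewrite !lt_min => /andP[a1 a2] /andP[b1 b2]. Qed.

Lemma box_mono z (r1 r2 : R) : r1 <= r2 -> box z r1 `<=` box z r2.
Proof. by move=> r12 w [a b]; split; exact: lt_le_trans r12. Qed.

(** If the gradient of [f] at [z0] is that of a coordinate, selected by the boolean [i], then [f]
    minus this coordinate is Lipschitz with constant [1 / 2] near [z0]: each of the two partial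
    derivatives contributes [1 / 4]. *)
Lemma near_identity U z0 f (i : bool) : open U -> U z0 -> smooth_on U f ->
  partial_x f z0 = (~~ i)%:R -> partial_y f z0 = i%:R ->
  exists2 r : R, 0 < r & forall z w, box z0 r z -> box z0 r w ->
   `|(if i then z.2 - w.2 else z.1 - w.1) - (f z - f w)| <= `|z - w| / 2.
Proof.
move=> oU Uz0 sf fx fy.
have q0 : 0 < 1 / 4 :> R by rewrite divr_gt0.
have [r0 r0P H0] := open_box oU Uz0.
have [r1 r1P H1] := continuous_near_box (smooth_cont (smooth_x sf) Uz0) q0.
have [r2 r2P H2] := continuous_near_box (smooth_cont (smooth_y sf) Uz0) q0.
exists (Num.min r0 (Num.min r1 r2)); first by rewrite !lt_min r0P r1P.
set r := Num.min _ _ => z w Bz Bw.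
have sf' : smooth_on (box z0 r) f.
  by apply: smooth_subset sf => u /box_min[[? ?] _]; exact: H0.
have [p [q H]] := slopes sf' Bw.
have [Bp Bq _ _ ->] := H z Bz.
have := H1 _ (box_min (box_min Bp).2).1; have := H2 _ (box_min (box_min Bq).2).2.
rewrite fx fy; set X := partial_x f _; set Y := partial_y f _ => HY HX.
have [n1 n2] : `|z.1 - w.1| <= `|z - w| /\ `|z.2 - w.2| <= `|z - w|.
  by rewrite lorentz_normE !le_max !lexx orbT.
have -> : (if i then z.2 - w.2 else z.1 - w.1) -
  ((z.1 - w.1) * X + (z.2 - w.2) * Y) =
  - ((z.1 - w.1) * (X - (~~ i)%:R) + (z.2 - w.2) * (Y - i%:R)).
  by case: i {fx fy HX HY} => /=; ring.
rewrite normrN; apply: le_trans (ler_normD _ _) _; rewrite !normrM.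
have -> : `|z - w| / 2 = `|z - w| * (1 / 4) + `|z - w| * (1 / 4) by field.
by apply: lerD; apply: ler_pM => //; exact: ltW.
Qed.

Lemma compact_closed_box z (r : R) :
  compact [set w : A | `|w.1 - z.1| <= r /\ `|w.2 - z.2| <= r].
Proof.
rewrite (_ : [set w : A | _] =
  `[z.1 - r, z.1 + r]%classic `*` `[z.2 - r, z.2 + r]%classic).
  by apply: compact_setX; exact: segment_compact.
by apply/seteqP; split=> -[a b]; rewrite /= !in_itv /= !ler_distl => -[].
Qed.

(* The displacement of a contraction attains its minimum on the compact box,
   and a nonzero minimum would decrease after one more step. *)
Lemma contraction_solve (Phi : A -> A) z0 (r : R) : 0 < r ->
  (forall z, box z0 r z -> {for z, continuous Phi}) ->
  (forall z w, box z0 r z -> box z0 r w ->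
     `|(z - w) - (Phi z - Phi w)| <= `|z - w| / 2) ->
  forall y, `|y - Phi z0| <= r / 4 ->
  exists2 z, box z0 r z & Phi z = y.
Proof.
move=> r0 cP ctr y yr.
pose K := [set w : A | `|w.1 - z0.1| <= r / 2 /\ `|w.2 - z0.2| <= r / 2].
have KB : K `<=` box z0 r by move=> w [a b]; split; lra.
have KE w : K w <-> `|w - z0| <= r / 2.
  by rewrite lorentz_normE ge_max; split=> [[-> ->]|/andP[]].
have cK : compact K by exact: compact_closed_box.
have Kz0 : K z0 by rewrite KE subrr normr0; lra.
have ch : {within K, continuous (fun z => `|y - Phi z|)}.
  apply: continuous_in_subspaceT => z /[1!inE] /KB Bz.
  apply: (@continuous_comp _ _ _ (fun z => y - Phi z) (fun z : A => `|z|)).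
    by apply: continuousB; [exact: cst_continuous|exact: cP].
  exact: norm_continuous.
have K0 : K !=set0 by exists z0.
have [zm /[1!inE] Kzm minz] := @compact_EVT_min _ _ _ _ K0 cK ch.
exists zm; first exact: KB.
(* One step of the map [w |-> y + w - Phi w], whose fixed points are the solutions. It stays in [K]
   because [r / 4] from the distance of [y] and [r / 4] from the contraction add up to [r / 2]. *)
pose z' := y + zm - Phi zm.
have Kz' : K z'.
  rewrite KE /z' (_ : y + zm - Phi zm - z0 =
    (y - Phi z0) + ((zm - z0) - (Phi zm - Phi z0))); last first.
    ring.
  apply: le_trans (ler_normD _ _) _.
  have := ctr zm z0 (KB _ Kzm) (box_center z0 r0); move/KE: Kzm => Kzm; lra.
have h1 : `|y - Phi z'| <= `|y - Phi zm| / 2.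
  have -> : y - Phi z' = (z' - zm) - (Phi z' - Phi zm).
    by rewrite /z'; ring.
  have -> : `|y - Phi zm| = `|z' - zm| by congr `| _ |; rewrite /z'; ring.
  by apply: ctr; exact: KB.
have h2 := minz z' ltac:(by rewrite inE).
have : `|y - Phi zm| <= 0 by lra.
by rewrite normr_le0 subr_eq0 => /eqP.
Qed.

End Contractions.

Section InverseFunction.
Context {R : realType}.
Local Notation A := (lorentz R).
Implicit Types (U V : set A) (f g : A -> R) (z v w : A).

Lemma is_derive_lincomb f g z v (k l df dg : R) : is_derive z v f df ->
  is_derive z v g dg -> is_derive z v (fun w => k * f w + l * g w) (k * df + l * dg).
Proof.
by move=> Df Dg; exact: (is_deriveD' (is_deriveZ k Df) (is_deriveZ l Dg)).
Qed.

Lemma smooth_lincomb U f g (k l : R) : open U -> smooth_on U f -> smooth_on U g ->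
  smooth_on U (fun z => k * f z + l * g z).
Proof.
by move=> oU sf sg; apply: smoothD => //; apply: smoothM => //; exact: smooth_cst.
Qed.

Definition jac2 (T1 T2 : A -> R) z : R :=
  partial_x T1 z * partial_y T2 z - partial_y T1 z * partial_x T2 z.

Lemma smooth_jac2 U (T1 T2 : A -> R) : open U -> smooth_on U T1 -> smooth_on U T2 ->
  smooth_on U (jac2 T1 T2).
Proof.
move=> oU s1 s2.
exact: (smoothB oU (smoothM oU (smooth_x s1) (smooth_y s2))
  (smoothM oU (smooth_y s1) (smooth_x s2))).
Qed.

Lemma cvg_lipschitz0 (u : R -> A) z (K : R) :
  (\forall h \near (0 : R)^', `|u h - z| <= K * `|h|) -> u h @[h --> 0^'] --> z.
Proof.
move=> H; apply/cvgrPdist_lt => e e0.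
near=> h; rewrite distrC.
(* [K] has no prescribed sign, hence a positive majorant to divide by. *)
have K1 : 0 < `|K| + 1 by rewrite ltr_wpDl.
have : `|h| < e / (`|K| + 1).
  near: h; apply: dnbhs0_lt; exact: divr_gt0.
rewrite ltr_pdivlMr// => /(le_lt_trans _); apply.
apply: le_trans (near H h _) _ => //.
by rewrite mulrC ler_wpM2l// (le_trans (ler_norm _))// lerDl.
Unshelve. all: by end_near. Qed.

Lemma near_line V y v : open V -> V y -> \forall h \near (0 : R)^', V (y + h *: v).
Proof.
move=> oV Vy.
have c : (fun h : R => y + h *: v) @ (0 : R) --> y.
  rewrite -[X in _ --> X]addr0 -[X in y + X](scale0r v).
  by apply: cvgD; [exact: cvg_cst|apply: cvgZr_tmp; exact: cvg_id].
by apply: cvg_within; apply: c; exact: open_nbhs_nbhs.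
Qed.

Section LocalInverse.
Variables (z0 y0 : A) (r s K : R) (T1 T2 S1 S2 : A -> R).
Hypotheses (r0 : 0 < r) (s0 : 0 < s).
Let V := box y0 s.
Hypotheses (sT1 : smooth_on (box z0 r) T1) (sT2 : smooth_on (box z0 r) T2).
Hypothesis J0 : forall z, box z0 r z -> jac2 T1 T2 z != 0.
Hypothesis SB : forall y, V y -> box z0 r (S1 y, S2 y).
Hypothesis TS1 : forall y, V y -> T1 (S1 y, S2 y) = y.1.
Hypothesis TS2 : forall y, V y -> T2 (S1 y, S2 y) = y.2.
Hypothesis LS : forall y y', V y -> V y' ->
  `|((S1 y', S2 y') : A) - (S1 y, S2 y)| <= K * `|y' - y|.

Let oV : open V. Proof. exact: open_boxE. Qed.
Let oB : open (box z0 r). Proof. exact: open_boxE. Qed.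

(** The slopes of [T1] and [T2] between the two preimages form a linear system for the increments of
    [S1] and [S2]. Its determinant [D h] tends to the Jacobian, so Cramer's rule gives slopes for
    [S1] and [S2] that converge. *)
Lemma local_inverse_derive y v : V y ->
  is_derive y v S1 ((v.1 * partial_y T2 (S1 y, S2 y) - v.2 * partial_y T1 (S1 y, S2 y))
     / jac2 T1 T2 (S1 y, S2 y)) /\
  is_derive y v S2 ((v.2 * partial_x T1 (S1 y, S2 y) - v.1 * partial_x T2 (S1 y, S2 y))
     / jac2 T1 T2 (S1 y, S2 y)).
Proof.
move=> Vy; set z : A := (S1 y, S2 y); have Bz : box z0 r z := SB Vy.
have [p1 [q1 H1]] := slopes sT1 Bz.
have [p2 [q2 H2]] := slopes sT2 Bz.
pose w h : A := (S1 (y + h *: v), S2 (y + h *: v)).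
have nV : \forall h \near (0 : R)^', V (y + h *: v) by exact: near_line.
(* The intermediate points are no farther from [z] than [w h], which is within a multiple of [h] of
   [z] by the Lipschitz bound [LS]; hence they converge to [z]. *)
have lip (u : A -> A) : (forall w', box z0 r w' -> `|u w' - z| <= `|w' - z|) ->
    u (w h) @[h --> (0 : R)^'] --> z.
  move=> Hu; apply: (@cvg_lipschitz0 _ _ (K * `|v|)); near=> h.
  have Vh : V (y + h *: v) by near: h.
  apply: le_trans (Hu _ (SB Vh)) _; apply: le_trans (LS Vy Vh) _.
  by rewrite addrAC subrr add0r normrZ -mulrA [`|v| * _]mulrC.
pose P1 h := partial_x T1 (p1 (w h)); pose Q1 h := partial_y T1 (q1 (w h)).
pose P2 h := partial_x T2 (p2 (w h)); pose Q2 h := partial_y T2 (q2 (w h)).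
have cP1 : P1 h @[h --> (0 : R)^'] --> partial_x T1 z.
  apply: (@cvg_comp _ _ _ (fun h => p1 (w h)) (partial_x T1)).
    by apply: lip => w' /H1[].
  exact: (smooth_cont (smooth_x sT1) Bz).
have cQ1 : Q1 h @[h --> (0 : R)^'] --> partial_y T1 z.
  apply: (@cvg_comp _ _ _ (fun h => q1 (w h)) (partial_y T1)).
    by apply: lip => w' /H1[].
  exact: (smooth_cont (smooth_y sT1) Bz).
have cP2 : P2 h @[h --> (0 : R)^'] --> partial_x T2 z.
  apply: (@cvg_comp _ _ _ (fun h => p2 (w h)) (partial_x T2)).
    by apply: lip => w' /H2[].
  exact: (smooth_cont (smooth_x sT2) Bz).
have cQ2 : Q2 h @[h --> (0 : R)^'] --> partial_y T2 z.
  apply: (@cvg_comp _ _ _ (fun h => q2 (w h)) (partial_y T2)).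
    by apply: lip => w' /H2[].
  exact: (smooth_cont (smooth_y sT2) Bz).
pose D h := P1 h * Q2 h - Q1 h * P2 h.
have cD : D h @[h --> (0 : R)^'] --> jac2 T1 T2 z.
  exact: (cvgB (cvgM cP1 cQ2) (cvgM cQ1 cP2)).
have nD : \forall h \near (0 : R)^', D h != 0.
  exact: (cvgr_neq0 _ cD (J0 Bz)).
have E h : V (y + h *: v) -> D h != 0 ->
    S1 (y + h *: v) - S1 y = h * ((v.1 * Q2 h - v.2 * Q1 h) / D h) /\
    S2 (y + h *: v) - S2 y = h * ((v.2 * P1 h - v.1 * P2 h) / D h).
  move=> Vh Dh.
  have [_ _ _ _ e1] := H1 (w h) (SB Vh); have [_ _ _ _ e2] := H2 (w h) (SB Vh).
  move: e1 e2; rewrite -/(P1 h) -/(Q1 h) -/(P2 h) -/(Q2 h).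
  rewrite /w /z TS1// TS2// TS1// TS2//.
  have -> : (y + h *: v).1 - y.1 = h * v.1 by rewrite /= /GRing.scale /=; ring.
  have -> : (y + h *: v).2 - y.2 = h * v.2 by rewrite /= /GRing.scale /=; ring.
  rewrite [(_, _).1]/= [(_, _).2]/= [(S1 y, _).1]/= [(S1 y, _).2]/=.
  set X := S1 _ - S1 y; set Y := S2 _ - S2 y => e1 e2.
  split; apply: (mulIf Dh); rewrite -!mulrA mulVf// mulr1.
    transitivity (Q2 h * (h * v.1) - Q1 h * (h * v.2)); last ring.
    by rewrite e1 e2 /D; ring.
  transitivity (P1 h * (h * v.2) - P2 h * (h * v.1)); last ring.
  by rewrite e1 e2 /D; ring.
split.
- apply: (@caratheodory _ _ (fun h => (v.1 * Q2 h - v.2 * Q1 h) / D h)).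
    near=> h; have [|//|//] := E h; by near: h.
  apply: cvgM; last exact: cvgV (J0 Bz) cD.
  exact: (cvgB (cvgMl_tmp cQ2) (cvgMl_tmp cQ1)).
- apply: (@caratheodory _ _ (fun h => (v.2 * P1 h - v.1 * P2 h) / D h)).
    near=> h; have [|//|//] := E h; by near: h.
  apply: cvgM; last exact: cvgV (J0 Bz) cD.
  exact: (cvgB (cvgMl_tmp cP1) (cvgMl_tmp cP2)).
Unshelve. all: by end_near. Qed.

Lemma local_inverse_continuous y : V y ->
  {for y, continuous S1} /\ {for y, continuous S2}.
Proof.
move=> Vy.
have H y' : V y' -> `|S1 y' - S1 y| <= `|K| * `|y' - y| /\
                    `|S2 y' - S2 y| <= `|K| * `|y' - y|.
  move=> Vy'; have := LS Vy Vy'; rewrite {1}lorentz_normE ge_max /= => /andP[h1 h2].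
  have hK : K * `|y' - y| <= `|K| * `|y' - y| by rewrite ler_wpM2r// ler_norm.
  by split; [exact: le_trans h1 hK|exact: le_trans h2 hK].
have cont (S : A -> R) : (forall y', V y' -> `|S y' - S y| <= `|K| * `|y' - y|) ->
    {for y, continuous S}.
  move=> HS; apply/cvgrPdist_lt => e e0.
  have K1 : 0 < `|K| + 1 by rewrite ltr_wpDl.
  have ne : \forall y' \near y, `|y' - y| < e / (`|K| + 1).
    apply/nbhs_box; exists (e / (`|K| + 1)); first exact: divr_gt0.
    by move=> w [w1 w2]; rewrite lorentz_normE gt_max w1 w2.
  have nV : \forall y' \near y, V y' by exact: (near_open oV Vy).
  near=> y'; rewrite distrC; apply: le_lt_trans (HS _ _) _; first by near: y'.
  have : `|y' - y| < e / (`|K| + 1) by near: y'.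
  rewrite ltr_pdivlMr// => /(le_lt_trans _); apply.
  by rewrite mulrC ler_wpM2l// lerDl.
by split; apply: cont => y' /H[].
Unshelve. all: by end_near. Qed.

(** Bootstrap: the derivatives of [S1] and [S2] are smooth functions composed with [(S1, S2)], so
    they inherit its class C^k, and [S1], [S2] gain one degree. *)
Lemma local_inverse_smooth : smooth_on V S1 /\ smooth_on V S2.
Proof.
have sJ : smooth_on (box z0 r) (fun z => (jac2 T1 T2 z)^-1).
  exact: (smoothV oB J0 (smooth_jac2 oB sT1 sT2)).
have s1x : smooth_on (box z0 r) (fun z => partial_y T2 z * (jac2 T1 T2 z)^-1).
  exact: (smoothM oB (smooth_y sT2) sJ).
have s1y : smooth_on (box z0 r) (fun z => - partial_y T1 z * (jac2 T1 T2 z)^-1).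
  exact: (smoothM oB (smoothN oB (smooth_y sT1)) sJ).
have s2x : smooth_on (box z0 r) (fun z => - partial_x T2 z * (jac2 T1 T2 z)^-1).
  exact: (smoothM oB (smoothN oB (smooth_x sT2)) sJ).
have s2y : smooth_on (box z0 r) (fun z => partial_x T1 z * (jac2 T1 T2 z)^-1).
  exact: (smoothM oB (smooth_x sT1) sJ).
suff H k : Ck_on k V S1 /\ Ck_on k V S2 by split=> k; have [] := H k.
elim: k => [|k [C1 C2]].
  by split; split=> // y /[1!inE] /local_inverse_continuous[].
have sub (f : A -> R) : smooth_on (box z0 r) f ->
    Ck_on k V (fun y => f (S1 y, S2 y)).
  by move=> sf; exact: Ck_on_subst oV oB SB C1 C2 (sf k).
split.
- apply: (Ck_onS oV _ _ _ (sub _ s1x) (sub _ s1y)) => y Vy.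
  + by case: (local_inverse_continuous Vy).
  + by have [+ _] := local_inverse_derive (1 : A) Vy; rewrite /= mul1r mul0r subr0.
  + by have [+ _] := local_inverse_derive lsigma Vy; rewrite /= mul1r mul0r sub0r.
- apply: (Ck_onS oV _ _ _ (sub _ s2x) (sub _ s2y)) => y Vy.
  + by case: (local_inverse_continuous Vy).
  + by have [_] := local_inverse_derive (1 : A) Vy; rewrite /= mul1r mul0r sub0r.
  + by have [_] := local_inverse_derive lsigma Vy; rewrite /= mul1r mul0r subr0.
Qed.

End LocalInverse.

Lemma inverse_function U z0 (T1 T2 : A -> R) : open U -> U z0 ->
  smooth_on U T1 -> smooth_on U T2 -> jac2 T1 T2 z0 != 0 ->
  exists (W : set A) (s : R) (S1 S2 : A -> R),
  [/\ open W /\ W `<=` U, W z0, 0 < s,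
      smooth_on (box (T1 z0, T2 z0) s) S1 /\ smooth_on (box (T1 z0, T2 z0) s) S2 &
      (forall z, W z -> [/\ box (T1 z0, T2 z0) s (T1 z, T2 z),
         S1 (T1 z, T2 z) = z.1 & S2 (T1 z, T2 z) = z.2]) /\
      (forall y, box (T1 z0, T2 z0) s y ->
         [/\ W (S1 y, S2 y), T1 (S1 y, S2 y) = y.1 & T2 (S1 y, S2 y) = y.2])].
Proof.
move=> oU Uz0 sT1 sT2.
pose a := partial_x T1 z0; pose b := partial_y T1 z0.
pose c := partial_x T2 z0; pose d := partial_y T2 z0.
rewrite /jac2 -/a -/b -/c -/d; set j := a * d - b * c => j0.
(* [(phi1, phi2)] is [(T1, T2)] followed by the inverse of the Jacobian matrix at [z0], so its
   differential at [z0] is the identity. [N] below is that inverse matrix. *)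
pose phi1 z := (d / j) * T1 z + (- b / j) * T2 z.
pose phi2 z := (- c / j) * T1 z + (a / j) * T2 z.
have s1 : smooth_on U phi1 by exact: smooth_lincomb.
have s2 : smooth_on U phi2 by exact: smooth_lincomb.
have p1x : partial_x phi1 z0 = (~~ false)%:R.
  have [_] := is_derive_lincomb (d / j) (- b / j) (smooth_dx sT1 Uz0) (smooth_dx sT2 Uz0).
  by rewrite -/a -/c => E; rewrite [LHS]E /=; move: j0; rewrite /j => j0; field.
have p1y : partial_y phi1 z0 = false%:R.
  have [_] := is_derive_lincomb (d / j) (- b / j) (smooth_dy sT1 Uz0) (smooth_dy sT2 Uz0).
  by rewrite -/b -/d => E; rewrite [LHS]E /=; move: j0; rewrite /j => j0; field.
have p2x : partial_x phi2 z0 = (~~ true)%:R.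
  have [_] := is_derive_lincomb (- c / j) (a / j) (smooth_dx sT1 Uz0) (smooth_dx sT2 Uz0).
  by rewrite -/a -/c => E; rewrite [LHS]E /=; move: j0; rewrite /j => j0; field.
have p2y : partial_y phi2 z0 = true%:R.
  have [_] := is_derive_lincomb (- c / j) (a / j) (smooth_dy sT1 Uz0) (smooth_dy sT2 Uz0).
  by rewrite -/b -/d => E; rewrite [LHS]E /=; move: j0; rewrite /j => j0; field.
have [r1 r1P H1] := near_identity oU Uz0 s1 p1x p1y.
have [r2 r2P H2] := near_identity oU Uz0 s2 p2x p2y.
have [r0 r0P H0] := open_box oU Uz0.
have cJ : {for z0, continuous (jac2 T1 T2)}.
  exact: smooth_cont (smooth_jac2 oU sT1 sT2) Uz0.
have [r3 r3P H3] := continuous_near_box cJ (ltac:(by rewrite normr_gt0) : 0 < `|j|).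
pose r := Num.min (Num.min r0 r3) (Num.min r1 r2).
have rP : 0 < r by rewrite !lt_min r0P r1P r2P r3P.
have BU : box z0 r `<=` U by move=> w /box_min[/box_min[[? ?] _] _]; exact: H0.
have BJ w : box z0 r w -> jac2 T1 T2 w != 0.
  move=> /box_min[/box_min[_ /H3 +] _]; apply: contraTneq => ->.
  by rewrite sub0r normrN /jac2 -/a -/b -/c -/d ltxx.
pose Phi z : A := (phi1 z, phi2 z).
have ctr z w : box z0 r z -> box z0 r w -> `|(z - w) - (Phi z - Phi w)| <= `|z - w| / 2.
  move=> /box_min[_ /box_min[z1 z2]] /box_min[_ /box_min[w1 w2]].
  by rewrite {1}lorentz_normE ge_max /= (H1 z w z1 w1) (H2 z w z2 w2).
have cPhi z : box z0 r z -> {for z, continuous Phi}.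
  by move=> /BU Uz; apply: continuous_pairA; [exact: smooth_cont s1 Uz|exact: smooth_cont s2 Uz].
pose N (y : A) : A := ((d / j) * y.1 + (- b / j) * y.2, (- c / j) * y.1 + (a / j) * y.2).
have PhiN z : Phi z = N (T1 z, T2 z) by [].
have Ninj y y' : N y = N y' -> y = y'.
  case: y y' => [u1 u2] [v1 v2] [e1 e2].
  have f1 : u1 = v1.
    transitivity (a * (d / j * u1 + - b / j * u2) + b * (- c / j * u1 + a / j * u2)).
      by move: j0; rewrite /j => j0; field.
    by rewrite e1 e2; move: j0; rewrite /j => j0; field.
  have f2 : u2 = v2.
    transitivity (c * (d / j * u1 + - b / j * u2) + d * (- c / j * u1 + a / j * u2)).
      by move: j0; rewrite /j => j0; field.
    by rewrite e1 e2; move: j0; rewrite /j => j0; field.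
  by rewrite f1 f2.
(* A Lipschitz constant for [N]; the added [1] makes it positive so that one may divide by it. *)
pose C := `|d / j| + `|- b / j| + (`|- c / j| + `|a / j|) + 1.
have C0 : 0 < C by rewrite /C ltr_wpDl// !addr_ge0.
have NL y y' : `|N y - N y'| <= C * `|y - y'|.
  have [n1 n2] : `|y.1 - y'.1| <= `|y - y'| /\ `|y.2 - y'.2| <= `|y - y'|.
    by rewrite (lorentz_normE (y - y')) !le_max !lexx orbT.
  have bnd (k l : R) : `|k * y.1 + l * y.2 - (k * y'.1 + l * y'.2)| <=
      (`|k| + `|l|) * `|y - y'|.
    rewrite (_ : _ - _ = k * (y.1 - y'.1) + l * (y.2 - y'.2)); last by ring.
    apply: le_trans (ler_normD _ _) _; rewrite !normrM mulrDl.
    by apply: lerD; rewrite ler_wpM2l.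
  have n0 := normr_ge0 (y - y').
  rewrite {1}lorentz_normE ge_max /=; apply/andP; split; apply: le_trans (bnd _ _) _;
    rewrite ler_wpM2r// /C.
    by rewrite -!addrA lerD2l lerDl // !addr_ge0.
  by rewrite -addrA addrC -addrA lerDl !addr_ge0.
(* Chosen so that [N] maps the box of radius [s] within [r / 4] of [Phi z0], as [contraction_solve]
   requires. *)
pose s := r / (4 * C).
have sP : 0 < s by rewrite divr_gt0// mulr_gt0.
pose y0 : A := (T1 z0, T2 z0).
have solve y : exists z, box y0 s y -> box z0 r z /\ (T1 z, T2 z) = y.
  have [[y1 y2]|nb] := pselect (box y0 s y); last by exists z0.
  have [|z Bz Ez] := contraction_solve rP cPhi ctr (y := N y).
    rewrite PhiN; apply: le_trans (NL _ _) _.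
    rewrite -ler_pdivlMl// (_ : C^-1 * (r / 4) = s).
      by rewrite lorentz_normE ge_max !ltW.
    by rewrite /s; move: C0 => /gt_eqF/negbT C0; field.
  by exists z => _; split=> //; apply: Ninj; rewrite -PhiN.
have [S SP] := choice solve.
pose S1 y := (S y).1; pose S2 y := (S y).2.
have SE y : (S1 y, S2 y) = S y by rewrite /S1 /S2 -surjective_pairing.
(* From the contraction estimate, the distance of the preimages is at most twice that of their
   images under [Phi], which is at most [C] times that of [y] and [y']. *)
have LS y y' : box y0 s y -> box y0 s y' ->
    `|((S1 y', S2 y') : A) - (S1 y, S2 y)| <= (2 * C) * `|y' - y|.
  move=> Vy Vy'; rewrite !SE.
  have [B1 E1] := SP y Vy; have [B2 E2] := SP y' Vy'.
  have := ctr _ _ B2 B1; rewrite !PhiN E1 E2 => c1.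
  have := ler_normD ((S y' - S y) - (N y' - N y)) (N y' - N y); rewrite subrK => c2.
  have := NL y' y; lra.
have TS1 y : box y0 s y -> T1 (S1 y, S2 y) = y.1.
  by move=> /SP[_ E]; rewrite SE -[in RHS]E.
have TS2 y : box y0 s y -> T2 (S1 y, S2 y) = y.2.
  by move=> /SP[_ E]; rewrite SE -[in RHS]E.
have SB y : box y0 s y -> box z0 r (S1 y, S2 y) by move=> /SP[+ _]; rewrite SE.
pose W := box z0 r `&` (fun z => (T1 z, T2 z) : A) @^-1` (box y0 s).
have oW : open W.
  rewrite openE => z [Bz Vz]; apply: filterI.
    by apply: open_nbhs_nbhs; split=> //; exact: open_boxE.
  have cT : {for z, continuous (fun z => (T1 z, T2 z) : A)}.
    by apply: continuous_pairA; [exact: smooth_cont sT1 (BU _ Bz)|exact: smooth_cont sT2 (BU _ Bz)].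
  by apply: cT; apply: open_nbhs_nbhs; split=> //; exact: open_boxE.
have inj z w : box z0 r z -> box z0 r w -> (T1 z, T2 z) = (T1 w, T2 w) -> z = w.
  move=> Bz Bw E; have := ctr z w Bz Bw; rewrite !PhiN E subrr subr0.
  have := normr_ge0 (z - w) => n0 h.
  have : `|z - w| <= 0 by lra.
  by rewrite normr_le0 subr_eq0 => /eqP.
have [sS1 sS2] := local_inverse_smooth rP sP (smooth_subset BU sT1)
  (smooth_subset BU sT2) BJ SB TS1 TS2 LS.
exists W, s, S1, S2; split=> //.
- by split=> // z [/BU].
- by split; [exact: box_center|exact: box_center].
- split=> [z [Bz Vz]|y Vy].
    have [B E] := SP _ Vz; have := inj _ _ B Bz E => Sz.
    by split=> //; rewrite /S1 /S2 Sz.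
  split; [|exact: TS1|exact: TS2].
  split; first exact: SB.
  by rewrite /preimage /= TS1// TS2// -surjective_pairing.
Qed.

End InverseFunction.

(** * Real quaternions and maps into R^4 *)

Section RealQuaternions.
Context {R : realType}.
Local Notation A := (lorentz R).
Local Notation E4 := 'rV[R]_4.
Implicit Types (u v w : E4).

Definition mk4 (x0 x1 x2 x3 : R) : E4 := \row_i nth 0 [:: x0; x1; x2; x3] i.

Lemma mk4E (x0 x1 x2 x3 : R) :
  ((mk4 x0 x1 x2 x3) 0 0 = x0) * ((mk4 x0 x1 x2 x3) 0 1 = x1) *
  ((mk4 x0 x1 x2 x3) 0 2%R = x2) * ((mk4 x0 x1 x2 x3) 0 3%R = x3).
Proof. by split; [split; [split|]|]; rewrite mxE. Qed.

Lemma rv4P u v : u 0 0 = v 0 0 -> u 0 1 = v 0 1 -> u 0 2%R = v 0 2%R ->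
  u 0 3%R = v 0 3%R -> u = v.
Proof.
move=> e0 e1 e2 e3; apply/rowP => -[[|[|[|[|//]]]] p].
- by move: e0; congr (u 0 _ = v 0 _); exact: val_inj.
- by move: e1; congr (u 0 _ = v 0 _); exact: val_inj.
- by move: e2; congr (u 0 _ = v 0 _); exact: val_inj.
- by move: e3; congr (u 0 _ = v 0 _); exact: val_inj.
Qed.

Lemma sum4 (f : 'I_4 -> R) : \sum_i f i = f 0 + f 1 + f 2%R + f 3%R.
Proof.
rewrite !big_ord_recr big_ord0 /= add0r; do !congr (_ + _); congr f; exact: val_inj.
Qed.

Lemma mk4_eta u : u = mk4 (u 0 0) (u 0 1) (u 0 2%R) (u 0 3%R).
Proof. by apply: rv4P; rewrite !mk4E. Qed.

Lemma dotpE u v : dotp u v =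
  u 0 0 * v 0 0 + u 0 1 * v 0 1 + u 0 2%R * v 0 2%R + u 0 3%R * v 0 3%R.
Proof. by rewrite /dotp sum4. Qed.

(** Hamilton's product, with the same table as [qmul] but real coefficients. Keeping it on row
    vectors makes [dotp], the matrix lemmas and coordinatewise calculus directly applicable. *)
Definition qm u v : E4 := mk4
  (u 0 0 * v 0 0 - u 0 1 * v 0 1 - u 0 2%R * v 0 2%R - u 0 3%R * v 0 3%R)
  (u 0 0 * v 0 1 + u 0 1 * v 0 0 + u 0 2%R * v 0 3%R - u 0 3%R * v 0 2%R)
  (u 0 0 * v 0 2%R - u 0 1 * v 0 3%R + u 0 2%R * v 0 0 + u 0 3%R * v 0 1)
  (u 0 0 * v 0 3%R + u 0 1 * v 0 2%R - u 0 2%R * v 0 1 + u 0 3%R * v 0 0).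

Definition qbar u : E4 := mk4 (u 0 0) (- u 0 1) (- u 0 2%R) (- u 0 3%R).

Lemma addvE u v i : (u + v) 0 i = u 0 i + v 0 i. Proof. by rewrite mxE. Qed.
Lemma oppvE u i : (- u) 0 i = - u 0 i. Proof. by rewrite mxE. Qed.
Lemma scalevE k u i : (k *: u) 0 i = k * u 0 i. Proof. by rewrite mxE. Qed.
Lemma zerovE i : (0 : E4) 0 i = 0. Proof. by rewrite mxE. Qed.
Definition rowE := (addvE, oppvE, scalevE, zerovE, mk4E).

Lemma qmA u v w : qm u (qm v w) = qm (qm u v) w.
Proof. by apply: rv4P; rewrite /qm !rowE; ring. Qed.
Lemma qmDl u v w : qm (u + v) w = qm u w + qm v w.
Proof. by apply: rv4P; rewrite /qm !rowE; ring. Qed.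
Lemma qmDr u v w : qm u (v + w) = qm u v + qm u w.
Proof. by apply: rv4P; rewrite /qm !rowE; ring. Qed.
Lemma qmNl u v : qm (- u) v = - qm u v.
Proof. by apply: rv4P; rewrite /qm !rowE; ring. Qed.
Lemma qmNr u v : qm u (- v) = - qm u v.
Proof. by apply: rv4P; rewrite /qm !rowE; ring. Qed.
Lemma qmZl k u v : qm (k *: u) v = k *: qm u v.
Proof. by apply: rv4P; rewrite /qm !rowE; ring. Qed.
Lemma qmZr k u v : qm u (k *: v) = k *: qm u v.
Proof. by apply: rv4P; rewrite /qm !rowE; ring. Qed.
Lemma qbarM u v : qbar (qm u v) = qm (qbar v) (qbar u).
Proof. by apply: rv4P; rewrite /qm /qbar !rowE; ring. Qed.
Lemma qbarK u : qbar (qbar u) = u.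
Proof. by apply: rv4P; rewrite /qbar !rowE ?opprK. Qed.
Lemma qbarD u v : qbar (u + v) = qbar u + qbar v.
Proof. by apply: rv4P; rewrite /qbar !rowE; ring. Qed.
Lemma qbarZ k u : qbar (k *: u) = k *: qbar u.
Proof. by apply: rv4P; rewrite /qbar !rowE; ring. Qed.

Definition q1 : E4 := mk4 1 0 0 0.
Lemma qm1l u : qm q1 u = u.
Proof. by apply: rv4P; rewrite /qm /q1 !rowE; ring. Qed.
Lemma qm1r u : qm u q1 = u.
Proof. by apply: rv4P; rewrite /qm /q1 !rowE; ring. Qed.
Lemma qmV u : qm u (qbar u) = dotp u u *: q1.
Proof. by rewrite dotpE; apply: rv4P; rewrite /qm /qbar /q1 !rowE; ring. Qed.
Lemma qVm u : qm (qbar u) u = dotp u u *: q1.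
Proof. by rewrite dotpE; apply: rv4P; rewrite /qm /qbar /q1 !rowE; ring. Qed.

Lemma dotp_qm u v : dotp (qm u v) (qm u v) = dotp u u * dotp v v.
Proof. by rewrite !dotpE /qm !rowE; ring. Qed.
Lemma dotp_qml u v w : dotp (qm u v) (qm u w) = dotp u u * dotp v w.
Proof. by rewrite !dotpE /qm !rowE; ring. Qed.
Lemma dotp_qmr u v w : dotp (qm v u) (qm w u) = dotp u u * dotp v w.
Proof. by rewrite !dotpE /qm !rowE; ring. Qed.
Lemma dotp_bar u v : dotp (qbar u) (qbar v) = dotp u v.
Proof. by rewrite !dotpE /qbar !rowE; ring. Qed.
Lemma dotpC u v : dotp u v = dotp v u.
Proof. by rewrite !dotpE; ring. Qed.
Lemma dotpDl u v w : dotp (u + v) w = dotp u w + dotp v w.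
Proof. by rewrite !dotpE !rowE; ring. Qed.
Lemma dotpDr u v w : dotp w (u + v) = dotp w u + dotp w v.
Proof. by rewrite !dotpE !rowE; ring. Qed.
Lemma dotpZl k u v : dotp (k *: u) v = k * dotp u v.
Proof. by rewrite !dotpE !rowE; ring. Qed.
Lemma dotpZr k u v : dotp u (k *: v) = k * dotp u v.
Proof. by rewrite !dotpE !rowE; ring. Qed.
Lemma dotpNl u v : dotp (- u) v = - dotp u v.
Proof. by rewrite !dotpE !rowE; ring. Qed.
Lemma dotpNr u v : dotp u (- v) = - dotp u v.
Proof. by rewrite !dotpE !rowE; ring. Qed.
Lemma dotp_ge0 u : 0 <= dotp u u.
Proof. by rewrite dotpE -!expr2 !addr_ge0 ?sqr_ge0. Qed.
Lemma dotp_eq0 u : (dotp u u == 0) = (u == 0).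
Proof.
apply/eqP/eqP => [|->]; last by rewrite dotpE !rowE !mulr0 !addr0.
rewrite dotpE -!expr2 => /eqP.
rewrite !paddr_eq0 ?addr_ge0 ?sqr_ge0// !sqrf_eq0.
move=> /andP[/andP[/andP[/eqP e0 /eqP e1] /eqP e2] /eqP e3].
by apply: rv4P; rewrite zerovE.
Qed.

End RealQuaternions.

Lemma partial_xE (R : realType) (W : normedModType R) (f : lorentz R -> W) z :
  partial_x f z = 'D_(1 : lorentz R) f z.
Proof. by []. Qed.

Lemma partial_yE (R : realType) (W : normedModType R) (f : lorentz R -> W) z :
  partial_y f z = 'D_(lsigma : lorentz R) f z.
Proof. by []. Qed.

(** * Calculus of vector-valued and quaternion-valued maps *)

Section RowCalculus.
Context {R : realType}.
Local Notation A := (lorentz R).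
Local Notation E4 := 'rV[R]_4.
Implicit Types (U : set A) (F G : A -> E4) (f : A -> R) (z v : A).

Lemma coord_linear m n i j : linear (fun M : 'M[R]_(m, n) => M i j).
Proof. by move=> k u v; rewrite !mxE. Qed.

Lemma is_derive_coord F z v (d : E4) i : is_derive z v F d ->
  is_derive z v (fun w => F w 0 i) (d 0 i).
Proof.
exact: (@is_derive_lin _ _ _ (fun M : E4 => M 0 i) (@coord_linear _ _ _ _)
  (@coord_continuous _ _ _ _ _)).
Qed.

Lemma smooth_coord U F i : open U -> smooth_on U F -> smooth_on U (fun z => F z 0 i).
Proof.
exact: (@smooth_lin _ _ _ (fun M : E4 => M 0 i) (@coord_linear _ _ _ _)
  (@coord_continuous _ _ _ _ _)).
Qed.

Lemma scalel_linear (W : normedModType R) (e : W) : linear (fun x : R => x *: e).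
Proof. by move=> k x y; rewrite scalerDl scalerA. Qed.

Lemma smooth_scalel (W : normedModType R) (e : W) U f : open U -> smooth_on U f ->
  smooth_on U (fun z => f z *: e).
Proof.
exact: (@smooth_lin _ _ _ (fun x : R => x *: e) (@scalel_linear _ _)
  (@scalel_continuous _ _ _)).
Qed.

Lemma is_derive_scalel (W : normedModType R) (e : W) f z v (d : R) : is_derive z v f d ->
  is_derive z v (fun z => f z *: e) (d *: e).
Proof.
exact: (@is_derive_lin _ _ _ (fun x : R => x *: e) (@scalel_linear _ _)
  (@scalel_continuous _ _ _)).
Qed.

Lemma smooth_mx m n U (F : A -> 'M[R]_(m, n)) : open U ->
  (forall i j, smooth_on U (fun z => F z i j)) -> smooth_on U F.
Proof.
move=> oU sF; apply: (@smooth_ext _ _ U (fun z => \sum_i \sum_j F z i j *: delta_mx i j)) => //.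
  by move=> z _; rewrite -matrix_sum_delta.
by apply: smooth_sum => // i; apply: smooth_sum => // j; exact: smooth_scalel.
Qed.

Lemma mk4_sum (x0 x1 x2 x3 : R) : mk4 x0 x1 x2 x3 =
  x0 *: mk4 1 0 0 0 + (x1 *: mk4 0 1 0 0 + (x2 *: mk4 0 0 1 0 + x3 *: mk4 0 0 0 1)).
Proof. by apply: rv4P; rewrite !rowE; ring. Qed.

Lemma smooth_mk4 U (f0 f1 f2 f3 : A -> R) : open U -> smooth_on U f0 ->
  smooth_on U f1 -> smooth_on U f2 -> smooth_on U f3 ->
  smooth_on U (fun z => mk4 (f0 z) (f1 z) (f2 z) (f3 z)).
Proof.
move=> oU s0 s1 s2 s3.
apply: (@smooth_ext _ _ U (fun z => f0 z *: mk4 1 0 0 0 + (f1 z *: mk4 0 1 0 0 +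
  (f2 z *: mk4 0 0 1 0 + f3 z *: mk4 0 0 0 1)))) => //.
  by move=> z _; rewrite [RHS]mk4_sum.
exact: (smoothD oU (smooth_scalel _ oU s0) (smoothD oU (smooth_scalel _ oU s1)
  (smoothD oU (smooth_scalel _ oU s2) (smooth_scalel _ oU s3)))).
Qed.

Lemma is_derive_mk4 (f0 f1 f2 f3 : A -> R) z v (d0 d1 d2 d3 : R) :
  is_derive z v f0 d0 -> is_derive z v f1 d1 -> is_derive z v f2 d2 ->
  is_derive z v f3 d3 ->
  is_derive z v (fun z => mk4 (f0 z) (f1 z) (f2 z) (f3 z)) (mk4 d0 d1 d2 d3).
Proof.
move=> D0 D1 D2 D3; rewrite [mk4 d0 d1 d2 d3]mk4_sum.
rewrite (_ : (fun z => _) = (fun z => f0 z *: mk4 1 0 0 0 + (f1 z *: mk4 0 1 0 0 +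
  (f2 z *: mk4 0 0 1 0 + f3 z *: mk4 0 0 0 1)))); last first.
  by apply/funext => w; rewrite -mk4_sum.
exact: (is_deriveD' (is_derive_scalel _ D0) (is_deriveD' (is_derive_scalel _ D1)
  (is_deriveD' (is_derive_scalel _ D2) (is_derive_scalel _ D3)))).
Qed.

Lemma is_derive_dotp F G z v (dF dG : E4) : is_derive z v F dF -> is_derive z v G dG ->
  is_derive z v (fun w => dotp (F w) (G w)) (dotp dF (G z) + dotp (F z) dG).
Proof.
move=> DF DG; pose c i := is_deriveM' (is_derive_coord i DF) (is_derive_coord i DG).
have D := is_deriveD' (is_deriveD' (is_deriveD' (c 0) (c 1)) (c 2%R)) (c 3%R).
rewrite (_ : (fun w => _) = (fun w => F w 0 0 * G w 0 0 + F w 0 1 * G w 0 1 +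
  F w 0 2%R * G w 0 2%R + F w 0 3%R * G w 0 3%R)).
  by apply: (is_derive_eq D); rewrite !dotpE; ring.
by apply/funext => w; rewrite dotpE.
Qed.

Lemma smooth_dotp U F G : open U -> smooth_on U F -> smooth_on U G ->
  smooth_on U (fun z => dotp (F z) (G z)).
Proof.
move=> oU sF sG; pose c i := smoothM oU (smooth_coord i oU sF) (smooth_coord i oU sG).
apply: smooth_ext (smoothD oU (smoothD oU (smoothD oU (c 0) (c 1)) (c 2%R)) (c 3%R)) => //.
by move=> z _; rewrite dotpE.
Qed.

Lemma is_derive_qm F G z v (dF dG : E4) : is_derive z v F dF -> is_derive z v G dG ->
  is_derive z v (fun w => qm (F w) (G w)) (qm dF (G z) + qm (F z) dG).
Proof.
move=> DF DG; pose c i j := is_deriveM' (is_derive_coord i DF) (is_derive_coord j DG).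
pose n i j := is_deriveN (c i j).
have D := is_derive_mk4
  (is_deriveD' (is_deriveD' (is_deriveD' (c 0 0) (n 1 1)) (n 2%R 2%R)) (n 3%R 3%R))
  (is_deriveD' (is_deriveD' (is_deriveD' (c 0 1) (c 1 0)) (c 2%R 3%R)) (n 3%R 2%R))
  (is_deriveD' (is_deriveD' (is_deriveD' (c 0 2%R) (n 1 3%R)) (c 2%R 0)) (c 3%R 1))
  (is_deriveD' (is_deriveD' (is_deriveD' (c 0 3%R) (c 1 2%R)) (n 2%R 1)) (c 3%R 0)).
apply: (is_derive_eq D); apply: rv4P; rewrite /qm !rowE; ring.
Qed.

Lemma smooth_qm U F G : open U -> smooth_on U F -> smooth_on U G ->
  smooth_on U (fun z => qm (F z) (G z)).
Proof.
move=> oU sF sG; pose c i j := smoothM oU (smooth_coord i oU sF) (smooth_coord j oU sG).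
pose n i j := smoothN oU (c i j).
exact: (smooth_mk4 oU
  (smoothD oU (smoothD oU (smoothD oU (c 0 0) (n 1 1)) (n 2%R 2%R)) (n 3%R 3%R))
  (smoothD oU (smoothD oU (smoothD oU (c 0 1) (c 1 0)) (c 2%R 3%R)) (n 3%R 2%R))
  (smoothD oU (smoothD oU (smoothD oU (c 0 2%R) (n 1 3%R)) (c 2%R 0)) (c 3%R 1))
  (smoothD oU (smoothD oU (smoothD oU (c 0 3%R) (c 1 2%R)) (n 2%R 1)) (c 3%R 0))).
Qed.

Lemma is_derive_qbar F z v (dF : E4) : is_derive z v F dF ->
  is_derive z v (fun w => qbar (F w)) (qbar dF).
Proof.
move=> DF; pose c i := is_derive_coord i DF; pose n i := is_deriveN (c i).
exact: (is_derive_mk4 (c 0) (n 1) (n 2%R) (n 3%R)).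
Qed.

Lemma smooth_qbar U F : open U -> smooth_on U F -> smooth_on U (fun z => qbar (F z)).
Proof.
move=> oU sF; pose c i := smooth_coord i oU sF; pose n i := smoothN oU (c i).
exact: (smooth_mk4 oU (c 0) (n 1) (n 2%R) (n 3%R)).
Qed.

Lemma is_derive_scale f F z v (df : R) (dF : E4) : is_derive z v f df -> is_derive z v F dF ->
  is_derive z v (fun w => f w *: F w) (df *: F z + f z *: dF).
Proof.
move=> Df DF; pose c i := is_deriveM' Df (is_derive_coord i DF).
have D := is_derive_mk4 (c 0) (c 1) (c 2%R) (c 3%R).
rewrite (_ : (fun w => _) = fun w => mk4 (f w * F w 0 0) (f w * F w 0 1)
  (f w * F w 0 2%R) (f w * F w 0 3%R)).
  by apply: (is_derive_eq D); apply: rv4P; rewrite !rowE.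
by apply/funext => w; apply: rv4P; rewrite !rowE.
Qed.

Lemma smooth_scale U f F : open U -> smooth_on U f -> smooth_on U F ->
  smooth_on U (fun z => f z *: F z).
Proof.
move=> oU sf sF; apply: smooth_mx => // i j; rewrite ord1.
apply: smooth_ext (smoothM oU sf (smooth_coord j oU sF)) => // w _.
by rewrite mxE.
Qed.

Lemma smoothNv U F : open U -> smooth_on U F -> smooth_on U (fun z => - F z).
Proof.
move=> oU sF; apply: (@smooth_ext _ _ U (fun z => -1 *: F z)) => //.
  by move=> w _; rewrite scaleN1r.
by apply: smooth_scale => //; exact: smooth_cst.
Qed.

Lemma partial_coord U F z i : smooth_on U F -> U z ->
  (partial_x F z) 0 i = partial_x (fun w => F w 0 i) z /\
  (partial_y F z) 0 i = partial_y (fun w => F w 0 i) z.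
Proof.
move=> sF Uz; split.
  by have [_ <-] := is_derive_coord i (smooth_dx sF Uz).
by have [_ <-] := is_derive_coord i (smooth_dy sF Uz).
Qed.

Lemma schwarz_row U F z : open U -> smooth_on U F -> U z ->
  partial_x (partial_y F) z = partial_y (partial_x F) z.
Proof.
move=> oU sF Uz; apply/rowP => i.
transitivity (partial_x (fun w => partial_y F w 0 i) z).
  exact: (partial_coord i (smooth_y sF) Uz).1.
transitivity (partial_x (partial_y (fun w => F w 0 i)) z).
  apply: (@derive_ext _ _ U _ _ z 1 oU Uz) => w Uw.
  exact: (partial_coord i sF Uw).2.
transitivity (partial_y (partial_x (fun w => F w 0 i)) z).
  exact: schwarz oU (smooth_coord i oU sF) Uz.
transitivity (partial_y (fun w => partial_x F w 0 i) z).
  apply: (@derive_ext _ _ U _ _ z lsigma oU Uz) => w Uw.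
  exact/esym/(partial_coord i sF Uw).1.
exact/esym/(partial_coord i (smooth_x sF) Uz).2.
Qed.

Lemma is_diff_mx m n U (F : A -> 'M[R]_(m, n)) z : open U -> smooth_on U F -> U z ->
  is_diff z F (fun v => v.1 *: partial_x F z + v.2 *: partial_y F z).
Proof.
move=> oU sF Uz.
have s i j : smooth_on U (fun z => F z i j).
  exact: (@smooth_lin _ _ _ (fun M : 'M[R]_(m, n) => M i j) (@coord_linear _ _ _ _)
    (@coord_continuous _ _ _ _ _)).
have dF : differentiable F z.
  have -> : F = \sum_(i < m) \sum_(j < n) (fun z => F z i j *: delta_mx i j).
    apply/funext => w; rewrite [LHS]matrix_sum_delta.
    rewrite fct_sumE; apply: eq_bigr => i _; rewrite fct_sumE; by apply: eq_bigr.
  apply: differentiable_sum => i; apply: differentiable_sum => j.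
  by apply: differentiableZl; case: (smooth_is_diff oU (s i j) Uz).
split=> //; apply/funext => v.
have {1}-> : v = v.1 *: (1 : A) + v.2 *: lsigma.
  have := lorentz_line1 0 v.1; rewrite add0r => ->; rewrite lorentz_lines /= !add0r.
  by case: v.
by rewrite linearD !linearZ /= -!deriveE.
Qed.

End RowCalculus.

(** * Closed forms on a simply connected domain *)

Section GlobalPrimitive.
Context {R : realType}.
Local Notation A := (lorentz R).
Implicit Types (z v w : A).

Lemma boxP z (r : R) w : box z r w <-> `|w - z| < r.
Proof. by rewrite lorentz_normE gt_max; split=> [[-> ->]|/andP[]]. Qed.

Definition primitive_of (P Q f : A -> R) z :=
  is_derive z (1 : A) f (P z) /\ is_derive z (lsigma : A) f (Q z).

(** The difference of the two primitives has zero derivative along the segment. Only the segment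
    from [w] to [w'] is asked to stay in [B], so intersections of boxes can be used. *)
Lemma primitive_unique (B : set A) (P Q f g : A -> R) w w' : open B ->
  smooth_on B P -> smooth_on B Q ->
  (forall z, B z -> primitive_of P Q f z) -> (forall z, B z -> primitive_of P Q g z) ->
  (forall t : R, 0 <= t <= 1 -> B (w + t *: (w' - w))) ->
  f w' - f w = g w' - g w.
Proof.
move=> oB sP sQ Hf Hg seg.
have sf := smooth_primitive oB sP sQ Hf; have sg := smooth_primitive oB sP sQ Hg.
have dv t : 0 <= t <= 1 -> is_derive (w + (t * 1) *: (w' - w)) (w' - w) (fun z => f z - g z) 0.
  move=> /seg; rewrite mulr1 => Bt; have [df vf] := smooth_is_diff oB sf Bt.
  have [dg vg] := smooth_is_diff oB sg Bt.
  have dE : 'd f (w + t *: (w' - w)) (w' - w) = 'd g (w + t *: (w' - w)) (w' - w).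
    have [[_ e1] [_ e2]] := Hf _ Bt; have [[_ e3] [_ e4]] := Hg _ Bt.
    by rewrite vf vg /partial_x /partial_y e1 e2 e3 e4.
  have Df := derivableP (@diff_derivable _ _ _ f _ (w' - w) df).
  have Dg := derivableP (@diff_derivable _ _ _ g _ (w' - w) dg).
  apply: (is_derive_eq (is_deriveB Df Dg)).
  by rewrite (deriveE _ df) (deriveE _ dg) dE subrr.
have [t t01] := @mvt_dir R (fun z => f z - g z) w (w' - w) 1
  (fun t t01 => @ex_derive _ _ _ _ _ _ _ (dv t t01)).
have [_ ->] := dv t t01; rewrite (_ : w + 1 *: (w' - w) = w'); last first.
  by rewrite scale1r addrC subrK.
by rewrite mulr0 => E; lra.
Qed.

Section Fixed.
Variables (U : set A) (P Q : A -> R).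
Hypotheses (oU : open U) (sP : smooth_on U P) (sQ : smooth_on U Q).
Hypothesis PQ : forall z, U z -> partial_y P z = partial_x Q z.

Lemma local_primitives : exists pf : A * R -> A -> R, forall z r, 0 < r ->
  box z r `<=` U -> forall w, box z (r / 2) w -> primitive_of P Q (pf (z, r)) w.
Proof.
suff /choice[pf H] : forall zr : A * R, exists f, 0 < zr.2 -> box zr.1 zr.2 `<=` U ->
    forall w, box zr.1 (zr.2 / 2) w -> primitive_of P Q f w.
  by exists pf => z r; exact: (H (z, r)).
move=> [z r] /=; have [r0|] := pselect (0 < r); last by exists (fun=> 0).
have [BU|] := pselect (box z r `<=` U); last by exists (fun=> 0).
have [f H] := poincare r0 (smooth_subset BU sP) (smooth_subset BU sQ)
  (fun w Bw => PQ (BU w Bw)).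
by exists f => _ _ w /H.
Qed.

Variable pf : A * R -> A -> R.
Hypothesis pfP : forall z r, 0 < r -> box z r `<=` U ->
  forall w, box z (r / 2) w -> primitive_of P Q (pf (z, r)) w.

(** Integral of the form from [z] to [w], read in the primitive attached to the box at [z]. It is
    meaningful when that box lies in [U] and [w] is within [d / 2] of [z]. *)
Definition step (d : R) z w := pf (z, d) w - pf (z, d) z.

Lemma step_refl d z : step d z z = 0. Proof. exact: subrr. Qed.

(** On the segment from [w] to [v] both primitives are valid: its points are within [d / 4 + d / 4]
    of [z] and within [d' / 2] of [w]. Uniqueness then replaces one by the other. *)
Lemma step_add d d' z w v : 0 < d -> 0 < d' -> box z d `<=` U -> box w d' `<=` U ->
  `|w - z| < d / 4 -> `|v - w| < d / 4 -> `|v - w| < d' / 2 ->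
  step d z w + step d' w v = step d z v.
Proof.
move=> d0 d'0 zU wU wz vw vw'.
pose m := Num.min (d / 4) (d' / 2).
have m0 : 0 < m by rewrite lt_min !divr_gt0.
have md u : box w m u -> box z (d / 2) u /\ box w (d' / 2) u.
  rewrite !boxP lt_min => /andP[u1 u2]; split=> //.
  rewrite -(subrKA w); apply: le_lt_trans (ler_normD _ _) _; lra.
have mU : box w m `<=` U.
  by move=> u /md[_ /boxP u2]; apply: wU; apply/boxP; lra.
have E : pf (w, d') v - pf (w, d') w = pf (z, d) v - pf (z, d) w.
  apply: (@primitive_unique (box w m) P Q); first exact: open_boxE.
  - exact: smooth_subset sP.
  - exact: smooth_subset sQ.
  - by move=> u /md[_ /(pfP d'0 wU)].
  - by move=> u /md[/(pfP d0 zU)].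
  - move=> t /andP[t0 t1]; apply/boxP; rewrite addrAC subrr add0r normrZ ger0_norm//.
    by apply: le_lt_trans (ler_piMl _ t1) _ => //; rewrite lt_min vw vw'.
by rewrite /step E; ring.
Qed.

Lemma step_sym d z w : 0 < d -> box z d `<=` U -> box w d `<=` U ->
  `|w - z| < d / 4 -> step d w z = - step d z w.
Proof.
move=> d0 zU wU wz; have := @step_add d d z w z d0 d0 zU wU wz.
rewrite distrC step_refl => /(_ wz) H; have := H ltac:(lra); lra.
Qed.

Definition fine (c : R -> A) (d : R) (n : nat) :=
  [/\ (0 < n)%N, 0 < d, forall t, 0 <= t <= 1 -> box (c t) d `<=` U &
   forall s t, 0 <= s <= 1 -> 0 <= t <= 1 -> `|s - t| <= n%:R^-1 -> `|c s - c t| < d / 8].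

Definition sum_steps d n (c : R -> A) :=
  \sum_(0 <= i < n) step d (c (i%:R / n%:R)) (c (i.+1%:R / n%:R)).

Lemma frac01 i n : (0 < n)%N -> (i <= n)%N -> 0 <= (i%:R / n%:R : R) <= 1.
Proof.
move=> n0 i_n; rewrite divr_ge0 ?ler0n//= ler_pdivrMr ?ltr0n// mul1r ler_nat //.
Qed.

Lemma fine_mul c d n m : fine c d n -> (0 < m)%N -> fine c d (n * m).
Proof.
move=> [n0 d0 cU cd] m0; split=> //; first by rewrite muln_gt0 n0.
move=> s t s01 t01 st; apply: cd => //; apply: le_trans st _.
by rewrite natrM lef_pV2 ?posrE ?mulr_gt0 ?ltr0n// ler_peMr ?ler0n// ler1n.
Qed.

(** Points that are pairwise close all lie where the primitive of the first one is valid, so the sum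
    telescopes through [step_add]. *)
Lemma step_chain d (p : nat -> A) a b : 0 < d -> (a <= b)%N ->
  (forall i, (a <= i <= b)%N -> box (p i) d `<=` U) ->
  (forall i j, (a <= i <= b)%N -> (a <= j <= b)%N -> `|p i - p j| < d / 8) ->
  \sum_(a <= i < b) step d (p i) (p i.+1) = step d (p a) (p b).
Proof.
move=> d0; elim: b => [|b IH] ab pU pd.
  by move: ab; rewrite leqn0 => /eqP ->; rewrite big_nil step_refl.
move: ab; rewrite leq_eqVlt => /orP[/eqP->|].
  by rewrite big_geq // step_refl.
rewrite ltnS => ab; rewrite big_nat_recr //= IH//.
- have h1 : (a <= b <= b.+1)%N by rewrite ab leqnSn.
  have h2 : (a <= b.+1 <= b.+1)%N by rewrite (leq_trans ab) ?leqnn.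
  have h0 : (a <= a <= b.+1)%N by rewrite leqnn (leq_trans ab).
  apply: step_add => //; [exact: pU|exact: pU| | |].
  + have := pd b a h1 h0; lra.
  + have := pd b.+1 b h2 h1; lra.
  + have := pd b.+1 b h2 h1; lra.
- by move=> i /andP[ai ib]; apply: pU; rewrite ai leqW.
- by move=> i j /andP[ai ib] /andP[aj jb]; apply: pd; rewrite ?ai ?aj leqW.
Qed.

Lemma sum_steps_mul c d n m : fine c d n -> (0 < m)%N ->
  sum_steps d (n * m) c = sum_steps d n c.
Proof.
move=> fc m0; have [n0 d0 cU cd] := fc.
have nm0 : (0 < n * m)%N by rewrite muln_gt0 n0.
rewrite /sum_steps big_nat_mul; apply: eq_big_nat => i /andP[_ i_n].
have le_nm j : (i * m <= j <= i.+1 * m)%N -> (j <= n * m)%N.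
  by move=> /andP[_ /leq_trans]; apply; rewrite leq_mul2r i_n orbT.
rewrite (@step_chain d (fun j => c (j%:R / (n * m)%:R)) (i * m) (i.+1 * m))//.
- have E k : ((k * m)%:R / (n * m)%:R : R) = k%:R / n%:R.
    by rewrite !natrM -mulf_div divff ?mulr1// pnatr_eq0 -lt0n.
  by rewrite !E.
- by rewrite leq_mul2r leqnSn orbT.
- by move=> j /le_nm jnm; apply: cU; exact: frac01.
- move=> j k jH kH; apply: cd; try exact: frac01 (le_nm _ _).
  have m0' : 0 < (m%:R : R) by rewrite ltr0n.
  have n0' : 0 < (n%:R : R) by rewrite ltr0n.
  rewrite -mulrBl normrM (@ger0_norm _ (_^-1)) ?invr_ge0 ?ler0n// natrM invfM.
  rewrite mulrCA ler_pdivrMl// mulfV ?gt_eqF// ler_pdivrMr// mul1r.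
  move: jH kH => /andP[j1 j2] /andP[k1 k2].
  move: j1 j2 k1 k2; rewrite -!(ler_nat R) !natrM -[i.+1%:R]natr1 mulrDl mul1r.
  by move=> j1 j2 k1 k2; rewrite ler_norml; apply/andP; split; lra.
Qed.

Lemma sum_steps_radius c d d' n : fine c d n -> fine c d' n ->
  sum_steps d n c = sum_steps d' n c.
Proof.
move=> [n0 d0 cU cd] [_ d'0 c'U cd']; apply: eq_big_nat => i /andP[_ i_n].
have f1 := frac01 n0 (ltnW i_n); have f2 := frac01 n0 i_n.
have close : `|i.+1%:R / n%:R - i%:R / n%:R : R| <= n%:R^-1.
  by rewrite -mulrBl -natr1 addrAC subrr add0r mul1r ger0_norm// invr_ge0 ler0n.
have := cd _ _ f2 f1 close; have := cd' _ _ f2 f1 close => e1 e2.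
(* A first leg of length zero turns [step_add] into a comparison of the radii [d] and [d'] at the
   same point. *)
rewrite -(@step_add d d' (c (i%:R / n%:R)) (c (i%:R / n%:R)))//.
- by rewrite step_refl add0r.
- exact: cU.
- exact: c'U.
- by rewrite subrr normr0 divr_gt0.
- lra.
- lra.
Qed.

(** Both subdivisions are compared with their common refinement into [n * n'] pieces. *)
Lemma sum_steps_indep c d d' n n' : fine c d n -> fine c d' n' ->
  sum_steps d n c = sum_steps d' n' c.
Proof.
move=> fc fc'; have [n0 _ _ _] := fc; have [n'0 _ _ _] := fc'.
rewrite -(sum_steps_mul fc n'0) -(sum_steps_mul fc' n0) [(n' * n)%N]mulnC.
by apply: sum_steps_radius; [exact: fine_mul|rewrite mulnC; exact: fine_mul].
Qed.

Definition square : set (R * R) := `[0, 1]%classic `*` `[0, 1]%classic.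

Lemma squareP s t : square (s, t) <-> 0 <= s <= 1 /\ 0 <= t <= 1.
Proof. by rewrite /square /setX /= !in_itv. Qed.

Definition fine_square (h : R * R -> A) (d : R) (n : nat) :=
  [/\ (0 < n)%N, 0 < d, forall p, square p -> box (h p) d `<=` U &
   forall p q, square p -> square q -> `|p - q| <= n%:R^-1 -> `|h p - h q| < d / 8].

(** A Lebesgue number argument, run twice on the compact square: once for a uniform radius of boxes
    inside [U], once for uniform continuity. In each case a condition stable for small positive
    parameters near every point becomes uniform by the near-covering form of compactness. *)
Lemma fine_square_exists (h : R * R -> A) : {within square, continuous h} ->
  (forall p, square p -> U (h p)) -> exists d n, fine_square h d n.
Proof.
move=> ch hU.
have cK : compact square by apply: compact_setX; exact: segment_compact.
have nc := (near_covering_withinP _).2 ((compact_near_coveringP _).1 cK).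
have chx p e : square p -> 0 < e -> exists2 r, 0 < r &
    forall q, square q -> `|q - p| < r -> `|h q - h p| < e.
  move=> Sp e0; have := (subspace_continuousP _ _).1 ch p Sp.
  move=> /cvgrPdist_lt /(_ e e0); rewrite near_withinE => /nbhs_ballP[r r0 H].
  exists r => // q Sq qp; rewrite distrC; apply: H => //.
  by rewrite -ball_normE /= distrC.
have [d d0 dU] : exists2 d, 0 < d & forall p, square p -> box (h p) d `<=` U.
  have := nc R (0 : R)^'+ (fun d p => box (h p) d `<=` U) _ _.
  case=> [p Sp|/= d /= d0 H].
    have [r r0 rU] := open_box oU (hU p Sp).
    have r20 : 0 < r / 2 by rewrite divr_gt0.
    have [r' r'0 H] := chx p (r / 2) Sp r20.
    exists (ball p r', [set d | 0 < d < r / 2]); first split => /=.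
    - exact: nbhsx_ballx.
    - near=> d; apply/andP; split; near: d; first exact: nbhs_right_gt.
      exact: nbhs_right_lt.
    move=> [q d] /= [pq /andP[d0 dr]] Sq w /boxP wq.
    have /boxP[b1 b2] : `|w - h p| < r.
      rewrite -(subrKA (h q)); apply: le_lt_trans (ler_normD _ _) _.
      have : `|h q - h p| < r / 2.
        by apply: H => //; move: pq; rewrite -ball_normE /= distrC.
      lra.
    exact: rU.
  exists (d / 2); first by rewrite divr_gt0.
  apply: H; rewrite /ball_ /= ?sub0r ?normrN ?gtr0_norm ?divr_gt0//.
  by rewrite ltr_pdivrMr// ltr_pMr// ltr1n.
have d80 : 0 < d / 16 by rewrite divr_gt0.
have [e e0 eH] : exists2 e, 0 < e & forall p, square p -> forall q, square q ->
    `|p - q| < e -> `|h p - h q| < d / 8.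
  have := nc R (0 : R)^'+ (fun e p => forall q, square q ->
    `|p - q| < e -> `|h p - h q| < d / 8) _ _.
  case=> [p Sp|/= e /= e0 H].
    have [r r0 H] := chx p (d / 16) Sp d80.
    exists (ball p (r / 2), [set e | 0 < e < r / 2]); first split => /=.
    - by apply: nbhsx_ballx; rewrite divr_gt0.
    - near=> e; apply/andP; split; near: e; first exact: nbhs_right_gt.
      by apply: nbhs_right_lt; rewrite divr_gt0.
    move=> [q e] /= [pq /andP[e0 er]] Sq q' Sq' qq'.
    have pq2 : `|q - p| < r / 2 by move: pq; rewrite -ball_normE /= distrC.
    have pq' : `|q' - p| < r.
      rewrite -(subrKA q); apply: le_lt_trans (ler_normD _ _) _.
      rewrite distrC; lra.
    have pqr : `|q - p| < r by lra.
    have := H q Sq pqr; have := H q' Sq' pq' => h1 h2.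
    rewrite -(subrKA (h p)); apply: le_lt_trans (ler_normD _ _) _.
    rewrite [in X in _ + X]distrC; lra.
  exists (e / 2); first by rewrite divr_gt0.
  apply: H; rewrite /ball_ /= ?sub0r ?normrN ?gtr0_norm ?divr_gt0//.
  by rewrite ltr_pdivrMr// ltr_pMr// ltr1n.
pose n := (Num.trunc e^-1).+1.
have n_e : n%:R^-1 < e.
  rewrite -[ltRHS]invrK ltf_pV2 ?posrE ?invr_gt0 ?ltr0n//.
  exact: truncnS_gt.
exists d, n; split=> // p q Sp Sq pq; apply: eH => //; exact: le_lt_trans n_e.
Unshelve. all: by end_near. Qed.

(** Consecutive rows of the grid have equal sums: around each cell the two ways to the opposite
    corner both give the diagonal step, and the vertical sides contribute nothing because [h] stays
    at [z] there. *)
Lemma sum_steps_square h d n z : fine_square h d n ->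
  (forall s, 0 <= s <= 1 -> h (s, 0) = z /\ h (s, 1) = z) ->
  sum_steps d n (fun t => h (0, t)) = sum_steps d n (fun t => h (1, t)).
Proof.
move=> [n0 d0 hU hd] hz.
pose q i j := h (i%:R / n%:R, j%:R / n%:R).
have Sq i j : (i <= n)%N -> (j <= n)%N -> square (i%:R / n%:R, j%:R / n%:R).
  by move=> i_n jn; apply/squareP; split; exact: frac01.
have n0' : 0 < (n%:R : R) by rewrite ltr0n.
have fr i i' : (i <= i' <= i.+1)%N -> `|i'%:R / n%:R - i%:R / n%:R : R| <= n%:R^-1.
  move=> /andP[]; rewrite -!(ler_nat R) -natr1 => h1 h2.
  rewrite -mulrBl normrM (@ger0_norm _ (_^-1)) ?invr_ge0 ?ler0n//.
  by rewrite ler_piMl ?invr_ge0 ?ler0n// ler_norml; apply/andP; split; lra.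
have qd i j i' j' : (i <= i' <= i.+1)%N -> (j <= j' <= j.+1)%N -> (i' <= n)%N ->
    (j' <= n)%N -> `|q i' j' - q i j| < d / 8.
  move=> hi hj i'n j'n; apply: hd.
  - exact: Sq.
  - by case/andP: hi => hi _; case/andP: hj => hj _; apply: Sq; exact: leq_trans i'n || exact: leq_trans j'n.
  - by rewrite prod_normE /= ge_max; apply/andP; split; exact: fr.
have qU i j : (i <= n)%N -> (j <= n)%N -> box (q i j) d `<=` U.
  by move=> i_n jn; apply: hU; exact: Sq.
(* Accumulated over the first [J] cells of a row: lower side and right edge against left edge and
   upper side. *)
have cell i J : (i < n)%N -> (J <= n)%N ->
    \sum_(0 <= j < J) step d (q i j) (q i j.+1) + step d (q i J) (q i.+1 J) =
    step d (q i 0%N) (q i.+1 0%N) + \sum_(0 <= j < J) step d (q i.+1 j) (q i.+1 j.+1).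
  move=> i_n; elim: J => [|J IH] Jn.
    by rewrite !big_geq // add0r addr0.
  have {}IH := IH (ltnW Jn); rewrite !big_nat_recr //=.
  have d1 : `|q i J.+1 - q i J| < d / 8 by apply: qd; rewrite ?leqnn ?leqnSn // ltnW.
  have d2 : `|q i.+1 J.+1 - q i J.+1| < d / 8 by apply: qd; rewrite ?leqnn ?leqnSn.
  have d3 : `|q i.+1 J - q i J| < d / 8 by apply: qd; rewrite ?leqnn ?leqnSn // ltnW.
  have d4 : `|q i.+1 J.+1 - q i.+1 J| < d / 8 by apply: qd; rewrite ?leqnn ?leqnSn.
  have u1 := qU _ _ (ltnW i_n) Jn; have u2 := qU _ _ i_n (ltnW Jn).
  have u3 := qU _ _ (ltnW i_n) (ltnW Jn).
  have E1 : step d (q i J) (q i J.+1) + step d (q i J.+1) (q i.+1 J.+1) =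
      step d (q i J) (q i.+1 J.+1) by apply: step_add => //; lra.
  have E2 : step d (q i J) (q i.+1 J) + step d (q i.+1 J) (q i.+1 J.+1) =
      step d (q i J) (q i.+1 J.+1) by apply: step_add => //; lra.
  lra.
have row i : (i <= n)%N -> \sum_(0 <= j < n) step d (q 0%N j) (q 0%N j.+1) =
    \sum_(0 <= j < n) step d (q i j) (q i j.+1).
  elim: i => [//|i IH] i_n; rewrite IH ?(ltnW i_n)//.
  have := cell i n i_n (leqnn n).
  have q0 k : (k <= n)%N -> q k 0%N = z.
    by move=> kn; rewrite /q mul0r; have [] := hz _ (frac01 n0 kn).
  have qn k : (k <= n)%N -> q k n = z.
    by move=> kn; rewrite /q divff ?gt_eqF//; have [] := hz _ (frac01 n0 kn).
  by rewrite !q0 ?qn ?(ltnW i_n)// step_refl add0r addr0.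
have := row n (leqnn n); rewrite /q mul0r divff ?gt_eqF//.
Qed.

Hypothesis scU : simply_connected U.

Lemma fine_row (h : R * R -> A) d n s (c : R -> A) : fine_square h d n -> 0 <= s <= 1 ->
  (forall t, 0 <= t <= 1 -> h (s, t) = c t) -> fine c d n.
Proof.
move=> [n0 d0 hU hd] s01 hc; split=> // [t t01|t t' t01 t'01 tt'].
  by rewrite -hc//; apply: hU; apply/squareP.
rewrite -!hc//; apply: hd; [exact/squareP|exact/squareP|].
by rewrite prod_normE /= subrr normr0 ge_max tt' invr_ge0 ler0n.
Qed.

(** A path is viewed as a square that is constant in its first variable. *)
Lemma fine_path_exists (c : R -> A) : continuous c -> (forall t, U (c t)) ->
  exists d n, fine c d n.
Proof.
move=> cc cU; have [|//|d [n fs]] := @fine_square_exists (fun p => c p.2).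
  apply: continuous_subspaceT => p.
  by apply: (@continuous_comp _ _ _ (fun p : R * R => p.2) c); [exact: cvg_snd|exact: cc].
by exists d, n; apply: (fine_row (s := 0) fs) => //; rewrite lexx ler01.
Qed.

(** The homotopy carries the sum of the loop to that of a constant path, all of whose steps
    vanish. *)
Lemma loop_sum (c : R -> A) d n : path_in U c -> c 0 = c 1 -> fine c d n ->
  sum_steps d n c = 0.
Proof.
move=> pc c01 fc; have [_ /(_ c pc c01)[h [ch hU h0 h1]]] := scU.
have [d' [n' fs]] : exists d n, fine_square h d n.
  apply: fine_square_exists => // -[s t] /squareP[s1 t1]; exact: hU.
have I0 : 0 <= (0 : R) <= 1 by rewrite lexx ler01.
have hc t : 0 <= t <= 1 -> h (0, t) = c t by move=> /h0[].
have fc' := fine_row fs I0 hc.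
rewrite (sum_steps_indep fc fc').
have [n'0 _ _ _] := fc'.
transitivity (sum_steps d' n' (fun t => h (0, t))).
  apply: eq_big_nat => i /andP[_ i_n].
  by rewrite !hc//; apply: frac01 => //; exact: ltnW.
rewrite (sum_steps_square fs h1) /sum_steps big_nat big1// => i /andP[_ i_n].
have [_ ->] := h0 _ (frac01 n'0 (ltnW i_n)); have [_ ->] := h0 _ (frac01 n'0 i_n).
exact: step_refl.
Qed.

(** Precomposition with this retraction turns a path continuous within the unit interval into one
    continuous on all of [R] and constant outside, so that paths can be added and reparametrised
    freely. *)
Definition clamp (t : R) := Num.max 0 (Num.min 1 t).

Lemma clamp01 t : 0 <= clamp t <= 1.
Proof. by rewrite /clamp le_max lexx /= ge_max ler01 ge_min lexx. Qed.
Lemma clamp_id t : 0 <= t <= 1 -> clamp t = t.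
Proof. by move=> /andP[t0 t1]; rewrite /clamp (min_idPr t1) (max_idPr t0). Qed.
Lemma clamp_le0 t : t <= 0 -> clamp t = 0.
Proof.
move=> t0; rewrite /clamp (min_idPr (le_trans t0 ler01)); exact/max_idPl.
Qed.
Lemma clamp_ge1 t : 1 <= t -> clamp t = 1.
Proof. by move=> t1; rewrite /clamp (min_idPl t1); exact/max_idPr. Qed.
Lemma clamp_continuous : continuous clamp.
Proof.
move=> t; apply: continuous_max; first exact: cst_continuous.
by apply: continuous_min; [exact: cst_continuous|exact: cvg_id].
Qed.

Lemma continuous_path_clamp (c : R -> A) : {within `[0, 1], continuous c} ->
  continuous (c \o clamp).
Proof.
move=> cc t; apply: (@cvg_comp _ _ _ clamp c _ (within `[0, 1]%classic (nbhs (clamp t)))).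
  move=> B HB.
  have H : nbhs t (clamp @^-1` [set y | `[0, 1]%classic y -> B y]).
    exact: (@clamp_continuous t _ HB).
  apply: filterS H => x /=; apply; rewrite in_itv /=; exact: clamp01.
have H1 : `[0, 1]%classic (clamp t) by rewrite /= in_itv /=; exact: clamp01.
exact: ((subspace_continuousP _ _).1 cc _ H1).
Qed.

Lemma extended_path z w : U z -> U w -> exists c : R -> A,
  [/\ continuous c, forall t, U (c t), forall t, t <= 0 -> c t = z &
      forall t, 1 <= t -> c t = w].
Proof.
move=> Uz Uw; have [/(_ z w Uz Uw)[c [[cc cU] c0 c1]] _] := scU.
exists (c \o clamp); split=> [t|t|t t0|t t1] /=.
- exact: continuous_path_clamp.
- by apply: cU; exact: clamp01.
- by rewrite clamp_le0.
- by rewrite clamp_ge1.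
Qed.

(** The loop goes from [z0] to [z] by [cz], along the segment to [w], and back by [cw]. Its sum
    vanishes, and the middle part is the increment of the local primitive at [z]. *)
Lemma three_piece_loop z0 z w (cz cw : R -> A) (r d1 d2 : R) (n1 n2 : nat) : U z0 -> 0 < r ->
  box z r `<=` U -> box z (r / 2) w ->
  continuous cz -> (forall t, U (cz t)) -> (forall t, t <= 0 -> cz t = z0) ->
  (forall t, 1 <= t -> cz t = z) ->
  continuous cw -> (forall t, U (cw t)) -> (forall t, t <= 0 -> cw t = z0) ->
  (forall t, 1 <= t -> cw t = w) ->
  fine cz d1 n1 -> fine cw d2 n2 ->
  sum_steps d2 n2 cw = sum_steps d1 n1 cz + (pf (z, r) w - pf (z, r) z).
Proof.
move=> Uz0 r0 zU Bw ccz czU cz0 cz1 ccw cwU cw0 cw1 f1 f2.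
pose sg (s : R) : A := z + clamp s *: (w - z).
have csg : continuous sg.
  move=> s; apply: cvgD; first exact: cvg_cst.
  by apply: cvgZr_tmp; exact: clamp_continuous.
have sg0 s : s <= 0 -> sg s = z by move=> s0; rewrite /sg clamp_le0// scale0r addr0.
have sg1 s : 1 <= s -> sg s = w by move=> s1; rewrite /sg clamp_ge1// scale1r addrC subrK.
have sgB s : box z (r / 2) (sg s).
  apply/boxP; rewrite /sg addrAC subrr add0r normrZ.
  have /andP[k0 k1] := clamp01 s; rewrite ger0_norm//.
  by move/boxP: Bw; apply: le_lt_trans; rewrite ler_piMl.
have sgU s : U (sg s) by apply: zU; apply/boxP; have /boxP := sgB s; lra.
(* A sum rather than a definition by cases: on each third two of the three terms are constant since
   the pieces are clamped, so continuity holds without gluing. *)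
pose L (t : R) : A := cz (3 * t) + (sg (3 * t - 1) - z) + (cw (3 - 3 * t) - w).
have L0 u : u <= 1 -> L (u / 3) = cz u.
  move=> u1; rewrite /L (_ : 3 * (u / 3) = u); last by field.
  by rewrite sg0; [rewrite cw1; [rewrite !subrr !addr0|lra]|lra].
have L1 u : 0 <= u <= 1 -> L ((1 + u) / 3) = sg u.
  move=> /andP[u0 u1]; rewrite /L (_ : 3 * ((1 + u) / 3) = 1 + u); last by field.
  rewrite cz1; last by lra.
  rewrite cw1; last by lra.
  by rewrite subrr addr0 [1 + u]addrC addrK addrC subrK.
have L2 u : 0 <= u -> L ((2 + u) / 3) = cw (1 - u).
  move=> u0; rewrite /L (_ : 3 * ((2 + u) / 3) = 2 + u); last by field.
  rewrite cz1; last by lra.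
  rewrite sg1; last by lra.
  rewrite (_ : 3 - (2 + u) = 1 - u); last by ring.
  ring.
have cL : continuous L.
  have lin (a b : R) : continuous (fun t : R => a * t + b).
    by move=> t; apply: cvgD; [exact: cvgMl_tmp cvg_id|exact: cvg_cst].
  move=> t; apply: cvgD; first apply: cvgD.
  - apply: (@continuous_comp _ _ _ (fun t : R => 3 * t) cz); last exact: ccz.
    exact: cvgMl_tmp cvg_id.
  - apply: cvgB; last exact: cvg_cst.
    by apply: (@continuous_comp _ _ _ (fun t : R => 3 * t - 1) sg); [exact: lin|exact: csg].
  - apply: cvgB; last exact: cvg_cst.
    apply: (@continuous_comp _ _ _ (fun t : R => 3 - 3 * t) cw); last exact: ccw.
    by apply: cvgB; [exact: cvg_cst|exact: cvgMl_tmp cvg_id].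
have LU t : U (L t).
  have [t1|t1] := leP (3 * t) 1.
    by have -> : t = (3 * t) / 3; [field|rewrite L0].
  have [t2|t2] := leP (3 * t) 2.
    have -> : t = (1 + (3 * t - 1)) / 3 by field.
    by rewrite L1 //; apply/andP; split; lra.
  have -> : t = (2 + (3 * t - 2)) / 3 by field.
  by rewrite L2 //; lra.
(* The mesh is made a multiple of three so that each third of the loop is a union of subdivision
   intervals. *)
have [d' [n' fL']] := fine_path_exists cL LU.
have fL : fine L d' (3 * n') by rewrite mulnC; exact: fine_mul.
have [n3 d'0 LB Ld] := fL; have n'0 : (0 < n')%N by have [] := fL'.
have n'R : 0 < (n'%:R : R) by rewrite ltr0n.
have pL : path_in U L by split=> //; exact: continuous_subspaceT.
have Lz : L 0 = L 1.
  have := L0 0 ler01; rewrite mul0r => ->.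
  have := L2 1 ler01; rewrite (_ : (2 + 1) / 3 = 1 :> R); last by field.
  by move=> ->; rewrite subrr cz0// cw0.
have S0 := loop_sum pL Lz fL.
have thirds (s t : R) : `|s - t| <= n'%:R^-1 -> `|s / 3 - t / 3| <= (3 * n')%:R^-1.
  move=> st; rewrite -mulrBl normrM (@ger0_norm _ (3^-1)) ?invr_ge0 ?ler0n//.
  have -> : (3 * n')%:R^-1 = n'%:R^-1 / 3 :> R by rewrite natrM; field; rewrite gt_eqF.
  by rewrite ler_pM2r ?invr_gt0 ?ltr0n.
have fz : fine cz d' n'.
  split=> // [t /andP[t0 t1]|s t /andP[s0 s1] /andP[t0 t1] st].
    by rewrite -(L0 t t1); apply: LB; apply/andP; split; lra.
  rewrite -(L0 t t1) -(L0 s s1); apply: Ld; try (apply/andP; split; lra).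
  exact: thirds.
have fw' : fine (fun s => cw (1 - s)) d' n'.
  split=> // [t /andP[t0 t1]|s t /andP[s0 s1] /andP[t0 t1] st].
    by rewrite -(L2 t t0); apply: LB; apply/andP; split; lra.
  rewrite -(L2 t t0) -(L2 s s0); apply: Ld; try (apply/andP; split; lra).
  by apply: thirds; rewrite opprD addrACA subrr add0r.
have fw : fine cw d' n'.
  have [_ _ wB wd] := fw'.
  split=> // [t /andP[t0 t1]|s t /andP[s0 s1] /andP[t0 t1] st].
    have := wB (1 - t); rewrite subKr; apply; apply/andP; split; lra.
  have := wd (1 - s) (1 - t); rewrite !subKr; apply; try (apply/andP; split; lra).
  by rewrite (_ : 1 - s - (1 - t) = t - s) 1?distrC//; ring.
have fs : forall t, 0 <= t <= 1 -> box (sg t) d' `<=` U.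
  move=> t t01; rewrite -(L1 t t01); case/andP: t01 => t0 t1; apply: LB.
  by apply/andP; split; lra.
have ds s t : 0 <= s <= 1 -> 0 <= t <= 1 -> `|s - t| <= n'%:R^-1 ->
    `|sg s - sg t| < d' / 8.
  move=> s01 t01 st; rewrite -(L1 t t01) -(L1 s s01).
  move: s01 t01 => /andP[s0 s1] /andP[t0 t1].
  apply: Ld; try (apply/andP; split; lra).
  by apply: thirds; rewrite opprD addrACA subrr add0r.
have nn k : ((k%:R : R) / (3 * n')%:R) = k%:R / n'%:R / 3.
  by rewrite natrM invfM mulrA mulrAC.
have near_frac k : (k < n')%N -> `|k.+1%:R / n'%:R - k%:R / n'%:R : R| <= n'%:R^-1.
  by move=> _; rewrite -mulrBl -natr1 addrAC subrr add0r mul1r ger0_norm// invr_ge0 ler0n.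
have part0 : \sum_(0 <= j < n') step d' (L (j%:R / (3 * n')%:R)) (L (j.+1%:R / (3 * n')%:R))
    = sum_steps d' n' cz.
  apply: eq_big_nat => j /andP[_ jn]; rewrite !nn !L0//.
    by have /andP[] := frac01 n'0 jn.
  by have /andP[] := frac01 n'0 (ltnW jn).
have shift_frac (i k : nat) : (k + i * n')%:R / n'%:R = i%:R + k%:R / n'%:R :> R.
  by rewrite natrD natrM; field; rewrite gt_eqF.
(* Every step of the middle third is reread in the single primitive [pf (z, r)], after which the sum
   telescopes. *)
have part1 : \sum_(n' <= j < 2 * n') step d' (L (j%:R / (3 * n')%:R)) (L (j.+1%:R / (3 * n')%:R))
    = pf (z, r) w - pf (z, r) z.
  rewrite -{1}[n']add0n big_addn mul2n -addnn addnK.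
  have shift1 k : (k + n')%:R / n'%:R = 1 + k%:R / n'%:R :> R.
    by rewrite -(shift_frac 1%N) mul1n.
  transitivity (\sum_(0 <= j < n') (pf (z, r) (sg (j.+1%:R / n'%:R)) - pf (z, r) (sg (j%:R / n'%:R)))).
    apply: eq_big_nat => j /andP[_ jn].
    have j1 := frac01 n'0 (ltnW jn); have j2 := frac01 n'0 jn.
    rewrite -addSn !nn !(shift1 _) !L1// /step.
    set p := sg (j%:R / n'%:R); set q := sg (j.+1%:R / n'%:R).
    have pq : `|q - p| < d' / 8 by apply: ds => //; exact: near_frac.
    pose B := box z (r / 2) `&` box p (d' / 2).
    have BU : B `<=` U by move=> u [/boxP bu _]; apply: zU; apply/boxP; lra.
    apply: (@primitive_unique B P Q).
    - by apply: openI; apply: open_boxE; rewrite divr_gt0.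
    - exact: smooth_subset sP.
    - exact: smooth_subset sQ.
    - by move=> u [_ Bu]; apply: (pfP d'0) Bu; exact: fs.
    - by move=> u [Bu _]; exact: (pfP r0).
    - move=> t /andP[t0 t1]; split; apply/boxP.
        have -> : p + t *: (q - p) - z = (1 - t) *: (p - z) + t *: (q - z).
          rewrite !scalerBr !scalerBl !scale1r.
          by move: (t *: p) (t *: q) (t *: z) => u v u'; ring.
        apply: le_lt_trans (ler_normD _ _) _; rewrite !normrZ ger0_norm ?subr_ge0//.
        rewrite (ger0_norm t0).
        have /boxP b1 : box z (r / 2) p by exact: sgB.
        have /boxP b2 : box z (r / 2) q by exact: sgB.
        have [->|tn] := eqVneq t 0; first by rewrite subr0 mul1r mul0r addr0.
        have tp : 0 < t by rewrite lt_neqAle eq_sym tn.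
        have c1 : (1 - t) * `|p - z| <= (1 - t) * (r / 2) by rewrite ler_wpM2l ?subr_ge0// ltW.
        have c2 : t * `|q - z| < t * (r / 2) by rewrite ltr_pM2l.
        lra.
      rewrite addrAC subrr add0r normrZ ger0_norm//.
      have := ler_piMl (normr_ge0 (q - p)) t1; lra.
  rewrite telescope_sumr // divff ?gt_eqF// mul0r sg1 ?lexx// sg0 ?lexx//.
(* The last third runs along [cw] backwards: the index is reversed and each step changes sign by
   [step_sym]. *)
have part2 : \sum_(2 * n' <= j < 3 * n') step d' (L (j%:R / (3 * n')%:R)) (L (j.+1%:R / (3 * n')%:R))
    = - sum_steps d' n' cw.
  rewrite -{1}[(2 * n')%N]add0n big_addn -mulnBl mul1n.
  rewrite /sum_steps big_nat_rev /= add0n -sumrN; apply: eq_big_nat => j /andP[_ jn].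
  have j1 := frac01 n'0 (ltnW jn); have j2 := frac01 n'0 jn.
  have fr1 : (n' - j.+1)%:R / n'%:R = 1 - j.+1%:R / n'%:R :> R.
    by rewrite natrB// mulrBl divff ?gt_eqF.
  have fr2 : (n' - j.+1).+1%:R / n'%:R = 1 - j%:R / n'%:R :> R.
    by rewrite -subSn// subSS natrB ?(ltnW jn)// mulrBl divff ?gt_eqF.
  rewrite -addSn !nn !(shift_frac 2%N) fr1 fr2.
  rewrite !L2; try by rewrite subr_ge0; case/andP: j1 j2 => ? ? /andP[].
  rewrite !subKr; case: fw => _ _ wB wd; apply: step_sym => //; try exact: wB.
  have := wd _ _ j2 j1 (near_frac j jn); rewrite distrC; lra.
move: S0; rewrite {1}/sum_steps (@big_cat_nat _ _ _ n') //=; last by rewrite leq_pmull.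
rewrite (@big_cat_nat _ _ _ (2 * n') n') //=; last by rewrite leq_mul2r orbT.
  rewrite part0 part1 part2 (sum_steps_indep f1 fz) (sum_steps_indep f2 fw) => /eqP.
  by rewrite addrA subr_eq0 => /eqP ->.
by rewrite leq_pmull.
Qed.

End Fixed.

(** The value at [z] is the sum along a chosen path from a base point. Near [z] it differs from the
    local primitive by a constant, by [three_piece_loop], and so has the required derivatives. *)
Lemma global_primitive (U : set A) (P Q : A -> R) : open U -> simply_connected U ->
  smooth_on U P -> smooth_on U Q ->
  (forall z, U z -> partial_y P z = partial_x Q z) ->
  exists f, forall z, U z -> primitive_of P Q f z.
Proof.
move=> oU scU sP sQ PQ; have [pf pfP] := local_primitives sP sQ PQ.
have [[z0 Uz0]|U0] := pselect (exists z0, U z0); last first.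
  by exists (fun=> 0) => z Uz; case: U0; exists z.
have /choice[F FP] : forall z, exists v : R, U z -> exists (c : R -> A) d n,
    [/\ continuous c, (forall t, U (c t)) /\ (forall t, t <= 0 -> c t = z0),
     forall t, 1 <= t -> c t = z, fine U c d n & v = sum_steps pf d n c].
  move=> z; have [Uz|nU] := pselect (U z); last by exists 0.
  have [c [cc cU c0 c1]] := extended_path scU Uz0 Uz.
  have [d [n f]] := fine_path_exists oU cc cU.
  by exists (sum_steps pf d n c) => _; exists c, d, n.
exists F => z Uz.
have [r r0 rU] := open_box oU Uz.
have BU : box z r `<=` U by move=> w [? ?]; exact: rU.
have FE w : box z (r / 2) w -> pf (z, r) w + (F z - pf (z, r) z) = F w.
  move=> Bw; have Uw : U w by apply: BU; move: Bw; rewrite !boxP; lra.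
  have [cz [d1 [n1 [ccz [czU cz0] cz1 f1 ->]]]] := FP z Uz.
  have [cw [d2 [n2 [ccw [cwU cw0] cw1 f2 ->]]]] := FP w Uw.
  rewrite (three_piece_loop oU sP sQ pfP scU Uz0 r0 BU Bw ccz czU cz0 cz1 ccw cwU cw0 cw1 f1 f2).
  ring.
have oB : open (box z (r / 2)) by apply: open_boxE; rewrite divr_gt0.
have Bz : box z (r / 2) z by apply: box_center; rewrite divr_gt0.
have [D1 D2] := pfP z r r0 BU z Bz.
split; apply: (is_derive_ext oB Bz FE).
- by rewrite -[P z]addr0; apply: is_deriveD'.
- by rewrite -[Q z]addr0; apply: is_deriveD'.
Qed.

End GlobalPrimitive.

(** * Gauss and Ricci equations *)

Section FrameEquations.
Context {R : realType}.
Local Notation A := (lorentz R).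
Local Notation E4 := 'rV[R]_4.
Implicit Types (u v w : E4) (z : A).

Lemma dotp_mul u v : u *m v^T = (dotp u v)%:M.
Proof.
apply/matrixP => i j; rewrite !ord1 !mxE eqxx mulr1n /dotp.
by apply: eq_bigr => k _; rewrite mxE.
Qed.

Lemma scalar0_mx (a : R) : (a%:M : 'M[R]_1) = 0 -> a = 0.
Proof. by move=> /matrixP/(_ 0 0); rewrite !mxE eqxx mulr1n. Qed.

Lemma jac_orth (F : A -> E4) z v : jac F z *m v^T = 0 <->
  dotp (partial_x F z) v = 0 /\ dotp (partial_y F z) v = 0.
Proof.
have -> : jac F z *m v^T = col_mx (partial_x F z *m v^T) (partial_y F z *m v^T).
  exact: (@mul_col_mx _ 1 1 4 1 (partial_x F z) (partial_y F z) v^T).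
rewrite (dotp_mul (partial_x F z)) (dotp_mul (partial_y F z)); split=> [E|[-> ->]]; last first.
  have -> : (0%:M : 'M[R]_1) = 0 by apply/matrixP => i j; rewrite !mxE mul0rn.
  exact: (@col_mx0 _ 1 1 1).
have /eq_col_mx[e1 e2] : col_mx (dotp (partial_x F z) v)%:M (dotp (partial_y F z) v)%:M =
  col_mx (0 : 'M[R]_1) (0 : 'M[R]_1) by rewrite col_mx0; exact: E.
by rewrite (scalar0_mx e1) (scalar0_mx e2).
Qed.

Section OneFrame.
Variables (F : A -> E4) (z : A) (n1 n2 : E4).
Hypotheses (n11 : dotp n1 n1 = 1) (n22 : dotp n2 n2 = 1) (n12 : dotp n1 n2 = 0).
Hypotheses (Jn1 : jac F z *m n1^T = 0) (Jn2 : jac F z *m n2^T = 0).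
Let M : 'M[R]_4 := col_mx (jac F z) (col_mx n1 n2).
Hypothesis M0 : \det M != 0.

Let N : 'M[R]_(1 + 1, 4) := col_mx n1 n2.

Lemma frame_NN : N *m N^T = 1%:M.
Proof.
rewrite /N tr_col_mx mul_col_row !dotp_mul n11 n22 n12 dotpC n12 raddf0.
by rewrite -scalar_mx_block.
Qed.

Lemma frame_JN : jac F z *m N^T = 0.
Proof. by rewrite /N tr_col_mx mul_mx_row Jn1 Jn2 row_mx0. Qed.

Lemma frame_det_gram : \det (gram F z) = \det M ^+ 2.
Proof.
pose M2 : 'M[R]_(2 + 2, 4) := M.
have NJ : N *m (jac F z)^T = 0.
  by rewrite -[N]trmxK -trmx_mul frame_JN trmx0.
(* The normal vectors are orthonormal and orthogonal to the rows of the Jacobian, so the Gram matrix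
   of the full frame is block diagonal with an identity block. *)
have E : M2 *m M2^T = block_mx (gram F z) 0 0 1%:M.
  transitivity (block_mx (jac F z *m (jac F z)^T) (jac F z *m N^T)
    (N *m (jac F z)^T) (N *m N^T)); last by rewrite frame_JN frame_NN NJ.
  by rewrite -mul_col_row -tr_col_mx.
have : \det (M *m M^T) = \det (gram F z).
  by have := congr1 determinant E; rewrite det_lblock det1 mulr1.
by rewrite det_mulmx det_tr -expr2.
Qed.

Lemma frame_gram_unit : gram F z \in unitmx.
Proof. by rewrite unitmxE frame_det_gram unitfE expf_neq0. Qed.

(** The difference of the two sides is orthogonal to every row of the invertible frame matrix [M],
    hence zero. This removes the inverse Gram matrix from all later derivatives. *)
Lemma nor_projE v : nor_proj F z v = dotp v n1 *: n1 + dotp v n2 *: n2.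
Proof.
apply/eqP; rewrite -subr_eq0; apply/eqP; set w := _ - _.
have nJ (n : E4) : jac F z *m n^T = 0 -> n *m (jac F z)^T = 0.
  by move=> H; rewrite -[n]trmxK -trmx_mul H trmx0.
have wJ : w *m (jac F z)^T = 0.
  rewrite /w /nor_proj /tan_proj mulmxBl mulmxBl mulmxDl -!scalemxAl (nJ _ Jn1) (nJ _ Jn2).
  rewrite !scaler0 addr0 subr0.
  by rewrite -[_ *m jac F z *m _]mulmxA -/(gram F z) mulmxKV ?frame_gram_unit// subrr.
have wn (n : E4) : jac F z *m n^T = 0 ->
    dotp v n = dotp v n1 * dotp n1 n + dotp v n2 * dotp n2 n -> w *m n^T = 0.
  move=> Jn E; rewrite /w /nor_proj /tan_proj !mulmxBl -[_ *m jac F z *m _]mulmxA Jn.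
  rewrite mulmx0 subr0 mulmxDl -!scalemxAl !dotp_mul E.
  by rewrite !scale_scalar_mx -raddfD subrr.
have w1 : w *m n1^T = 0 by apply: wn => //; rewrite n11 dotpC [dotp n2 _]dotpC n12 dotpC; ring.
have w2 : w *m n2^T = 0 by apply: wn => //; rewrite n22 n12; ring.
have wM : w *m M^T = 0.
  have -> : M^T = row_mx (jac F z)^T (row_mx n1^T n2^T).
    by rewrite -tr_col_mx -[RHS]tr_col_mx.
  transitivity (row_mx (w *m (jac F z)^T) (row_mx (w *m n1^T) (w *m n2^T))).
    by rewrite -!mul_mx_row.
  by rewrite wJ w1 w2 row_mx0 row_mx0.
have MU : M^T \in unitmx by rewrite unitmx_tr unitmxE unitfE.
by rewrite -[w](mulmxK MU) wM mul0mx.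
Qed.

End OneFrame.

Section FrameField.
Variables (W : set A) (F : A -> E4) (n1 n2 : A -> E4).
Hypotheses (oW : open W) (sF : smooth_on W F).
Hypothesis fr : oriented_normal_frame W F n1 n2.

Let s1 : smooth_on W n1. Proof. by case: fr. Qed.
Let s2 : smooth_on W n2. Proof. by case: fr. Qed.

Lemma frame_facts z : W z ->
  [/\ dotp (n1 z) (n1 z) = 1, dotp (n2 z) (n2 z) = 1, dotp (n1 z) (n2 z) = 0,
      [/\ dotp (partial_x F z) (n1 z) = 0, dotp (partial_y F z) (n1 z) = 0,
        dotp (partial_x F z) (n2 z) = 0 & dotp (partial_y F z) (n2 z) = 0] &
      forall v, nor_proj F z v = dotp v (n1 z) *: n1 z + dotp v (n2 z) *: n2 z].
Proof.
move=> Wz; have [_ _ /(_ z Wz)[e11 e22 e12 [J1 J2] d]] := fr.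
have [a b] := (jac_orth _ _ _).1 J1; have [a' b'] := (jac_orth _ _ _).1 J2.
split=> // v; apply: nor_projE => //; by rewrite gt_eqF.
Qed.

Lemma frame_gram_gt0 z : W z -> 0 < \det (gram F z).
Proof.
move=> Wz; have [_ _ /(_ z Wz)[e11 e22 e12 [J1 J2] d]] := fr.
by rewrite (frame_det_gram e11 e22 e12 J1 J2) exprn_gt0.
Qed.

Lemma dotp_derive0 (Y Z : A -> E4) (c : R) z (v : A) (dY dZ : E4) : W z ->
  (forall q, W q -> dotp (Y q) (Z q) = c) ->
  is_derive z v Y dY -> is_derive z v Z dZ -> dotp dY (Z z) = - dotp (Y z) dZ.
Proof.
move=> Wz YZ DY DZ; have [_ e1] := is_derive_dotp DY DZ.
have : 'D_v (fun q => dotp (Y q) (Z q)) z = 0.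
  by rewrite (@derive_ext _ _ W _ (fun=> c) z v oW Wz YZ) derive_cst.
by rewrite e1 => E; apply/eqP; rewrite -addr_eq0 E.
Qed.

Lemma dotp_nor_tangent z v T : W z -> dotp T (n1 z) = 0 -> dotp T (n2 z) = 0 ->
  dotp (nor_proj F z v) T = 0.
Proof.
move=> Wz T1 T2; have [_ _ _ _ ->] := frame_facts Wz.
by rewrite dotpDl !dotpZl ![dotp _ T]dotpC T1 T2; ring.
Qed.

(** The inner tangential projection is written as the identity minus the normal part. After pairing
    with a tangent [T], only the terms where [n1] and [n2] themselves are differentiated survive
    from that part. *)
Lemma tan_nabla_twice z (v w : A) (Y G : A -> E4) (Yvw n1v n2v T : E4) : W z ->
  (forall p, W p -> 'D_w Y p = G p) -> is_derive z v G Yvw ->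
  is_derive z v n1 n1v -> is_derive z v n2 n2v ->
  dotp T (n1 z) = 0 -> dotp T (n2 z) = 0 ->
  dotp (tan_nabla F v (tan_nabla F w Y) z) T =
  dotp Yvw T - dotp (G z) (n1 z) * dotp n1v T - dotp (G z) (n2 z) * dotp n2v T.
Proof.
move=> Wz YG DG D1 D2 T1 T2.
have tanE (u : E4) : dotp (tan_proj F z u) T = dotp u T.
  have -> : tan_proj F z u = u - nor_proj F z u by rewrite /nor_proj subKr.
  by rewrite dotpDl dotpNl dotp_nor_tangent// subr0.
rewrite {1}/tan_nabla tanE.
pose H p := G p + (- (dotp (G p) (n1 p) *: n1 p) + - (dotp (G p) (n2 p) *: n2 p)).
have tH p : W p -> tan_nabla F w Y p = H p.
  move=> Wp; rewrite /tan_nabla /H -opprD -YG//.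
  have -> : tan_proj F p ('D_w Y p) = 'D_w Y p - nor_proj F p ('D_w Y p).
    by rewrite /nor_proj subKr.
  by have [_ _ _ _ ->] := frame_facts Wp.
rewrite (@derive_ext _ _ W _ H z v oW Wz tH).
have DS1 := is_derive_scale (is_derive_dotp DG D1) D1.
have DS2 := is_derive_scale (is_derive_dotp DG D2) D2.
have [_ ->] := is_deriveD' DG (is_deriveD' (is_deriveN DS1) (is_deriveN DS2)).
rewrite !dotpDl !dotpNl !dotpDl !dotpZl ![dotp (_ z) T]dotpC T1 T2; ring.
Qed.

(** The third derivatives of [F] cancel by symmetry. Differentiating the orthogonality of
    [partial_y F] to the normals turns the second fundamental form into products with the
    derivatives of [n1] and [n2], so only the normal frame is differentiated in the result. *)
Lemma gauss_equation z : W z -> gauss_curvature F z =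
  ((dotp (partial_y F z) (partial_y n1 z) * dotp (partial_x n1 z) (partial_x F z)
    - dotp (partial_y F z) (partial_x n1 z) * dotp (partial_y n1 z) (partial_x F z))
   + (dotp (partial_y F z) (partial_y n2 z) * dotp (partial_x n2 z) (partial_x F z)
    - dotp (partial_y F z) (partial_x n2 z) * dotp (partial_y n2 z) (partial_x F z)))
  / \det (gram F z).
Proof.
move=> Wz; rewrite /gauss_curvature; congr (_ / _).
have [_ _ _ [x1 y1 x2 y2] _] := frame_facts Wz.
rewrite /curv dotpDl dotpNl.
have sY := smooth_y sF.
have E1 := tan_nabla_twice Wz (fun p _ => esym (partial_yE (partial_y F) p))
  (smooth_dx (smooth_y sY) Wz) (smooth_dx s1 Wz) (smooth_dx s2 Wz) x1 x2.
have E2 := tan_nabla_twice Wz (fun p _ => esym (partial_xE (partial_y F) p))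
  (smooth_dy (smooth_x sY) Wz) (smooth_dy s1 Wz) (smooth_dy s2 Wz) x1 x2.
have Fy1 p : W p -> dotp (partial_y F p) (n1 p) = 0 by move=> /frame_facts[_ _ _ [_ ->]].
have Fy2 p : W p -> dotp (partial_y F p) (n2 p) = 0 by move=> /frame_facts[_ _ _ [_ _ _ ->]].
have d1 := dotp_derive0 Wz Fy1 (smooth_dy sY Wz) (smooth_dy s1 Wz).
have d2 := dotp_derive0 Wz Fy2 (smooth_dy sY Wz) (smooth_dy s2 Wz).
have d3 := dotp_derive0 Wz Fy1 (smooth_dx sY Wz) (smooth_dx s1 Wz).
have d4 := dotp_derive0 Wz Fy2 (smooth_dx sY Wz) (smooth_dx s2 Wz).
have alg (k1 k2 s s' f1 f2 f3 f4 p1 p2 p3 p4 a1 a2 a3 a4 : R) :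
    k1 = s - f1 * p1 - f2 * p2 -> k2 = s' - f3 * p3 - f4 * p4 -> s = s' ->
    f1 = - a1 -> f2 = - a2 -> f3 = - a3 -> f4 = - a4 ->
    k1 - k2 = (a1 * p1 - a3 * p3) + (a2 * p2 - a4 * p4).
  by move=> -> -> -> -> -> -> ->; ring.
exact: (alg _ _ _ _ _ _ _ _ _ _ _ _ _ _ _ _ E1 E2
  (congr1 (fun u => dotp u (partial_x F z)) (schwarz_row oW sY Wz)) d1 d2 d3 d4).
Qed.

(** As [n2] has unit length, its derivative has no component along [n2], so its normal derivative is
    a multiple of [n1]. *)
Lemma nor_nabla_twice z (v w : A) (G : A -> E4) (n2vw n1v : E4) : W z ->
  (forall p, W p -> is_derive p w n2 (G p)) -> is_derive z v G n2vw ->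
  is_derive z v n1 n1v ->
  dotp (nor_nabla F v (nor_nabla F w n2) z) (n1 z) = dotp n2vw (n1 z) + dotp (G z) n1v.
Proof.
move=> Wz YG DG D1.
have [e11 _ e12 _ nE] := frame_facts Wz.
rewrite {1}/nor_nabla nE dotpDl !dotpZl e11 [dotp (n2 z) _]dotpC e12 mulr0 mulr1 addr0.
pose H p := dotp (G p) (n1 p) *: n1 p.
have tH p : W p -> nor_nabla F w n2 p = H p.
  move=> Wp; rewrite /nor_nabla /H; have [_ ->] := YG p Wp.
  have [_ _ _ _ ->] := frame_facts Wp.
  have c q : W q -> dotp (n2 q) (n2 q) = 1 by case/frame_facts.
  have := dotp_derive0 Wp c (YG p Wp) (YG p Wp); rewrite [dotp (n2 p) _]dotpC => E.
  by rewrite (_ : dotp (G p) (n2 p) = 0) ?scale0r ?addr0//; lra.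
rewrite (@derive_ext _ _ W _ H z v oW Wz tH).
have [_ ->] := is_derive_scale (is_derive_dotp DG D1) D1.
rewrite dotpDl !dotpZl e11 mulr1.
have c q : W q -> dotp (n1 q) (n1 q) = 1 by case/frame_facts.
have := dotp_derive0 Wz c D1 D1; rewrite [dotp (n1 z) _]dotpC => E.
by rewrite (_ : dotp n1v (n1 z) = 0) ?mulr0 ?addr0//; lra.
Qed.

Lemma ricci_equation z : W z -> dotp (curv (nor_nabla F) n2 z) (n1 z) =
  dotp (partial_y n2 z) (partial_x n1 z) - dotp (partial_x n2 z) (partial_y n1 z).
Proof.
move=> Wz; rewrite /curv dotpDl dotpNl.
have E1 := nor_nabla_twice Wz (fun p Wp => smooth_dy s2 Wp)
  (smooth_dx (smooth_y s2) Wz) (smooth_dx s1 Wz).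
have E2 := nor_nabla_twice Wz (fun p Wp => smooth_dx s2 Wp)
  (smooth_dy (smooth_x s2) Wz) (smooth_dy s1 Wz).
have alg (k1 k2 s s' a b : R) : k1 = s + a -> k2 = s' + b -> s = s' -> k1 - k2 = a - b.
  by move=> -> -> ->; ring.
exact: (alg _ _ _ _ _ _ E1 E2
  (congr1 (fun u => dotp u (n1 z)) (schwarz_row oW s2 Wz))).
Qed.

End FrameField.
End FrameEquations.

(** * Null coordinates on the Lorentz numbers *)

Section NullCoordinates.
Context {R : realType}.
Local Notation A := (lorentz R).
Local Notation E4 := 'rV[R]_4.
Implicit Types (z w : A) (p q : lquat R).

Definition np z : R := z.1 + z.2.
Definition nm z : R := z.1 - z.2.
Definition pm (x y : R) : A := ((x + y) / 2, (x - y) / 2).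

Lemma npM z w : np (z * w) = np z * np w.
Proof. by rewrite /np /=; ring. Qed.
Lemma nmM z w : nm (z * w) = nm z * nm w.
Proof. by rewrite /nm /=; ring. Qed.
Lemma npD z w : np (z + w) = np z + np w.
Proof. by rewrite /np /=; ring. Qed.
Lemma nmD z w : nm (z + w) = nm z + nm w.
Proof. by rewrite /nm /=; ring. Qed.
Lemma npN z : np (- z) = - np z.
Proof. by rewrite /np /=; ring. Qed.
Lemma nmN z : nm (- z) = - nm z.
Proof. by rewrite /nm /=; ring. Qed.
Lemma np1 : np 1 = 1. Proof. by rewrite /np /= addr0. Qed.
Lemma nm1 : nm 1 = 1. Proof. by rewrite /nm /= subr0. Qed.
Lemma np0 : np 0 = 0. Proof. by rewrite /np /= addr0. Qed.
Lemma nm0 : nm 0 = 0. Proof. by rewrite /nm /= subr0. Qed.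
Lemma npX z n : np (z ^+ n) = np z ^+ n.
Proof. by elim: n => [|n IH]; rewrite ?np1 // !exprS npM IH. Qed.
Lemma nmX z n : nm (z ^+ n) = nm z ^+ n.
Proof. by elim: n => [|n IH]; rewrite ?nm1 // !exprS nmM IH. Qed.
Lemma npZ (k : R) z : np (k *: z) = k * np z.
Proof. by rewrite /np /= /GRing.scale /= mulrDr. Qed.
Lemma nmZ (k : R) z : nm (k *: z) = k * nm z.
Proof. by rewrite /nm /= /GRing.scale /= mulrBr. Qed.
Lemma np_pm (x y : R) : np (pm x y) = x.
Proof. by rewrite /np /=; field. Qed.
Lemma nm_pm (x y : R) : nm (pm x y) = y.
Proof. by rewrite /nm /=; field. Qed.
Lemma pmK z : pm (np z) (nm z) = z.
Proof. by apply: lorentzP; rewrite /np /nm /=; field. Qed.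
Lemma null_inj z w : np z = np w -> nm z = nm w -> z = w.
Proof. by move=> e1 e2; rewrite -(pmK z) e1 e2 pmK. Qed.

Lemma null_lim (u : A ^nat) (x y : R) : (np (u n) @[n --> \oo] --> x) ->
  (nm (u n) @[n --> \oo] --> y) -> limn u = pm x y.
Proof.
move=> cx cy; apply: cvg_lim => //.
have -> : u = fun n => (2^-1 * (np (u n) + nm (u n)), 2^-1 * (np (u n) - nm (u n))).
  by apply/funext => n; apply: lorentzP; rewrite /np /nm /=; field.
have -> : pm x y = (2^-1 * (x + y), 2^-1 * (x - y)) by rewrite /pm ![2^-1 * _]mulrC.
exact: (cvg_pair (cvgMl_tmp (cvgD cx cy)) (cvgMl_tmp (cvgB cx cy))).
Qed.

Lemma null_series (t : A ^nat) n :
  np (series t n) = series (np \o t) n /\ nm (series t n) = series (nm \o t) n.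
Proof.
rewrite /series /=; elim: n => [|n [IH1 IH2]]; first by rewrite !big_geq // np0 nm0.
by rewrite !big_nat_recr //= npD nmD IH1 IH2.
Qed.

(** The projections [np] and [nm] are ring morphisms compatible with real scalars, so they send the
    partial sums of the Lorentz series to those of the real cosine. *)
Lemma lcosE z : lcos z = pm (cos (np z)) (cos (nm z)).
Proof.
rewrite /lcos; set t := fun k : nat => _.
apply: null_lim.
- rewrite (_ : (fun n => _) = series (cos_coeff' (np z))); first exact: cvg_cos_coeff'.
  apply/funext => n; rewrite (null_series t n).1; congr (series _ n).
  by apply/funext => k; rewrite /t /= npZ npX /cos_coeff' mul2n mulrAC.
- rewrite (_ : (fun n => _) = series (cos_coeff' (nm z))); first exact: cvg_cos_coeff'.
  apply/funext => n; rewrite (null_series t n).2; congr (series _ n).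
  by apply/funext => k; rewrite /t /= nmZ nmX /cos_coeff' mul2n mulrAC.
Qed.

Lemma lsinE z : lsin z = pm (sin (np z)) (sin (nm z)).
Proof.
rewrite /lsin; set t := fun k : nat => _.
apply: null_lim.
- rewrite (_ : (fun n => _) = series (sin_coeff' (np z))); first exact: cvg_sin_coeff'.
  apply/funext => n; rewrite (null_series t n).1; congr (series _ n).
  by apply/funext => k; rewrite /t /= npZ npX /sin_coeff' mul2n mulrAC.
- rewrite (_ : (fun n => _) = series (sin_coeff' (nm z))); first exact: cvg_sin_coeff'.
  apply/funext => n; rewrite (null_series t n).2; congr (series _ n).
  by apply/funext => k; rewrite /t /= nmZ nmX /sin_coeff' mul2n mulrAC.
Qed.

Definition qplus q : E4 := mk4 (np (qc0 q)) (np (qc1 q)) (np (qc2 q)) (np (qc3 q)).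
Definition qminus q : E4 := mk4 (nm (qc0 q)) (nm (qc1 q)) (nm (qc2 q)) (nm (qc3 q)).
Definition qpair (a b : E4) : lquat R :=
  Quat (pm (a 0 0) (b 0 0)) (pm (a 0 1) (b 0 1)) (pm (a 0 2%R) (b 0 2%R)) (pm (a 0 3%R) (b 0 3%R)).

Lemma qplusM p q : qplus (p * q) = qm (qplus p) (qplus q).
Proof. by rewrite qmulE /qplus !qc_mul !(npD, npN, npM); apply: rv4P; rewrite /qm !mk4E. Qed.
Lemma qminusM p q : qminus (p * q) = qm (qminus p) (qminus q).
Proof. by rewrite qmulE /qminus !qc_mul !(nmD, nmN, nmM); apply: rv4P; rewrite /qm !mk4E. Qed.
Lemma qplusD p q : qplus (p + q) = qplus p + qplus q.
Proof. by apply: rv4P; rewrite /qplus !rowE qc_add npD. Qed.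
Lemma qminusD p q : qminus (p + q) = qminus p + qminus q.
Proof. by apply: rv4P; rewrite /qminus !rowE qc_add nmD. Qed.
Lemma qplusZ (k : R) q : qplus (k *: q) = k *: qplus q.
Proof. by apply: rv4P; rewrite /qplus !rowE npZ. Qed.
Lemma qminusZ (k : R) q : qminus (k *: q) = k *: qminus q.
Proof. by apply: rv4P; rewrite /qminus !rowE nmZ. Qed.
Lemma qplus_pair a b : qplus (qpair a b) = a.
Proof. by rewrite /qplus /qpair !qc_Quat !np_pm -mk4_eta. Qed.
Lemma qminus_pair a b : qminus (qpair a b) = b.
Proof. by rewrite /qminus /qpair !qc_Quat !nm_pm -mk4_eta. Qed.
Lemma qpair_inj p q : qplus p = qplus q -> qminus p = qminus q -> p = q.
Proof.
move=> e1 e2.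
have c (i : 'I_4) : qplus p 0 i = qplus q 0 i /\ qminus p 0 i = qminus q 0 i.
  by rewrite e1 e2.
have := c 0; have := c 1; have := c 2%R; have := c 3%R; rewrite !mk4E.
by move=> [? ?] [? ?] [? ?] [? ?]; apply: lquatP; exact: null_inj.
Qed.
Lemma qplus_conj q : qplus (qconj q) = qbar (qplus q).
Proof. by apply: rv4P; rewrite /qplus /qbar !mk4E !qc_Quat ?npN. Qed.
Lemma qminus_conj q : qminus (qconj q) = qbar (qminus q).
Proof. by apply: rv4P; rewrite /qminus /qbar !mk4E !qc_Quat ?nmN. Qed.
Lemma np_conj z : np (lconj z) = nm z. Proof. by []. Qed.
Lemma nm_conj z : nm (lconj z) = np z. Proof. by rewrite /nm /= opprK. Qed.
Lemma qplus_hat q : qplus (qhat q) = qminus q.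
Proof. by apply: rv4P; rewrite /qplus /qminus !mk4E !qc_Quat np_conj. Qed.
Lemma qminus_hat q : qminus (qhat q) = qplus q.
Proof. by apply: rv4P; rewrite /qplus /qminus !mk4E !qc_Quat nm_conj. Qed.
Lemma qplus_r4 (x : E4) : qplus (r4 x) = x.
Proof.
rewrite [RHS]mk4_eta /qplus /r4 !qc_Quat npM.
by congr mk4; rewrite /np /= ?addr0 // add0r mul1r.
Qed.
(** In the minus component [lsigma] becomes [-1]: R^4 is the set of pairs [(x, - qbar x)], so the
    plus component alone recovers the vector. *)
Lemma qminus_r4 (x : E4) : qminus (r4 x) = - qbar x.
Proof.
rewrite /qminus /r4 !qc_Quat nmM; apply: rv4P; rewrite /qbar !rowE /nm /=; ring.
Qed.
Lemma np_qH q : np (qH q) = dotp (qplus q) (qplus q).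
Proof. by rewrite /qH !npD !npX dotpE !mk4E !expr2. Qed.
Lemma nm_qH q : nm (qH q) = dotp (qminus q) (qminus q).
Proof. by rewrite /qH !nmD !nmX dotpE !mk4E !expr2. Qed.
Lemma S3P q : S3 q <-> dotp (qplus q) (qplus q) = 1 /\ dotp (qminus q) (qminus q) = 1.
Proof.
rewrite -np_qH -nm_qH /S3 /=; split=> [->|[e1 e2]]; first by rewrite np1 nm1.
by apply: null_inj; rewrite ?np1 ?nm1.
Qed.

Lemma qplus_JK (k l : A) : qplus (qofL k * qJ + qofL l * qK) = mk4 0 0 (np k) (np l).
Proof.
rewrite qplusD !qplusM; apply: rv4P;
  rewrite /qm /qplus !rowE !qc_Quat np0 np1; ring.
Qed.
Lemma qminus_JK (k l : A) : qminus (qofL k * qJ + qofL l * qK) = mk4 0 0 (nm k) (nm l).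
Proof.
rewrite qminusD !qminusM; apply: rv4P;
  rewrite /qm /qminus !rowE !qc_Quat nm0 nm1; ring.
Qed.

Lemma qplus_sigma : qplus (qofL lsigma) = q1 :> E4.
Proof. by apply: rv4P; rewrite /qplus /q1 !mk4E !qc_Quat /np /= ?addr0 ?add0r. Qed.
Lemma qminus_sigma : qminus (qofL lsigma) = - q1 :> E4.
Proof. by apply: rv4P; rewrite /qminus /q1 !rowE !qc_Quat /nm /=; ring. Qed.

(* The isometry [x |-> a^-1 x b] of R^4 restricted to the span of J and K. *)
Definition om (a b : E4) (x y : R) : E4 := qm (qm (qbar a) (mk4 0 0 x y)) b.

(** [qhat] exchanges the two components, which gives [a^-1 w b] in the plus part and [b^-1 w a] in
    the minus part. As [w] is imaginary, the latter is minus the conjugate of the former, that is,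
    [xi] takes values in R^4. *)
Lemma xi_formE (g : A -> lquat R) (w2 w3 : A -> {linear A -> R}) z v : S3 (g z) ->
  xi_form g w2 w3 z v = r4 (om (qplus (g z)) (qminus (g z)) (w2 z v) (w3 z v)).
Proof.
move=> Sg; have [_ gV] := S3_invr Sg; rewrite /xi_form gV.
apply: qpair_inj.
  by rewrite qplus_r4 !qplusM qplus_conj qplus_hat qplus_JK /om /np /= !addr0.
rewrite qminus_r4 !qminusM qminus_conj qminus_hat qminus_JK /om !qbarM qbarK.
rewrite /nm /= !subr0 qmA -qmNl -qmNr; congr (qm (qm _ _) _).
by apply: rv4P; rewrite /qbar !rowE ?oppr0 ?opprK.
Qed.

Lemma continuous_mk4 (T : topologicalType) (f0 f1 f2 f3 : T -> R) :
  continuous f0 -> continuous f1 -> continuous f2 -> continuous f3 ->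
  continuous (fun t => mk4 (f0 t) (f1 t) (f2 t) (f3 t)).
Proof.
move=> c0 c1 c2 c3 t.
rewrite (_ : (fun t => _) = fun t => f0 t *: mk4 1 0 0 0 + (f1 t *: mk4 0 1 0 0 +
  (f2 t *: mk4 0 0 1 0 + f3 t *: mk4 0 0 0 1))); last first.
  by apply/funext => s; rewrite [LHS]mk4_sum.
by apply: cvgD; [|apply: cvgD; [|apply: cvgD]]; apply: cvgZr_tmp;
  [exact: c0|exact: c1|exact: c2|exact: c3].
Qed.

Lemma np_continuous : continuous np.
Proof. by move=> z; apply: cvgD; [exact: continuous_fst'|exact: continuous_snd']. Qed.
Lemma nm_continuous : continuous nm.
Proof. by move=> z; apply: cvgB; [exact: continuous_fst'|exact: continuous_snd']. Qed.

Lemma qc_continuous : [/\ continuous (@qc0 R), continuous (@qc1 R),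
  continuous (@qc2 R) & continuous (@qc3 R)].
Proof.
split=> q.
- apply: (@continuous_comp _ _ _ (fun q : lquat R => q.1.1) (fun x : A * A => x.1)).
    apply: (@continuous_comp _ _ _ (fun q : lquat R => q.1) (fun x : A * A * A => x.1));
      exact: cvg_fst.
  exact: cvg_fst.
- apply: (@continuous_comp _ _ _ (fun q : lquat R => q.1.1) (fun x : A * A => x.2)).
    apply: (@continuous_comp _ _ _ (fun q : lquat R => q.1) (fun x : A * A * A => x.1));
      exact: cvg_fst.
  exact: cvg_snd.
- apply: (@continuous_comp _ _ _ (fun q : lquat R => q.1) (fun x : A * A * A => x.2)).
    exact: cvg_fst.
  exact: cvg_snd.
- exact: cvg_snd.
Qed.

Lemma qplus_linear : linear qplus.
Proof. by move=> k p q; rewrite qplusD qplusZ. Qed.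
Lemma qminus_linear : linear qminus.
Proof. by move=> k p q; rewrite qminusD qminusZ. Qed.

Lemma qplus_continuous : continuous qplus.
Proof.
have [c0 c1 c2 c3] := qc_continuous.
apply: continuous_mk4 => q.
- exact: (continuous_comp (c0 q) (@np_continuous _)).
- exact: (continuous_comp (c1 q) (@np_continuous _)).
- exact: (continuous_comp (c2 q) (@np_continuous _)).
- exact: (continuous_comp (c3 q) (@np_continuous _)).
Qed.
Lemma qminus_continuous : continuous qminus.
Proof.
have [c0 c1 c2 c3] := qc_continuous.
apply: continuous_mk4 => q.
- exact: (continuous_comp (c0 q) (@nm_continuous _)).
- exact: (continuous_comp (c1 q) (@nm_continuous _)).
- exact: (continuous_comp (c2 q) (@nm_continuous _)).
- exact: (continuous_comp (c3 q) (@nm_continuous _)).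
Qed.

End NullCoordinates.

Section Pairs.
Context {R : realType} {W1 W2 : normedModType R}.
Local Notation A := (lorentz R).

Lemma inl_linear : linear (fun w : W1 => (w, 0 : W2)).
Proof.
move=> k u v; congr (_, _); rewrite /GRing.scale /=; exact/esym/(etrans (addr0 _))/scaler0.
Qed.
Lemma inr_linear : linear (fun w : W2 => (0 : W1, w)).
Proof.
move=> k u v; congr (_, _); rewrite /GRing.scale /=; exact/esym/(etrans (addr0 _))/scaler0.
Qed.
Lemma inl_continuous : continuous (fun w : W1 => (w, 0 : W2)).
Proof. by move=> w; exact: (cvg_pair cvg_id (cvg_cst _)). Qed.
Lemma inr_continuous : continuous (fun w : W2 => (0 : W1, w)).
Proof. by move=> w; exact: (cvg_pair (cvg_cst _) cvg_id). Qed.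

Lemma smooth_pair U (f : A -> W1) (g : A -> W2) : open U -> smooth_on U f ->
  smooth_on U g -> smooth_on U (fun z => (f z, g z)).
Proof.
move=> oU sf sg.
apply: (@smooth_ext _ _ U (fun z => (f z, 0 : W2) + (0 : W1, g z))) => //.
  by move=> w _; congr (_, _); rewrite ?addr0 ?add0r.
apply: smoothD => //.
  exact: (smooth_lin inl_linear inl_continuous oU sf).
exact: (smooth_lin inr_linear inr_continuous oU sg).
Qed.

Lemma is_derive_pair (f : A -> W1) (g : A -> W2) z v df dg : is_derive z v f df ->
  is_derive z v g dg -> is_derive z v (fun z => (f z, g z)) (df, dg).
Proof.
move=> Df Dg.
rewrite (_ : (fun z => _) = fun z => (f z, 0 : W2) + (0 : W1, g z)); last first.
  by apply/funext => w; congr (_, _); rewrite ?addr0 ?add0r.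
have D := is_deriveD' (is_derive_lin inl_linear inl_continuous Df)
   (is_derive_lin inr_linear inr_continuous Dg).
by apply: (is_derive_eq D); congr (_, _); rewrite ?addr0 ?add0r.
Qed.

End Pairs.

(** * Determinants in dimension four *)

Section Determinant4.
Context {R : realType}.
Local Notation E4 := 'rV[R]_4.

Lemma col4E (w0 w1 w2 w3 : E4) (j : 'I_4) :
  let M := col_mx (col_mx w0 w1) (col_mx w2 w3) : 'M[R]_4 in
  [/\ M 0 j = w0 0 j, M 1 j = w1 0 j, M 2%R j = w2 0 j & M 3%R j = w3 0 j].
Proof.
pose N := col_mx (col_mx w0 w1) (col_mx w2 w3).
have e0 : (0 : 'I_4) = @lshift 2 2 (@lshift 1 1 0) :> 'I_(2 + 2) by exact: val_inj.
have e1 : (1 : 'I_4) = @lshift 2 2 (@rshift 1 1 0) :> 'I_(2 + 2) by exact: val_inj.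
have e2 : (2%R : 'I_4) = @rshift 2 2 (@lshift 1 1 0) :> 'I_(2 + 2) by exact: val_inj.
have e3 : (3%R : 'I_4) = @rshift 2 2 (@rshift 1 1 0) :> 'I_(2 + 2) by exact: val_inj.
split.
- by rewrite [X in _ X j]e0 [LHS](@col_mxEu _ 2 2 4 (col_mx w0 w1) (col_mx w2 w3)) (@col_mxEu _ 1 1 4).
- by rewrite [X in _ X j]e1 [LHS](@col_mxEu _ 2 2 4 (col_mx w0 w1) (col_mx w2 w3)) (@col_mxEd _ 1 1 4).
- by rewrite [X in _ X j]e2 [LHS](@col_mxEd _ 2 2 4 (col_mx w0 w1) (col_mx w2 w3)) (@col_mxEu _ 1 1 4).
- by rewrite [X in _ X j]e3 [LHS](@col_mxEd _ 2 2 4 (col_mx w0 w1) (col_mx w2 w3)) (@col_mxEd _ 1 1 4).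
Qed.

Lemma det2 (M : 'M[R]_2) : \det M = M 0 0 * M 1 1 - M 0 1 * M 1 0.
Proof.
(* Cofactor expansion produces ordinals equal to the expected ones only in value; indexing the
   entries by natural numbers lets [ring] identify them. *)
pose m i j : R := M (inord i) (inord j).
have mE (i j : 'I_2) : M i j = m i j by rewrite /m !inord_val.
rewrite (expand_det_row _ ord0) !big_ord_recl big_ord0 /cofactor !det_mx11.
rewrite !mxE !mE /=; rewrite /bump /=; ring.
Qed.

Lemma det3 (M : 'M[R]_3) : \det M =
  M 0 0 * (M 1 1 * M 2%R 2%R - M 1 2%R * M 2%R 1)
  - M 0 1 * (M 1 0 * M 2%R 2%R - M 1 2%R * M 2%R 0)
  + M 0 2%R * (M 1 0 * M 2%R 1 - M 1 1 * M 2%R 0).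
Proof.
pose m i j : R := M (inord i) (inord j).
have mE (i j : 'I_3) : M i j = m i j by rewrite /m !inord_val.
rewrite (expand_det_row _ ord0) !big_ord_recl big_ord0 /cofactor !det2.
rewrite !mxE !mE /=; rewrite /bump /=; ring.
Qed.

Lemma det4 (M : 'M[R]_4) : \det M =
  M 0 0 * (M 1 1 * (M 2%R 2%R * M 3%R 3%R - M 2%R 3%R * M 3%R 2%R)
         - M 1 2%R * (M 2%R 1 * M 3%R 3%R - M 2%R 3%R * M 3%R 1)
         + M 1 3%R * (M 2%R 1 * M 3%R 2%R - M 2%R 2%R * M 3%R 1))
  - M 0 1 * (M 1 0 * (M 2%R 2%R * M 3%R 3%R - M 2%R 3%R * M 3%R 2%R)
         - M 1 2%R * (M 2%R 0 * M 3%R 3%R - M 2%R 3%R * M 3%R 0)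
         + M 1 3%R * (M 2%R 0 * M 3%R 2%R - M 2%R 2%R * M 3%R 0))
  + M 0 2%R * (M 1 0 * (M 2%R 1 * M 3%R 3%R - M 2%R 3%R * M 3%R 1)
         - M 1 1 * (M 2%R 0 * M 3%R 3%R - M 2%R 3%R * M 3%R 0)
         + M 1 3%R * (M 2%R 0 * M 3%R 1 - M 2%R 1 * M 3%R 0))
  - M 0 3%R * (M 1 0 * (M 2%R 1 * M 3%R 2%R - M 2%R 2%R * M 3%R 1)
         - M 1 1 * (M 2%R 0 * M 3%R 2%R - M 2%R 2%R * M 3%R 0)
         + M 1 2%R * (M 2%R 0 * M 3%R 1 - M 2%R 1 * M 3%R 0)).
Proof.
pose m i j : R := M (inord i) (inord j).
have mE (i j : 'I_4) : M i j = m i j by rewrite /m !inord_val.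
rewrite (expand_det_row _ ord0) !big_ord_recl big_ord0 /cofactor !det3.
rewrite !mxE !mE /=; rewrite /bump /=; ring.
Qed.

Definition rowmx4 (r0 r1 r2 r3 : E4) : 'M[R]_4 := col_mx (col_mx r0 r1) (col_mx r2 r3).

Lemma mul_rowmx4 (u r0 r1 r2 r3 : E4) : u *m rowmx4 r0 r1 r2 r3 =
  u 0 0 *: r0 + u 0 1 *: r1 + u 0 2%R *: r2 + u 0 3%R *: r3.
Proof.
apply/rowP => j; rewrite mxE sum4 !rowE /rowmx4.
by have [-> -> -> ->] := col4E r0 r1 r2 r3 j.
Qed.

Definition lmulmx (a : E4) := rowmx4 (qm a (mk4 1 0 0 0)) (qm a (mk4 0 1 0 0))
  (qm a (mk4 0 0 1 0)) (qm a (mk4 0 0 0 1)).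
Definition rmulmx (b : E4) := rowmx4 (qm (mk4 1 0 0 0) b) (qm (mk4 0 1 0 0) b)
  (qm (mk4 0 0 1 0) b) (qm (mk4 0 0 0 1) b).

Lemma mul_lmulmx a u : u *m lmulmx a = qm a u.
Proof. by rewrite mul_rowmx4; apply: rv4P; rewrite /qm !rowE; ring. Qed.
Lemma mul_rmulmx b u : u *m rmulmx b = qm u b.
Proof. by rewrite mul_rowmx4; apply: rv4P; rewrite /qm !rowE; ring. Qed.

Lemma rowmx4_entry (r0 r1 r2 r3 : E4) (j : 'I_4) :
  ((rowmx4 r0 r1 r2 r3) 0 j = r0 0 j) * ((rowmx4 r0 r1 r2 r3) 1 j = r1 0 j) *
  ((rowmx4 r0 r1 r2 r3) 2%R j = r2 0 j) * ((rowmx4 r0 r1 r2 r3) 3%R j = r3 0 j).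
Proof. by have [? ? ? ?] := col4E r0 r1 r2 r3 j. Qed.

Lemma det_lmulmx a : \det (lmulmx a) = dotp a a ^+ 2.
Proof. rewrite det4 !rowmx4_entry dotpE /qm !mk4E; ring. Qed.
Lemma det_rmulmx b : \det (rmulmx b) = dotp b b ^+ 2.
Proof. rewrite det4 !rowmx4_entry dotpE /qm !mk4E; ring. Qed.

Lemma rowmx4_mul (w0 w1 w2 w3 : E4) (M : 'M[R]_4) :
  rowmx4 (w0 *m M) (w1 *m M) (w2 *m M) (w3 *m M) = rowmx4 w0 w1 w2 w3 *m M.
Proof.
have e01 : col_mx (w0 *m M) (w1 *m M) = (col_mx w0 w1 : 'M[R]_(2, 4)) *m M.
  exact/esym/(@mul_col_mx _ 1 1 4 4).
have e23 : col_mx (w2 *m M) (w3 *m M) = (col_mx w2 w3 : 'M[R]_(2, 4)) *m M.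
  exact/esym/(@mul_col_mx _ 1 1 4 4).
rewrite /rowmx4 e01 e23; exact/esym/(@mul_col_mx _ 2 2 4 4).
Qed.

(** Left and right multiplications by unit quaternions have determinant one, so this change of frame
    keeps the orientation. *)
Lemma det_conj_frame a b (w0 w1 w2 w3 : E4) : dotp a a = 1 -> dotp b b = 1 ->
  let g w := qm (qm (qbar a) w) b in
  \det (rowmx4 (g w0) (g w1) (g w2) (g w3)) = \det (rowmx4 w0 w1 w2 w3).
Proof.
move=> aa bb g.
have gE w : g w = w *m (lmulmx (qbar a) *m rmulmx b).
  by rewrite mulmxA mul_lmulmx mul_rmulmx.
rewrite !gE rowmx4_mul !det_mulmx det_lmulmx det_rmulmx dotp_bar aa bb.
by rewrite expr1n !mulr1.
Qed.

End Determinant4.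

(** * From the representation data to flat surfaces *)

Section ConjugatedFrame.
Context {R : realType}.
Local Notation A := (lorentz R).
Local Notation E4 := 'rV[R]_4.
Implicit Types (a b u v w : E4) (z : A).

Definition cj a b w : E4 := qm (qm (qbar a) w) b.

Lemma omE a b (x y : R) : om a b x y = cj a b (mk4 0 0 x y). Proof. by []. Qed.

Lemma cjD a b u v : cj a b (u + v) = cj a b u + cj a b v.
Proof. by rewrite /cj qmDr qmDl. Qed.
Lemma cjZ a b (k : R) u : cj a b (k *: u) = k *: cj a b u.
Proof. by rewrite /cj qmZr qmZl. Qed.

Lemma dotp_cj a b u v : dotp a a = 1 -> dotp b b = 1 ->
  dotp (cj a b u) (cj a b v) = dotp u v.
Proof.
by move=> aa bb; rewrite /cj dotp_qmr dotp_qml dotp_bar aa bb !mul1r.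
Qed.

(** Moving frame formula: with [u1], [u2] the logarithmic derivatives of the two rotations, the
    derivative is again an image under [cj], and equations between derivatives can be read on the
    inner coefficients. *)
Lemma is_derive_cj (fa fb fw : A -> E4) z (v : A) (da db u1 u2 dw : E4) :
  is_derive z v fa da -> is_derive z v fb db -> is_derive z v fw dw ->
  da = qm u1 (fa z) -> db = qm u2 (fb z) ->
  is_derive z v (fun z => cj (fa z) (fb z) (fw z))
    (cj (fa z) (fb z) (qm (qbar u1) (fw z) + dw + qm (fw z) u2)).
Proof.
move=> Da Db Dw ea eb.
have D := is_derive_qm (is_derive_qm (is_derive_qbar Da) Dw) Db.
apply: (is_derive_eq D); rewrite /cj ea eb qbarM !qmDr !qmDl !qmA; congr (_ + _).
Qed.

Lemma smooth_cj (U : set A) (fa fb fw : A -> E4) : open U -> smooth_on U fa ->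
  smooth_on U fb -> smooth_on U fw -> smooth_on U (fun z => cj (fa z) (fb z) (fw z)).
Proof.
move=> oU sa sb sw.
exact: (smooth_qm oU (smooth_qm oU (smooth_qbar oU sa) sw) sb).
Qed.

End ConjugatedFrame.

Section RowPrimitives.
Context {R : realType}.
Local Notation A := (lorentz R).
Local Notation E4 := 'rV[R]_4.
Variables (U : set A) (P Q : A -> E4).
Hypotheses (oU : open U) (sP : smooth_on U P) (sQ : smooth_on U Q).

Lemma smooth_row_primitive F :
  (forall z, U z -> is_derive z (1 : A) F (P z) /\ is_derive z (lsigma : A) F (Q z)) ->
  smooth_on U F.
Proof.
move=> H; apply: smooth_mx => // i j; rewrite ord1.
apply: (smooth_primitive oU (smooth_coord j oU sP) (smooth_coord j oU sQ)) => z Uz.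
by have [h1 h2] := H z Uz; split; exact: is_derive_coord.
Qed.

Lemma global_row_primitive : simply_connected U ->
  (forall z, U z -> partial_y P z = partial_x Q z) ->
  exists F : A -> E4, forall z, U z ->
    is_derive z (1 : A) F (P z) /\ is_derive z (lsigma : A) F (Q z).
Proof.
move=> scU PQ.
have /choice[f fP] : forall i : 'I_4, exists f, forall z, U z ->
    primitive_of (fun z => P z 0 i) (fun z => Q z 0 i) f z.
  move=> i; apply: (global_primitive oU scU (smooth_coord i oU sP) (smooth_coord i oU sQ)).
  move=> z Uz; have [_ e1] := partial_coord i sP Uz; have [e2 _] := partial_coord i sQ Uz.
  by apply: (etrans (esym e1)); apply: etrans e2; rewrite PQ.
exists (fun z => mk4 (f 0 z) (f 1 z) (f 2%R z) (f 3%R z)) => z Uz.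
have [a0 b0] := fP 0 z Uz; have [a1 b1] := fP 1 z Uz.
have [a2 b2] := fP 2%R z Uz; have [a3 b3] := fP 3%R z Uz.
by split; [rewrite [P z]mk4_eta|rewrite [Q z]mk4_eta]; exact: is_derive_mk4.
Qed.

End RowPrimitives.

Lemma r4_inj {R : realType} : injective (@r4 R).
Proof. by move=> x y /(congr1 qplus); rewrite !qplus_r4. Qed.

Section FlatImmersions.
Context {R : realType}.
Local Notation A := (lorentz R).
Local Notation E4 := 'rV[R]_4.

Lemma lorentz_split (v : A) : v = v.1 *: (1 : A) + v.2 *: lsigma.
Proof.
by apply: lorentzP => /=; rewrite /GRing.scale /=; ring.
Qed.

Lemma lin_split (w : {linear A -> R}) v : w v = v.1 * w (1 : A) + v.2 * w (lsigma : A).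
Proof.
transitivity (w (v.1 *: (1 : A) + v.2 *: lsigma)); first by rewrite -lorentz_split.
by rewrite linearD !linearZZ.
Qed.

(* The frame is written in the orthonormal tangent frame [cj a b J, cj a b K]. *)
Section FlatFrame.
Variables (U : set A) (a b : A -> E4) (th1 th2 lam mu : A -> R).
Let u z : E4 := mk4 0 0 (cos (th1 z + th2 z)) (sin (th1 z + th2 z)).
Let v z : E4 := mk4 0 0 (cos (th1 z - th2 z)) (sin (th1 z - th2 z)).
Hypothesis oU : open U.
Hypotheses (sa : smooth_on U a) (sb : smooth_on U b).
Hypotheses (aa : forall z, U z -> dotp (a z) (a z) = 1)
  (bb : forall z, U z -> dotp (b z) (b z) = 1).
Hypothesis ax : forall z, U z -> partial_x a z = qm (u z) (a z).
Hypothesis ay : forall z, U z -> partial_y a z = qm (u z) (a z).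
Hypothesis bx : forall z, U z -> partial_x b z = qm (v z) (b z).
Hypothesis by_ : forall z, U z -> partial_y b z = qm (- v z) (b z).
Hypotheses (st1 : smooth_on U th1) (st2 : smooth_on U th2).
Hypothesis th_conf : forall z, U z -> partial_y th1 z = partial_x th2 z /\
  partial_y th2 z = partial_x th1 z.
Hypotheses (slam : smooth_on U lam) (smu : smooth_on U mu).
Hypothesis mux : forall z, U z -> partial_x mu z = lam z * partial_x th2 z.
Hypothesis lamy : forall z, U z -> partial_y lam z = - mu z * partial_y th2 z.
Hypothesis lm : forall z, U z -> 0 < lam z * mu z.

(** [p], [q] are the coefficients of [w2] on [dx], [dy], and [p'], [q'] those of [w3], as computed
    in [dual_formsE] by inverting the matrix of the frame. *)
Let p z := sin (th1 z) * lam z.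
Let p' z := - cos (th1 z) * lam z.
Let q z := cos (th1 z) * mu z.
Let q' z := sin (th1 z) * mu z.
Definition fw_x z : E4 := om (a z) (b z) (p z) (p' z).
Definition fw_y z : E4 := om (a z) (b z) (q z) (q' z).

Let sP : smooth_on U (fun z => mk4 0 0 (p z) (p' z)).
Proof.
apply: smooth_mk4 => //; try exact: smooth_cst.
  by apply: smoothM => //; exact: smooth_sin.
by apply: smoothM => //; apply: smoothN => //; exact: smooth_cos.
Qed.
Let sQ : smooth_on U (fun z => mk4 0 0 (q z) (q' z)).
Proof.
apply: smooth_mk4 => //; try exact: smooth_cst.
  by apply: smoothM => //; exact: smooth_cos.
by apply: smoothM => //; exact: smooth_sin.
Qed.

Lemma smooth_fw_x : smooth_on U fw_x. Proof. exact: smooth_cj. Qed.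
Lemma smooth_fw_y : smooth_on U fw_y. Proof. exact: smooth_cj. Qed.

(** Read in the moving frame, the components along [1] and [I] agree by trigonometric identities;
    those along [J] and [K] agree by the equations for [lam] and [mu] and the conformality of
    [psi]. *)
Lemma fw_closed z : U z -> partial_y fw_x z = partial_x fw_y z.
Proof.
move=> Uz.
have dsin (w : A) d : is_derive z w th1 d -> is_derive z w (fun z => sin (th1 z)) (d * cos (th1 z)).
  by move=> D; exact: is_derive_chain D (is_derive_sin _).
have dcos (w : A) d : is_derive z w th1 d -> is_derive z w (fun z => cos (th1 z)) (d * - sin (th1 z)).
  by move=> D; exact: is_derive_chain D (is_derive_cos _).
have t1y := smooth_dy st1 Uz; have t1x := smooth_dx st1 Uz.
have Dp := is_deriveM' (dsin _ _ t1y) (smooth_dy slam Uz).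
have dncos (w : A) d : is_derive z w th1 d -> is_derive z w (fun z => - cos (th1 z)) (- (d * - sin (th1 z))).
  by move=> D; exact: is_deriveN (dcos _ _ D).
have Dp' := is_deriveM' (dncos _ _ t1y) (smooth_dy slam Uz).
have Dq := is_deriveM' (dcos _ _ t1x) (smooth_dx smu Uz).
have Dq' := is_deriveM' (dsin _ _ t1x) (smooth_dx smu Uz).
have D0 (w : A) : is_derive z w (fun=> 0 : R) 0 by exact: is_derive_cst.
have [_ e1] := is_derive_cj (smooth_dy sa Uz) (smooth_dy sb Uz)
  (is_derive_mk4 (D0 _) (D0 _) Dp Dp') (ay Uz) (by_ Uz).
have [_ e2] := is_derive_cj (smooth_dx sa Uz) (smooth_dx sb Uz)
  (is_derive_mk4 (D0 _) (D0 _) Dq Dq') (ax Uz) (bx Uz).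
apply: (etrans e1); apply: etrans (esym e2); congr (cj _ _ _).
have [h1 h2] := th_conf Uz; have h3 := mux Uz; have h4 := lamy Uz.
move: h1 h2 h3 h4; move: (partial_y th1 z) (partial_x th1 z) (partial_y th2 z)
  (partial_x th2 z) (partial_x mu z) (partial_y lam z) => t1 t2 t3 t4 t5 t6.
move=> -> -> -> ->.
rewrite /u /v /p /p' /q /q'.
rewrite !cosD !sinD cosN sinN.
move: (sin _) (cos _) (sin _) (cos _) => s1 c1 s2 c2.
apply: rv4P; rewrite /qm /qbar !rowE; ring.
Qed.

Lemma fw_primitive_exists : simply_connected U -> exists F : A -> E4,
  forall z, U z -> is_derive z (1 : A) F (fw_x z) /\ is_derive z (lsigma : A) F (fw_y z).
Proof.
move=> scU; apply: (global_row_primitive oU smooth_fw_x smooth_fw_y scU) => z.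
exact: fw_closed.
Qed.

Variable F : A -> E4.
Hypothesis DF : forall z, U z -> is_derive z (1 : A) F (fw_x z) /\
  is_derive z (lsigma : A) F (fw_y z).

Lemma fw_smooth : smooth_on U F.
Proof. exact: smooth_row_primitive oU smooth_fw_x smooth_fw_y _ DF. Qed.

Let Fx z : U z -> partial_x F z = fw_x z. Proof. by move=> /DF[[_ <-] _]. Qed.
Let Fy z : U z -> partial_y F z = fw_y z. Proof. by move=> /DF[_ [_ <-]]. Qed.

(** The induced metric is [lam^2 dx^2 + mu^2 dy^2], nondegenerate because [lam * mu] does not
    vanish. *)
Lemma fw_immersion : immersion_on U F.
Proof.
split=> [|z Uz]; first exact: fw_smooth.
have [_ dE] := is_diff_mx oU fw_smooth Uz.
have E (w : A) : 'd F z w = om (a z) (b z) (w.1 * p z + w.2 * q z) (w.1 * p' z + w.2 * q' z).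
  rewrite dE (Fx Uz) (Fy Uz) /fw_x /fw_y !omE -!cjZ -cjD; congr (cj _ _ _).
  by apply: rv4P; rewrite !rowE; ring.
have N (w : A) : dotp ('d F z w) ('d F z w) = (w.1 * lam z) ^+ 2 + (w.2 * mu z) ^+ 2.
  rewrite E !omE dotp_cj ?aa ?bb// dotpE !mk4E /p /p' /q /q'.
  rewrite -[RHS]mulr1 -(cos2Dsin2 (th1 z)); ring.
have lz : lam z != 0 by have := lm Uz; apply: contraTneq => ->; rewrite mul0r ltxx.
have mz : mu z != 0 by have := lm Uz; apply: contraTneq => ->; rewrite mulr0 ltxx.
move=> w1 w2 e; apply/eqP; rewrite -subr_eq0; apply/eqP.
have : dotp ('d F z (w1 - w2)) ('d F z (w1 - w2)) = 0.
  by rewrite linearB /= e subrr dotpE !rowE; ring.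
rewrite N => /eqP; rewrite paddr_eq0 ?sqr_ge0// !sqrf_eq0 !mulf_eq0 (negbTE lz) (negbTE mz) !orbF.
by move=> /andP[/eqP h1 /eqP h2]; apply: lorentzP.
Qed.

Let n1 z := cj (a z) (b z) (mk4 1 0 0 0).
Let n2 z := cj (a z) (b z) (mk4 0 1 0 0).

Lemma fw_frame : oriented_normal_frame U F n1 n2.
Proof.
split=> [||z Uz]; first by apply: smooth_cj => //; exact: smooth_cst.
  by apply: smooth_cj => //; exact: smooth_cst.
have [az bz] := (aa Uz, bb Uz).
split.
- by rewrite dotp_cj// dotpE !mk4E; ring.
- by rewrite dotp_cj// dotpE !mk4E; ring.
- by rewrite dotp_cj// dotpE !mk4E; ring.
- by split; apply/jac_orth; rewrite (Fx Uz) (Fy Uz) /fw_x /fw_y !omE !dotp_cj// !dotpE !mk4E;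
    split; ring.
- have -> : \det (col_mx (jac F z) (col_mx (n1 z) (n2 z)) : 'M[R]_4) =
    \det (rowmx4 (fw_x z) (fw_y z) (n1 z) (n2 z)).
    by rewrite /rowmx4 /jac (Fx Uz) (Fy Uz).
  (* The determinant of the frame is [lam * mu]: positivity of this product is exactly what orients
     it. *)
  rewrite /fw_x /fw_y !omE (det_conj_frame _ _ _ _ az bz) det4 !rowmx4_entry !mk4E.
  rewrite (_ : _ + _ = lam z * mu z * (cos (th1 z) ^+ 2 + sin (th1 z) ^+ 2)).
    by rewrite cos2Dsin2 mulr1; exact: lm.
  by rewrite /p /p' /q /q'; ring.
Qed.

Lemma fw_normal_derivs z : U z ->
  [/\ partial_x n1 z = cj (a z) (b z) (qbar (u z) + v z),
      partial_y n1 z = cj (a z) (b z) (qbar (u z) - v z),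
      partial_x n2 z = cj (a z) (b z) (qm (qbar (u z)) (mk4 0 1 0 0) + qm (mk4 0 1 0 0) (v z)) &
      partial_y n2 z = cj (a z) (b z) (qm (qbar (u z)) (mk4 0 1 0 0) - qm (mk4 0 1 0 0) (v z))].
Proof.
move=> Uz.
have D0 (w : A) (c : E4) : is_derive z w (fun=> c) 0 by exact: is_derive_cst.
have H (c : E4) := is_derive_cj (smooth_dx sa Uz) (smooth_dx sb Uz) (D0 1 c) (ax Uz) (bx Uz).
have H' (c : E4) := is_derive_cj (smooth_dy sa Uz) (smooth_dy sb Uz) (D0 lsigma c) (ay Uz) (by_ Uz).
split.
- by have [_ e] := H (mk4 1 0 0 0); apply: (etrans e); rewrite addr0 qm1l qm1r.
- by have [_ e] := H' (mk4 1 0 0 0); apply: (etrans e); rewrite addr0 qm1l qm1r.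
- by have [_ e] := H (mk4 0 1 0 0); apply: (etrans e); rewrite addr0.
- by have [_ e] := H' (mk4 0 1 0 0); apply: (etrans e); rewrite addr0 qmNr.
Qed.

(** In the frame, [n1] has derivatives [v - u] and [- (u + v)], while [n2] has [I (u + v)] and
    [I (u - v)]. The Ricci term vanishes because [I w] is orthogonal to [w]. The Gauss term vanishes
    because [I] acts as a rotation on the plane of [J] and [K], so the areas spanned by the two
    pairs are opposite. *)
Lemma fw_flat z : U z -> gauss_curvature F z = 0 /\ is_normal_curvature F z 0.
Proof.
move=> Uz; have [az bz] := (aa Uz, bb Uz).
have [e1 e2 e3 e4] := fw_normal_derivs Uz.
have ex := Fx Uz; have ey := Fy Uz.
split.
  rewrite (gauss_equation oU fw_smooth fw_frame Uz) e1 e2 e3 e4 ex ey /fw_x /fw_y !omE.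
  rewrite !(dotp_cj _ _ az bz) [X in X / _](_ : _ = 0) ?mul0r//.
  by rewrite !dotpE /u /v /qm /qbar !rowE; ring.
exists U, n1, n2; split=> //; first exact: fw_frame.
rewrite (ricci_equation oU fw_frame Uz) e1 e2 e3 e4.
rewrite !(dotp_cj _ _ az bz) [X in _ = X / _](_ : _ = 0) ?mul0r//.
by rewrite !dotpE /u /v /qm /qbar !rowE; ring.
Qed.

End FlatFrame.
End FlatImmersions.

Section DirectPart.
Context {R : realType}.
Local Notation A := (lorentz R).
Local Notation E4 := 'rV[R]_4.

Lemma primitive_onP (U : set A) (F : A -> E4) (P Q : A -> E4) xi : open U ->
  smooth_on U P -> smooth_on U Q ->
  (forall z, U z -> forall v, xi z v = r4 (v.1 *: P z + v.2 *: Q z)) ->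
  primitive_on U F xi <->
  (forall z, U z -> is_derive z (1 : A) F (P z) /\ is_derive z (lsigma : A) F (Q z)).
Proof.
move=> oU sP sQ xiE; split=> [H z Uz|H z Uz].
  have [dF dE] := H z Uz.
  have D (v : A) : is_derive z v F (v.1 *: P z + v.2 *: Q z).
    split; first exact: diff_derivable.
    by rewrite deriveE//; apply: r4_inj; rewrite dE xiE.
  split.
    by apply: (is_derive_eq (D 1)); rewrite /= scale1r scale0r addr0.
  by apply: (is_derive_eq (D lsigma)); rewrite /= scale1r scale0r add0r.
have sF := smooth_row_primitive oU sP sQ H.
have [dF dE] := is_diff_mx oU sF Uz.
split=> // v; rewrite xiE// dE; have [[_ <-] [_ <-]] := H z Uz; by [].
Qed.

Lemma fst_linear : linear (fun z : A => z.1).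
Proof. by []. Qed.
Lemma snd_linear : linear (fun z : A => z.2).
Proof. by []. Qed.

Lemma smooth_fst U (f : A -> A) : open U -> smooth_on U f -> smooth_on U (fun z => (f z).1).
Proof. exact: (smooth_lin fst_linear (@continuous_fst' R)). Qed.
Lemma smooth_snd U (f : A -> A) : open U -> smooth_on U f -> smooth_on U (fun z => (f z).2).
Proof. exact: (smooth_lin snd_linear (@continuous_snd' R)). Qed.

Lemma dual_formsE (th lam mu : R) (w2 w3 : {linear A -> R}) (e2 e3 : A) :
  lam != 0 -> mu != 0 ->
  e2 = lofR (sin th * lam^-1) + lsigma * lofR (cos th * mu^-1) ->
  e3 = lofR (- cos th * lam^-1) + lsigma * lofR (sin th * mu^-1) ->
  [/\ w2 e2 = 1, w2 e3 = 0, w3 e2 = 0 & w3 e3 = 1] ->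
  forall v, w2 v = v.1 * (sin th * lam) + v.2 * (cos th * mu) /\
    w3 v = v.1 * (- cos th * lam) + v.2 * (sin th * mu).
Proof.
move=> l0 m0 E2 E3 [h1 h2 h3 h4] v.
have cs := cos2Dsin2 th; move: E2 E3 cs; move: (sin th) (cos th) => s c E2 E3 cs.
have e21 : e2.1 = s / lam by rewrite E2 /=; ring.
have e22 : e2.2 = c / mu by rewrite E2 /=; ring.
have e31 : e3.1 = - c / lam by rewrite E3 /=; ring.
have e32 : e3.2 = s / mu by rewrite E3 /=; ring.
have k1 : s / lam * w2 (1 : A) + c / mu * w2 lsigma = 1 by rewrite -e21 -e22 -lin_split.
have k2 : - c / lam * w2 (1 : A) + s / mu * w2 lsigma = 0 by rewrite -e31 -e32 -lin_split.
have k3 : s / lam * w3 (1 : A) + c / mu * w3 lsigma = 0 by rewrite -e21 -e22 -lin_split.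
have k4 : - c / lam * w3 (1 : A) + s / mu * w3 lsigma = 1 by rewrite -e31 -e32 -lin_split.
(* The matrix of the system is a rotation followed by the scalings by [1 / lam] and [1 / mu],
   inverted by [cos^2 + sin^2 = 1]. *)
have sol (X Y k l : R) : s / lam * X + c / mu * Y = k -> - c / lam * X + s / mu * Y = l ->
    X = lam * (s * k - c * l) /\ Y = mu * (c * k + s * l).
  move=> <- <-; split; rewrite -[LHS]mulr1 -cs; field; by rewrite l0 m0.
have [x1 y1] := sol _ _ _ _ k1 k2; have [x2 y2] := sol _ _ _ _ k3 k4.
split.
  by apply: (etrans (lin_split w2 v)); rewrite x1 y1; ring.
by apply: (etrans (lin_split w3 v)); rewrite x2 y2; ring.
Qed.

Section Data.
Variables (U : set A) (psi : A -> A) (th1 th2 lam mu : A -> R)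
  (g : A -> lquat R) (w2 w3 : A -> {linear A -> R}).
Hypothesis H : rep_data U psi th1 th2 lam mu g w2 w3.

Let a z := qplus (g z).
Let b z := qminus (g z).

Let oU : open U. Proof. by case: H => [[]]. Qed.
Let scU : simply_connected U. Proof. by case: H => [[]]. Qed.
Let psiE z : U z -> psi z = lofR (th1 z) + lsigma * lofR (th2 z).
Proof. by case: H => _ [_ h] _ _ _; exact: h. Qed.
Let spsi : smooth_on U psi. Proof. by case: H => _ [[h _] _] _ _ _. Qed.
Let psi_conf z : U z -> partial_y psi z = lsigma * partial_x psi z.
Proof. by case: H => _ [[_ h] _] _ _ _; exact: h. Qed.
Let slam : smooth_on U lam. Proof. by case: H => _ _ [h _ _] _ _. Qed.
Let smu : smooth_on U mu. Proof. by case: H => _ _ [_ h _] _ _. Qed.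
Let sg : smooth_on U g. Proof. by case: H => _ _ _ [[h _] _ _] _. Qed.
Let g_conf z : U z -> partial_y g z = qofL lsigma * partial_x g z.
Proof. by case: H => _ _ _ [[_ h] _ _] _; exact: h. Qed.
Let gS z : U z -> S3 (g z). Proof. by case: H => _ _ _ [_ h _] _; exact: h. Qed.
Let gE z : U z -> partial_x g z * (g z)^-1 =
  qofL (lcos (psi z)) * qJ + qofL (lsin (psi z)) * qK.
Proof. by case: H => _ _ _ [_ _ h] _; exact: h. Qed.
Let dual : dual_forms U (frame_e2 th1 lam mu) (frame_e3 th1 lam mu) w2 w3.
Proof. by case: H. Qed.
Let pde z : U z -> [/\ partial_x mu z = lam z * partial_x th2 z,
  partial_y lam z = - mu z * partial_y th2 z & 0 < lam z * mu z].
Proof. by case: H => _ _ [_ _ h] _ _; exact: h. Qed.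

Let th1E z : U z -> (psi z).1 = th1 z.
Proof. by move=> Uz; rewrite psiE//=; ring. Qed.
Let th2E z : U z -> (psi z).2 = th2 z.
Proof. by move=> Uz; rewrite psiE//=; ring. Qed.

Lemma data_smooth_th1 : smooth_on U th1.
Proof. exact: smooth_ext oU th1E (smooth_fst oU spsi). Qed.

Lemma data_partial_th z : U z ->
  [/\ partial_x th1 z = (partial_x psi z).1, partial_y th1 z = (partial_y psi z).1,
      partial_x th2 z = (partial_x psi z).2 & partial_y th2 z = (partial_y psi z).2].
Proof.
move=> Uz.
have Dx := smooth_dx spsi Uz; have Dy := smooth_dy spsi Uz.
have f1 := is_derive_ext oU Uz th1E
  (is_derive_lin fst_linear (@continuous_fst' R) Dx).
have f2 := is_derive_ext oU Uz th1E
  (is_derive_lin fst_linear (@continuous_fst' R) Dy).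
have f3 := is_derive_ext oU Uz th2E
  (is_derive_lin snd_linear (@continuous_snd' R) Dx).
have f4 := is_derive_ext oU Uz th2E
  (is_derive_lin snd_linear (@continuous_snd' R) Dy).
by split; [case: f1|case: f2|case: f3|case: f4].
Qed.

Lemma data_th_conf z : U z -> partial_y th1 z = partial_x th2 z /\
  partial_y th2 z = partial_x th1 z.
Proof.
move=> Uz; have [e1 e2 e3 e4] := data_partial_th Uz; have := psi_conf Uz => e5.
split.
  by apply: (etrans e2); apply: etrans (esym e3); rewrite e5 /=; ring.
by apply: (etrans e4); apply: etrans (esym e1); rewrite e5 /=; ring.
Qed.

Let sa : smooth_on U a.
Proof. exact: (smooth_lin qplus_linear qplus_continuous oU sg). Qed.
Let sb : smooth_on U b.
Proof. exact: (smooth_lin qminus_linear qminus_continuous oU sg). Qed.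
Let aa z : U z -> dotp (a z) (a z) = 1. Proof. by move=> /gS /S3P[]. Qed.
Let bb z : U z -> dotp (b z) (b z) = 1. Proof. by move=> /gS /S3P[]. Qed.

Let gx z : U z -> partial_x g z =
  (qofL (lcos (psi z)) * qJ + qofL (lsin (psi z)) * qK) * g z.
Proof.
by move=> Uz; rewrite -gE// mulrVK//; have [] := S3_invr (gS Uz).
Qed.

Let npsi z : U z -> np (psi z) = th1 z + th2 z.
Proof. by move=> Uz; rewrite /np th1E// th2E. Qed.
Let nmsi z : U z -> nm (psi z) = th1 z - th2 z.
Proof. by move=> Uz; rewrite /nm th1E// th2E. Qed.

Let ax z : U z -> partial_x a z =
  qm (mk4 0 0 (cos (th1 z + th2 z)) (sin (th1 z + th2 z))) (a z).
Proof.
move=> Uz; have [_ e] := is_derive_lin qplus_linear qplus_continuous (smooth_dx sg Uz).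
apply: (etrans e); rewrite (gx Uz) qplusM qplus_JK lcosE lsinE !np_pm (npsi Uz) //.
Qed.
Let bx z : U z -> partial_x b z =
  qm (mk4 0 0 (cos (th1 z - th2 z)) (sin (th1 z - th2 z))) (b z).
Proof.
move=> Uz; have [_ e] := is_derive_lin qminus_linear qminus_continuous (smooth_dx sg Uz).
apply: (etrans e); rewrite (gx Uz) qminusM qminus_JK lcosE lsinE !nm_pm (nmsi Uz) //.
Qed.
Let ay z : U z -> partial_y a z =
  qm (mk4 0 0 (cos (th1 z + th2 z)) (sin (th1 z + th2 z))) (a z).
Proof.
move=> Uz; have [_ e] := is_derive_lin qplus_linear qplus_continuous (smooth_dy sg Uz).
apply: (etrans e).
rewrite (g_conf Uz) (gx Uz) qplusM [X in qm _ X]qplusM qplus_JK lcosE lsinE !np_pm (npsi Uz).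
by rewrite qplus_sigma qm1l.
Qed.
Let by_ z : U z -> partial_y b z =
  qm (- mk4 0 0 (cos (th1 z - th2 z)) (sin (th1 z - th2 z))) (b z).
Proof.
move=> Uz; have [_ e] := is_derive_lin qminus_linear qminus_continuous (smooth_dy sg Uz).
apply: (etrans e).
rewrite (g_conf Uz) (gx Uz) qminusM [X in qm _ X]qminusM qminus_JK lcosE lsinE !nm_pm (nmsi Uz).
by rewrite qminus_sigma !qmNl qm1l.
Qed.

Let lm z : U z -> 0 < lam z * mu z. Proof. by case/pde. Qed.

Lemma data_xi z : U z -> forall v, xi_form g w2 w3 z v =
  r4 (v.1 *: fw_x a b th1 lam z + v.2 *: fw_y a b th1 mu z).
Proof.
move=> Uz v; have lz : lam z != 0 by have := lm Uz; apply: contraTneq => ->; rewrite mul0r ltxx.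
have mz : mu z != 0 by have := lm Uz; apply: contraTneq => ->; rewrite mulr0 ltxx.
have [e2 e3] := dual_formsE lz mz erefl erefl (dual Uz) v.
rewrite (xi_formE _ _ _ (gS Uz)) e2 e3; congr r4.
rewrite /fw_x /fw_y !omE -!cjZ -cjD; congr (cj _ _ _).
by apply: rv4P; rewrite !rowE; ring.
Qed.

Let sPx := smooth_fw_x oU sa sb data_smooth_th1 slam.
Let sPy := smooth_fw_y oU sa sb data_smooth_th1 smu.

Lemma forward_part :
  (exists F : A -> E4, primitive_on U F (xi_form g w2 w3)) /\
  (forall F : A -> E4, primitive_on U F (xi_form g w2 w3) ->
     immersion_on U F /\
     forall z, U z -> gauss_curvature F z = 0 /\ is_normal_curvature F z 0).
Proof.
have mux z : U z -> partial_x mu z = lam z * partial_x th2 z by case/pde.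
have lamy z : U z -> partial_y lam z = - mu z * partial_y th2 z by case/pde.
split.
  have [F DF] := fw_primitive_exists oU sa sb ax ay bx by_ data_smooth_th1
    data_th_conf slam smu mux lamy scU.
  by exists F; apply/(primitive_onP _ oU sPx sPy data_xi).
move=> F /(primitive_onP _ oU sPx sPy data_xi) DF; split.
  exact: (fw_immersion oU sa sb aa bb data_smooth_th1 slam smu lm DF).
move=> z Uz.
exact: (fw_flat oU sa sb aa bb ax ay bx by_ data_smooth_th1 slam smu lm DF Uz).
Qed.

End Data.
End DirectPart.

(** * Twistor lifts of a flat surface *)

Section TwistorAlgebra.
Context {R : realType}.
Local Notation E4 := 'rV[R]_4.
Implicit Types (P Q n u v w X : E4).

Lemma qmV_orth u v : dotp u v = 0 -> qm u (qbar v) = - qm v (qbar u).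
Proof.
rewrite dotpE => e; apply: rv4P; rewrite /qm /qbar !rowE; try ring.
apply/eqP; rewrite -addr_eq0; apply/eqP; rewrite -[RHS](mulr0 2) -e; ring.
Qed.

Lemma qm_imK X u : X 0 0 = 0 -> dotp X X = 1 -> qm X (qm X u) = - u.
Proof.
move=> X0 X1; rewrite qmA (_ : qm X X = - q1) ?qmNl ?qm1l//.
have XB : qbar X = - X by apply: rv4P; rewrite /qbar !rowE // X0 oppr0.
by rewrite -[X in qm _ X]opprK -XB qmNr qmV X1 scale1r.
Qed.

Lemma dotp_im_skew X u v : X 0 0 = 0 -> dotp (qm X u) v = - dotp u (qm X v).
Proof. by move=> X0; rewrite !dotpE /qm !rowE X0; ring. Qed.

Lemma dotp_im0 X u : X 0 0 = 0 -> dotp (qm X u) u = 0.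
Proof. by move=> X0; rewrite dotpE /qm !rowE X0; ring. Qed.

Definition gramd P Q : R := dotp P P * dotp Q Q - dotp P Q ^+ 2.

(* The two twistor lifts of the oriented plane spanned by [P] and [Q] are
   [tw P Q] and [tw (qbar P) (qbar Q)]: left (resp. right) multiplication by
   them is the rotation of angle [pi / 2] in that plane, up to sign. *)
Definition tw P Q : E4 :=
  (Num.sqrt (gramd P Q))^-1 *: (dotp P Q *: q1 - qm P (qbar Q)).

Lemma tw_im P Q : tw P Q 0 0 = 0.
Proof. by rewrite /tw dotpE /qm /qbar /q1 !rowE; ring. Qed.

Lemma tw_P P Q : qm (tw P Q) P =
  (Num.sqrt (gramd P Q))^-1 *: (dotp P P *: Q - dotp P Q *: P).
Proof.
rewrite /tw qmZl; congr (_ *: _); rewrite !dotpE.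
by apply: rv4P; rewrite /qm /qbar /q1 !rowE; ring.
Qed.

(** On the plane itself, left multiplication by one lift and right multiplication by the other
    differ only by a sign; [cj_split] uses this to locate the tangent plane in the frame. *)
Lemma tw_anti P Q : qm (tw P Q) P = - qm P (tw (qbar P) (qbar Q)).
Proof.
rewrite tw_P /tw /gramd !dotp_bar qmZr -[in RHS]scalerN; congr (_ *: _).
by rewrite qbarK qmDr qmNr qmZr qm1r qmA qmV qmZl qm1l opprB.
Qed.

Lemma tw_norm P Q : 0 < gramd P Q -> dotp (tw P Q) (tw P Q) = 1.
Proof.
move=> D0; rewrite /tw dotpZl dotpZr mulrA -invfM -expr2 sqr_sqrtr ?ltW//.
rewrite (_ : dotp _ _ = gramd P Q) ?mulVf ?gt_eqF//.
by rewrite /gramd !dotpE /qm /qbar /q1 !rowE; ring.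
Qed.

Lemma tw_area P Q : 0 < gramd P Q -> dotp (qm (tw P Q) P) Q = Num.sqrt (gramd P Q).
Proof.
move=> D0; rewrite tw_P dotpZl dotpDl dotpNl !dotpZl -expr2 -/(gramd P Q).
by rewrite -[X in _ * X]sqr_sqrtr ?ltW// expr2 mulrA mulVf ?mul1r// gt_eqF// sqrtr_gt0.
Qed.

(** Stated without orientation, hence stable under [qbar]: the anti-self-dual lift is treated by
    applying the same lemmas to conjugated vectors. *)
Definition orth_frame P Q n1 n2 : Prop :=
  [/\ [/\ dotp n1 n1 = 1, dotp n2 n2 = 1 & dotp n1 n2 = 0],
      [/\ dotp P n1 = 0, dotp Q n1 = 0, dotp P n2 = 0 & dotp Q n2 = 0],
      0 < gramd P Q &
      forall v, dotp v n1 = 0 -> dotp v n2 = 0 -> exists a b, v = a *: P + b *: Q].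

Lemma orth_frame_bar P Q n1 n2 : orth_frame P Q n1 n2 ->
  orth_frame (qbar P) (qbar Q) (qbar n1) (qbar n2).
Proof.
case=> H1 H2 H3 H4; split; rewrite /gramd ?dotp_bar//.
move=> v; rewrite -[v]qbarK !dotp_bar => /H4 H /H[a [b ->]].
by exists a, b; rewrite qbarD !qbarZ.
Qed.

Section Frame.
Variables (P Q n1 n2 : E4).
Hypothesis fr : orth_frame P Q n1 n2.
Let X := qm n2 (qbar n1).

Lemma normal_tw_im : X 0 0 = 0.
Proof. by case: fr => -[_ _ <-] _ _ _; rewrite /X dotpE /qm /qbar !rowE; ring. Qed.

Lemma normal_tw_norm : dotp X X = 1.
Proof. by case: fr => -[e1 e2 _] _ _ _; rewrite /X dotp_qm dotp_bar e1 e2 mulr1. Qed.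

Lemma normal_tw_n1 : qm X n1 = n2.
Proof. by case: fr => -[e1 _ _] _ _ _; rewrite /X -qmA qVm e1 scale1r qm1r. Qed.

Lemma normal_tw_n2 : qm X n2 = - n1.
Proof. by rewrite -{1}normal_tw_n1 (qm_imK _ normal_tw_im normal_tw_norm). Qed.

Lemma normal_tw_tangent v : dotp v n1 = 0 -> dotp v n2 = 0 ->
  dotp (qm X v) n1 = 0 /\ dotp (qm X v) n2 = 0.
Proof.
move=> v1 v2; rewrite !(dotp_im_skew _ _ normal_tw_im) normal_tw_n1 normal_tw_n2.
by rewrite dotpNr v1 v2 !oppr0.
Qed.

(** The twistor of the normal plane is a multiple of that of the tangent plane. The part [w] of [X]
    orthogonal to [tw P Q] sends [P] to a tangent vector that is orthogonal to [P] and to its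
    rotation, hence to zero, so [w = 0]. *)
Lemma normal_twE : X = dotp X (tw P Q) *: tw P Q.
Proof.
case: fr => _ [P1 Q1 P2 Q2] D0 span.
set c := dotp _ _; apply/eqP; rewrite -subr_eq0; set w := X - _.
have w0 : w 0 0 = 0 by rewrite /w addvE oppvE scalevE normal_tw_im tw_im; ring.
have T1 : dotp (tw P Q) (tw P Q) = 1 := tw_norm D0.
have TP v : dotp P v = 0 -> dotp Q v = 0 -> dotp (qm (tw P Q) P) v = 0.
  by move=> e1 e2; rewrite tw_P dotpZl dotpDl dotpNl !dotpZl e1 e2; ring.
have [XP1 XP2] := normal_tw_tangent P1 P2.
have wP1 : dotp (qm w P) n1 = 0.
  by rewrite /w qmDl qmNl qmZl dotpDl dotpNl dotpZl XP1 TP//; ring.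
have wP2 : dotp (qm w P) n2 = 0.
  by rewrite /w qmDl qmNl qmZl dotpDl dotpNl dotpZl XP2 TP//; ring.
have wPP : dotp (qm w P) P = 0 := dotp_im0 _ w0.
have wPT : dotp (qm w P) (qm (tw P Q) P) = 0.
  by rewrite dotp_qmr /w dotpDl dotpNl dotpZl T1 /c; ring.
have PP0 : dotp P P != 0.
  apply/eqP => e; move: D0; rewrite /gramd e mul0r sub0r.
  by rewrite oppr_gt0 ltNge sqr_ge0.
have wPQ : dotp (qm w P) Q = 0.
  have s0 : Num.sqrt (gramd P Q) != 0 by rewrite gt_eqF// sqrtr_gt0.
  move: wPT; rewrite tw_P dotpZr => /eqP; rewrite mulf_eq0 invr_eq0 (negbTE s0) /=.
  by rewrite dotpDr dotpNr !dotpZr wPP mulr0 subr0 mulf_eq0 (negbTE PP0) => /eqP.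
have /eqP : dotp (qm w P) (qm w P) = 0.
  have [a [b e]] := span _ wP1 wP2.
  by rewrite {2}e dotpDr !dotpZr wPP wPQ; ring.
by rewrite dotp_qm mulf_eq0 (negbTE PP0) orbF dotp_eq0.
Qed.

Lemma span_area (a b c d : R) :
  (dotp (qm X (a *: P + b *: Q)) (c *: P + d *: Q) = (a * d - b * c) * dotp (qm X P) Q) *
  (dotp (a *: P + b *: Q) P * dotp (c *: P + d *: Q) Q
   - dotp (a *: P + b *: Q) Q * dotp (c *: P + d *: Q) P = (a * d - b * c) * gramd P Q).
Proof.
split.
  have e : dotp (qm X Q) P = - dotp (qm X P) Q.
    by rewrite (dotp_im_skew _ _ normal_tw_im) dotpC.
  rewrite qmDr !qmZr dotpDl !dotpZl !dotpDr !dotpZr e !(dotp_im0 _ normal_tw_im).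
  ring.
by rewrite !dotpDl !dotpZl [dotp Q P]dotpC /gramd; ring.
Qed.

(** With the derivatives of [n1] and [n2] split into normal and tangent parts, the normal connection
    coefficient [al] cancels in the derivative of [n2] times conjugate [n1]. *)
Lemma normal_tw_derive (al : R) t1 t2 : dotp t1 n1 = 0 -> dotp t2 n2 = 0 ->
  qm (- al *: n1 + t2) (qbar n1) + qm n2 (qbar (al *: n2 + t1)) =
  qm (t2 - qm X t1) (qbar n1).
Proof.
case: fr => -[e1 e2 _] _ _ _ h1 h2.
rewrite !qmDl qbarD qbarZ qmDr !qmZl !qmZr !qmV e1 e2 qmNl -qmA -[in LHS]normal_tw_n1.
rewrite -[qm (qm X n1) _]qmA.
rewrite [qm n1 (qbar t1)]qmV_orth; last by rewrite dotpC.
rewrite qmNr; move: (qm X _) (qm t2 _) => s t.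
by apply: rv4P; rewrite !rowE; ring.
Qed.

(** The pulled-back area form expands into four products. Two of them form the Ricci expression; the
    other two are areas in the tangent plane whose sum is proportional to the Gauss expression. *)
Lemma normal_tw_flat (al be : R) t1x t1y t2x t2y :
  dotp t1x n1 = 0 -> dotp t1x n2 = 0 -> dotp t1y n1 = 0 -> dotp t1y n2 = 0 ->
  dotp t2x n1 = 0 -> dotp t2x n2 = 0 -> dotp t2y n1 = 0 -> dotp t2y n2 = 0 ->
  (dotp t1x P * dotp t1y Q - dotp t1x Q * dotp t1y P)
  + (dotp t2x P * dotp t2y Q - dotp t2x Q * dotp t2y P) = 0 ->
  dotp t2y t1x - dotp t2x t1y = 0 ->
  dotp (qm X (qm (- al *: n1 + t2x) (qbar n1) + qm n2 (qbar (al *: n2 + t1x))))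
    (qm (- be *: n1 + t2y) (qbar n1) + qm n2 (qbar (be *: n2 + t1y))) = 0.
Proof.
move=> h1 h2 h3 h4 h5 h6 h7 h8.
case: (fr) => -[e1 _ _] _ D0 span.
rewrite !normal_tw_derive// qmA dotp_qmr dotp_bar e1 mul1r.
rewrite qmDr qmNr (qm_imK _ normal_tw_im normal_tw_norm) opprK.
rewrite dotpDl !dotpDr !dotpNr dotp_qml normal_tw_norm mul1r.
rewrite -[- dotp t1x (qm X t1y)](dotp_im_skew t1x t1y normal_tw_im).
have [a1 [b1 ->]] := span _ h1 h2; have [c1 [d1 ->]] := span _ h3 h4.
have [a2 [b2 ->]] := span _ h5 h6; have [c2 [d2 ->]] := span _ h7 h8.
rewrite ![dotp (qm X (_ *: P + _ *: Q)) _]span_area !span_area -mulrDl => /eqP.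
rewrite mulf_eq0 (gt_eqF D0) orbF => /eqP G.
set u2y := c2 *: P + _; set u2x := a2 *: P + _ => Rc.
have -> (r s t q : R) : r - s + (t + q) = (t - s) + (q + r) by ring.
by rewrite [dotp _ u2y]dotpC Rc add0r -mulrDl G mul0r.
Qed.

End Frame.
End TwistorAlgebra.

(** * Area forms pulled back by the twistor lifts *)

Section TwistorLifts.
Context {R : realType}.
Local Notation A := (lorentz R).
Local Notation E4 := 'rV[R]_4.
Implicit Types (W : set A) (F P Q X : A -> E4).

Lemma det_gramE F z : \det (gram F z) = gramd (partial_x F z) (partial_y F z).
Proof.
have E (p q : E4) : \det (col_mx p q *m (col_mx p q)^T) = gramd p q; last exact: E.
rewrite (_ : _ *m _ = (block_mx ((dotp p p)%:M : 'M[R]_1) ((dotp p q)%:M : 'M[R]_1)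
    ((dotp q p)%:M : 'M[R]_1) ((dotp q q)%:M : 'M[R]_1) : 'M[R]_(1 + 1))); last first.
  by rewrite (@tr_col_mx _ 1 1) (@mul_col_row _ 1 1 4 1 1) !dotp_mul.
set a := (dotp p p)%:M; set b := (dotp p q)%:M; set c := (dotp q p)%:M; set d := (dotp q q)%:M.
rewrite det2; have sE (k : R) : (k%:M : 'M[R]_1) 0 0 = k by rewrite mxE eqxx mulr1n.
have e00 : block_mx a b c d 0 0 = dotp p p.
  rewrite -[RHS]sE -[RHS](block_mxEul a b c d).
  by congr (block_mx a b c d _ _); exact: val_inj.
have e01 : block_mx a b c d 0 1 = dotp p q.
  rewrite -[RHS]sE -[RHS](block_mxEur a b c d).
  by congr (block_mx a b c d _ _); exact: val_inj.
have e10 : block_mx a b c d 1 0 = dotp q p.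
  rewrite -[RHS]sE -[RHS](block_mxEdl a b c d).
  by congr (block_mx a b c d _ _); exact: val_inj.
have e11 : block_mx a b c d 1 1 = dotp q q.
  rewrite -[RHS]sE -[RHS](block_mxEdr a b c d).
  by congr (block_mx a b c d _ _); exact: val_inj.
transitivity (dotp p p * dotp q q - dotp p q * dotp q p).
  by congr (_ * _ - _ * _).
by rewrite /gramd [dotp q p]dotpC expr2.
Qed.

Lemma smooth_tw W P Q : open W -> smooth_on W P -> smooth_on W Q ->
  (forall z, W z -> 0 < gramd (P z) (Q z)) -> smooth_on W (fun z => tw (P z) (Q z)).
Proof.
move=> oW sP sQ D0; have sPQ := smooth_dotp oW sP sQ.
have sD : smooth_on W (fun z => gramd (P z) (Q z)).
  apply: smoothB => //; first exact: (smoothM oW (smooth_dotp oW sP sP) (smooth_dotp oW sQ sQ)).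
  exact: (smoothM oW sPQ sPQ).
apply: smooth_scale => //.
  apply: smoothV => //; last exact: smooth_sqrt.
  by move=> z Wz; rewrite gt_eqF// sqrtr_gt0 D0.
apply: smoothD => //; first by apply: smooth_scale => //; exact: smooth_cst.
by apply: smoothNv => //; apply: smooth_qm => //; exact: smooth_qbar.
Qed.

Section Flat.
Variables (W : set A) (P Q n1 n2 : A -> E4).
Hypotheses (oW : open W) (sP : smooth_on W P) (sQ : smooth_on W Q).
Hypotheses (s1 : smooth_on W n1) (s2 : smooth_on W n2).
Hypothesis fr : forall z, W z -> orth_frame (P z) (Q z) (n1 z) (n2 z).
Let X z := tw (P z) (Q z).
Let X' z := qm (n2 z) (qbar (n1 z)).
Let c z := dotp (X' z) (X z).

Let sX : smooth_on W X.
Proof. by apply: smooth_tw => // z /fr[]. Qed.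
Lemma twistor_sign_sqr z : W z -> c z * c z = 1.
Proof.
move=> /fr H; have := normal_tw_norm H; rewrite (normal_twE H) -/(X' z) -/(X z) -/(c z).
by case: H => _ _ D0 _; rewrite dotpZl dotpZr tw_norm// mulr1.
Qed.

(** The factor [c] relating the frame-dependent lift [X'] to the canonical [X] has square one, so
    its derivative is zero, and the derivatives are related by the same factor. *)
Lemma twistor_derive z v (dX dX' : E4) : W z -> is_derive z v X dX -> is_derive z v X' dX' ->
  dX' = c z *: dX.
Proof.
move=> Wz D D'; have Dc := is_derive_dotp D' D; set dc := dotp _ _ + _ in Dc.
have dc0 : dc = 0.
  have [_ e] := is_deriveM' Dc Dc.
  have := @derive_ext _ _ W _ (fun=> 1 : R) z v oW Wz twistor_sign_sqr.
  rewrite derive_cst => e0; move: (etrans (esym e) e0) => h.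
  have : 2 * (c z * (c z * dc)) = 0 by rewrite -[in RHS](mulr0 (c z)) -h -/(c z); ring.
  rewrite [c z * _]mulrA (twistor_sign_sqr Wz) mul1r => /eqP.
  by rewrite mulf_eq0 pnatr_eq0 => /eqP.
have D2 := is_derive_scale Dc D.
have [_ e] := is_derive_ext oW Wz (fun q Wq => esym (normal_twE (fr Wq))) D2.
by have [_ <-] := D'; apply: (etrans e); rewrite dc0 scale0r add0r.
Qed.

Lemma twistor_flat z (n1x n1y n2x n2y Xx Xy : E4) : W z ->
  is_derive z (1 : A) n1 n1x -> is_derive z (lsigma : A) n1 n1y ->
  is_derive z (1 : A) n2 n2x -> is_derive z (lsigma : A) n2 n2y ->
  is_derive z (1 : A) X Xx -> is_derive z (lsigma : A) X Xy ->
  (dotp n1x (P z) * dotp n1y (Q z) - dotp n1x (Q z) * dotp n1y (P z))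
  + (dotp n2x (P z) * dotp n2y (Q z) - dotp n2x (Q z) * dotp n2y (P z)) = 0 ->
  dotp n2y n1x - dotp n2x n1y = 0 ->
  dotp (qm (X z) Xx) Xy = 0.
Proof.
move=> Wz D1x D1y D2x D2y DXx DXy G Rc.
have H := fr Wz.
have o11 q (Wq : W q) : dotp (n1 q) (n1 q) = 1 by case: (fr Wq) => -[].
have o22 q (Wq : W q) : dotp (n2 q) (n2 q) = 1 by case: (fr Wq) => -[].
have o12 q (Wq : W q) : dotp (n1 q) (n2 q) = 0 by case: (fr Wq) => -[].
have half (u v : E4) : dotp u v = - dotp v u -> dotp u v = 0.
  rewrite [dotp v u]dotpC => /eqP; rewrite -subr_eq0 opprK -mulr2n mulrn_eq0 /=.
  by move=> /eqP.
have n11x := half _ _ (dotp_derive0 oW Wz o11 D1x D1x).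
have n11y := half _ _ (dotp_derive0 oW Wz o11 D1y D1y).
have n22x := half _ _ (dotp_derive0 oW Wz o22 D2x D2x).
have n22y := half _ _ (dotp_derive0 oW Wz o22 D2y D2y).
have n12x := dotp_derive0 oW Wz o12 D1x D2x.
have n12y := dotp_derive0 oW Wz o12 D1y D2y.
case: (H) => -[e11 e22 e12] [P1 Q1 P2 Q2] D0 _.
(* Normal connection coefficients; the [t] vectors below are the tangent parts of the derivatives of
   the normals. *)
pose al := dotp n1x (n2 z); pose be := dotp n1y (n2 z).
pose t1x := n1x - al *: n2 z; pose t1y := n1y - be *: n2 z.
pose t2x := n2x + al *: n1 z; pose t2y := n2y + be *: n1 z.
have al' : dotp n2x (n1 z) = - al by rewrite /al n12x opprK dotpC.
have be' : dotp n2y (n1 z) = - be by rewrite /be n12y opprK dotpC.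
have sub (u v w : E4) k : dotp (u - k *: v) w = dotp u w - k * dotp v w.
  by rewrite dotpDl dotpNl dotpZl.
have add (u v w : E4) k : dotp (u + k *: v) w = dotp u w + k * dotp v w.
  by rewrite dotpDl dotpZl.
have F := @normal_tw_flat _ _ _ _ _ H al be t1x t1y t2x t2y.
have E1x : n1x = al *: n2 z + t1x by rewrite /t1x addrC subrK.
have E1y : n1y = be *: n2 z + t1y by rewrite /t1y addrC subrK.
have E2x : n2x = - al *: n1 z + t2x by rewrite /t2x scaleNr addrC addrK.
have E2y : n2y = - be *: n1 z + t2y by rewrite /t2y scaleNr addrC addrK.
have X'x := is_derive_qm D2x (is_derive_qbar D1x).
have X'y := is_derive_qm D2y (is_derive_qbar D1y).
have hx := twistor_derive Wz DXx X'x; have hy := twistor_derive Wz DXy X'y.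
move: F; rewrite -E1x -E1y -E2x -E2y hx hy (normal_twE H) -/(X' z) -/(X z) -/(c z).
rewrite qmZl qmZr !dotpZl dotpZr.
have {}sub2 : c z * (c z * (c z * dotp (qm (X z) Xx) Xy)) = c z * dotp (qm (X z) Xx) Xy.
  by rewrite mulrA twistor_sign_sqr// mul1r.
have c0 : c z != 0.
  by apply/eqP => e; move: (twistor_sign_sqr Wz); rewrite e mul0r => /esym/eqP; rewrite oner_eq0.
rewrite sub2 => F; apply: (mulfI c0); rewrite mulr0; apply: F.
- by rewrite /t1x sub n11x dotpC e12; ring.
- by rewrite /t1x sub e22 /al; ring.
- by rewrite /t1y sub n11y dotpC e12; ring.
- by rewrite /t1y sub e22 /be; ring.
- by rewrite /t2x add al' e11; ring.
- by rewrite /t2x add n22x e12; ring.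
- by rewrite /t2y add be' e11; ring.
- by rewrite /t2y add n22y e12; ring.
- rewrite /t1x /t1y /t2x /t2y !sub !add ![dotp (n1 z) _]dotpC ![dotp (n2 z) _]dotpC.
  by rewrite P1 P2 Q1 Q2 !mulr0 !subr0 !addr0.
- have prod (p q : E4) k l : dotp q (n2 z) = 0 -> dotp (n1 z) p = 0 ->
      dotp (q + k *: n1 z) (p - l *: n2 z) = dotp q p.
    by move=> h1 h2; rewrite dotpDl !dotpDr !dotpNr !dotpZl !dotpZr h1 h2 e12; ring.
  rewrite /t1x /t1y /t2x /t2y !prod// ?[dotp (n1 z) _]dotpC//.
Qed.

End Flat.
End TwistorLifts.

(** * Spin lift of a degenerate map to the sphere *)

Section ProportionalForms.
Context {R : realType}.
Local Notation A := (lorentz R).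
Implicit Types (U : set A) (p q f : A -> R) (z : A).

Lemma box_pos z f (r : R) : 0 < r -> {for z, continuous f} -> 0 < f z ->
  exists r', [/\ 0 < r', box z r' `<=` box z r & forall w, box z r' w -> 0 < f w].
Proof.
move=> r0 cf fz; have [r1 r10 H] := continuous_near_box cf fz.
exists (Num.min r r1); split; first by rewrite lt_min r0.
  by move=> w /box_min[].
move=> w /box_min[_ /H]; rewrite ltr_norml => /andP[h _].
by move: h; rewrite ltrBrDr addNr.
Qed.

Definition curl0 U p q := forall z, U z -> partial_y p z = partial_x q z.

(** If the second form is [m] times the first and both are closed, then [dm] is proportional to the
    first. Hence multiplying the first by [k = sqrt (1 + m^2)] keeps it closed; its primitive is
    [s], and [al = atan m], so that the two forms are [cos al ds] and [sin al ds]. *)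
Lemma arc_lemma_cos z0 (r : R) (p q p' q' : A -> R) : 0 < r ->
  smooth_on (box z0 r) p -> smooth_on (box z0 r) q ->
  smooth_on (box z0 r) p' -> smooth_on (box z0 r) q' ->
  curl0 (box z0 r) p q -> curl0 (box z0 r) p' q' ->
  (forall z, box z0 r z -> p z * q' z = q z * p' z) ->
  0 < p z0 * p z0 + q z0 * q z0 ->
  exists r' (s al : A -> R), [/\ 0 < r', box z0 r' `<=` box z0 r,
    smooth_on (box z0 r') s /\ smooth_on (box z0 r') al &
    forall z, box z0 r' z -> [/\
      p z = cos (al z) * partial_x s z /\ q z = cos (al z) * partial_y s z,
      p' z = sin (al z) * partial_x s z /\ q' z = sin (al z) * partial_y s z,
      partial_x al z * partial_y s z = partial_y al z * partial_x s z &
      0 < partial_x s z * partial_x s z + partial_y s z * partial_y s z]].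
Proof.
move=> r0 sp sq sp' sq' cl cl' wedge n0.
pose n z := p z * p z + q z * q z.
have oB := @open_boxE _ z0 _ r0; have B0 := @box_center _ z0 _ r0.
have sn : smooth_on (box z0 r) n by exact: (smoothD oB (smoothM oB sp sp) (smoothM oB sq sq)).
have [r1 [r10 sub np]] := box_pos r0 (smooth_cont sn B0) n0.
have {}oB := @open_boxE _ z0 _ r10.
have {}sp := smooth_subset sub sp; have {}sq := smooth_subset sub sq.
have {}sp' := smooth_subset sub sp'; have {}sq' := smooth_subset sub sq'.
have {}sn := smooth_subset sub sn.
(* The ratio is taken by orthogonal projection, so that only [p^2 + q^2] has to be nonzero. *)
pose m z := (p z * p' z + q z * q' z) * (n z)^-1.
have sm : smooth_on (box z0 r1) m.
  apply: smoothM => //; first exact: (smoothD oB (smoothM oB sp sp') (smoothM oB sq sq')).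
  by apply: smoothV => // z /np; rewrite lt0r => /andP[].
have mp z : box z0 r1 z -> p' z = m z * p z /\ q' z = m z * q z.
  move=> Bz; have nz : n z != 0 by rewrite gt_eqF ?np.
  have w := wedge z (sub _ Bz).
  split; apply: (mulIf nz); rewrite mulrAC /m mulfVK// /n.
    have -> : (p z * p' z + q z * q' z) * p z = p z * p z * p' z + q z * (p z * q' z) by ring.
    by rewrite w; ring.
  have -> : (p z * p' z + q z * q' z) * q z = q z * q z * q' z + p z * (q z * p' z) by ring.
  by rewrite -w; ring.
have m1 z : 0 < 1 + m z * m z by rewrite ltr_wpDr// -expr2 sqr_ge0.
pose k z := Num.sqrt (1 + m z * m z).
have smm : smooth_on (box z0 r1) (fun z => 1 + m z * m z).
  exact: (smoothD oB (@smooth_cst _ _ _ _) (smoothM oB sm sm)).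
have sk : smooth_on (box z0 r1) k by apply: smooth_sqrt.
have k0 z : 0 < k z by rewrite sqrtr_gt0.
have kk z : k z * k z = 1 + m z * m z by rewrite -expr2 sqr_sqrtr// ltW.
have dk z v dm dk : box z0 r1 z -> is_derive z v m dm -> is_derive z v k dk ->
    k z * dk = m z * dm.
  move=> Bz Dm Dk; have [_ e1] := is_deriveM' Dk Dk.
  have [_ e2] := is_deriveD' (is_derive_cst (1 : R) z v) (is_deriveM' Dm Dm).
  have e : (fun w => k w * k w) = fun w => 1 + m w * m w by apply/funext.
  move: e1; rewrite e e2 add0r => e3.
  apply: (@mulfI _ 2); first by rewrite pnatr_eq0.
  by transitivity (dk * k z + k z * dk); [ring|rewrite -e3; ring].
have dmE z : box z0 r1 z -> partial_y m z * p z = partial_x m z * q z.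
  move=> Bz.
  have [_ e1] := is_derive_ext oB Bz (fun w Bw => esym (mp w Bw).1)
    (is_deriveM' (smooth_dy sm Bz) (smooth_dy sp Bz)).
  have [_ e2] := is_derive_ext oB Bz (fun w Bw => esym (mp w Bw).2)
    (is_deriveM' (smooth_dx sm Bz) (smooth_dx sq Bz)).
  have h := etrans (esym e1) (etrans (cl' z (sub _ Bz)) e2).
  have h' := cl z (sub _ Bz).
  move: h h'; move: (partial_y m z) (partial_x m z) (partial_y p z) (partial_x q z).
  by move=> t1 t2 t3 t4 + e; rewrite e => /addIr.
pose P z := k z * p z; pose Q z := k z * q z.
have sP : smooth_on (box z0 r1) P by exact: smoothM.
have sQ : smooth_on (box z0 r1) Q by exact: smoothM.
have PQ z : box z0 r1 z -> partial_y P z = partial_x Q z.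
  move=> Bz.
  have [_ e1] := is_deriveM' (smooth_dy sk Bz) (smooth_dy sp Bz).
  have [_ e2] := is_deriveM' (smooth_dx sk Bz) (smooth_dx sq Bz).
  apply: (etrans e1); apply: etrans (esym e2).
  have d1 := dk _ _ _ _ Bz (smooth_dy sm Bz) (smooth_dy sk Bz).
  have d2 := dk _ _ _ _ Bz (smooth_dx sm Bz) (smooth_dx sk Bz).
  have h := dmE z Bz; have h' := cl z (sub _ Bz).
  move: d1 d2 h h'; move: (partial_y m z) (partial_x m z) (partial_y p z) (partial_x q z)
    (partial_y k z) (partial_x k z) => t1 t2 t3 t4 t5 t6 d1 d2 h ->; congr (_ + _).
  apply: (@mulfI _ (k z)); first by rewrite gt_eqF.
  by rewrite !mulrA d1 d2 -!mulrA h.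
have [s Ds] := poincare r10 sP sQ PQ.
have r20 : 0 < r1 / 2 by rewrite divr_gt0.
have sub2 : box z0 (r1 / 2) `<=` box z0 r1.
  by apply: box_mono; rewrite ler_pdivrMr// ler_pMr// ler1n.
have {}oB2 := @open_boxE _ z0 _ r20.
have ss := smooth_primitive oB2 (smooth_subset sub2 sP) (smooth_subset sub2 sQ) Ds.
have sal : smooth_on (box z0 (r1 / 2)) (fun z => atan (m z)).
  by apply: smooth_atan => //; exact: smooth_subset sub2 sm.
exists (r1 / 2), s, (fun z => atan (m z)); split=> //.
  by move=> w /sub2 /sub.
move=> z Bz; have [[_ ex] [_ ey]] := Ds z Bz.
have {}Bz := sub2 _ Bz.
have sx : partial_x s z = k z * p z by [].
have sy : partial_y s z = k z * q z by [].
have ca : cos (atan (m z)) = (k z)^-1 by rewrite cos_atan.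
have sa : sin (atan (m z)) = m z * (k z)^-1.
  rewrite -ca -{2}[m z]atanK /tan mulfVK// ca invr_eq0 gt_eqF//.
have kz : k z != 0 by rewrite gt_eqF.
have Dat := is_derive1_atan (m z).
have [_ ax] := is_derive_chain (smooth_dx sm Bz) Dat.
have [_ ay] := is_derive_chain (smooth_dy sm Bz) Dat.
have h := dmE z Bz.
rewrite sx sy ca sa; have [-> ->] := mp z Bz.
split.
- by split; rewrite mulKf.
- by split; rewrite -mulrA mulKf.
- transitivity (partial_x m z * (1 + m z ^+ 2)^-1 * (k z * q z)); first by congr (_ * _).
  transitivity (partial_y m z * (1 + m z ^+ 2)^-1 * (k z * p z)); last by congr (_ * _).
  move: h; move: (partial_x m z) (partial_y m z) => t1 t2 h.
  transitivity ((t1 * q z) * ((1 + m z ^+ 2)^-1 * k z)); first by ring.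
  by rewrite -h; ring.
- have -> : k z * p z * (k z * p z) + k z * q z * (k z * q z) = k z * k z * n z.
    by rewrite /n; ring.
  by rewrite !mulr_gt0// np.
Qed.

(** If the first form vanishes at [z0], the second does not, and the two are exchanged; the angle
    becomes [pi / 2 - al], which swaps sine and cosine. *)
Lemma arc_lemma z0 (r : R) (p q p' q' : A -> R) : 0 < r ->
  smooth_on (box z0 r) p -> smooth_on (box z0 r) q ->
  smooth_on (box z0 r) p' -> smooth_on (box z0 r) q' ->
  curl0 (box z0 r) p q -> curl0 (box z0 r) p' q' ->
  (forall z, box z0 r z -> p z * q' z = q z * p' z) ->
  0 < (p z0 * p z0 + q z0 * q z0) + (p' z0 * p' z0 + q' z0 * q' z0) ->
  exists r' (s al : A -> R), [/\ 0 < r', box z0 r' `<=` box z0 r,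
    smooth_on (box z0 r') s /\ smooth_on (box z0 r') al &
    forall z, box z0 r' z -> [/\
      p z = cos (al z) * partial_x s z /\ q z = cos (al z) * partial_y s z,
      p' z = sin (al z) * partial_x s z /\ q' z = sin (al z) * partial_y s z,
      partial_x al z * partial_y s z = partial_y al z * partial_x s z &
      0 < partial_x s z * partial_x s z + partial_y s z * partial_y s z]].
Proof.
move=> r0 sp sq sp' sq' cl cl' wedge n0.
have [pq0|pq0] := ltP 0 (p z0 * p z0 + q z0 * q z0); first exact: arc_lemma_cos.
have pq0' : 0 < p' z0 * p' z0 + q' z0 * q' z0.
  by apply: lt_le_trans n0 _; rewrite gerDr.
have w' z : box z0 r z -> p' z * q z = q' z * p z.
  by move=> /wedge e; rewrite mulrC -e mulrC.
have [r' [s [al [r'0 sub [ss sal] H]]]] := arc_lemma_cos r0 sp' sq' sp sq cl' cl w' pq0'.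
have oB := @open_boxE _ z0 _ r'0.
have sal' : smooth_on (box z0 r') (fun z => - (al z - pi / 2)).
  by apply: smoothN => //; apply: smoothB => //; exact: smooth_cst.
exists r', s, (fun z => - (al z - pi / 2)); split=> // z Bz.
have D v d : is_derive z v al d -> 'D_v (fun z => - (al z - pi / 2)) z = - d.
  move=> D; have [_ e] := is_deriveN (is_deriveB D (is_derive_cst (pi / 2 : R) z v)).
  by apply: (etrans e); rewrite subr0.
have [e1 e2 e3 e4] := H z Bz.
rewrite cosN sinN cosBpihalf sinBpihalf opprK; split=> //.
transitivity (- partial_x al z * partial_y s z).
  by congr (_ * _); exact: D (smooth_dx sal Bz).
transitivity (- partial_y al z * partial_x s z).
  by rewrite !mulNr e3.
by congr (_ * _); exact/esym/(D _ _ (smooth_dy sal Bz)).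
Qed.

End ProportionalForms.

(** * Local spin lifts and their connection form *)

Section SpinLift.
Context {R : realType}.
Local Notation A := (lorentz R).
Local Notation E4 := 'rV[R]_4.
Implicit Types (U : set A) (a X : A -> E4) (z v : A) (w u : E4).

Definition qi : E4 := mk4 0 1 0 0.
Definition qj : E4 := mk4 0 0 1 0.
Definition qk : E4 := mk4 0 0 0 1.

(* The conjugator of [X] into [qi], up to normalisation; it vanishes only for
   one value of [X]. *)
Definition conjugator w (X : E4) : E4 := w - qm (qm X w) qi.

Lemma conjugatorP w (X : E4) : X 0 0 = 0 -> dotp X X = 1 ->
  qm X (conjugator w X) = qm (conjugator w X) qi.
Proof.
move=> X0 X1; rewrite /conjugator qmDr qmNr !qmDl !qmNl -[qm (qm X w) qi]qmA.
rewrite (qm_imK _ X0 X1) opprK -!qmA (_ : qm qi qi = - q1).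
  by rewrite !qmNr qm1r opprK addrC.
by apply: rv4P; rewrite /qm /qi /q1 !rowE; ring.
Qed.

(** The seed [q1] fails only at [- qi] and the seed [qj] only at [qi], so at each point one of them
    works. *)
Lemma conjugator_neq0 (X : E4) : conjugator q1 X != 0 \/ conjugator qj X != 0.
Proof.
have [e|] := eqVneq (conjugator q1 X) 0; [right|by left].
apply/eqP => e'.
have h : X 0 1 = -1.
  have := congr1 (fun u : E4 => u 0 0) e; rewrite /conjugator /qm /qi /q1 !rowE => h.
  by apply/eqP; rewrite -addr_eq0 -[X in _ == X]h; apply/eqP; ring.
have h' : X 0 1 = 1.
  have := congr1 (fun u : E4 => u 0 2%R) e'; rewrite /conjugator /qm /qi /qj !rowE => h'.
  by apply/eqP; rewrite eq_sym -subr_eq0 -[X in _ == X]h'; apply/eqP; ring.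
by move/eqP: h; rewrite h' -subr_eq0 opprK -mulr2n pnatr_eq0.
Qed.

Lemma conj_lift (X c : E4) : 0 < dotp c c -> qm X c = qm c qi ->
  forall a : E4, a = (Num.sqrt (dotp c c))^-1 *: qbar c -> dotp a a = 1 /\ cj a a qi = X.
Proof.
move=> c0 Xc a ->; set k := (Num.sqrt _)^-1.
have kk : k * k * dotp c c = 1.
  by rewrite -invfM -expr2 sqr_sqrtr ?ltW// mulVf// gt_eqF.
split; first by rewrite dotpZl dotpZr dotp_bar mulrA.
by rewrite /cj qbarZ qbarK !qmZl qmZr -Xc -qmA qmV qmZr scalerA scalerA kk scale1r qm1r.
Qed.

Lemma lift_exists U X z0 : open U -> U z0 -> smooth_on U X ->
  (forall z, U z -> X z 0 0 = 0 /\ dotp (X z) (X z) = 1) ->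
  exists r a, [/\ 0 < r, box z0 r `<=` U, smooth_on (box z0 r) a &
    forall z, box z0 r z -> dotp (a z) (a z) = 1 /\ cj (a z) (a z) qi = X z].
Proof.
move=> oU Uz0 sX HX.
have [w cw] : exists w, conjugator w (X z0) != 0.
  by have [h|h] := conjugator_neq0 (X z0); [exists q1|exists qj].
have [r0 r00 sub0] : exists2 r, 0 < r & box z0 r `<=` U.
  by apply/nbhs_box; exact: open_nbhs_nbhs.
have oB := @open_boxE _ z0 _ r00.
have {}sX := smooth_subset sub0 sX.
pose c z := conjugator w (X z).
have sc : smooth_on (box z0 r0) c.
  apply: smoothD => //; first exact: smooth_cst.
  apply: smoothNv => //; apply: smooth_qm => //; last exact: smooth_cst.
  by apply: smooth_qm => //; exact: smooth_cst.
have scc := smooth_dotp oB sc sc.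
have c0 : 0 < dotp (c z0) (c z0) by rewrite lt0r dotp_eq0 cw dotp_ge0.
have [r [r1 sub cp]] := box_pos r00 (smooth_cont scc (@box_center _ z0 _ r00)) c0.
have {}oB := @open_boxE _ z0 _ r1.
exists r, (fun z => (Num.sqrt (dotp (c z) (c z)))^-1 *: qbar (c z)).
split=> //; first by move=> z /sub /sub0.
  have {}sc := smooth_subset sub sc; have {}scc := smooth_subset sub scc.
  apply: smooth_scale => //; last exact: smooth_qbar.
  apply: smoothV => //; last exact: smooth_sqrt.
  by move=> z /cp h; rewrite gt_eqF// sqrtr_gt0.
move=> z Bz; have [X0 X1] := HX z (sub0 _ (sub _ Bz)).
by apply: (conj_lift (cp _ Bz) _ erefl); exact: conjugatorP.
Qed.

(* The components of the connection form [da a^-1]. *)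
Lemma unit_deriveE U a z v (da : E4) : open U -> U z ->
  (forall z, U z -> dotp (a z) (a z) = 1) -> is_derive z v a da ->
  da = qm (mk4 0 (dotp da (qm qi (a z))) (dotp da (qm qj (a z))) (dotp da (qm qk (a z)))) (a z).
Proof.
move=> oU Uz a1 D.
have d0 : dotp da (a z) = 0.
  have := dotp_derive0 oU Uz a1 D D; rewrite [dotp (a z) da]dotpC => /eqP.
  by rewrite -subr_eq0 opprK -mulr2n mulrn_eq0 => /eqP.
have E : qm da (qbar (a z)) = mk4 0 (dotp da (qm qi (a z))) (dotp da (qm qj (a z)))
    (dotp da (qm qk (a z))).
  rewrite -d0; move: (a z) da {D d0} => b d.
  by apply: rv4P; rewrite !dotpE /qm /qbar /qi /qj /qk !rowE; ring.
by rewrite -E -qmA qVm a1// scale1r qm1r.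
Qed.

(** Structure equation for one component of [da a^-1]: the second derivatives of [a] cancel by
    symmetry, and the skewness of multiplication by an imaginary [e] doubles the remaining
    product. *)
Lemma connection_curl U a z (e : E4) : open U -> U z -> smooth_on U a -> e 0 0 = 0 ->
  partial_y (fun q => dotp (partial_x a q) (qm e (a q))) z =
  partial_x (fun q => dotp (partial_y a q) (qm e (a q))) z +
  2 * dotp (partial_x a z) (qm e (partial_y a z)).
Proof.
move=> oU Uz sa e0.
have De v : is_derive z v (fun=> e) 0 by exact: is_derive_cst.
have [_ h1] := is_derive_dotp (smooth_dy (smooth_x sa) Uz) (is_derive_qm (De _) (smooth_dy sa Uz)).
have [_ h2] := is_derive_dotp (smooth_dx (smooth_y sa) Uz) (is_derive_qm (De _) (smooth_dx sa Uz)).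
have h3 := schwarz_row oU sa Uz.
apply: (etrans h1); apply: etrans (esym (congr1 (fun t => t + _) h2)).
rewrite h3; move: (partial_y (partial_x a) z) (partial_x a z) (partial_y a z) (a z).
move=> d b b' c.
have q0 (u : E4) : qm 0 u = 0 by apply: rv4P; rewrite /qm !rowE; ring.
have -> : dotp b' (qm 0 c + qm e b) = - dotp b (qm e b').
  by rewrite q0 add0r dotpC (dotp_im_skew _ _ e0).
by rewrite q0 add0r; ring.
Qed.

End SpinLift.

Section HalfLemma.
Context {R : realType}.
Local Notation A := (lorentz R).
Local Notation E4 := 'rV[R]_4.
Implicit Types (U : set A) (a X : A -> E4) (z v : A).

Lemma cjM (a u w : E4) : dotp a a = 1 -> qm (cj a a u) (cj a a w) = cj a a (qm u w).
Proof.
by move=> a1; rewrite /cj !qmA -[qm (qm (qm (qbar a) u) a) (qbar a)]qmA qmV a1 scale1r qm1r.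
Qed.

Lemma qi_bracket (b1 b2 b3 : R) : let B := mk4 0 b1 b2 b3 in
  qm (qbar B) qi + 0 + qm qi B = 2 *: mk4 0 0 (- b3) b2.
Proof. by apply: rv4P; rewrite /qm /qbar /qi !rowE; ring. Qed.

(** The area form pulled back by [X] is, up to a constant, the curl of the [I]-part of the
    connection. Its vanishing therefore makes this part closed, which is what allows it to be gauged
    away. *)
Lemma flat_connection (X Xx Xy a ax ay : E4) (b1 b2 b3 c1 c2 c3 : R) :
  let B := mk4 0 b1 b2 b3 in let C := mk4 0 c1 c2 c3 in
  dotp a a = 1 -> cj a a qi = X -> ax = qm B a -> ay = qm C a ->
  Xx = cj a a (qm (qbar B) qi + 0 + qm qi B) ->
  Xy = cj a a (qm (qbar C) qi + 0 + qm qi C) ->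
  dotp (qm X Xx) Xy = - 4 * dotp ax (qm qi ay).
Proof.
move=> B C a1 <- -> -> -> ->; rewrite !qi_bracket cjM// dotp_cj// qmA dotp_qmr a1.
rewrite !dotpE /qm /qi !rowE; ring.
Qed.

Lemma lift_derive U a X z v (da dX B : E4) : open U -> U z ->
  (forall z, U z -> cj (a z) (a z) qi = X z) ->
  is_derive z v a da -> is_derive z v X dX -> da = qm B (a z) ->
  dX = cj (a z) (a z) (qm (qbar B) qi + 0 + qm qi B).
Proof.
move=> oU Uz aX Da [_ <-] e.
by have [_ <-] := is_derive_ext oU Uz aX (is_derive_cj Da Da (is_derive_cst qi z v) e e).
Qed.

Lemma smooth_connection U a (e : E4) : open U -> smooth_on U a ->
  smooth_on U (fun q => dotp (partial_x a q) (qm e (a q))) /\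
  smooth_on U (fun q => dotp (partial_y a q) (qm e (a q))).
Proof.
move=> oU sa.
have se := smooth_qm oU (@smooth_cst _ _ U e) sa.
by split; [exact: (smooth_dotp oU (smooth_x sa) se)|exact: (smooth_dotp oU (smooth_y sa) se)].
Qed.

Lemma lift_gauge U X z0 : open U -> U z0 -> smooth_on U X ->
  (forall z, U z -> X z 0 0 = 0 /\ dotp (X z) (X z) = 1) ->
  (forall z, U z -> dotp (qm (X z) (partial_x X z)) (partial_y X z) = 0) ->
  exists r a, [/\ 0 < r, box z0 r `<=` U, smooth_on (box z0 r) a &
    forall z, box z0 r z -> [/\ dotp (a z) (a z) = 1, cj (a z) (a z) qi = X z,
      dotp (partial_x a z) (qm qi (a z)) = 0 & dotp (partial_y a z) (qm qi (a z)) = 0]].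
Proof.
move=> oU Uz0 sX HX flat.
have [r [a0 [r0 sub sa0 Ha0]]] := lift_exists oU Uz0 sX HX.
have oB := @open_boxE _ z0 _ r0.
have a1 z : box z0 r z -> dotp (a0 z) (a0 z) = 1 by move=> /Ha0[].
have aX z : box z0 r z -> cj (a0 z) (a0 z) qi = X z by move=> /Ha0[].
have [sp sq] := smooth_connection qi oB sa0.
have cl : curl0 (box z0 r) (fun q => dotp (partial_x a0 q) (qm qi (a0 q)))
    (fun q => dotp (partial_y a0 q) (qm qi (a0 q))).
  move=> z Bz; have Uz := sub _ Bz.
  apply: (etrans (connection_curl oB Bz sa0 _)); first by rewrite /qi mk4E.
  have ex := unit_deriveE oB Bz a1 (smooth_dx sa0 Bz).
  have ey := unit_deriveE oB Bz a1 (smooth_dy sa0 Bz).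
  have fx := lift_derive oB Bz aX (smooth_dx sa0 Bz) (smooth_dx sX Uz) ex.
  have fy := lift_derive oB Bz aX (smooth_dy sa0 Bz) (smooth_dy sX Uz) ey.
  have /eqP := etrans (esym (flat_connection (a1 z Bz) (aX z Bz) ex ey fx fy)) (flat z Uz).
  by rewrite mulf_eq0 oppr_eq0 pnatr_eq0 => /eqP ->; rewrite mulr0 addr0.
have [tau Dtau] := poincare r0 sp sq cl.
have r20 : 0 < r / 2 by rewrite divr_gt0.
have sub2 : box z0 (r / 2) `<=` box z0 r.
  by apply: box_mono; rewrite ler_pdivrMr// ler_pMr// ler1n.
have oB2 := @open_boxE _ z0 _ r20.
have {}sa0 := smooth_subset sub2 sa0.
have st := smooth_primitive oB2 (smooth_subset sub2 sp) (smooth_subset sub2 sq) Dtau.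
(* The exponential of [- tau I], where [d tau] is the [I]-part to be removed. It commutes with [qi],
   so the product with [a0] still lifts [X]. *)
pose e z := mk4 (cos (tau z)) (- sin (tau z)) 0 0.
have se : smooth_on (box z0 (r / 2)) e.
  apply: smooth_mk4 => //; try exact: smooth_cst; first exact: smooth_cos.
  by apply: smoothN => //; exact: smooth_sin.
have De z v d : is_derive z v tau d -> is_derive z v e (- d *: qm qi (e z)).
  move=> D; have Dc := is_derive_chain D (is_derive_cos _).
  have Ds := is_deriveN (is_derive_chain D (is_derive_sin _)).
  apply: (is_derive_eq (is_derive_mk4 Dc Ds (is_derive_cst 0 z v) (is_derive_cst 0 z v))).
  by apply: rv4P; rewrite /e /qm /qi !rowE; ring.
have ee z : dotp (e z) (e z) = 1.
  by rewrite dotpE /e !mk4E -[RHS](cos2Dsin2 (tau z)); ring.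
exists (r / 2), (fun z => qm (e z) (a0 z)); split=> //; first by move=> z /sub2/sub.
  exact: smooth_qm.
move=> z Bz; have Brz := sub2 _ Bz.
have qe : qm qi (e z) = qm (e z) qi by apply: rv4P; rewrite /e /qm /qi !rowE; ring.
have gauge v da d : is_derive z v a0 da -> is_derive z v tau d ->
    d = dotp da (qm qi (a0 z)) ->
    dotp ('D_v (fun z => qm (e z) (a0 z)) z) (qm qi (qm (e z) (a0 z))) = 0.
  move=> Da Dt dE; have [_ h] := is_derive_qm (De _ _ _ Dt) Da.
  rewrite h qmZl [qm qi (qm _ _)]qmA dotpDl dotpZl dotp_qm dotp_qm a1// ee.
  rewrite qe -qmA dotp_qml ee -dE (_ : dotp qi qi = 1); first by ring.
  by rewrite /qi dotpE !mk4E; ring.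
have [D1 D2] := Dtau z Bz.
split.
- by rewrite dotp_qm ee a1// mul1r.
- rewrite -(aX z Brz) /cj qbarM -!qmA; congr qm.
  rewrite !qmA; congr qm.
  by rewrite -qmA qe qmA qVm ee scale1r qm1l.
- exact: gauge (smooth_dx sa0 Bz) D1 erefl.
- exact: gauge (smooth_dy sa0 Bz) D2 erefl.
Qed.

Lemma unit_deriveE_gauged U a z v (da : E4) : open U -> U z ->
  (forall z, U z -> dotp (a z) (a z) = 1) -> is_derive z v a da ->
  dotp da (qm qi (a z)) = 0 ->
  da = qm (mk4 0 0 (dotp da (qm qj (a z))) (dotp da (qm qk (a z)))) (a z).
Proof.
by move=> oU Uz a1 D h; have := unit_deriveE oU Uz a1 D; rewrite h.
Qed.

(** Products of two elements of the plane of [J] and [K] have no part along [J] or [K]: without an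
    [I]-part, the connection has closed [J]- and [K]-components. *)
Lemma gauged_wedge (a ax ay : E4) (b2 b3 c2 c3 : R) : dotp a a = 1 ->
  ax = qm (mk4 0 0 b2 b3) a -> ay = qm (mk4 0 0 c2 c3) a ->
  [/\ dotp ax (qm qi ay) = b3 * c2 - b2 * c3, dotp ax (qm qj ay) = 0 &
      dotp ax (qm qk ay) = 0].
Proof.
move=> a1 -> ->; rewrite !qmA !dotp_qmr a1 !dotpE /qm /qi /qj /qk !rowE.
by split; ring.
Qed.

Lemma gauged_lift_derive (a dX : E4) (b2 b3 : R) :
  let B := mk4 0 0 b2 b3 in
  dX = cj a a (qm (qbar B) qi + 0 + qm qi B) -> dX = 2 *: cj a a (mk4 0 0 (- b3) b2).
Proof. by move=> B; rewrite qi_bracket cjZ. Qed.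

(* A flat map to the unit 2-sphere factors through an arc parameter [s]. *)
Definition half_data U X a (s al : A -> R) : Prop :=
  [/\ smooth_on U a, smooth_on U s, smooth_on U al &
  forall z, U z -> [/\
    dotp (a z) (a z) = 1 /\ cj (a z) (a z) qi = X z,
    partial_x a z = partial_x s z *: qm (mk4 0 0 (cos (al z)) (sin (al z))) (a z) /\
    partial_y a z = partial_y s z *: qm (mk4 0 0 (cos (al z)) (sin (al z))) (a z),
    partial_x al z * partial_y s z = partial_y al z * partial_x s z,
    0 < partial_x s z * partial_x s z + partial_y s z * partial_y s z &
    exists N, partial_x X z = partial_x s z *: N /\ partial_y X z = partial_y s z *: N]].

(** After the gauge the [J]- and [K]-parts of the connection are closed, and the curl of the zero
    [I]-part forces them to be proportional; [arc_lemma] then supplies [s] and [al]. They do not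
    both vanish at [z0], because the derivative of [X] is a rotated copy of them. *)
Lemma half_lemma U X z0 : open U -> U z0 -> smooth_on U X ->
  (forall z, U z -> X z 0 0 = 0 /\ dotp (X z) (X z) = 1) ->
  (forall z, U z -> dotp (qm (X z) (partial_x X z)) (partial_y X z) = 0) ->
  partial_x X z0 != 0 \/ partial_y X z0 != 0 ->
  exists r a s al, [/\ 0 < r, box z0 r `<=` U & half_data (box z0 r) X a s al].
Proof.
move=> oU Uz0 sX HX flat X0.
have [r [a [r0 sub sa Ha]]] := lift_gauge oU Uz0 sX HX flat.
have oB := @open_boxE _ z0 _ r0.
have a1 z : box z0 r z -> dotp (a z) (a z) = 1 by move=> /Ha[].
have aX z : box z0 r z -> cj (a z) (a z) qi = X z by move=> /Ha[].
have [si si'] := smooth_connection qi oB sa.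
have [sp sq] := smooth_connection qj oB sa.
have [sp' sq'] := smooth_connection qk oB sa.
have [ix iy] : (forall z, box z0 r z -> dotp (partial_x a z) (qm qi (a z)) = 0) /\
    (forall z, box z0 r z -> dotp (partial_y a z) (qm qi (a z)) = 0).
  by split=> z /Ha[].
have ex z (Bz : box z0 r z) := unit_deriveE_gauged oB Bz a1 (smooth_dx sa Bz) (ix z Bz).
have ey z (Bz : box z0 r z) := unit_deriveE_gauged oB Bz a1 (smooth_dy sa Bz) (iy z Bz).
have wd z (Bz : box z0 r z) := gauged_wedge (a1 z Bz) (ex z Bz) (ey z Bz).
have clj : curl0 (box z0 r) (fun q => dotp (partial_x a q) (qm qj (a q)))
    (fun q => dotp (partial_y a q) (qm qj (a q))).
  move=> z Bz; have [_ h _] := wd z Bz.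
  apply: (etrans (connection_curl oB Bz sa _)); first by rewrite /qj mk4E.
  by rewrite h mulr0 addr0.
have clk : curl0 (box z0 r) (fun q => dotp (partial_x a q) (qm qk (a q)))
    (fun q => dotp (partial_y a q) (qm qk (a q))).
  move=> z Bz; have [_ _ h] := wd z Bz.
  apply: (etrans (connection_curl oB Bz sa _)); first by rewrite /qk mk4E.
  by rewrite h mulr0 addr0.
have wedge_alg (p q p' q' : R) : p' * q - p * q' = 0 -> p * q' = q * p'.
  by move=> /eqP; rewrite subr_eq0 => /eqP <-; rewrite mulrC.
have wedge z : box z0 r z ->
    dotp (partial_x a z) (qm qj (a z)) * dotp (partial_y a z) (qm qk (a z)) =
    dotp (partial_y a z) (qm qj (a z)) * dotp (partial_x a z) (qm qk (a z)).
  move=> Bz; have [h _ _] := wd z Bz.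
  have qi0 : qi 0 0 = 0 :> R by rewrite /qi mk4E.
  have k1 := etrans (derive_ext lsigma oB Bz ix) (derive_cst _ _ _).
  have k2 := etrans (derive_ext (1 : A) oB Bz iy) (derive_cst _ _ _).
  have h' := etrans (esym k1) (etrans (connection_curl oB Bz sa qi0) (congr1 (fun t => t + _) k2)).
  move: h'; rewrite h add0r => /esym/eqP; rewrite mulf_eq0 pnatr_eq0 /= => /eqP.
  exact: wedge_alg.
have B0 := @box_center _ z0 _ r0.
have XD z (Bz : box z0 r z) := conj
  (gauged_lift_derive (lift_derive oB Bz aX (smooth_dx sa Bz) (smooth_dx sX (sub _ Bz)) (ex z Bz)))
  (gauged_lift_derive (lift_derive oB Bz aX (smooth_dy sa Bz) (smooth_dy sX (sub _ Bz)) (ey z Bz))).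
have mk0 : mk4 0 0 (- 0) 0 = 0 :> E4 by apply: rv4P; rewrite !rowE ?oppr0.
have cj0 (b : E4) : cj b b 0 = 0 by rewrite -[X in cj b b X](scale0r 0) cjZ scale0r.
have nz (b Xx Xy : E4) (p p' q q' : R) : Xx = 2 *: cj b b (mk4 0 0 (- p') p) ->
    Xy = 2 *: cj b b (mk4 0 0 (- q') q) -> Xx != 0 \/ Xy != 0 ->
    0 < (p * p + q * q) + (p' * p' + q' * q').
  move=> hx hy X1; rewrite lt0r -!expr2 !addr_ge0 ?sqr_ge0// andbT.
  apply/negP; rewrite !paddr_eq0 ?addr_ge0 ?sqr_ge0// !sqrf_eq0.
  case/andP=> /andP[/eqP p0 /eqP q0] /andP[/eqP p'0 /eqP q'0].
  by case: X1 => /eqP; apply; rewrite ?hx ?hy ?p0 ?p'0 ?q0 ?q'0 mk0 cj0 scaler0.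
have n0 : 0 < (dotp (partial_x a z0) (qm qj (a z0)) * dotp (partial_x a z0) (qm qj (a z0)) +
    dotp (partial_y a z0) (qm qj (a z0)) * dotp (partial_y a z0) (qm qj (a z0))) +
  (dotp (partial_x a z0) (qm qk (a z0)) * dotp (partial_x a z0) (qm qk (a z0)) +
    dotp (partial_y a z0) (qm qk (a z0)) * dotp (partial_y a z0) (qm qk (a z0))).
  by have [hx hy] := XD z0 B0; exact: nz hx hy X0.
have [r' [s [al [r'0 sub' [ss sal] H]]]] := arc_lemma r0 sp sq sp' sq' clj clk wedge n0.
exists r', a, s, al; split=> //; first by move=> z /sub'/sub.
split=> //; first exact: smooth_subset sub' sa.
move=> z Bz'; have Bz := sub' _ Bz'; have [[e1 e2] [e3 e4] e5 e6] := H z Bz'.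
have sc (t c d : R) : mk4 0 0 (c * t) (d * t) = t *: mk4 0 0 c d.
  by apply: rv4P; rewrite !rowE; ring.
split=> //; first by split; [exact: a1|exact: aX].
  split; first by apply: (etrans (ex z Bz)); rewrite e1 e3 sc qmZl.
  by apply: (etrans (ey z Bz)); rewrite e2 e4 sc qmZl.
have [hx hy] := XD z Bz.
exists (2 *: cj (a z) (a z) (mk4 0 0 (- sin (al z)) (cos (al z)))); split.
  by apply: (etrans hx); rewrite e1 e3 -mulNr sc cjZ !scalerA mulrC.
by apply: (etrans hy); rewrite e2 e4 -mulNr sc cjZ !scalerA mulrC.
Qed.

End HalfLemma.

(** * From flat surfaces to the representation data *)

Section CoordinateChange.
Context {R : realType}.
Local Notation A := (lorentz R).
Local Notation E4 := 'rV[R]_4.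
Implicit Types (U V W : set A) (F a b X : A -> E4) (s t al be : A -> R) (z y v : A).

Lemma is_derive_subst_row U F (S1 S2 : A -> R) z v (d1 d2 : R) : open U ->
  smooth_on U F -> U (S1 z, S2 z) ->
  is_derive z v S1 d1 -> is_derive z v S2 d2 ->
  is_derive z v (fun w => F (S1 w, S2 w))
    (d1 *: partial_x F (S1 z, S2 z) + d2 *: partial_y F (S1 z, S2 z)).
Proof.
move=> oU sF Uz D1 D2.
have c i : is_derive z v (fun w => F (S1 w, S2 w) 0 i)
    (d1 * partial_x F (S1 z, S2 z) 0 i + d2 * partial_y F (S1 z, S2 z) 0 i).
  have [h1 h2] := partial_coord i sF Uz; rewrite h1 h2.
  exact: is_derive_subst (smooth_is_diff oU (smooth_coord i oU sF) Uz) D1 D2.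
rewrite (_ : (fun w => _) = fun w => mk4 (F (S1 w, S2 w) 0 0) (F (S1 w, S2 w) 0 1)
    (F (S1 w, S2 w) 0 2%R) (F (S1 w, S2 w) 0 3%R)); last by apply/funext => w; rewrite -mk4_eta.
have lc (p q : E4) : mk4 (d1 * p 0 0 + d2 * q 0 0) (d1 * p 0 1 + d2 * q 0 1)
    (d1 * p 0 2%R + d2 * q 0 2%R) (d1 * p 0 3%R + d2 * q 0 3%R) = d1 *: p + d2 *: q.
  by apply: rv4P; rewrite !rowE.
exact: is_derive_eq (is_derive_mk4 (c 0) (c 1) (c 2%R) (c 3%R)) (lc _ _).
Qed.

Lemma smooth_subst_row U V F (S1 S2 : A -> R) : open U -> open V ->
  (forall z, U z -> V (S1 z, S2 z)) -> smooth_on U S1 -> smooth_on U S2 ->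
  smooth_on V F -> smooth_on U (fun z => F (S1 z, S2 z)).
Proof.
move=> oU oV UV s1 s2 sF; apply: smooth_mx => // i j; rewrite ord1.
exact: (smooth_subst oU oV UV s1 s2 (smooth_coord j oV sF)).
Qed.

Lemma tw_anti_r (P Q : E4) : qm (tw P Q) Q = - qm Q (tw (qbar P) (qbar Q)).
Proof.
rewrite /tw /gramd !dotp_bar qmZl qmZr -[in RHS]scalerN; congr (_ *: _).
rewrite qbarK qmDl qmNl qmZl qm1l qmDr qmNr qmZr qm1r -[qm (qm P _) Q]qmA qVm qmZr qm1r.
by rewrite !dotpE; apply: rv4P; rewrite /qm /qbar !rowE; ring.
Qed.

(** Write [P] as the image of [w] in the frame. The relation between [X] and [Y] on [P] says that
    [w] anticommutes with [qi], which leaves only components along [J] and [K]. *)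
Lemma cj_split (a b X Y P : E4) : dotp a a = 1 -> dotp b b = 1 ->
  cj a a qi = X -> cj b b qi = Y -> qm X P = - qm P Y ->
  exists p p', P = cj a b (mk4 0 0 p p') /\ qm X P = cj a b (mk4 0 0 (- p') p).
Proof.
move=> a1 b1 aX bY XP.
have [w PE] : exists w, P = cj a b w.
  exists (qm (qm a P) (qbar b)).
  by rewrite /cj !qmA qVm a1 scale1r qm1l -qmA qVm b1 scale1r qm1r.
have XPE : qm X P = cj a b (qm qi w).
  by rewrite PE -aX /cj !qmA -[qm (qm (qm (qbar a) qi) a) (qbar a)]qmA qmV a1 scale1r qm1r.
have PYE : qm P Y = cj a b (qm w qi).
  by rewrite {1}PE -bY /cj !qmA -[qm (qm (qm (qbar a) w) b) (qbar b)]qmA qmV b1 scale1r qm1r.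
have E : qm qi w = - qm w qi.
  have : cj a b (qm qi w) = cj a b (- qm w qi).
    by rewrite -XPE XP PYE -scaleN1r -cjZ scaleN1r.
  move=> /(congr1 (fun u => qm (qm a u) (qbar b))); rewrite /cj !qmA qmV a1 scale1r !qm1l.
  by rewrite -![qm (qm _ b) (qbar b)]qmA qmV b1 scale1r !qm1r.
have w0 : w 0 0 = 0.
  have := congr1 (fun u : E4 => u 0 1) E; rewrite /qm /qi !rowE => h; lra.
have w1 : w 0 1 = 0.
  have := congr1 (fun u : E4 => u 0 0) E; rewrite /qm /qi !rowE => h; lra.
exists (w 0 2%R), (w 0 3%R).
have wE : w = mk4 0 0 (w 0 2%R) (w 0 3%R) by rewrite {1}[w]mk4_eta w0 w1.
rewrite -wE; split=> //; rewrite XPE; congr cj.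
by rewrite wE; apply: rv4P; rewrite /qm /qi !rowE; ring.
Qed.

Lemma half_data_subset U V X a s al : V `<=` U -> half_data U X a s al -> half_data V X a s al.
Proof.
move=> VU [sa ss sal H]; split; try exact: smooth_subset VU _.
by move=> z /VU; exact: H.
Qed.

(** Reversing the arc parameter and adding [pi] to the angle leave [a] and its derivatives
    unchanged; this is the freedom used to correct the orientation of the new coordinates. *)
Lemma half_data_flip U X a s al : open U -> half_data U X a s al ->
  half_data U X a (fun z => - s z) (fun z => al z + pi).
Proof.
move=> oU [sa ss sal H].
have sal' : smooth_on U (fun z => al z + pi) by apply: smoothD => //; exact: smooth_cst.
split=> //; first exact: smoothN.
move=> z Uz; have [e1 [e2 e2'] e3 e4 [N [e5 e5']]] := H z Uz.
have [_ hx] := is_deriveN (smooth_dx ss Uz); have [_ hy] := is_deriveN (smooth_dy ss Uz).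
have [_ kx] := is_deriveD' (smooth_dx sal Uz) (is_derive_cst (pi : R) z 1).
have [_ ky] := is_deriveD' (smooth_dy sal Uz) (is_derive_cst (pi : R) z lsigma).
have {}hx : partial_x (fun z => - s z) z = - partial_x s z := hx.
have {}hy : partial_y (fun z => - s z) z = - partial_y s z := hy.
have {}kx : partial_x (fun z => al z + pi) z = partial_x al z := etrans kx (addr0 _).
have {}ky : partial_y (fun z => al z + pi) z = partial_y al z := etrans ky (addr0 _).
rewrite hx hy kx ky cosDpi sinDpi; split; first exact: e1.
- have uN c d : mk4 0 0 (- c) (- d) = - mk4 0 0 c d :> E4.
    by apply: rv4P; rewrite !rowE; ring.
  have flip (k : R) c d (q : E4) : k *: qm (mk4 0 0 c d) q =
      (- k) *: qm (mk4 0 0 (- c) (- d)) q.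
    by rewrite uN qmNl scalerN scaleNr opprK.
  by split; [exact: etrans e2 (flip _ _ _ _)|exact: etrans e2' (flip _ _ _ _)].
- have mN (x y x' y' : R) : x * y = x' * y' -> x * - y = x' * - y' by rewrite !mulrN => ->.
  exact: mN e3.
- have mNN (x y : R) : 0 < x * x + y * y -> 0 < - x * - x + - y * - y by rewrite !mulrNN.
  exact: mNN e4.
- have sN (k : R) (q : E4) : k *: q = - k *: - q by rewrite scalerN scaleNr opprK.
  by exists (- N); split; [exact: etrans e5 (sN _ _)|exact: etrans e5' (sN _ _)].
Qed.

Definition diffeo W V (T1 T2 S1 S2 : A -> R) : Prop :=
  [/\ open W, open V, smooth_on W T1 /\ smooth_on W T2, smooth_on V S1 /\ smooth_on V S2 &
    (forall z, W z -> V (T1 z, T2 z) /\ (S1 (T1 z, T2 z), S2 (T1 z, T2 z)) = z) /\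
    (forall y, V y -> [/\ W (S1 y, S2 y), T1 (S1 y, S2 y) = y.1 & T2 (S1 y, S2 y) = y.2])].

Definition conv_data V a b al be F : Prop :=
  [/\ [/\ smooth_on V a, smooth_on V b, smooth_on V al, smooth_on V be & smooth_on V F],
    forall y, V y -> dotp (a y) (a y) = 1 /\ dotp (b y) (b y) = 1,
    (forall y, V y -> partial_x a y = qm (mk4 0 0 (cos (al y)) (sin (al y))) (a y) /\
      partial_y a y = qm (mk4 0 0 (cos (al y)) (sin (al y))) (a y)) /\
    (forall y, V y -> partial_x b y = qm (mk4 0 0 (cos (be y)) (sin (be y))) (b y) /\
      partial_y b y = qm (- mk4 0 0 (cos (be y)) (sin (be y))) (b y)),
    forall y, V y -> partial_y al y = partial_x al y /\ partial_y be y = - partial_x be y &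
    forall y, V y -> exists p p' q q', [/\ partial_x F y = cj (a y) (b y) (mk4 0 0 p p'),
      partial_y F y = cj (a y) (b y) (mk4 0 0 q q') & 0 < p * q' - p' * q]].

Lemma change_coordinates (z0 : A) (r : R) F a b s t al be : 0 < r ->
  let U := box z0 r in
  smooth_on U F -> (forall z, U z -> 0 < gramd (partial_x F z) (partial_y F z)) ->
  half_data U (fun z => tw (partial_x F z) (partial_y F z)) a s al ->
  half_data U (fun z => tw (qbar (partial_x F z)) (qbar (partial_y F z))) b t be ->
  partial_x s z0 * partial_y t z0 - partial_y s z0 * partial_x t z0 < 0 ->
  exists W (y0 : A) (r' : R) (T1 T2 S1 S2 : A -> R), let V := box y0 r' in
    [/\ W `<=` U, W z0, 0 < r', diffeo W V T1 T2 S1 S2 &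
      conv_data V (fun y => a (S1 y, S2 y)) (fun y => b (S1 y, S2 y))
        (fun y => al (S1 y, S2 y)) (fun y => be (S1 y, S2 y)) (fun y => F (S1 y, S2 y))].
Proof.
move=> r0 U sF D0 [sa ss sal Ha] [sb st sbe Hb] J0.
have oU : open U by exact: open_boxE.
have Uz0 : U z0 by exact: box_center.
pose T1 z := (1 / 2) * s z + (1 / 2) * t z.
pose T2 z := (1 / 2) * s z + (- 1 / 2) * t z.
have sT1 : smooth_on U T1 by exact: smooth_lincomb.
have sT2 : smooth_on U T2 by exact: smooth_lincomb.
(* The map from [(s, t)] to the half sum and half difference has determinant [- 1 / 2], so the
   negative sign in the hypothesis makes the change of coordinates orientation preserving. *)
have jacE z : U z -> jac2 T1 T2 z =
    - (1 / 2) * (partial_x s z * partial_y t z - partial_y s z * partial_x t z).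
  move=> Uz.
  have [_ h1] := is_derive_lincomb (1 / 2) (1 / 2) (smooth_dx ss Uz) (smooth_dx st Uz).
  have [_ h2] := is_derive_lincomb (1 / 2) (1 / 2) (smooth_dy ss Uz) (smooth_dy st Uz).
  have [_ h3] := is_derive_lincomb (1 / 2) (- 1 / 2) (smooth_dx ss Uz) (smooth_dx st Uz).
  have [_ h4] := is_derive_lincomb (1 / 2) (- 1 / 2) (smooth_dy ss Uz) (smooth_dy st Uz).
  have alg (x1 x2 x3 x4 a1 a2 b1 b2 : R) : x1 = (1 / 2) * a1 + (1 / 2) * b1 ->
      x2 = (1 / 2) * a2 + (1 / 2) * b2 -> x3 = (1 / 2) * a1 + (- 1 / 2) * b1 ->
      x4 = (1 / 2) * a2 + (- 1 / 2) * b2 ->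
      x1 * x4 - x2 * x3 = - (1 / 2) * (a1 * b2 - a2 * b1).
    by move=> -> -> -> ->; field.
  exact: alg h1 h2 h3 h4.
have jac0 : 0 < jac2 T1 T2 z0.
  by rewrite (jacE _ Uz0) mulNr -mulrN mulr_gt0 ?divr_gt0// oppr_gt0.
have sJ := smooth_jac2 oU sT1 sT2.
have [r1 [r10 sub Jp]] := box_pos r0 (smooth_cont sJ Uz0) jac0.
have oB := @open_boxE _ z0 _ r10; have B0 := @box_center _ z0 _ r10.
have jacn0 : jac2 T1 T2 z0 != 0 by rewrite gt_eqF.
have [W [r' [S1 [S2 [[oW WB] Wz0 r'0 [sS1 sS2] [TW SV]]]]]] :=
  inverse_function oB B0 (smooth_subset sub sT1) (smooth_subset sub sT2) jacn0.
set y0 : A := (T1 z0, T2 z0) in r'0 sS1 sS2 TW SV.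
have WU : W `<=` U by move=> w /WB/sub.
have oV := @open_boxE _ y0 _ r'0.
exists W, y0, r', T1, T2, S1, S2; split=> //.
  split=> //; first by split; exact: smooth_subset WU _.
  split=> [z Wz|//]; have [h1 h2 h3] := TW z Wz; split=> //.
  by rewrite h2 h3 -surjective_pairing.
set V := box y0 r' in oV sS1 sS2 SV *.
have SU y : V y -> U (S1 y, S2 y) by move=> /SV[/WU].
have sE y : V y -> s (S1 y, S2 y) = y.1 + y.2.
  by move=> /SV[_ <- <-]; rewrite /T1 /T2; field.
have tE y : V y -> t (S1 y, S2 y) = y.1 - y.2.
  by move=> /SV[_ <- <-]; rewrite /T1 /T2; field.
have Dfst y v : is_derive y v (fun z : A => z.1) v.1.
  exact: (is_derive_lin fst_linear (@continuous_fst' R) (is_derive_id y v)).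
have Dsnd y v : is_derive y v (fun z : A => z.2) v.2.
  exact: (is_derive_lin snd_linear (@continuous_snd' R) (is_derive_id y v)).
have sdir y v d1 d2 : V y -> is_derive y v S1 d1 -> is_derive y v S2 d2 ->
    d1 * partial_x s (S1 y, S2 y) + d2 * partial_y s (S1 y, S2 y) = v.1 + v.2.
  move=> Vy D1 D2.
  have [_ <-] := is_derive_subst (smooth_is_diff oU ss (SU y Vy)) D1 D2.
  by rewrite (derive_ext v oV Vy sE); have [_ <-] := is_deriveD' (Dfst y v) (Dsnd y v).
have tdir y v d1 d2 : V y -> is_derive y v S1 d1 -> is_derive y v S2 d2 ->
    d1 * partial_x t (S1 y, S2 y) + d2 * partial_y t (S1 y, S2 y) = v.1 - v.2.
  move=> Vy D1 D2.
  have [_ <-] := is_derive_subst (smooth_is_diff oU st (SU y Vy)) D1 D2.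
  by rewrite (derive_ext v oV Vy tE); have [_ <-] := is_deriveB (Dfst y v) (Dsnd y v).
have smap (h : A -> R) : smooth_on U h -> smooth_on V (fun y => h (S1 y, S2 y)).
  exact: (smooth_subst oV oU SU sS1 sS2).
have smapr (h : A -> E4) : smooth_on U h -> smooth_on V (fun y => h (S1 y, S2 y)).
  exact: (smooth_subst_row oV oU SU sS1 sS2).
have adir y v d1 d2 : V y -> is_derive y v S1 d1 -> is_derive y v S2 d2 ->
    is_derive y v (fun y => a (S1 y, S2 y)) ((v.1 + v.2) *:
      qm (mk4 0 0 (cos (al (S1 y, S2 y))) (sin (al (S1 y, S2 y)))) (a (S1 y, S2 y))).
  move=> Vy D1 D2; have [_ [e1 e2] _ _ _] := Ha _ (SU y Vy).
  apply: (is_derive_eq (is_derive_subst_row oU sa (SU y Vy) D1 D2)).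
  by rewrite -(sdir y v d1 d2 Vy D1 D2) e1 e2 !scalerA -scalerDl.
have bdir y v d1 d2 : V y -> is_derive y v S1 d1 -> is_derive y v S2 d2 ->
    is_derive y v (fun y => b (S1 y, S2 y)) ((v.1 - v.2) *:
      qm (mk4 0 0 (cos (be (S1 y, S2 y))) (sin (be (S1 y, S2 y)))) (b (S1 y, S2 y))).
  move=> Vy D1 D2; have [_ [e1 e2] _ _ _] := Hb _ (SU y Vy).
  apply: (is_derive_eq (is_derive_subst_row oU sb (SU y Vy) D1 D2)).
  by rewrite -(tdir y v d1 d2 Vy D1 D2) e1 e2 !scalerA -scalerDl.
(* A covector proportional to the nonzero [ds] is its orthogonal projection on [ds]. The resulting
   factor is the same for every direction, so in the new coordinates [al] varies with [s] only and
   [be] with [t] only. *)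
have prop (d1 d2 x y sx sy : R) : x * sy = y * sx -> 0 < sx * sx + sy * sy ->
    d1 * x + d2 * y = (d1 * sx + d2 * sy) * ((x * sx + y * sy) / (sx * sx + sy * sy)).
  move=> e n0; apply: (@mulIf _ (sx * sx + sy * sy)); first by rewrite gt_eqF.
  rewrite !mulrA mulfVK ?gt_eqF//.
  apply/eqP; rewrite -subr_eq0 (_ : _ - _ = (d1 * sy - d2 * sx) * (x * sy - y * sx)).
    by rewrite e subrr mulr0.
  by ring.
have aldir y v d1 d2 : V y -> is_derive y v S1 d1 -> is_derive y v S2 d2 ->
    exists k : R, forall v d1 d2, is_derive y v S1 d1 -> is_derive y v S2 d2 ->
    is_derive y v (fun y => al (S1 y, S2 y)) ((v.1 + v.2) * k).
  move=> Vy _ _; have [_ _ e1 e2 _] := Ha _ (SU y Vy); eexists => {}v {}d1 {}d2 D1 D2.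
  apply: (is_derive_eq (is_derive_subst (smooth_is_diff oU sal (SU y Vy)) D1 D2)).
  by apply: (etrans (prop _ _ _ _ _ _ e1 e2)); rewrite (sdir y v d1 d2 Vy D1 D2).
have bedir y v d1 d2 : V y -> is_derive y v S1 d1 -> is_derive y v S2 d2 ->
    exists k : R, forall v d1 d2, is_derive y v S1 d1 -> is_derive y v S2 d2 ->
    is_derive y v (fun y => be (S1 y, S2 y)) ((v.1 - v.2) * k).
  move=> Vy _ _; have [_ _ e1 e2 _] := Hb _ (SU y Vy); eexists => {}v {}d1 {}d2 D1 D2.
  apply: (is_derive_eq (is_derive_subst (smooth_is_diff oU sbe (SU y Vy)) D1 D2)).
  by apply: (etrans (prop _ _ _ _ _ _ e1 e2)); rewrite (tdir y v d1 d2 Vy D1 D2).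
split.
- by split; [exact: smapr|exact: smapr|exact: smap|exact: smap|exact: smapr].
- by move=> y /SU Uy; have [[? _] _ _ _ _] := Ha _ Uy; have [[? _] _ _ _ _] := Hb _ Uy.
- split=> y Vy; have [x1 x2] := (smooth_dx sS1 Vy, smooth_dx sS2 Vy);
    have [y1 y2] := (smooth_dy sS1 Vy, smooth_dy sS2 Vy).
    have [_ ex] := adir y 1 _ _ Vy x1 x2; have [_ ey] := adir y lsigma _ _ Vy y1 y2.
    by split; [apply: (etrans ex)|apply: (etrans ey)]; rewrite /= ?addr0 ?add0r scale1r.
  have [_ ex] := bdir y 1 _ _ Vy x1 x2; have [_ ey] := bdir y lsigma _ _ Vy y1 y2.
  split; first by apply: (etrans ex); rewrite /= subr0 scale1r.
  by apply: (etrans ey); rewrite /= sub0r scaleN1r qmNl.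
- move=> y Vy; have [x1 x2] := (smooth_dx sS1 Vy, smooth_dx sS2 Vy);
    have [y1 y2] := (smooth_dy sS1 Vy, smooth_dy sS2 Vy).
  have [k Hk] := aldir y 1 _ _ Vy x1 x2; have [l Hl] := bedir y 1 _ _ Vy x1 x2.
  have [_ e1] := Hk 1 _ _ x1 x2; have [_ e2] := Hk lsigma _ _ y1 y2.
  have [_ e3] := Hl 1 _ _ x1 x2; have [_ e4] := Hl lsigma _ _ y1 y2.
  split; first by apply: (etrans e2); apply: etrans (esym e1); rewrite /= addr0 add0r.
  by apply: (etrans e4); apply: etrans (esym (congr1 -%R e3)); rewrite /= subr0 sub0r mulN1r mul1r.
- move=> y Vy; have [x1 x2] := (smooth_dx sS1 Vy, smooth_dx sS2 Vy);
    have [y1 y2] := (smooth_dy sS1 Vy, smooth_dy sS2 Vy); have Uy := SU y Vy.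
  have [[a1 aX] _ _ _ _] := Ha _ Uy; have [[b1 bY] _ _ _ _] := Hb _ Uy.
  have [p [p' [eP eXP]]] := cj_split a1 b1 aX bY (tw_anti _ _).
  have [q [q' [eQ _]]] := cj_split a1 b1 aX bY (tw_anti_r _ _).
  have area : 0 < p * q' - p' * q.
    have : 0 < dotp (qm (tw (partial_x F (S1 y, S2 y)) (partial_y F (S1 y, S2 y)))
        (partial_x F (S1 y, S2 y))) (partial_y F (S1 y, S2 y)).
      by rewrite tw_area ?D0// sqrtr_gt0 D0.
    have al2 (u Q : E4) : u = cj (a (S1 y, S2 y)) (b (S1 y, S2 y)) (mk4 0 0 (- p') p) ->
        Q = cj (a (S1 y, S2 y)) (b (S1 y, S2 y)) (mk4 0 0 q q') -> dotp u Q = p * q' - p' * q.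
      by move=> -> ->; rewrite dotp_cj// dotpE !mk4E; ring.
    by rewrite (al2 _ _ eXP eQ).
  have Jy : 0 < jac2 T1 T2 (S1 y, S2 y) by have [/WB h _ _] := SV y Vy; exact: Jp.
  rewrite (jacE _ Uy) in Jy.
  have := sdir y 1 _ _ Vy x1 x2; have := sdir y lsigma _ _ Vy y1 y2.
  have := tdir y 1 _ _ Vy x1 x2; have := tdir y lsigma _ _ Vy y1 y2.
  have [_ Gx] := is_derive_subst_row oU sF Uy x1 x2.
  have [_ Gy] := is_derive_subst_row oU sF Uy y1 y2.
  move: Gx Gy Jy.
  have fin (sx sy tx ty d1 d2 f1 f2 : R) (Gx Gy P Q c d : E4) :
      P = cj c d (mk4 0 0 p p') -> Q = cj c d (mk4 0 0 q q') ->
      Gx = d1 *: P + d2 *: Q -> Gy = f1 *: P + f2 *: Q ->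
      0 < - (1 / 2) * (sx * ty - sy * tx) ->
      f1 * tx + f2 * ty = 0 - 1 -> d1 * tx + d2 * ty = 1 - 0 ->
      f1 * sx + f2 * sy = 0 + 1 -> d1 * sx + d2 * sy = 1 + 0 ->
      exists p p' q q', [/\ Gx = cj c d (mk4 0 0 p p'), Gy = cj c d (mk4 0 0 q q') &
        0 < p * q' - p' * q].
    move=> -> -> -> -> J h1 h2 h3 h4.
    exists (d1 * p + d2 * q), (d1 * p' + d2 * q'), (f1 * p + f2 * q), (f1 * p' + f2 * q').
    split.
    - by rewrite -!cjZ -cjD; congr cj; apply: rv4P; rewrite !rowE; ring.
    - by rewrite -!cjZ -cjD; congr cj; apply: rv4P; rewrite !rowE; ring.
    have -> : (d1 * p + d2 * q) * (f1 * p' + f2 * q') - (d1 * p' + d2 * q') * (f1 * p + f2 * q)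
      = (d1 * f2 - d2 * f1) * (p * q' - p' * q) by ring.
    apply: mulr_gt0 => //.
    (* The Jacobians of the coordinate change and of its inverse multiply to one, so the inverse
       also preserves the orientation. *)
    have : (d1 * f2 - d2 * f1) * (- (1 / 2) * (sx * ty - sy * tx)) = 1.
      transitivity (- (1 / 2) * ((d1 * sx + d2 * sy) * (f1 * tx + f2 * ty)
        - (f1 * sx + f2 * sy) * (d1 * tx + d2 * ty))); first by ring.
      by rewrite h1 h2 h3 h4; field.
    by move=> e; rewrite -(pmulr_lgt0 _ J) e.
  exact: fin eP eQ.
Qed.

End CoordinateChange.

Section BoxSimplyConnected.
Context {R : realType}.
Local Notation A := (lorentz R).

Lemma box_convex (y0 z w : A) (r k : R) : 0 <= k <= 1 -> box y0 r z -> box y0 r w ->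
  box y0 r (z + k *: (w - z)).
Proof.
move=> /andP[k0 k1] /boxP Bz /boxP Bw; apply/boxP.
have -> : z + k *: (w - z) - y0 = (1 - k) *: (z - y0) + k *: (w - y0).
  by apply: lorentzP => /=; rewrite /GRing.scale /=; ring.
apply: (le_lt_trans (ler_normD _ _)); rewrite !normrZ ger0_norm ?subr_ge0// ger0_norm//.
have [->|kn] := eqVneq k 0; first by rewrite subr0 mul1r mul0r addr0.
have kp : 0 < k by rewrite lt0r kn.
have h1 : (1 - k) * `|z - y0| <= (1 - k) * r by rewrite ler_wpM2l ?subr_ge0// ltW.
have h2 : k * `|w - y0| < k * r by rewrite ltr_pM2l.
lra.
Qed.

(** Straight segments and straight-line contraction, by convexity. Both parameters are clamped so
    that the homotopy is continuous on the whole plane. *)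
Lemma box_simply_connected (y0 : A) (r : R) : simply_connected (box y0 r).
Proof.
have seg_cont (z : A) (f : R -> R) (g : R -> A) : continuous f -> continuous g ->
    continuous (fun t => z + f t *: g t).
  by move=> cf cg t; apply: cvgD; [exact: cvg_cst|apply: cvgZ; [exact: cf|exact: cg]].
split=> [z w Bz Bw|c [cc cB] c01].
  exists (fun t => z + t *: (w - z)); split; last by rewrite scale1r addrC subrK.
    split; last by move=> t t01; exact: box_convex.
    apply: continuous_subspaceT; apply: seg_cont => t; [exact: cvg_id|exact: cvg_cst].
  by rewrite scale0r addr0.
have cK := continuous_path_clamp cc.
have cBK t : box y0 r (c (clamp t)) by apply: cB; exact: clamp01.
exists (fun p => c (clamp p.2) + clamp p.1 *: (c 0 - c (clamp p.2))); split.
- apply: continuous_subspaceT => p.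
  have c2 : {for p, continuous (fun p : R * R => c (clamp p.2))}.
    by apply: (@continuous_comp _ _ _ (fun p : R * R => p.2) (c \o clamp)); [exact: cvg_snd|exact: cK].
  have c1 : {for p, continuous (fun p : R * R => clamp p.1)}.
    by apply: (@continuous_comp _ _ _ (fun p : R * R => p.1) clamp); [exact: cvg_fst|exact: clamp_continuous].
  apply: cvgD; first exact: c2.
  by apply: cvgZ; [exact: c1|apply: cvgB; [exact: cvg_cst|exact: c2]].
- move=> s t s01 t01; apply: box_convex; first exact: clamp01.
    exact: cBK.
  by apply: cB; rewrite lexx ler01.
- move=> t t01 /=; rewrite (clamp_id t01) (@clamp_le0 _ 0 (lexx 0)) (@clamp_ge1 _ 1 (lexx 1)) scale0r addr0 scale1r.
  by rewrite addrC subrK.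
- move=> s s01 /=; rewrite (clamp_id s01); split.
    by rewrite (@clamp_le0 _ 0 (lexx 0)) subrr scaler0 addr0.
  by rewrite (@clamp_ge1 _ 1 (lexx 1)) -c01 subrr scaler0 addr0.
Qed.

End BoxSimplyConnected.

(** * Reconstruction of the representation data *)

Section Representation.
Context {R : realType}.
Local Notation A := (lorentz R).
Local Notation E4 := 'rV[R]_4.

Lemma cj_inj (a b u w : E4) : dotp a a = 1 -> dotp b b = 1 -> cj a b u = cj a b w -> u = w.
Proof.
move=> a1 b1 /(congr1 (fun x => qm (qm a x) (qbar b))); rewrite /cj !qmA qmV a1 scale1r !qm1l.
by rewrite -![qm (qm _ b) (qbar b)]qmA qmV b1 scale1r !qm1r.
Qed.

Lemma cjK (a b u : E4) : dotp a a = 1 -> dotp b b = 1 ->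
  qm (qm a (cj a b u)) (qbar b) = u.
Proof.
move=> a1 b1; rewrite /cj !qmA qmV a1 scale1r qm1l.
by rewrite -[qm (qm _ b) (qbar b)]qmA qmV b1 scale1r qm1r.
Qed.

(** The components along [1] and [I] say that a rotation by [th2] annihilates the pair [(cos th1 * p
    + sin th1 * p', cos th1 * q' - sin th1 * q)], which is therefore zero; the other two components
    then reduce to closedness of the coefficients. *)
Lemma closed_frame_compat (th1 th2 p p' q q' py py' qx qx' : R) :
  let u := mk4 0 0 (cos (th1 + th2)) (sin (th1 + th2)) in
  let v := mk4 0 0 (cos (th1 - th2)) (sin (th1 - th2)) in
  qm (qbar u) (mk4 0 0 p p') + mk4 0 0 py py' + qm (mk4 0 0 p p') (- v) =
  qm (qbar u) (mk4 0 0 q q') + mk4 0 0 qx qx' + qm (mk4 0 0 q q') v ->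
  [/\ cos th1 * p + sin th1 * p' = 0, cos th1 * q' - sin th1 * q = 0, py = qx & py' = qx'].
Proof.
move=> u v E.
have e0 := congr1 (fun x : E4 => x 0 0) E; have e1 := congr1 (fun x : E4 => x 0 1) E.
have e2 := congr1 (fun x : E4 => x 0 2%R) E; have e3 := congr1 (fun x : E4 => x 0 3%R) E.
move: e0 e1 e2 e3; rewrite /u /v /qm /qbar !rowE !cosD !sinD cosN sinN.
have := cos2Dsin2 th2.
move: (cos th1) (sin th1) (cos th2) (sin th2) => c1 s1 c2 s2 cs e0 e1 e2 e3.
have f0 : c2 * (c1 * p + s1 * p') = s2 * (c1 * q' - s1 * q) by lra.
have f1 : - s2 * (c1 * p + s1 * p') = c2 * (c1 * q' - s1 * q) by lra.
split; [| |by lra|by lra].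
  move: f0 f1; move: (c1 * p + _) (c1 * q' - _) => e f f0 f1.
  rewrite -[e]mul1r -cs; transitivity (c2 * (c2 * e) - s2 * (- s2 * e)); first by ring.
  by rewrite f0 f1; ring.
move: f0 f1; move: (c1 * p + _) (c1 * q' - _) => e f f0 f1.
rewrite -[f]mul1r -cs; transitivity (c2 * (c2 * f) + s2 * (s2 * f)); first by ring.
by rewrite -f0 -f1; ring.
Qed.

Lemma smooth_qpair (U : set A) (a b : A -> E4) : open U -> smooth_on U a -> smooth_on U b ->
  smooth_on U (fun y => qpair (a y) (b y)).
Proof.
move=> oU sa sb.
have c i : smooth_on U (fun y => pm (a y 0 i) (b y 0 i)).
  have h := smooth_coord i oU sa; have h' := smooth_coord i oU sb.
  apply: smooth_pair => //; apply: smoothM => //; try exact: smooth_cst.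
    exact: smoothD.
  exact: smoothB.
exact: (smooth_pair oU (smooth_pair oU (smooth_pair oU (c 0) (c 1)) (c 2%R)) (c 3%R)).
Qed.

Lemma partial_qpair (U : set A) (a b : A -> E4) y : open U -> U y ->
  smooth_on U a -> smooth_on U b ->
  let g := fun y => qpair (a y) (b y) in
  [/\ qplus (partial_x g y) = partial_x a y, qminus (partial_x g y) = partial_x b y,
      qplus (partial_y g y) = partial_y a y & qminus (partial_y g y) = partial_y b y].
Proof.
move=> oU Uy sa sb g; have sg : smooth_on U g by exact: smooth_qpair.
have pE : (fun y => qplus (g y)) = a by apply/funext => w; rewrite qplus_pair.
have mE : (fun y => qminus (g y)) = b by apply/funext => w; rewrite qminus_pair.
have [_ h1] := is_derive_lin qplus_linear qplus_continuous (smooth_dx sg Uy).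
have [_ h2] := is_derive_lin qminus_linear qminus_continuous (smooth_dx sg Uy).
have [_ h3] := is_derive_lin qplus_linear qplus_continuous (smooth_dy sg Uy).
have [_ h4] := is_derive_lin qminus_linear qminus_continuous (smooth_dy sg Uy).
rewrite pE in h1; rewrite mE in h2; rewrite pE in h3; rewrite mE in h4.
by split; apply/esym; [exact: h1|exact: h2|exact: h3|exact: h4].
Qed.

Section Converse.
Variables (y0 : A) (r : R) (a b F : A -> E4) (al be : A -> R).
Hypothesis r0 : 0 < r.
Let V := box y0 r.
Hypothesis D : conv_data V a b al be F.

Let oV : open V. Proof. exact: open_boxE. Qed.
Let sa : smooth_on V a. Proof. by case: D => -[]. Qed.
Let sb : smooth_on V b. Proof. by case: D => -[]. Qed.
Let sal : smooth_on V al. Proof. by case: D => -[]. Qed.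
Let sbe : smooth_on V be. Proof. by case: D => -[]. Qed.
Let sF : smooth_on V F. Proof. by case: D => -[]. Qed.
Let a1 y : V y -> dotp (a y) (a y) = 1. Proof. by case: D => _ h _ _ _ /h[]. Qed.
Let b1 y : V y -> dotp (b y) (b y) = 1. Proof. by case: D => _ h _ _ _ /h[]. Qed.

Let th1 y := (al y + be y) * 2^-1.
Let th2 y := (al y - be y) * 2^-1.
Let P y := qm (qm (a y) (partial_x F y)) (qbar (b y)).
Let Q y := qm (qm (a y) (partial_y F y)) (qbar (b y)).
Let p y := P y 0 2%R.
Let p' y := P y 0 3%R.
Let q y := Q y 0 2%R.
Let q' y := Q y 0 3%R.

Let alE y : al y = th1 y + th2 y. Proof. by rewrite /th1 /th2; field. Qed.
Let beE y : be y = th1 y - th2 y. Proof. by rewrite /th1 /th2; field. Qed.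

Let sth1 : smooth_on V th1.
Proof. by apply: smoothM => //; [exact: smoothD|exact: smooth_cst]. Qed.
Let sth2 : smooth_on V th2.
Proof. by apply: smoothM => //; [exact: smoothB|exact: smooth_cst]. Qed.
Let sP : smooth_on V P.
Proof. exact: (smooth_qm oV (smooth_qm oV sa (smooth_x sF)) (smooth_qbar oV sb)). Qed.
Let sQ : smooth_on V Q.
Proof. exact: (smooth_qm oV (smooth_qm oV sa (smooth_y sF)) (smooth_qbar oV sb)). Qed.
Let sp : smooth_on V p. Proof. exact: smooth_coord. Qed.
Let sp' : smooth_on V p'. Proof. exact: smooth_coord. Qed.
Let sq : smooth_on V q. Proof. exact: smooth_coord. Qed.
Let sq' : smooth_on V q'. Proof. exact: smooth_coord. Qed.

Let FE y : V y -> [/\ partial_x F y = cj (a y) (b y) (mk4 0 0 (p y) (p' y)),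
  partial_y F y = cj (a y) (b y) (mk4 0 0 (q y) (q' y)) & 0 < p y * q' y - p' y * q y].
Proof.
move=> Vy; case: D => _ _ _ _ /(_ y Vy)[k [k' [l [l' [e1 e2 e3]]]]].
have [PE QE] : P y = mk4 0 0 k k' /\ Q y = mk4 0 0 l l'.
  by rewrite /P /Q e1 e2 !cjK ?a1 ?b1.
by rewrite /p /p' /q /q' PE QE !mk4E.
Qed.

Let thx y : V y -> partial_x th1 y = partial_y th2 y /\ partial_y th1 y = partial_x th2 y.
Proof.
move=> Vy; case: D => _ _ _ /(_ y Vy)[e1 e2] _.
have Dc v : is_derive y v (fun=> 2^-1 : R) 0 by exact: is_derive_cst.
have [_ h1] := is_deriveM' (is_deriveD' (smooth_dx sal Vy) (smooth_dx sbe Vy)) (Dc _).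
have [_ h2] := is_deriveM' (is_deriveD' (smooth_dy sal Vy) (smooth_dy sbe Vy)) (Dc _).
have [_ h3] := is_deriveM' (is_deriveB (smooth_dx sal Vy) (smooth_dx sbe Vy)) (Dc _).
have [_ h4] := is_deriveM' (is_deriveB (smooth_dy sal Vy) (smooth_dy sbe Vy)) (Dc _).
split.
  by apply: (etrans h1); apply: etrans (esym h4); rewrite e1 e2 opprK !mulr0.
by apply: (etrans h2); apply: etrans (esym h3); rewrite e1 e2 !mulr0.
Qed.

Let compat y : V y ->
  [/\ cos (th1 y) * p y + sin (th1 y) * p' y = 0, cos (th1 y) * q' y - sin (th1 y) * q y = 0,
      partial_y p y = partial_x q y & partial_y p' y = partial_x q' y].
Proof.
move=> Vy; have D0 v : is_derive y v (fun=> 0 : R) 0 by exact: is_derive_cst.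
have [Hax Hbx] : (forall y, V y -> partial_x a y = qm (mk4 0 0 (cos (al y)) (sin (al y))) (a y) /\
      partial_y a y = qm (mk4 0 0 (cos (al y)) (sin (al y))) (a y)) /\
    (forall y, V y -> partial_x b y = qm (mk4 0 0 (cos (be y)) (sin (be y))) (b y) /\
      partial_y b y = qm (- mk4 0 0 (cos (be y)) (sin (be y))) (b y)).
  by case: D.
have [ax ay] := Hax y Vy; have [bx by_] := Hbx y Vy.
have [_ e1] := is_derive_ext oV Vy (fun w Vw => let: And3 h _ _ := FE Vw in esym h)
  (is_derive_cj (smooth_dy sa Vy) (smooth_dy sb Vy)
    (is_derive_mk4 (D0 _) (D0 _) (smooth_dy sp Vy) (smooth_dy sp' Vy)) ay by_).
have [_ e2] := is_derive_ext oV Vy (fun w Vw => let: And3 _ h _ := FE Vw in esym h)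
  (is_derive_cj (smooth_dx sa Vy) (smooth_dx sb Vy)
    (is_derive_mk4 (D0 _) (D0 _) (smooth_dx sq Vy) (smooth_dx sq' Vy)) ax bx).
have E := etrans (esym e1) (etrans (esym (schwarz_row oV sF Vy)) e2).
have {}E := cj_inj (a1 Vy) (b1 Vy) E; rewrite alE beE in E.
exact: closed_frame_compat E.
Qed.

Let lam y := sin (th1 y) * p y - cos (th1 y) * p' y.
Let mu y := cos (th1 y) * q y + sin (th1 y) * q' y.

(** By [compat], [(p, p')] is orthogonal to [(cos th1, sin th1)] and [(q, q')] is parallel to it, so
    each is determined by one coefficient. Their oriented area is [lam * mu], whence the sign. *)
Let lam_mu y : V y -> [/\ p y = sin (th1 y) * lam y, p' y = - cos (th1 y) * lam y,
  q y = cos (th1 y) * mu y, q' y = sin (th1 y) * mu y & 0 < lam y * mu y].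
Proof.
move=> Vy; have [e f _ _] := compat Vy; have [_ _ area] := FE Vy.
rewrite /lam /mu; move: e f area; have := cos2Dsin2 (th1 y).
move: (cos _) (sin _) (p y) (p' y) (q y) (q' y) => c s k k' l l' cs e f area.
have e1 : k = s * (s * k - c * k').
  rewrite -[k in LHS]mul1r -cs -[RHS]addr0 -(mulr0 c) -e; ring.
have e2 : k' = - c * (s * k - c * k').
  rewrite -[k' in LHS]mul1r -cs -[RHS]addr0 -(mulr0 s) -e; ring.
have f1 : l = c * (c * l + s * l').
  rewrite -[l in LHS]mul1r -cs -[RHS]subr0 -(mulr0 s) -f; ring.
have f2 : l' = s * (c * l + s * l').
  rewrite -[l' in LHS]mul1r -cs -[RHS]addr0 -(mulr0 c) -f; ring.
split=> //; rewrite (_ : _ * _ = k * l' - k' * l)//.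
move: e1 e2 f1 f2; move: (s * k - _) (c * l + _) => x y' -> -> -> ->.
rewrite -[LHS]mulr1 -cs; ring.
Qed.

Let slam : smooth_on V lam.
Proof.
apply: smoothB => //; apply: smoothM => //; [exact: smooth_sin|exact: smooth_cos].
Qed.
Let smu : smooth_on V mu.
Proof.
apply: smoothD => //; apply: smoothM => //; [exact: smooth_cos|exact: smooth_sin].
Qed.

(** The two orthogonality relations of [compat] are differentiated, one along [y] and one along [x].
    Combined with the closedness relations and the conformality of [psi], they give the equations
    for [lam] and [mu]. *)
Let pde y : V y -> partial_x mu y = lam y * partial_x th2 y /\
  partial_y lam y = - mu y * partial_y th2 y.
Proof.
move=> Vy; have [_ _ k1 k2] := compat Vy; have [t1 t2] := thx Vy.
have dsin v d : is_derive y v th1 d -> is_derive y v (fun z => sin (th1 z)) (d * cos (th1 y)).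
  by move=> Dt; exact: is_derive_chain Dt (is_derive_sin _).
have dcos v d : is_derive y v th1 d -> is_derive y v (fun z => cos (th1 z)) (d * - sin (th1 y)).
  by move=> Dt; exact: is_derive_chain Dt (is_derive_cos _).
have T1x := smooth_dx sth1 Vy; have T1y := smooth_dy sth1 Vy.
have [_ m] := is_deriveD' (is_deriveM' (dcos _ _ T1x) (smooth_dx sq Vy))
  (is_deriveM' (dsin _ _ T1x) (smooth_dx sq' Vy)).
have [_ l] := is_deriveB (is_deriveM' (dsin _ _ T1y) (smooth_dy sp Vy))
  (is_deriveM' (dcos _ _ T1y) (smooth_dy sp' Vy)).
have [_ e] := is_deriveD' (is_deriveM' (dcos _ _ T1y) (smooth_dy sp Vy))
  (is_deriveM' (dsin _ _ T1y) (smooth_dy sp' Vy)).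
have [_ f] := is_deriveB (is_deriveM' (dcos _ _ T1x) (smooth_dx sq' Vy))
  (is_deriveM' (dsin _ _ T1x) (smooth_dx sq Vy)).
have e0 := @derive_ext _ _ V (fun w => cos (th1 w) * p w + sin (th1 w) * p' w) (fun=> 0 : R) y lsigma oV Vy
  (fun w Vw => let: And4 h _ _ _ := compat Vw in h).
have f0 := @derive_ext _ _ V (fun w => cos (th1 w) * q' w - sin (th1 w) * q w) (fun=> 0 : R) y 1 oV Vy
  (fun w Vw => let: And4 _ h _ _ := compat Vw in h).
have {}e := etrans (esym e) (etrans e0 (derive_cst _ _ _)).
have {}f := etrans (esym f) (etrans f0 (derive_cst _ _ _)).
have [ee ff _ _] := compat Vy.
split.
  apply: (etrans m); rewrite -t2 -k1 -k2; move: e ff; rewrite /lam.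
  move: (partial_y p y) (partial_y p' y) (partial_y th1 y) (partial_x th1 y).
  move: (cos _) (sin _) (p y) (p' y) (q y) (q' y) => c s x1 x2 x3 x4 x5 x6 x7 x8 e ff.
  apply/eqP; rewrite -subr_eq0; apply/eqP; rewrite -[RHS](addr0 0) -{1}e -(mulr0 x8) -ff.
  by ring.
apply: (etrans l); rewrite -t1 k1 k2; move: f ee; rewrite /mu.
move: (partial_x q y) (partial_x q' y) (partial_y th1 y) (partial_x th1 y).
move: (cos _) (sin _) (p y) (p' y) (q y) (q' y) => c s x1 x2 x3 x4 x5 x6 x7 x8 f ee.
apply/eqP; rewrite -subr_eq0; apply/eqP; rewrite -[RHS](subr0 0) -{2}f -(mulr0 x7) -ee.
by ring.
Qed.

Let g y := qpair (a y) (b y).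
Let psi y : A := pm (al y) (be y).
Let w2 y : {linear A -> R} := lin2 (p y) (q y).
Let w3 y : {linear A -> R} := lin2 (p' y) (q' y).

Lemma conv_rep_data : rep_data V psi th1 th2 lam mu g w2 w3.
Proof.
split.
- by split; [exact: oV|exact: box_simply_connected].
- split; last by move=> y _; rewrite [LHS]lorentzE.
  split; first exact: (smooth_pair oV sth1 sth2).
  move=> y Vy; have [_ e1] := is_derive_pair (smooth_dx sth1 Vy) (smooth_dx sth2 Vy).
  have [_ e2] := is_derive_pair (smooth_dy sth1 Vy) (smooth_dy sth2 Vy).
  have [t1 t2] := thx Vy.
  apply: (etrans e2); apply: etrans (esym (congr1 (fun t => lsigma * t) e1)).
  by apply: lorentzP; rewrite /= ?t1 ?t2; ring.
- split=> // y Vy; have [m l] := pde Vy; have [_ _ _ _ h] := lam_mu Vy; by split.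
- have gS y : V y -> S3 (g y).
    by move=> Vy; apply/S3P; rewrite qplus_pair qminus_pair a1// b1.
  have Hab : (forall y, V y -> partial_x a y = qm (mk4 0 0 (cos (al y)) (sin (al y))) (a y) /\
      partial_y a y = qm (mk4 0 0 (cos (al y)) (sin (al y))) (a y)) /\
    (forall y, V y -> partial_x b y = qm (mk4 0 0 (cos (be y)) (sin (be y))) (b y) /\
      partial_y b y = qm (- mk4 0 0 (cos (be y)) (sin (be y))) (b y)).
    by case: D.
  case: Hab => Ha Hb.
  split=> //.
    split; first exact: smooth_qpair.
    move=> y Vy; have [h1 h2 h3 h4] := partial_qpair oV Vy sa sb.
    have [ax ay] := Ha y Vy; have [bx by_] := Hb y Vy.
    apply: qpair_inj.
      by rewrite qplusM qplus_sigma qm1l; apply: (etrans h3); apply: etrans (esym h1); rewrite ax.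
    rewrite qminusM qminus_sigma qmNl qm1l; apply: (etrans h4).
    apply: etrans (esym (congr1 -%R h2)); by rewrite by_ bx qmNl.
  move=> y Vy; have [h1 h2 _ _] := partial_qpair oV Vy sa sb.
  have [ax _] := Ha y Vy; have [bx _] := Hb y Vy; have [_ gV] := S3_invr (gS y Vy).
  rewrite gV lcosE lsinE; apply: qpair_inj.
    rewrite qplusM qplus_conj qplus_JK !np_pm; apply: (etrans (congr1 (fun t => qm t _) h1)).
    by rewrite ax qplus_pair -qmA qmV a1// scale1r qm1r.
  rewrite qminusM qminus_conj qminus_JK !nm_pm; apply: (etrans (congr1 (fun t => qm t _) h2)).
  by rewrite bx qminus_pair -qmA qmV b1// scale1r qm1r.
- move=> y Vy; have [e1 e2 e3 e4 h] := lam_mu Vy.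
  have lz : lam y != 0 by apply: contraTneq h => ->; rewrite mul0r ltxx.
  have mz : mu y != 0 by apply: contraTneq h => ->; rewrite mulr0 ltxx.
  have L (x1 x2 t1 t2 : R) : lin2 x1 x2 (lofR t1 + lsigma * lofR t2) = t1 * x1 + t2 * x2.
    by rewrite /lin2 /=; ring.
  rewrite /w2 /w3 /frame_e2 /frame_e3 /= e1 e2 e3 e4 !L.
  have := cos2Dsin2 (th1 y); move: (cos _) (sin _) => c s cs.
  split.
  + by rewrite -[RHS]cs; field; rewrite lz mz.
  + by field; rewrite lz mz.
  + by field; rewrite lz mz.
  + by rewrite -[RHS]cs; field; rewrite lz mz.
Qed.

Lemma conv_primitive : primitive_on V F (xi_form g w2 w3).
Proof.
apply/(primitive_onP _ oV (smooth_x sF) (smooth_y sF)).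
  move=> y Vy v; have [e1 e2 _] := FE Vy.
  rewrite xi_formE; last by apply/S3P; rewrite qplus_pair qminus_pair a1// b1.
  rewrite qplus_pair qminus_pair e1 e2 omE -!cjZ -cjD; congr (r4 (cj _ _ _)).
  have comb (v1 v2 x1 x2 x3 x4 : R) : mk4 0 0 (v1 * x1 + v2 * x2) (v1 * x3 + v2 * x4) =
      v1 *: mk4 0 0 x1 x3 + v2 *: mk4 0 0 x2 x4.
    by apply: rv4P; rewrite !rowE; ring.
  exact: comb.
by move=> y Vy; split; [exact: smooth_dx sF Vy|exact: smooth_dy sF Vy].
Qed.

End Converse.
End Representation.

(** * Self-dual and anti-self-dual parts of the Gauss map *)

Section FlatSurfaces.
Context {R : realType}.
Local Notation A := (lorentz R).
Local Notation E4 := 'rV[R]_4.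
Implicit Types (U W : set A) (F : A -> E4) (z : A).

Lemma normal_frame_subset U W F (m1 m2 : A -> E4) : U `<=` W ->
  oriented_normal_frame W F m1 m2 -> oriented_normal_frame U F m1 m2.
Proof.
move=> UW [s1 s2 H]; split; [exact: smooth_subset UW s1|exact: smooth_subset UW s2|].
by move=> z /UW; exact: H.
Qed.

Lemma normal_frame_orth W F (m1 m2 : A -> E4) z : oriented_normal_frame W F m1 m2 -> W z ->
  orth_frame (partial_x F z) (partial_y F z) (m1 z) (m2 z).
Proof.
move=> fr Wz; have [e11 e22 e12 [x1 y1 x2 y2] nE] := frame_facts fr Wz.
split=> //; first by rewrite -(det_gramE F z); exact: (frame_gram_gt0 fr Wz).
move=> v v1 v2; have := nE v; rewrite v1 v2 !scale0r addr0 => /eqP.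
rewrite subr_eq0 => /eqP ->; rewrite /tan_proj; set k := _ *m invmx _.
have [k1 [k2 ->]] : exists k1 k2 : 'M[R]_1, k = row_mx k1 k2.
  by exists (@lsubmx _ 1 1 1 k), (@rsubmx _ 1 1 1 k); rewrite hsubmxK.
exists (k1 0 0), (k2 0 0).
have E (m : 'M[R]_1) (p : E4) : m *m p = m 0 0 *: p.
  by rewrite {1}[m]mx11_scalar mul_scalar_mx.
rewrite /jac (@mul_row_col _ 1 1 1 4 k1 k2 (partial_x F z) (partial_y F z)).
by move: (partial_x F z) (partial_y F z) => p q; rewrite !E.
Qed.

Definition twX F z := tw (partial_x F z) (partial_y F z).
Definition twY F z := tw (qbar (partial_x F z)) (qbar (partial_y F z)).

Lemma gramd_bar (P Q : E4) : gramd (qbar P) (qbar Q) = gramd P Q.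
Proof. by rewrite /gramd !dotp_bar. Qed.

Lemma qmV_sym (u v : E4) : qm u (qbar v) = (2 * dotp u v) *: q1 - qm v (qbar u).
Proof. by rewrite dotpE; apply: rv4P; rewrite /qm /qbar /q1 !rowE; ring. Qed.

Lemma qVm_sym (u v : E4) : qm (qbar u) v = (2 * dotp u v) *: q1 - qm (qbar v) u.
Proof. by rewrite dotpE; apply: rv4P; rewrite /qm /qbar /q1 !rowE; ring. Qed.

Section Flat.
Variables (U : set A) (F : A -> E4).
Hypotheses (oU : open U) (sF : smooth_on U F).
Hypothesis flat : forall z, U z -> gauss_curvature F z = 0 /\ is_normal_curvature F z 0.

Lemma flat_frame z : U z -> exists W m1 m2, [/\ open W /\ W `<=` U, W z,
  oriented_normal_frame W F m1 m2 &
  dotp (curv (nor_nabla F) m2 z) (m1 z) = 0].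
Proof.
move=> Uz; have [_ [W [m1 [m2 [oW Wz fr k0]]]]] := flat Uz.
exists (W `&` U), m1, m2; split=> //.
- by split; [exact: openI|exact: subIsetr].
- exact: normal_frame_subset (@subIsetl _ _ _) fr.
have D0 := frame_gram_gt0 fr Wz.
move/esym/eqP: k0; rewrite mulf_eq0 invr_eq0 sqrtr_eq0 leNgt D0 orbF => /eqP; exact.
Qed.

Lemma flat_gramd z : U z -> 0 < gramd (partial_x F z) (partial_y F z).
Proof.
by move=> /flat_frame[W [m1 [m2 [_ Wz fr _]]]]; have [_ _ h _] := normal_frame_orth fr Wz.
Qed.

Lemma smooth_twX : smooth_on U (twX F).
Proof. exact: (smooth_tw oU (smooth_x sF) (smooth_y sF) flat_gramd). Qed.

Lemma smooth_twY : smooth_on U (twY F).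
Proof.
apply: (smooth_tw oU (smooth_qbar oU (smooth_x sF)) (smooth_qbar oU (smooth_y sF))).
by move=> z Uz; rewrite gramd_bar; exact: flat_gramd.
Qed.

Lemma twX_unit z : U z -> twX F z 0 0 = 0 /\ dotp (twX F z) (twX F z) = 1.
Proof. by move=> Uz; split; [exact: tw_im|exact/tw_norm/flat_gramd]. Qed.

Lemma twY_unit z : U z -> twY F z 0 0 = 0 /\ dotp (twY F z) (twY F z) = 1.
Proof.
move=> Uz; split; first exact: tw_im.
by apply: tw_norm; rewrite gramd_bar; exact: flat_gramd.
Qed.

Lemma flat_gauss_ricci z : U z -> exists W m1 m2 (m1x m1y m2x m2y : E4),
  [/\ open W /\ W `<=` U, W z, oriented_normal_frame W F m1 m2,
   [/\ is_derive z (1 : A) m1 m1x, is_derive z (lsigma : A) m1 m1y,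
       is_derive z (1 : A) m2 m2x & is_derive z (lsigma : A) m2 m2y] &
   (dotp m1x (partial_x F z) * dotp m1y (partial_y F z)
    - dotp m1x (partial_y F z) * dotp m1y (partial_x F z))
  + (dotp m2x (partial_x F z) * dotp m2y (partial_y F z)
    - dotp m2x (partial_y F z) * dotp m2y (partial_x F z)) = 0 /\
   dotp m2y m1x - dotp m2x m1y = 0].
Proof.
move=> Uz; have [W [m1 [m2 [[oW WU] Wz fr rc]]]] := flat_frame Uz.
have [s1 s2 _] := fr.
exists W, m1, m2, (partial_x m1 z), (partial_y m1 z), (partial_x m2 z), (partial_y m2 z).
split=> //; first by split; [exact: smooth_dx s1 Wz|exact: smooth_dy s1 Wz|
  exact: smooth_dx s2 Wz|exact: smooth_dy s2 Wz].
split; last exact: etrans (esym (ricci_equation oW fr Wz)) rc.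
have [K0 _] := flat Uz.
have := etrans (esym (gauss_equation oW (smooth_subset WU sF) fr Wz)) K0.
have d0 := frame_gram_gt0 fr Wz.
have alg (P Q m1x m1y m2x m2y : E4) (d : R) : 0 < d ->
   ((dotp Q m1y * dotp m1x P - dotp Q m1x * dotp m1y P) +
    (dotp Q m2y * dotp m2x P - dotp Q m2x * dotp m2y P)) / d = 0 ->
   (dotp m1x P * dotp m1y Q - dotp m1x Q * dotp m1y P)
   + (dotp m2x P * dotp m2y Q - dotp m2x Q * dotp m2y P) = 0.
  move=> dp /eqP; rewrite mulf_eq0 invr_eq0 (gt_eqF dp) orbF ![dotp Q _]dotpC => /eqP <-.
  by ring.
exact: alg d0.
Qed.

Lemma twX_flat z : U z ->
  dotp (qm (twX F z) (partial_x (twX F) z)) (partial_y (twX F) z) = 0.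
Proof.
move=> Uz; have [W [m1 [m2 [m1x [m1y [m2x [m2y [[oW WU] Wz fr [D1 D2 D3 D4] [G Rc]]]]]]]]] :=
  flat_gauss_ricci Uz.
exact: (twistor_flat oW (fun q Wq => normal_frame_orth fr Wq) Wz D1 D2 D3 D4
  (smooth_dx smooth_twX Uz) (smooth_dy smooth_twX Uz) G Rc).
Qed.

(** Conjugation is an isometry that turns one lift into the other, so the Gauss and Ricci relations
    hold unchanged for the conjugated frame. *)
Lemma twY_flat z : U z ->
  dotp (qm (twY F z) (partial_x (twY F) z)) (partial_y (twY F) z) = 0.
Proof.
move=> Uz; have [W [m1 [m2 [m1x [m1y [m2x [m2y [[oW WU] Wz fr [D1 D2 D3 D4] [G Rc]]]]]]]]] :=
  flat_gauss_ricci Uz.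
have bar (P Q m1x' m1y' m2x' m2y' : E4) :
    (dotp m1x' P * dotp m1y' Q - dotp m1x' Q * dotp m1y' P) +
    (dotp m2x' P * dotp m2y' Q - dotp m2x' Q * dotp m2y' P) = 0 ->
    (dotp (qbar m1x') (qbar P) * dotp (qbar m1y') (qbar Q)
     - dotp (qbar m1x') (qbar Q) * dotp (qbar m1y') (qbar P)) +
    (dotp (qbar m2x') (qbar P) * dotp (qbar m2y') (qbar Q)
     - dotp (qbar m2x') (qbar Q) * dotp (qbar m2y') (qbar P)) = 0 by rewrite !dotp_bar.
have bar' : dotp (qbar m2y) (qbar m1x) - dotp (qbar m2x) (qbar m1y) = 0 by rewrite !dotp_bar.
exact: (twistor_flat oW (fun q Wq => orth_frame_bar (normal_frame_orth fr Wq)) Wz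
  (is_derive_qbar D1) (is_derive_qbar D2) (is_derive_qbar D3) (is_derive_qbar D4)
  (smooth_dx smooth_twY Uz) (smooth_dy smooth_twY Uz) (bar _ _ _ _ _ _ G) bar').
Qed.

(** Splitting of skew endomorphisms of R^4 into left and right multiplications by imaginary
    quaternions, for the unit bivector of the plane of [P] and [Q]. *)
Lemma bivector_tw (P Q v : E4) : (Num.sqrt (gramd P Q))^-1 *: (dotp v P *: Q - dotp v Q *: P) =
  2^-1 *: (qm (tw P Q) v - qm v (tw (qbar P) (qbar Q))).
Proof.
rewrite /tw /gramd !dotp_bar qmZl qmZr -scalerBr [in RHS]scalerA [in RHS]mulrC -scalerA.
congr (_ *: _); rewrite qbarK qmDl qmDr qmNl qmNr qmZl qmZr qm1l qm1r.
have e1 : qm v (qm (qbar P) Q) = 2 *: (dotp v P *: Q - dotp v Q *: P) + qm (qm P (qbar Q)) v.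
  rewrite qmA qmV_sym qmDl qmNl qmZl qm1l -qmA qVm_sym qmDr qmNr qmZr qm1r qmA.
  by move: (qm _ v) (dotp v P) (dotp v Q) => x k l; apply: rv4P; rewrite !rowE; ring.
rewrite e1; move: (qm _ v) (dotp v P *: Q - _) (dotp P Q *: v) => x y t.
by apply: rv4P; rewrite !rowE; field.
Qed.

Lemma gauss_map_entry z i j : gauss_map F z i j =
  (2^-1 *: (qm (twX F z) (delta_mx 0 i) - qm (delta_mx 0 i) (twY F z))) 0 j.
Proof.
rewrite /twX /twY -bivector_tw /gauss_map det_gramE.
move: (partial_x F z) (partial_y F z) => P Q; rewrite !mxE !big_ord1 !mxE.
have e (u : E4) : dotp (delta_mx 0 i) u = u 0 i.
  rewrite /dotp (bigD1 i)//= !mxE !eqxx mul1r big1 ?addr0// => k ki.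
  by rewrite mxE eqxx (negbTE ki) mul0r.
by rewrite !e.
Qed.

Hypothesis reg : immersion_on U (gauss_map F).

(** The Gauss map is an affine function of the two lifts entry by entry, so a vector killed by both
    of their differentials is killed by the injective differential of the Gauss map. *)
Lemma gauss_regular z (w : A) : U z ->
  w.1 *: partial_x (twX F) z + w.2 *: partial_y (twX F) z = 0 ->
  w.1 *: partial_x (twY F) z + w.2 *: partial_y (twY F) z = 0 -> w = 0.
Proof.
move=> Uz hX hY; have [sG inj] := reg.
apply: (inj z Uz); rewrite linear0.
have [_ ->] := is_diff_mx oU sG Uz.
apply/matrixP => i j; rewrite [RHS]mxE.
have De v dX dY (dG : 'M[R]_4) : is_derive z v (twX F) dX -> is_derive z v (twY F) dY ->
    is_derive z v (gauss_map F) dG ->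
    dG i j = (2^-1 *: (qm dX (delta_mx 0 i) - qm (delta_mx 0 i) dY)) 0 j.
  move=> DX DY DG; have Dc : is_derive z v (fun=> delta_mx 0 i : E4) 0 by exact: is_derive_cst.
  have Dk : is_derive z v (fun=> 2^-1 : R) 0 by exact: is_derive_cst.
  have D1 := is_derive_qm DX Dc; have D2 := is_derive_qm Dc DY.
  have [_ e] := is_derive_coord j (is_derive_scale Dk (is_deriveB D1 D2)).
  have [_ <-] := @is_derive_lin _ _ _ (fun M : 'M[R]_4 => M i j) (@coord_linear _ _ _ _ _)
    (@coord_continuous _ _ _ _ _) _ _ _ _ DG.
  have -> : (fun q => gauss_map F q i j) = fun q => (2^-1 *: ((fun q => qm (twX F q) (delta_mx 0 i))
      - (fun q => qm (delta_mx 0 i) (twY F q))) q) 0 j.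
    by apply/funext => q; exact: gauss_map_entry.
  have q0 (u : E4) : qm 0 u = 0 by apply: rv4P; rewrite /qm !rowE; ring.
  have q0' (u : E4) : qm u 0 = 0 by apply: rv4P; rewrite /qm !rowE; ring.
  by rewrite e scale0r add0r q0 q0' addr0 add0r.
have ex := De _ _ _ _ (smooth_dx smooth_twX Uz) (smooth_dx smooth_twY Uz) (smooth_dx sG Uz).
have ey := De _ _ _ _ (smooth_dy smooth_twX Uz) (smooth_dy smooth_twY Uz) (smooth_dy sG Uz).
have fin (G1 G2 : 'M[R]_4) (X1 X2 Y1 Y2 : E4) (k l : R) :
    G1 i j = (2^-1 *: (qm X1 (delta_mx 0 i) - qm (delta_mx 0 i) Y1)) 0 j ->
    G2 i j = (2^-1 *: (qm X2 (delta_mx 0 i) - qm (delta_mx 0 i) Y2)) 0 j ->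
    k *: X1 + l *: X2 = 0 -> k *: Y1 + l *: Y2 = 0 -> (k *: G1 + l *: G2) i j = 0.
  move=> e1 e2 hX1 hY1; rewrite mxE [X in X + _]mxE [X in _ + X]mxE e1 e2 -!scalevE -addvE.
  set d := delta_mx 0 i.
  have -> : k *: (2^-1 *: (qm X1 d - qm d Y1)) + l *: (2^-1 *: (qm X2 d - qm d Y2)) =
      2^-1 *: (qm (k *: X1 + l *: X2) d - qm d (k *: Y1 + l *: Y2)).
    rewrite qmDl qmDr !qmZl !qmZr; move: (qm X1 d) (qm X2 d) (qm d Y1) (qm d Y2).
    by move=> x y x' y'; apply: rv4P; rewrite !rowE; ring.
  rewrite hX1 hY1.
  have q0 (u : E4) : qm 0 u = 0 by apply: rv4P; rewrite /qm !rowE; ring.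
  have q0' (u : E4) : qm u 0 = 0 by apply: rv4P; rewrite /qm !rowE; ring.
  by rewrite q0 q0' subr0 scaler0 zerovE.
exact: fin ex ey hX hY.
Qed.

End Flat.
End FlatSurfaces.

(** * Adapted charts *)

Section LocalConverse.
Context {R : realType}.
Local Notation A := (lorentz R).
Local Notation E4 := 'rV[R]_4.
Variables (U : set A) (F : A -> E4) (z0 : A).
Hypotheses (oU : open U) (sF : smooth_on U F) (Uz0 : U z0).
Hypothesis flat : forall z, U z -> gauss_curvature F z = 0 /\ is_normal_curvature F z 0.
Hypothesis reg : immersion_on U (gauss_map F).

Let sX := smooth_twX oU sF flat.
Let sY := smooth_twY oU sF flat.

Lemma pair_eq0 (x y : R) : (x, y) = 0 :> A -> x = 0 /\ y = 0.
Proof. by case=> -> ->. Qed.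

Lemma half_kernel W (X : A -> E4) a (s al : A -> R) : half_data W X a s al -> W z0 ->
  partial_y s z0 *: partial_x X z0 + (- partial_x s z0) *: partial_y X z0 = 0 /\
  ~ (partial_y s z0 = 0 /\ - partial_x s z0 = 0).
Proof.
move=> [_ _ _ H] Wz0; have [_ _ _ h [N [-> ->]]] := H z0 Wz0; split.
  by rewrite !scalerA mulNr scaleNr mulrC subrr.
by move=> [e1 /eqP]; rewrite oppr_eq0 => /eqP e2; move: h; rewrite e1 e2 !mul0r addr0 ltxx.
Qed.

(* If [dX] vanished at [z0], a kernel vector of [dY], which has rank at most one,
   would contradict the regularity of the Gauss map. *)
Lemma regular_derivative_neq0 (X Y : A -> E4) :
  smooth_on U Y -> (forall z, U z -> Y z 0 0 = 0 /\ dotp (Y z) (Y z) = 1) ->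
  (forall z, U z -> dotp (qm (Y z) (partial_x Y z)) (partial_y Y z) = 0) ->
  (forall w : A, w.1 *: partial_x X z0 + w.2 *: partial_y X z0 = 0 ->
    w.1 *: partial_x Y z0 + w.2 *: partial_y Y z0 = 0 -> w = 0) ->
  partial_x X z0 != 0 \/ partial_y X z0 != 0.
Proof.
move=> sY' uY fY H.
have [ex|] := eqVneq (partial_x X z0) 0; last by left.
have [ey|] := eqVneq (partial_y X z0) 0; last by right.
have X0 (w : A) : w.1 *: partial_x X z0 + w.2 *: partial_y X z0 = 0.
  by rewrite ex ey !scaler0 addr0.
have [Y0|Y0] : (partial_x Y z0 != 0 \/ partial_y Y z0 != 0) \/ partial_x Y z0 = 0.
  by have [|] := eqVneq (partial_x Y z0) 0; [right|left; left].
  have [r [a [s [al [r0 _ hd]]]]] := half_lemma oU Uz0 sY' uY fY Y0.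
  have [k n] := half_kernel hd (@box_center _ z0 _ r0).
  have e := H (partial_y s z0, - partial_x s z0) (X0 _) k.
  by case: n; exact: pair_eq0 e.
have e := H (1, 0) (X0 _); case/eqP: (@oner_neq0 R).
by apply: (pair_eq0 (e _)).1; rewrite Y0 scaler0 scale0r addr0.
Qed.

(** Both halves are shrunk to a common box; then the sign of the Jacobian of [(s, t)] at [z0]
    decides. A negative sign is ready for [change_coordinates], a positive one is flipped, and zero
    contradicts regularity. *)
Lemma flat_local : exists W (y0 : A) (r : R) (T1 T2 S1 S2 : A -> R) (a b : A -> E4)
    (al be : A -> R), let V := box y0 r in
  [/\ W `<=` U, W z0, 0 < r, diffeo W V T1 T2 S1 S2 &
    conv_data V a b al be (fun y => F (S1 y, S2 y))].
Proof.
have G w := gauss_regular oU sF flat reg (w := w) Uz0.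
have uX := twX_unit oU flat; have uY := twY_unit oU flat.
have fX := twX_flat oU sF flat; have fY := twY_flat oU sF flat.
have nX : partial_x (twX F) z0 != 0 \/ partial_y (twX F) z0 != 0.
  exact: (regular_derivative_neq0 sY uY fY G).
have nY : partial_x (twY F) z0 != 0 \/ partial_y (twY F) z0 != 0.
  by apply: (regular_derivative_neq0 sX uX fX) => w h1 h2; exact: G.
have [r1 [a [s [al [r10 sub1 hX]]]]] := half_lemma oU Uz0 sX uX fX nX.
have [r2 [b [t [be [r20 sub2 hY]]]]] := half_lemma oU Uz0 sY uY fY nY.
pose r := Num.min r1 r2.
have r0 : 0 < r by rewrite lt_min r10.
have s1 : box z0 r `<=` box z0 r1 by move=> w /box_min[].
have s2 : box z0 r `<=` box z0 r2 by move=> w /box_min[].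
have sU : box z0 r `<=` U by move=> w /s1/sub1.
have {}hX := half_data_subset s1 hX; have {}hY := half_data_subset s2 hY.
have B0 := @box_center _ z0 _ r0; have oB := @open_boxE _ z0 _ r0.
have D0 z : box z0 r z -> 0 < gramd (partial_x F z) (partial_y F z).
  by move=> /sU; exact: (flat_gramd oU flat).
have sFB := smooth_subset sU sF.
have key s' al' : half_data (box z0 r) (twX F) a s' al' ->
    partial_x s' z0 * partial_y t z0 - partial_y s' z0 * partial_x t z0 < 0 ->
    exists W (y0 : A) (r : R) (T1 T2 S1 S2 : A -> R) (a b : A -> E4)
      (al be : A -> R), let V := box y0 r in
    [/\ W `<=` U, W z0, 0 < r, diffeo W V T1 T2 S1 S2 &
      conv_data V a b al be (fun y => F (S1 y, S2 y))].
  move=> hs J.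
  have [W [y0 [r' [T1 [T2 [S1 [S2 [WU Wz r'0 df cd]]]]]]]] :=
    change_coordinates r0 sFB D0 hs hY J.
  exists W, y0, r', T1, T2, S1, S2, (fun y => a (S1 y, S2 y)), (fun y => b (S1 y, S2 y)),
    (fun y => al' (S1 y, S2 y)), (fun y => be (S1 y, S2 y)).
  split; [by move=> w /WU/sU|exact: Wz|exact: r'0|exact: df|exact: cd].
have [J|J|J] := ltgtP (partial_x s z0 * partial_y t z0 - partial_y s z0 * partial_x t z0) 0.
- exact: key hX J.
- apply: (key _ _ (half_data_flip oB hX)).
  have [_ ss _ _] := hX.
  have [_ hx] := is_deriveN (smooth_dx ss B0); have [_ hy] := is_deriveN (smooth_dy ss B0).
  have N (x x' y y' u v : R) : x' = - x -> y' = - y -> 0 < x * u - y * v -> x' * u - y' * v < 0.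
    by move=> -> -> h; lra.
  exact: N hx hy J.
(* If [ds] and [dt] are proportional, the nonzero kernel vector of [ds] is killed by the
   differentials of both lifts. *)
- have [k n] := half_kernel hX B0; have [_ _ _ /(_ z0 B0)[_ _ _ _ [N [e1 e2]]]] := hY.
  have e := G (partial_y s z0, - partial_x s z0) k.
  case: n; suff h : (partial_y s z0, - partial_x s z0) = 0 :> A.
    exact: pair_eq0 h.
  apply: e; rewrite /= e1 e2 !scalerA -scalerDl.
  have alg (x y u v : R) : x * u - y * v = 0 -> y * v + - x * u = 0.
    by move=> h; rewrite mulNr -opprB h oppr0.
  by rewrite (alg _ _ _ _ J) scale0r.
Qed.

End LocalConverse.

Section Charts.
Context {R : realType} (M : surface R).
Local Notation A := (lorentz R).

Lemma open_preim_on (T : topologicalType) (U : set A) (f : A -> T) (B : set T) :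
  open U -> {in U, continuous f} -> open B -> open (U `&` f @^-1` B).
Proof.
move=> oU cf oB; rewrite openE => z [Uz Bz].
have /(cf _) fz : z \in U by rewrite inE.
by apply: filterI; [exact: open_nbhs_nbhs|apply: fz; exact: open_nbhs_nbhs].
Qed.

Lemma diffeo_chart (c : set A * (A -> M)) W V (T1 T2 S1 S2 : A -> R) : atlas c ->
  W `<=` c.1 -> diffeo W V T1 T2 S1 S2 -> local_chart V (fun y => c.2 (S1 y, S2 y)).
Proof.
move=> ac WU [oW oV [sT1 sT2] [sS1 sS2] [TW SV]].
have [oU cphi iphi ophi] := atlas_homeo ac.
have SW y : V y -> W (S1 y, S2 y) by move=> /SV[].
have SU y : V y -> c.1 (S1 y, S2 y) by move=> /SW/WU.
have cS y : V y -> {for y, continuous (fun y => (S1 y, S2 y) : A)}.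
  by move=> Vy; apply: continuous_pairA; exact: smooth_cont Vy.
have cchi : {in V, continuous (fun y => c.2 (S1 y, S2 y))}.
  move=> y /[1!inE] Vy; apply: (@continuous_comp _ _ _ (fun y => (S1 y, S2 y) : A) c.2).
    exact: cS.
  by apply: cphi; rewrite inE; exact: SU.
(* The image is rewritten through the original chart, whose openness then applies. *)
have imV (B : set A) : B `<=` V -> (fun y => c.2 (S1 y, S2 y)) @` B =
    c.2 @` (W `&` (fun z => (T1 z, T2 z) : A) @^-1` B).
  move=> BV; apply/seteqP; split=> [_ [y By <-]|_ [z [Wz Bz] <-]].
    exists (S1 y, S2 y) => //; have [h1 h2 h3] := SV y (BV _ By).
    by split=> //=; rewrite h2 h3 -surjective_pairing.
  by exists (T1 z, T2 z) => //; have [_ ->] := TW z Wz.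
have oimV (B : set A) : open B -> B `<=` V -> open ((fun y => c.2 (S1 y, S2 y)) @` B).
  move=> oB BV; rewrite imV//; apply: ophi; last by move=> z [/WU].
  apply: open_preim_on => // z /[1!inE] Wz.
  by apply: continuous_pairA; exact: smooth_cont Wz.
have hV : param_homeo V (fun y => c.2 (S1 y, S2 y)).
  split=> // y y' /[!inE] Vy Vy' /iphi; rewrite !inE => /(_ (SU _ Vy) (SU _ Vy')) [e1 e2].
  have [_ h1 h2] := SV y Vy; have [_ h1' h2'] := SV y' Vy'.
  by apply: lorentzP; [rewrite -h1 -h1' e1 e2|rewrite -h2 -h2' e1 e2].
split=> // d ad; have [oD cd _ od] := atlas_homeo ad; split.
  have [tau [stau Htau]] := atlas_smooth ac ad.
  set D0 := c.1 `&` _ in stau Htau.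
  have oD0 : open D0 by apply: open_preim_on => //; exact: od.
  rewrite /smooth_transition; set D := V `&` _.
  have oD' : open D by apply: open_preim_on => //; exact: od.
  have SD y : D y -> D0 (S1 y, S2 y) by move=> [/SU ? ?]; split.
  exists (fun y => tau (S1 y, S2 y)); split; last by move=> y /SD; exact: Htau.
  have DV : D `<=` V by move=> y [].
  have [sS1' sS2'] := (smooth_subset DV sS1, smooth_subset DV sS2).
  have st1 := smooth_subst oD' oD0 SD sS1' sS2' (smooth_fst oD0 stau).
  have st2 := smooth_subst oD' oD0 SD sS1' sS2' (smooth_snd oD0 stau).
  by apply: (smooth_ext oD' _ (smooth_pair oD' st1 st2)) => w _; rewrite -surjective_pairing.
have [tau [stau Htau]] := atlas_smooth ad ac.
set D0 := d.1 `&` _ in stau Htau.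
rewrite /smooth_transition; set D := d.1 `&` _.
have oD0 : open D0 by apply: open_preim_on => //; exact: ophi.
have oD' : open D by apply: open_preim_on => //; exact: oimV.
(* By injectivity of the chart [c.2], the old transition map lands in [W], where [T1] and [T2] are
   smooth. *)
have key z : D z -> D0 z /\ exists2 y, V y & tau z = (S1 y, S2 y).
  move=> [dz [y Vy e]].
  have D0z : D0 z by split=> //; exists (S1 y, S2 y) => //; exact: SU.
  split=> //; exists y => //; have [h1 h2] := Htau z D0z.
  by apply: iphi; rewrite ?inE ?h2//; exact: SU.
have tW z : D z -> W (tau z) by move=> /key[_ [y Vy ->]]; exact: SW.
have DD0 : D `<=` D0 by move=> z /key[].
have {}stau := smooth_subset DD0 stau.
exists (fun z => (T1 (tau z), T2 (tau z)) : A); split.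
  have tW' z : D z -> W ((tau z).1, (tau z).2) by rewrite -surjective_pairing; exact: tW.
  have st1 := smooth_subst oD' oW tW' (smooth_fst oD' stau) (smooth_snd oD' stau) sT1.
  have st2 := smooth_subst oD' oW tW' (smooth_fst oD' stau) (smooth_snd oD' stau) sT2.
  by apply: (smooth_ext oD' _ (smooth_pair oD' st1 st2)) => w _; rewrite -surjective_pairing.
move=> z Dz; have [D0z _] := key z Dz; have Wt := tW z Dz; have [VT e] := TW _ Wt.
by split=> //; rewrite e; exact: (Htau z D0z).2.
Qed.

End Charts.

Theorem theorem3 (R : realType) :
  (forall (U : set (lorentz R)) (psi : lorentz R -> lorentz R)
     (th1 th2 lam mu : lorentz R -> R) (g : lorentz R -> lquat R)
     (w2 w3 : lorentz R -> {linear lorentz R -> R}),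
     rep_data U psi th1 th2 lam mu g w2 w3 ->
     (exists F : lorentz R -> 'rV[R]_4, primitive_on U F (xi_form g w2 w3)) /\
     (forall F : lorentz R -> 'rV[R]_4, primitive_on U F (xi_form g w2 w3) ->
        immersion_on U F /\
        forall z, U z -> gauss_curvature F z = 0 /\ is_normal_curvature F z 0))
  /\
  (forall (M : surface R) (f : M -> 'rV[R]_4),
     immersion f -> zero_gauss_curvature f -> zero_normal_curvature f ->
     regular_gauss_map f ->
     forall p : M,
     exists (U : set (lorentz R)) (phi : lorentz R -> M)
       (psi : lorentz R -> lorentz R) (th1 th2 lam mu : lorentz R -> R)
       (g : lorentz R -> lquat R) (w2 w3 : lorentz R -> {linear lorentz R -> R}),
       [/\ local_chart U phi, (phi @` U) p,
           rep_data U psi th1 th2 lam mu g w2 w3 &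
           primitive_on U (f \o phi) (xi_form g w2 w3)]).
Proof.
split=> [U psi th1 th2 lam mu g w2 w3|M f im K0 KN0 reg p]; first exact: forward_part.
have [c ac [z0 Uz0 z0p]] := atlas_cover p.
have [oU _ _ _] := atlas_homeo ac; have [sF _] := im c ac.
have flat z : c.1 z -> gauss_curvature (f \o c.2) z = 0 /\ is_normal_curvature (f \o c.2) z 0.
  by move=> Uz; split; [exact: K0 ac z Uz|exact: KN0 ac z Uz].
have [W [y0 [r [T1 [T2 [S1 [S2 [a [b [al [be [WU Wz0 r0 df cd]]]]]]]]]]]] :=
  flat_local oU sF Uz0 flat (reg c ac).
have rd := conv_rep_data r0 cd; have pr := conv_primitive r0 cd.
(* The eight remaining witnesses are the ones constructed inside [conv_rep_data], recovered by
   unification with [rd] and [pr]. *)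
exists (box y0 r), (fun y => c.2 (S1 y, S2 y)); do 8!eexists; split.
- exact: diffeo_chart df.
- have [_ _ _ _ [TW _]] := df; have [VT e] := TW z0 Wz0.
  by exists (T1 z0, T2 z0) => //; rewrite e.
- exact: rd.
- exact: pr.
Qed.
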